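(* Let $n\ge2$ be an integer and $1<p<\infty$. Let $\psi\in\mathcal{H}_n^\infty$ be the constant function $\psi(z)=1$, and let $u$ be a constant multiple of $\psi$ normalized so that convolution with $V_u(u)$ is idempotent, i.e. $V_u(u)*V_u(u)=V_u(u)\neq 0$ on $G$. Then the coorbit space $$\mathrm{Co}^u_{\mathcal{H}_n^\infty}L^p(G)=\{v'\in\mathcal{H}_n^{-\infty} : V_u(v')\in L^p(G)\},\qquad \|v'\|=\|V_u(v')\|_{L^p(G)},$$ is a Banach space.
   Context: $G=\left\{\begin{pmatrix}a&b\\0&a^{-1}\end{pmatrix}: a>0,\ b\in\mathbb{R}\right\}$ is the connected $(ax+b)$-group, with elements written $(a,b)$ and left Haar measure $\frac{da\,db}{a^2}$; $L^p(G)$ and the convolution $(f*g)(x)=\int_G f(y)g(y^{-1}x)\,dy$ are taken with respect to it. $G$ is regarded as a subgroup of $\mathrm{SU}(1,1)=\left\{\begin{pmatrix}\alpha&\beta\\\bar\beta&\bar\alpha\end{pmatrix}:|\alpha|^2-|\beta|^2=1\right\}$ through the Cayley transform $$\begin{pmatrix}\alpha&\beta\\\bar\beta&\bar\alpha\end{pmatrix}=\frac12\begin{pmatrix}1&-i\\-i&1\end{pmatrix}\begin{pmatrix}a&b\\0&a^{-1}\end{pmatrix}\begin{pmatrix}1&i\\i&1\end{pmatrix}.$$ Let $\mathbb{D}$ be the open unit disc. $\mathcal{H}_n$ is the Hilbert space of holomorphic functions $v$ on $\mathbb{D}$ with $(v,v)_n<\infty$, where $(u,v)_n=\int_{\mathbb{D}}u(z)\overline{v(z)}(1-|z|^2)^{n-2}\,dx\,dy$.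 The discrete series representation $\pi_n$ of $\mathrm{SU}(1,1)$ on $\mathcal{H}_n$ is $$\pi_n\begin{pmatrix}\alpha&\beta\\\bar\beta&\bar\alpha\end{pmatrix}v(z)=(-\bar\beta z+\alpha)^{-n}\,v\Big(\frac{\bar\alpha z-\beta}{-\bar\beta z+\alpha}\Big),$$ and it is restricted to $G$. $\mathcal{H}_n^\infty$ is the space of smooth vectors of $\pi_n$ (as a representation of $\mathrm{SU}(1,1)$) with its usual Fréchet topology, and $\mathcal{H}_n^{-\infty}$ is its conjugate dual (continuous conjugate linear functionals), with pairing $\langle v',v\rangle$ extending $(\cdot,\cdot)_n$. For $u\in\mathcal{H}_n^\infty$ and $v'\in\mathcal{H}_n^{-\infty}$ the voice transform is the function on $G$ given by $V_u(v')(x)=\langle v',\pi_n(x)u\rangle$. *)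

(* Defs.v *)
From HB Require Import structures.
From mathcomp Require Import all_boot all_order all_algebra.
From mathcomp Require Import all_classical all_reals all_analysis.
From mathcomp Require Import measurable_realfun.
From mathcomp Require Import complex.
Set Implicit Arguments.
Unset Strict Implicit.
Unset Printing Implicit Defensive.
Import Order.TTheory GRing.Theory Num.Theory.
Import numFieldNormedType.Exports.
Local Open Scope classical_set_scope.
Local Open Scope ring_scope.

(** * Complex numbers *)

(* The constant is convertible to [R[i]]; as a [numClosedFieldType] it
   receives the generic topology and normed module structure of the library,
   which are not inferred on [R[i]] itself. *)
Definition cplx (R : realType) : numClosedFieldType := R[i].

Definition ofR {R : realType} (t : R) : cplx R := (t%:C)%C.
Definition imag {R : realType} : cplx R := ('i)%C.
Definition rpart {R : realType} (z : cplx R) : R := complex.Re z.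
Definition ipart {R : realType} (z : cplx R) : R := complex.Im z.
Definition modulus {R : realType} (z : cplx R) : R := rpart `|z|.
Definition point_of {R : realType} (p : R * R) : cplx R := (p.1 +i* p.2)%C.

(* [measurableTypeR R] is [R] with the Borel sigma-algebra on which
   [lebesgue_measure] is defined. *)
Notation plane R := (measurableTypeR R * measurableTypeR R)%type.

Definition plane_measure (R : realType) : {measure set (plane R) -> \bar R} :=
  (@lebesgue_measure R \x @lebesgue_measure R)%E.

Definition cintegral {d : measure_display} {T : measurableType d}
    {R : realType} (mu : {measure set T -> \bar R}) (D : set T)
    (f : T -> cplx R) : cplx R :=
  ofR (\int[mu]_(x in D) rpart (f x)) +
  imag * ofR (\int[mu]_(x in D) ipart (f x)).

Definition mx22 {K : Type} (a b c d : K) : 'M[K]_2 :=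
  \matrix_(i, j) if i == ord0 then (if j == ord0 then a else b)
                 else (if j == ord0 then c else d).

(** * The group G *)

Section ax_plus_b.
Context {R : realType}.

(* The matrix [(a, b; 0, a^-1)] is represented by the pair [(a, b)]; only
   pairs in [axb] stand for elements of the group. *)
Definition axb : set (plane R) :=
  [set x | 0 < x.1].

Definition axb_mx (x : R * R) : 'M[R]_2 := mx22 x.1 x.2 0 x.1^-1.

Definition axb_mul (x y : R * R) : R * R :=
  (x.1 * y.1, x.1 * y.2 + x.2 * y.1^-1).

Definition axb_inv (x : R * R) : R * R := (x.1^-1, - x.2).

Lemma axb_mx_mul (x y : R * R) :
  axb_mx (axb_mul x y) = axb_mx x *m axb_mx y.
Proof.
apply/matrixP => i j; rewrite !mxE big_ord_recl big_ord1 !mxE /=.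
by case: ifP => _; case: ifP => _ /=;
  rewrite ?(mul0r, mulr0, addr0, add0r, invfM).
Qed.

Lemma axb_mx_inv (x : R * R) : axb x -> axb_mx (axb_inv x) *m axb_mx x = 1%:M.
Proof.
move=> /= /lt0r_neq0 x0; rewrite -axb_mx_mul; apply/matrixP => i j.
rewrite !mxE /axb_inv /axb_mul /= mulVf// invr1 mulrC mulNr addrN.
by case: i j => [[|[|//]] ?] [[|[|//]] ?].
Qed.

(* The Cayley transform, with values in SU(1,1). *)
Definition cayley (x : R * R) : 'M[cplx R]_2 :=
  2^-1 *: (mx22 1 (- imag) (- imag) 1 *m map_mx ofR (axb_mx x)
           *m mx22 1 imag imag 1).

(* The left Haar measure da db / a^2, as a measure on the plane carried
   by [axb]. *)
Definition haar (A : set (plane R)) : \bar R :=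
  (\int[plane_measure R]_(x in A `&` axb) (x.1 ^- 2)%:E)%E.

Let measurable_axb : measurable axb.
Proof.
rewrite (_ : axb = `]0, +oo[%classic `*` setT); first exact: measurableX.
by apply/seteqP; split => x /=; rewrite in_itv/= andbT// => -[].
Qed.

Let haar0 : haar set0 = 0%E.
Proof. by rewrite /haar set0I integral_set0. Qed.

Let haar_ge0 A : (0 <= haar A)%E.
Proof. by apply: integral_ge0 => x _; rewrite lee_fin invr_ge0 sqr_ge0. Qed.

Let measurable_density : measurable_fun axb
  (fun x : plane R => (x.1 : R) ^- 2 : R).
Proof.
apply: (@measurable_comp _ _ _ (plane R)
  (measurableTypeR R) _ `]0, +oo[%classic (fun a : R => a ^- 2) axb fst) => //=.
- by move=> _ [x x0 <-] /=; rewrite in_itv/= andbT.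
- apply: open_continuous_measurable_fun; first exact: interval_open.
  move=> a; rewrite inE/= in_itv/= andbT => a0.
  apply: cvgV; first by rewrite expf_neq0// gt_eqF.
  exact: exprn_continuous.
- exact: measurable_funS measurable_fst.
Qed.

Let haar_sigma_additive : semi_sigma_additive haar.
Proof.
move=> /= F mF tF mUF; rewrite /haar setI_bigcupl.
have mFG k : measurable (F k `&` axb) by exact: measurableI.
rewrite ge0_integral_bigcup//=.
- apply: is_cvg_ereal_nneg_natsum_cond => k _ _; exact: haar_ge0.
- apply/measurable_EFinP; apply: measurable_funS measurable_density => //.
  by move=> x [k _ []].
- by move=> x _; rewrite lee_fin invr_ge0 sqr_ge0.
- exact: trivIset_setIr.
Qed.

HB.instance Definition _ :=
  isMeasure.Build _ _ _ haar haar0 haar_ge0 haar_sigma_additive.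

End ax_plus_b.

Definition convolution {R : realType} (f g : R * R -> cplx R) (x : R * R) :
    cplx R :=
  cintegral (haar (R := R)) axb (fun y => f y * g (axb_mul (axb_inv y) x)).

(* The extension by zero outside [axb] makes the values of [f] at pairs that
   are not elements of the group irrelevant. *)
Definition Lp_norm {R : realType} (p : R) (f : R * R -> cplx R) : \bar R :=
  'N[haar (R := R)]_p%:E [(fun x => (modulus (f x))%:E) \_ axb]%E.

Definition in_Lp {R : realType} (p : R) (f : R * R -> cplx R) : Prop :=
  [/\ measurable_fun (axb (R := R)) (rpart \o f),
      measurable_fun (axb (R := R)) (ipart \o f) &
      (Lp_norm p f < +oo)%E].

(** * SU(1,1) *)

Definition SU11 {R : realType} : set 'M[cplx R]_2 :=
  [set g | [/\ g 1 0 = (g 0 1)^*, g 1 1 = (g 0 0)^* &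
               `|g 0 0| ^+ 2 - `|g 0 1| ^+ 2 = 1]].

Definition expmx {R : realType} (X : 'M[cplx R]_2) : 'M[cplx R]_2 :=
  limn (series (fun k => k`!%:R^-1 *: X ^+ k)).

(* The Lie algebra of SU(1,1), a closed subgroup of GL(2,C). *)
Definition su11 {R : realType} : set 'M[cplx R]_2 :=
  [set X | forall t : R, SU11 (expmx (ofR t *: X))].

(** * The Bergman space and the discrete series *)

(* A function on the disc is represented by its extension by zero to the
   plane, so that equality of vectors is Leibniz equality. *)
Section bergman.
Context {R : realType}.
Implicit Types (v w : cplx R -> cplx R) (g X : 'M[cplx R]_2).

Definition disc : set (cplx R) := [set z | `|z| < 1].

(* Complex differentiability on the disc: the increment in [derivable] ranges
   over the scalar field [cplx R]. *)
Definition holomorphic v : Prop := forall z, disc z -> derivable v z 1.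

Definition weight (n : nat) (z : cplx R) : R := (1 - modulus z ^+ 2) ^+ (n - 2).

Definition inner (n : nat) v w : cplx R :=
  cintegral (plane_measure R) (point_of @^-1` disc)
    (fun p => v (point_of p) * (w (point_of p))^* * ofR (weight n (point_of p))).

Definition bergman (n : nat) : set (cplx R -> cplx R) :=
  [set v | [/\ forall z, ~ disc z -> v z = 0, holomorphic v &
    (\int[plane_measure R]_(p in point_of @^-1` disc)
      (modulus (v (point_of p)) ^+ 2 * weight n (point_of p))%:E < +oo)%E]].

Definition bergman_norm (n : nat) v : R := Num.sqrt (rpart (inner n v v)).

Definition discrete_series (n : nat) g v : cplx R -> cplx R := fun z =>
  if `|z| < 1 then
    (- g 1 0 * z + g 0 0) ^- n * v ((g 1 1 * z - g 0 1) / (- g 1 0 * z + g 0 0))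
  else 0.

(** * Smooth vectors *)

(* [F'] is the derivative of the map [F], from SU(1,1) to the Bergman space,
   along the left-invariant vector field defined by [X]. *)
Definition is_lie_derivative (n : nat) X (F F' : 'M[cplx R]_2 -> cplx R -> cplx R)
    : Prop :=
  forall g, SU11 g -> bergman n (F' g) /\
    bergman_norm n (ofR t^-1 *: (F (g *m expmx (ofR t *: X)) - F g) - F' g)
      @[t --> (0 : R)^'] --> (0 : R).

Definition continuous_on_SU11 (n : nat) (F : 'M[cplx R]_2 -> cplx R -> cplx R)
    : Prop :=
  forall g, SU11 g ->
    bergman_norm n (F h - F g) @[h --> within SU11 (nbhs g)] --> (0 : R).

(* [F] is of class C^k: its iterated derivatives along left-invariant vector
   fields, which span each tangent space, exist and are continuous up to
   order k. *)
Fixpoint class_C (n k : nat) (F : 'M[cplx R]_2 -> cplx R -> cplx R) : Prop :=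
  continuous_on_SU11 n F /\
  if k is k'.+1 then
    forall X, su11 X -> exists2 F', is_lie_derivative n X F F' & class_C n k' F'
  else True.

Definition smooth_vector (n : nat) : set (cplx R -> cplx R) :=
  [set v | bergman n v /\
           forall k, class_C n k (fun g => discrete_series n g v)].

(* d pi_n(X) v, the derivative at t = 0 of pi_n(exp(tX)) v; it is 0 if there
   is no derivative. *)
Definition dpi (n : nat) X v : cplx R -> cplx R :=
  xget 0 [set w | bergman n w /\
    bergman_norm n (ofR t^-1 *: (discrete_series n (expmx (ofR t *: X)) v - v) - w)
      @[t --> (0 : R)^'] --> (0 : R)].

Definition smooth_seminorm (n : nat) (Xs : seq 'M[cplx R]_2) v : R :=
  bergman_norm n (foldr (dpi n) v Xs).

(* The neighborhoods of [v] in the Frechet space of smooth vectors: the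
   topology defined by the seminorms
   [v |-> || dpi X_1 (... (dpi X_k v)) ||]. *)
Definition smooth_nbhs (n : nat) v : set_system (cplx R -> cplx R) :=
  filter_from
    [set B : seq (seq 'M[cplx R]_2) * R |
      (forall Xs X, Xs \in B.1 -> X \in Xs -> su11 X) /\ 0 < B.2]
    (fun B => [set w | smooth_vector n w /\
      forall Xs, Xs \in B.1 -> smooth_seminorm n Xs (w - v) < B.2]).

(** * The conjugate dual and the coorbit space *)

(* Functionals on smooth vectors are also represented by their extension by
   zero to all functions. *)
Definition distribution_vector (n : nat) : set ((cplx R -> cplx R) -> cplx R) :=
  [set v' | [/\ forall v, ~ smooth_vector n v -> v' v = 0,
    forall a v w, smooth_vector n v -> smooth_vector n w ->
      v' (a *: v + w) = a^* * v' v + v' w &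
    forall v, smooth_vector n v -> v' w @[w --> smooth_nbhs n v] --> v' v]].

(* The embedding of the Bergman space in the conjugate dual. *)
Definition embedding (n : nat) w : (cplx R -> cplx R) -> cplx R := fun v =>
  if v \in smooth_vector n then inner n w v else 0.

Definition voice (n : nat) (u : cplx R -> cplx R)
    (v' : (cplx R -> cplx R) -> cplx R) : R * R -> cplx R :=
  fun x => v' (discrete_series n (cayley x) u).

Definition coorbit (n : nat) (p : R) (u : cplx R -> cplx R) :
    set ((cplx R -> cplx R) -> cplx R) :=
  [set v' | distribution_vector n v' /\ in_Lp p (voice n u v')].

Definition coorbit_norm (n : nat) (p : R) (u : cplx R -> cplx R)
    (v' : (cplx R -> cplx R) -> cplx R) : cplx R :=
  ofR (fine (Lp_norm p (voice n u v'))).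

Definition psi : cplx R -> cplx R := fun z => if `|z| < 1 then 1 else 0.

End bergman.

(* The subset [S] of [V], with the restriction to [S] of [N], is a Banach
   space for the vector space operations of [V]. *)
Definition is_banach {K : numFieldType} {V : lmodType K} (S : set V) (N : V -> K)
    : Prop :=
  exists (B : completeNormedModType K) (f : {linear B -> V}),
    [/\ injective f, range f = S & forall b, N (f b) = `|b|].

(* Main.v *)
Require Import Defs.
From HB Require Import structures.
From mathcomp Require Import all_boot all_order all_algebra.
From mathcomp Require Import all_classical all_reals all_analysis.
From mathcomp Require Import measurable_realfun.
From mathcomp Require Import complex.
From mathcomp Require Import ring lra zify.
Set Implicit Arguments.
Unset Strict Implicit.
Unset Printing Implicit Defensive.
Import Order.TTheory GRing.Theory Num.Theory.
Import numFieldNormedType.Exports.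
Local Open Scope classical_set_scope.
Local Open Scope ring_scope.

(* A smooth vector is a power series whose coefficients decay faster
   than any power of the index (the rotations act diagonally on the monomials),
   so a distribution vector v' is a sequence c_k = <v', z^k> of polynomial
   growth, and the voice transform with window d * psi is
     V(x) = conj(d) conj(alpha)^-n sum_k C(n+k-1, k) c_k w^k,
   where w = beta / conj(alpha) is a holomorphic coordinate of G onto the disc.
   Monomials in w are orthogonal for every weight that is a function of |w|.
   Testing V against w^k with a cutoff (r^2 - |w|^2)_+^e, where
   1 - r^2 is of order k^-2, gives |c_k| <= C (1+k)^M ||V||_p.  Hence the norm
   is definite, and the coefficients of a Cauchy sequence converge with uniform
   polynomial bounds; the limit sequence is a distribution vector, and Fatou's
   lemma shows that it is the limit in the coorbit norm. *)

(** * Complex numbers and power series *)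

(** Orthogonality of the monomials in w is obtained without polar coordinates. If f is a monomial in
    w and conj(w) times a power of the cutoff, a divergence-free field (P, Q) annihilating w makes J
    df/dconj(w) the divergence of (P f, Q f), whose integral vanishes; this is a recursion between
    moments. It sees only the chart, so one estimate serves twice: in the coordinates of the disc it
    bounds Taylor coefficients by the Bergman norm, in the coordinates (a, b) of G it bounds c_k by
    the L^p norm of V. The cutoff lives in a rectangle of G of size polynomial in k, where Haar and
    Lebesgue measure are comparable, while |w|^(2k) >= 1/2 on a box inside; this fixes 1 - r^2 = (k
    + 6)^-2. The integral bounds use x <= 1 + x^p (or 1 + x^2), hence are not homogeneous; rescaling
    the vector makes them linear in the norm. The decay of the coefficients of a smooth vector rests
    on the Bergman bound: coefficients are continuous functionals, so J derivatives along the
    rotations multiply the k-th one by (-i (n + 2k))^J, and the result still has polynomial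
    growth. *)

Section complex_basics.
Context {R : realType}.
Implicit Types (z w : cplx R) (t : R).

Lemma complex_eq z w : rpart z = rpart w -> ipart z = ipart w -> z = w.
Proof. by case: z w => [a b] [c d] /= -> ->. Qed.

Lemma rpartD z w : rpart (z + w) = rpart z + rpart w.
Proof. by case: z w => [a b] [c d]. Qed.

Lemma ipartD z w : ipart (z + w) = ipart z + ipart w.
Proof. by case: z w => [a b] [c d]. Qed.

Lemma rpartN z : rpart (- z) = - rpart z.
Proof. by case: z. Qed.

Lemma ipartN z : ipart (- z) = - ipart z.
Proof. by case: z. Qed.

Lemma rpartB z w : rpart (z - w) = rpart z - rpart w.
Proof. by rewrite rpartD rpartN. Qed.

Lemma ipartB z w : ipart (z - w) = ipart z - ipart w.
Proof. by rewrite ipartD ipartN. Qed.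

Lemma rpartM z w : rpart (z * w) = rpart z * rpart w - ipart z * ipart w.
Proof. by case: z w => [a b] [c d]. Qed.

Lemma ipartM z w : ipart (z * w) = rpart z * ipart w + ipart z * rpart w.
Proof. by case: z w => [a b] [c d]. Qed.

Lemma rpart_conj z : rpart z^* = rpart z.
Proof. by case: z. Qed.

Lemma ipart_conj z : ipart z^* = - ipart z.
Proof. by case: z. Qed.

Lemma rpart_ofR t : rpart (ofR t) = t. Proof. by []. Qed.
Lemma ipart_ofR t : ipart (ofR t) = 0. Proof. by []. Qed.
Lemma rpart0 : rpart (0 : cplx R) = 0. Proof. by []. Qed.
Lemma ipart0 : ipart (0 : cplx R) = 0. Proof. by []. Qed.
Lemma rpart1 : rpart (1 : cplx R) = 1. Proof. by []. Qed.
Lemma ipart1 : ipart (1 : cplx R) = 0. Proof. by []. Qed.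
Lemma rpart_imag : rpart (imag : cplx R) = 0. Proof. by []. Qed.
Lemma ipart_imag : ipart (imag : cplx R) = 1. Proof. by []. Qed.

Definition partE := (rpartB, ipartB, rpartD, ipartD, rpartN, ipartN, rpartM,
  ipartM, rpart_conj, ipart_conj, rpart_ofR, ipart_ofR, rpart0, ipart0,
  rpart1, ipart1, rpart_imag, ipart_imag).

Lemma rpart_sum (I : Type) (r : seq I) (P : pred I) (F : I -> cplx R) :
  rpart (\sum_(i <- r | P i) F i) = \sum_(i <- r | P i) rpart (F i).
Proof. by apply: (big_morph rpart) => // x y; exact: rpartD. Qed.

Lemma ipart_sum (I : Type) (r : seq I) (P : pred I) (F : I -> cplx R) :
  ipart (\sum_(i <- r | P i) F i) = \sum_(i <- r | P i) ipart (F i).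
Proof. by apply: (big_morph ipart) => // x y; exact: ipartD. Qed.

Lemma ofRD t (s : R) : ofR (t + s) = ofR t + ofR s.
Proof. by apply: complex_eq; rewrite !partE ?addr0. Qed.

Lemma ofRN t : ofR (- t) = - ofR t.
Proof. by apply: complex_eq; rewrite !partE ?oppr0. Qed.

Lemma ofRB t (s : R) : ofR (t - s) = ofR t - ofR s.
Proof. by rewrite ofRD ofRN. Qed.

Lemma ofRM t (s : R) : ofR (t * s) = ofR t * ofR s.
Proof. by apply: complex_eq; rewrite !partE; ring. Qed.

Lemma ofR0 : ofR (0 : R) = 0. Proof. by []. Qed.
Lemma ofR1 : ofR (1 : R) = 1. Proof. by []. Qed.

Lemma ofRX t k : ofR (t ^+ k) = ofR t ^+ k.
Proof. by elim: k => [|k IH]; rewrite ?expr0// !exprS ofRM IH. Qed.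

Lemma ofR_nat k : ofR (k%:R : R) = k%:R.
Proof. by elim: k => [|k IH]; rewrite ?mulr0n// !mulrS ofRD IH. Qed.

Lemma ofR_eq0 t : (ofR t == 0) = (t == 0).
Proof. by apply/eqP/eqP => [[]|->]. Qed.

Lemma ofRV t : ofR t^-1 = (ofR t)^-1.
Proof.
have [->|t0] := eqVneq t 0; first by rewrite invr0 ofR0 invr0.
by apply: (mulfI (x := ofR t)); rewrite ?ofR_eq0// -ofRM !divff// ofR_eq0.
Qed.

Lemma conj_ofR t : (ofR t)^* = ofR t.
Proof. by apply: complex_eq; rewrite !partE ?oppr0. Qed.

Lemma conj_imag : (imag : cplx R)^* = - imag.
Proof. by apply: complex_eq; rewrite !partE ?oppr0. Qed.

Lemma imag_sqr : imag * imag = -1 :> cplx R.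
Proof. by apply: complex_eq; rewrite !partE; ring. Qed.

Lemma normE z : `|z| = ofR (modulus z).
Proof. by rewrite /modulus; case: z. Qed.

Lemma ler_ofR t (s : R) : (ofR t <= ofR s) = (t <= s).
Proof. exact: lecR. Qed.

Lemma ltr_ofR t (s : R) : (ofR t < ofR s) = (t < s).
Proof. exact: ltcR. Qed.

Lemma ofR_gt0 t : (0 < ofR t) = (0 < t).
Proof. exact: (ltr_ofR 0). Qed.

(** In the order of [cplx R] a positive element is real. Through this fact balls and distances,
    whose radii are positive elements of [cplx R], become statements about a real radius and
    [modulus]. *)
Lemma gt0_ofR z : 0 < z -> exists2 e : R, 0 < e & z = ofR e.
Proof.
case: z => a b; rewrite ltcE/= => /andP[/eqP b0 a0]; exists a => //.
exact: complex_eq.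
Qed.

Lemma ofR_inj : injective (@ofR R).
Proof. by move=> x y []. Qed.

Lemma modulus_ge0 z : 0 <= modulus z.
Proof. by rewrite -ler_ofR -normE normr_ge0. Qed.

Lemma modulusM z w : modulus (z * w) = modulus z * modulus w.
Proof. by apply: ofR_inj; rewrite ofRM -!normE normrM. Qed.

Lemma modulusD z w : modulus (z + w) <= modulus z + modulus w.
Proof. by rewrite -ler_ofR ofRD -!normE ler_normD. Qed.

Lemma modulusN z : modulus (- z) = modulus z.
Proof. by apply: ofR_inj; rewrite -!normE normrN. Qed.

Lemma modulusB z w : modulus (z - w) <= modulus z + modulus w.
Proof. by rewrite (le_trans (modulusD _ _))// modulusN. Qed.

Lemma modulusC z w : modulus (z - w) = modulus (w - z).
Proof. by rewrite -modulusN opprB. Qed.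

Lemma modulus0 : modulus (0 : cplx R) = 0.
Proof. by apply: ofR_inj; rewrite -normE normr0. Qed.

Lemma modulus1 : modulus (1 : cplx R) = 1.
Proof. by apply: ofR_inj; rewrite -normE normr1. Qed.

Lemma modulus_eq0 z : (modulus z == 0) = (z == 0).
Proof. by rewrite -ofR_eq0 -normE normr_eq0. Qed.

Lemma modulus_gt0 z : (0 < modulus z) = (z != 0).
Proof. by rewrite lt_neqAle modulus_ge0 andbT eq_sym modulus_eq0. Qed.

Lemma modulusX z k : modulus (z ^+ k) = modulus z ^+ k.
Proof. by elim: k => [|k IH]; rewrite ?modulus1// !exprS modulusM IH. Qed.

Lemma modulusV z : modulus z^-1 = (modulus z)^-1.
Proof. by apply: ofR_inj; rewrite ofRV -!normE normfV. Qed.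

Lemma modulus_conj z : modulus z^* = modulus z.
Proof. by apply: ofR_inj; rewrite -!normE norm_conjC. Qed.

Lemma modulus_ofR t : modulus (ofR t) = `|t|.
Proof.
have [t0|t0] := ger0P t.
  by apply: ofR_inj; rewrite -normE ger0_norm// -ofR0 ler_ofR.
apply: ofR_inj; rewrite -normE ofRN ltr0_norm// -ofR0 ltr_ofR//.
Qed.

Lemma modulus_imag : modulus (imag : cplx R) = 1.
Proof.
apply/eqP; rewrite -(@eqrXn2 _ 2)// ?modulus_ge0// expr1n -modulusX expr2.
by rewrite imag_sqr modulusN modulus1.
Qed.

Lemma modulus_nat k : modulus (k%:R : cplx R) = k%:R.
Proof. by rewrite -ofR_nat modulus_ofR normr_nat. Qed.

Lemma modulus_sqr z : modulus z ^+ 2 = rpart z ^+ 2 + ipart z ^+ 2.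
Proof.
apply: ofR_inj; rewrite ofRX -normE -add_Re2_Im2 //.
Qed.

Lemma mul_conj_sqr z : z * z^* = ofR (modulus z ^+ 2).
Proof. by rewrite modulus_sqr; apply: complex_eq; rewrite !partE; ring. Qed.

Lemma rpart_le z : `|rpart z| <= modulus z.
Proof.
rewrite -(@ler_pXn2r _ 2)// ?nnegrE// ?modulus_ge0// modulus_sqr.
by rewrite real_normK ?num_real// lerDl sqr_ge0.
Qed.

Lemma ipart_le z : `|ipart z| <= modulus z.
Proof.
rewrite -(@ler_pXn2r _ 2)// ?nnegrE// ?modulus_ge0// modulus_sqr.
by rewrite real_normK ?num_real// lerDr sqr_ge0.
Qed.

Lemma complexE z : z = ofR (rpart z) + imag * ofR (ipart z).
Proof. by apply: complex_eq; rewrite !partE; ring. Qed.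

Lemma modulus_le z : modulus z <= `|rpart z| + `|ipart z|.
Proof.
rewrite {1}(complexE z) (le_trans (modulusD _ _))// modulusM modulus_imag.
by rewrite mul1r !modulus_ofR.
Qed.

Lemma modulus_sum (I : Type) (r : seq I) (P : pred I) (F : I -> cplx R) :
  modulus (\sum_(i <- r | P i) F i) <= \sum_(i <- r | P i) modulus (F i).
Proof.
elim/big_ind2 : _ => [|x1 x2 y1 y2 h1 h2|//]; first by rewrite modulus0.
by rewrite (le_trans (modulusD _ _))// lerD.
Qed.

Lemma discE z : disc z <-> modulus z < 1.
Proof. by rewrite /disc /= normE -ofR1 ltr_ofR. Qed.

Lemma norm_lt1 z : (`|z| < 1) = (modulus z < 1).
Proof. by rewrite normE -ltr_ofR. Qed.

Lemma point_ofE t (s : R) : point_of (t, s) = ofR t + imag * ofR s.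
Proof. by apply: complex_eq; rewrite !partE/=; ring. Qed.

Lemma modulus_lerB z w : modulus z - modulus w <= modulus (z - w).
Proof. by rewrite lerBlDr (le_trans _ (modulusD _ _))// subrK. Qed.

Lemma cvg_cplxP (T : Type) (F : set_system T) (FF : Filter F) (f : T -> cplx R)
    (l : cplx R) :
  f x @[x --> F] --> l <->
  forall e : R, 0 < e -> \forall x \near F, modulus (f x - l) < e.
Proof.
split.
  move=> /cvgrPdist_lt h e e0.
  have := h (ofR e); rewrite ofR_gt0 => /(_ e0).
  by apply: filterS => x; rewrite normE ltr_ofR modulusC.
move=> h; apply/cvgrPdist_lt => _ /gt0_ofR[e e0 ->].
by have := h _ e0; apply: filterS => x; rewrite normE ltr_ofR modulusC.
Qed.

Lemma nbhs_cplxP z (A : set (cplx R)) :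
  nbhs z A <-> exists2 d : R, 0 < d & forall w, modulus (w - z) < d -> A w.
Proof.
split.
  rewrite -nbhs_ballE => -[e /= /gt0_ofR[d d0 ->] dA].
  exists d => // w wz; apply: dA.
  by rewrite /ball/= normE modulusC ltr_ofR.
move=> [d d0 dA].
rewrite -nbhs_ballE; exists (ofR d); first by rewrite /= ofR_gt0.
by move=> w; rewrite /ball/= normE modulusC ltr_ofR => /dA.
Qed.

End complex_basics.

(** * Absolutely convergent complex series *)

Section complex_series.
Context {R : realType}.
Implicit Types (f g : nat -> cplx R) (a : nat -> cplx R) (z w : cplx R) (B : R).

Definition csum f : cplx R := limn (fun n => \sum_(k < n) f k).

(** Absolute convergence with a named bound on the partial sums: one hypothesis yields both the
    convergence of the series and the estimate of its sum. *)
Definition asum f B := forall n, \sum_(k < n) modulus (f k) <= B.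

Lemma cvg_rpart_ipart (s : nat -> cplx R) (l m : R) :
  (rpart (s n) @[n --> \oo] --> l) -> (ipart (s n) @[n --> \oo] --> m) ->
  s n @[n --> \oo] --> ofR l + imag * ofR m.
Proof.
move=> /cvgrPdist_lt sl /cvgrPdist_lt sm; apply/cvg_cplxP => e e0.
have e2 : 0 < e / 2 by rewrite divr_gt0.
near=> n; rewrite (le_lt_trans (modulus_le _))// [e]splitr !partE.
apply: ltrD; rewrite distrC.
- rewrite (_ : l + _ = l); last by ring.
  by near: n; exact: sl.
- rewrite (_ : 0 + _ = m); last by ring.
  by near: n; exact: sm.
Unshelve. all: by end_near. Qed.

Lemma cvg_modulus_le (s : nat -> cplx R) l B :
  s n @[n --> \oo] --> l -> (forall n, modulus (s n) <= B) -> modulus l <= B.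
Proof.
move=> /cvg_cplxP sl sB; rewrite leNgt; apply/negP => Bl.
have /sl [N _ /(_ N (leqnn N))] : 0 < modulus l - B by rewrite subr_gt0.
rewrite modulusC ltNge => /negP; apply.
by rewrite (le_trans _ (modulus_lerB _ _))// lerB.
Qed.

Lemma asum_cvg f B : asum f B -> \sum_(k < n) f k @[n --> \oo] --> csum f.
Proof.
move=> fB.
have aux (h : nat -> R) : (forall k, `|h k| <= modulus (f k)) ->
    cvgn (fun n => \sum_(k < n) h k).
  move=> hf; have : cvgn (series h).
    apply: normed_cvg; apply: nondecreasing_is_cvgn.
      apply/nondecreasing_seqP => n; rewrite -[X in X <= _]/(\sum_(0 <= k < n) `|h k|) -[X in _ <= X]/(\sum_(0 <= k < n.+1) `|h k|) big_nat_recr//=.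
      by rewrite lerDl.
    exists B => _ [n _ <-]; rewrite -[X in X <= _]/(\sum_(0 <= k < n) `|h k|) big_mkord.
    by apply: le_trans (fB n); apply: ler_sum => k _; exact: hf.
  by rewrite (_ : series h = fun n => \sum_(k < n) h k)//; apply/funext => n; rewrite /series/= big_mkord.
have /cvg_ex[l hl] := aux (rpart \o f) (fun k => rpart_le (f k)).
have /cvg_ex[m hm] := aux (ipart \o f) (fun k => ipart_le (f k)).
apply/cvg_ex; exists (ofR l + imag * ofR m); apply: cvg_rpart_ipart.
- by under eq_fun do rewrite rpart_sum.
- by under eq_fun do rewrite ipart_sum.
Qed.

Lemma cvg_csum f l : \sum_(k < n) f k @[n --> \oo] --> l -> csum f = l.
Proof. by move=> /cvg_lim; apply. Qed.

Lemma csum_le f B : asum f B -> modulus (csum f) <= B.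
Proof.
move=> fB; apply: (cvg_modulus_le (asum_cvg fB)) => n.
exact: le_trans (modulus_sum _ _ _) (fB n).
Qed.

Lemma asum_shift f B N : asum f B -> asum (fun k => f (N + k)%N) B.
Proof.
move=> fB n; apply: le_trans (fB (N + n)%N).
by rewrite big_split_ord/= lerDr sumr_ge0// => i _; exact: modulus_ge0.
Qed.

Lemma asumZ (c : cplx R) f B : asum f B -> asum (fun k => c * f k) (modulus c * B).
Proof.
move=> fB n; under eq_bigr do rewrite modulusM.
by rewrite -mulr_sumr ler_wpM2l// modulus_ge0.
Qed.

Lemma asumD f g B B' : asum f B -> asum g B' -> asum (fun k => f k + g k) (B + B').
Proof.
move=> fB gB n; rewrite (le_trans _ (lerD (fB n) (gB n)))// -big_split/=.
by apply: ler_sum => k _; exact: modulusD.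
Qed.

Lemma csum_split f B N : asum f B ->
  csum f = \sum_(k < N) f k + csum (fun k => f (N + k)%N).
Proof.
move=> fB; apply: cvg_csum; rewrite -(cvg_shiftn N)/=.
under eq_fun => n do rewrite addnC big_split_ord/=.
exact: (cvgD (cvg_cst _) (asum_cvg (asum_shift N fB))).
Qed.

Lemma csum_recl f B : asum f B -> csum f = f 0 + csum (fun k => f k.+1).
Proof. by move=> fB; rewrite (csum_split 1 fB) big_ord1. Qed.

Lemma csumD f g B B' : asum f B -> asum g B' ->
  csum (fun k => f k + g k) = csum f + csum g.
Proof.
move=> fB gB; apply: cvg_csum.
under eq_fun => n do rewrite big_split/=.
exact: (cvgD (asum_cvg fB) (asum_cvg gB)).
Qed.

Lemma csumZ (c : cplx R) f B : asum f B -> csum (fun k => c * f k) = c * csum f.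
Proof.
move=> fB; apply: cvg_csum.
under eq_fun => n do rewrite -mulr_sumr.
exact: (cvgM (cvg_cst _) (asum_cvg fB)).
Qed.

Lemma asumB f g B B' : asum f B -> asum g B' -> asum (fun k => f k - g k) (B + B').
Proof.
move=> fB gB; apply: asumD => // n.
by under eq_bigr do rewrite modulusN.
Qed.

Lemma csumB f g B B' : asum f B -> asum g B' ->
  csum (fun k => f k - g k) = csum f - csum g.
Proof.
move=> fB gB; apply: cvg_csum.
under eq_fun => n do rewrite sumrB/=.
exact: (cvgB (asum_cvg fB) (asum_cvg gB)).
Qed.

Lemma csum_fin f N : (forall k, (N <= k)%N -> f k = 0) -> csum f = \sum_(k < N) f k.
Proof.
move=> f0; apply: cvg_csum; rewrite -(cvg_shiftn N)/=.
rewrite (_ : (fun n => _) = fun=> \sum_(k < N) f k); first exact: (@cvg_cst (cplx R)).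
apply/funext => n; rewrite addnC big_split_ord/= [X in _ + X]big1 ?addr0// => i _.
by rewrite f0// leq_addr.
Qed.

(** Telescoping: 1/(n+2)^2 <= 1/(n+1) - 1/(n+2), so the induction runs on the sharper bound 2 -
    1/(n+1). *)
Lemma sum_inv_sqr n : \sum_(k < n) (k.+1%:R ^- 2 : R) <= 2.
Proof.
suff h : \sum_(k < n.+1) (k.+1%:R ^- 2 : R) <= 2 - n.+1%:R^-1.
  rewrite (le_trans (y := \sum_(k < n.+1) (k.+1%:R ^- 2 : R)))//.
    by rewrite big_ord_recr/= lerDl invr_ge0 exprn_ge0.
  by rewrite (le_trans h)// gerBl invr_ge0.
elim: n => [|n IH]; first by rewrite big_ord1 expr1n invr1; lra.
rewrite big_ord_recr/=; apply: le_trans (lerD IH (lexx _)) _.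
rewrite -lerBrDl; have n0 : (0 : R) < n.+1%:R by rewrite ltr0n.
rewrite -[n.+2]addn1 natrD; set x : R := n.+1%:R in n0 *.
have x1 : 0 < x + 1%:R by rewrite addr_gt0.
rewrite -subr_ge0 (_ : _ - _ = x^-1 * (x + 1%:R) ^- 2); last first.
  by field; rewrite !gt_eqF//.
by rewrite mulr_ge0// invr_ge0 ?exprn_ge0// ltW.
Qed.

(** The criterion used throughout: two powers of the index pay for summability, at the price of the
    factor 2 from [sum_inv_sqr]. *)
Lemma asum_sqr f B : (forall k, modulus (f k) * k.+1%:R ^+ 2 <= B) -> asum f (2 * B).
Proof.
move=> fB n; have B0 : 0 <= B.
  by apply: le_trans (fB 0); rewrite mulr_ge0// modulus_ge0.
apply: (le_trans (y := \sum_(k < n) B * k.+1%:R ^- 2)).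
  apply: ler_sum => k _; rewrite ler_pdivlMr ?exprn_gt0 ?ltr0n//; exact: fB.
by rewrite -mulr_sumr mulrC ler_wpM2r// sum_inv_sqr.
Qed.

Definition ps a : cplx R -> cplx R := fun z =>
  if `|z| < 1 then csum (fun k => a k * z ^+ k) else 0.

(** Weighted sup seminorms on coefficient sequences; [rdec] is the space of rapidly decreasing
    sequences and [pbound] its dual, the sequences of polynomial growth. *)
Definition rdec_by m B a := forall k, modulus (a k) * k.+1%:R ^+ m <= B.
Definition rdec a := forall m, exists B, rdec_by m B a.
Definition pbound c := exists m B, forall k, modulus (c k : cplx R) <= B * k.+1%:R ^+ m.

End complex_series.

(** * Power series: linearity, shift, derivative, Taylor expansion *)

Section power_series.
Context {R : realType}.
Implicit Types (a b : nat -> cplx R) (z w : cplx R) (B : R).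

Lemma rdec_byW m m' B a : (m' <= m)%N -> rdec_by m B a -> rdec_by m' B a.
Proof.
move=> mm aB k; apply: le_trans (aB k); rewrite ler_wpM2l ?modulus_ge0//.
by rewrite ler_weXn2l// ler1n.
Qed.

Lemma rdec_by_ge0 m B a : rdec_by m B a -> 0 <= B.
Proof.
by move=> /(_ 0); apply: le_trans; rewrite mulr_ge0 ?modulus_ge0// exprn_ge0.
Qed.

Lemma asum_ps m B a z : (1 < m)%N -> rdec_by m B a -> modulus z <= 1 ->
  asum (fun k => a k * z ^+ k) (2 * B).
Proof.
move=> m1 aB z1; apply: asum_sqr => k; apply: le_trans (rdec_byW m1 aB k).
rewrite modulusM ler_wpM2r ?exprn_ge0// modulusX ler_piMr ?modulus_ge0//.
by rewrite exprn_ile1// modulus_ge0.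
Qed.

Lemma psE a z : modulus z < 1 -> ps a z = csum (fun k => a k * z ^+ k).
Proof. by rewrite /ps -norm_lt1 => ->. Qed.

Lemma ps_out a z : 1 <= modulus z -> ps a z = 0.
Proof. by rewrite /ps norm_lt1 leNgt => /negbTE ->. Qed.

Lemma ps_le m B a z : (1 < m)%N -> rdec_by m B a -> modulus (ps a z) <= 2 * B.
Proof.
move=> m1 aB; have [z1|z1] := ltP (modulus z) 1; last first.
  by rewrite ps_out// modulus0 mulr_ge0// (rdec_by_ge0 aB).
by rewrite psE//; apply/csum_le/(asum_ps m1 aB)/ltW.
Qed.

(** Induction on the power with q = s * s: one factor s^k controls (k+1)^m by induction, the other
    absorbs the extra k + 1 through s^k (1 + k (1 - s)) <= 1. *)
Lemma natX_geo m (q : R) : 0 <= q < 1 -> exists B, forall k, k.+1%:R ^+ m * q ^+ k <= B.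
Proof.
elim: m q => [|m IH] q /andP[q0 q1].
  by exists 1 => k; rewrite mul1r exprn_ile1// ltW.
have s1 : 0 <= Num.sqrt q < 1.
  rewrite sqrtr_ge0/= -(@ltr_pXn2r _ 2)// ?nnegrE ?sqrtr_ge0//.
  by rewrite sqr_sqrtr// expr1n.
set s := Num.sqrt q in s1; have [B hB] := IH _ s1.
have [s0 s11] := andP s1.
have geo k : k%:R * (1 - s) * s ^+ k <= 1.
  have hk : s ^+ k * (1 + k%:R * (1 - s)) <= 1.
    elim: k => [|k IHk]; first by rewrite mul0r addr0 mul1r.
    apply: le_trans IHk; rewrite exprSr -mulrA ler_wpM2l ?exprn_ge0//.
    have kk : 0 <= (k%:R : R) by [].
    rewrite -natr1 -subr_ge0 (_ : _ - _ = (1 - s) ^+ 2 * (1 + k%:R)); last by ring.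
    by rewrite mulr_ge0 ?sqr_ge0// addr_ge0.
  apply: le_trans hk; have := exprn_ge0 k s0; set x := s ^+ k.
  by move=> x0; rewrite [leRHS]mulrDr mulr1 [leLHS]mulrC lerDr.
have B0 : 0 <= B by apply: le_trans (hB 0%N); rewrite !mulr1 exprn_ge0.
exists (B * (1 + (1 - s)^-1)) => k.
have -> : q = s * s by rewrite -expr2 sqr_sqrtr.
rewrite exprSr exprMn (_ : _ * _ = (k.+1%:R ^+ m * s ^+ k) * (k.+1%:R * s ^+ k)); last by ring.
apply: ler_pM; rewrite ?mulr_ge0 ?exprn_ge0//.
rewrite -nat1r mulrDl mul1r lerD ?exprn_ile1 ?(ltW s11)//.
have s1' : 0 < 1 - s by rewrite subr_gt0.
by rewrite -[leRHS]mul1r ler_pdivlMr// mulrAC.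
Qed.

Lemma pbound_asum a z : pbound a -> modulus z < 1 ->
  exists B, asum (fun k => a k * z ^+ k) B.
Proof.
move=> [m [B aB]] z1.
have [M hM] := natX_geo (m + 2) (introT andP (conj (modulus_ge0 z) z1)).
have B0 : 0 <= B.
  by have := le_trans (modulus_ge0 _) (aB 0%N); rewrite expr1n mulr1.
exists (2 * (B * M)); apply: asum_sqr => k.
rewrite modulusM modulusX.
apply: (le_trans (y := B * (k.+1%:R ^+ (m + 2) * modulus z ^+ k))); last first.
  by rewrite ler_wpM2l.
rewrite exprD (_ : B * _ = B * k.+1%:R ^+ m * (modulus z ^+ k * k.+1%:R ^+ 2)); last by ring.
by rewrite -[leLHS]mulrA ler_wpM2r ?mulr_ge0 ?exprn_ge0 ?modulus_ge0.
Qed.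

Lemma rdec_pbound a : rdec a -> pbound a.
Proof. by move=> /(_ 0%N)[B aB]; exists 0%N, B => k; have := aB k; rewrite !mulr1. Qed.

Lemma pboundZ (c : cplx R) a : pbound a -> pbound (fun k => c * a k).
Proof.
move=> [m [B aB]]; exists m, (modulus c * B) => k.
by rewrite modulusM -mulrA ler_wpM2l ?modulus_ge0.
Qed.

Lemma pboundD a b : pbound a -> pbound b -> pbound (fun k => a k + b k).
Proof.
have aux m m' B c k : modulus (c k) <= B * k.+1%:R ^+ m ->
    modulus (c k) <= `|B| * k.+1%:R ^+ (m + m') :> R.
  move=> /le_trans; apply.
  apply: (le_trans (y := `|B| * k.+1%:R ^+ m)).
    by rewrite ler_wpM2r ?exprn_ge0// ler_norm.
  by rewrite ler_wpM2l// ler_weXn2l ?ler1n ?leq_addr.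
move=> [m [B aB]] [m' [B' bB]]; exists (m + m')%N, (`|B| + `|B'|) => k.
rewrite mulrDl (le_trans (modulusD _ _))// lerD//; first exact: aux.
by rewrite addnC; exact: aux.
Qed.

Lemma rdecZ (c : cplx R) a : rdec a -> rdec (fun k => c * a k).
Proof.
move=> h m; have [B aB] := h m; exists (modulus c * B) => k.
by rewrite modulusM -mulrA ler_wpM2l ?modulus_ge0.
Qed.

Lemma rdec_byD m B B' a b : rdec_by m B a -> rdec_by m B' b ->
  rdec_by m (B + B') (fun k => a k + b k).
Proof.
move=> aB bB k; apply: le_trans (lerD (aB k) (bB k)).
by rewrite -mulrDl ler_wpM2r ?exprn_ge0// modulusD.
Qed.

Lemma rdec_byZ m B (c : cplx R) a : rdec_by m B a ->
  rdec_by m (modulus c * B) (fun k => c * a k).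
Proof. by move=> aB k; rewrite modulusM -mulrA ler_wpM2l ?modulus_ge0. Qed.

Lemma rdecD a b : rdec a -> rdec b -> rdec (fun k => a k + b k).
Proof.
move=> ha hb m; have [B aB] := ha m; have [B' bB] := hb m.
by exists (B + B'); exact: rdec_byD.
Qed.

Lemma psZ (c : cplx R) a z : pbound a -> ps (fun k => c * a k) z = c * ps a z.
Proof.
move=> pa; have [z1|z1] := ltP (modulus z) 1; last by rewrite !ps_out// mulr0.
have [B aB] := pbound_asum pa z1.
by rewrite !psE// -(csumZ _ aB); congr csum; apply/funext => k; rewrite mulrA.
Qed.

Lemma psD a b z : pbound a -> pbound b -> ps (fun k => a k + b k) z = ps a z + ps b z.
Proof.
move=> pa pb; have [z1|z1] := ltP (modulus z) 1; last by rewrite !ps_out// addr0.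
have [B aB] := pbound_asum pa z1; have [B' bB] := pbound_asum pb z1.
by rewrite !psE// -(csumD aB bB); congr csum; apply/funext => k; rewrite mulrDl.
Qed.

(** On power series [shiftr] is multiplication by z and [deriv_coef] is differentiation; every d
    pi_n(X) is built from these two. *)
Definition shiftr a : nat -> cplx R := fun k => if k is k'.+1 then a k' else 0.
Definition deriv_coef a : nat -> cplx R := fun k => k.+1%:R * a k.+1.

Lemma rdec_by_shiftr m B a : rdec_by m B a -> rdec_by m (2 ^+ m * B) (shiftr a).
Proof.
move=> aB [|k] /=.
  by rewrite modulus0 mul0r mulr_ge0 ?exprn_ge0// (rdec_by_ge0 aB).
rewrite (le_trans (y := modulus (a k) * (2 * k.+1%:R) ^+ m))//.
  rewrite ler_wpM2l ?modulus_ge0// lerXn2r ?nnegrE//.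
  by rewrite -natrM ler_nat mul2n -addnn addSnnS leq_addl.
by rewrite exprMn mulrCA ler_wpM2l ?exprn_ge0.
Qed.

Lemma rdec_by_deriv m B a : rdec_by m.+1 B a -> rdec_by m B (deriv_coef a).
Proof.
move=> aB k; apply: le_trans (aB k.+1); rewrite /deriv_coef modulusM modulus_nat.
rewrite mulrAC mulrC ler_wpM2l ?modulus_ge0// -exprS lerXn2r ?nnegrE//.
by rewrite ler_nat.
Qed.

Lemma rdec_shiftr a : rdec a -> rdec (shiftr a).
Proof.
by move=> ra m; have [B aB] := ra m; exists (2 ^+ m * B); exact: rdec_by_shiftr.
Qed.

Lemma rdec_deriv a : rdec a -> rdec (deriv_coef a).
Proof. by move=> ra m; have [B aB] := ra m.+1; exists B; exact: rdec_by_deriv. Qed.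

Lemma ps_shiftr a z : rdec a -> ps (shiftr a) z = z * ps a z.
Proof.
move=> ra; have [z1|z1] := ltP (modulus z) 1; last by rewrite !ps_out// mulr0.
have [B aB] := pbound_asum (rdec_pbound (rdec_shiftr ra)) z1.
have [B' aB'] := pbound_asum (rdec_pbound ra) z1.
rewrite !psE// (csum_recl aB) mul0r add0r -(csumZ _ aB').
by congr csum; apply/funext => k /=; rewrite exprS mulrCA.
Qed.

(** The remainders satisfy rem(k+1) = w rem(k) + k z^(k-1) (w - z)^2, powers of z and w are at most
    1 in modulus, and k^2 + k <= (k+1)^2. *)
Lemma pow_taylor k z w : modulus z <= 1 -> modulus w <= 1 ->
  modulus (w ^+ k - z ^+ k - k%:R * z ^+ k.-1 * (w - z)) <=
  k%:R ^+ 2 * modulus (w - z) ^+ 2.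
Proof.
move=> z1 w1; elim: k => [|k IH].
  by rewrite subrr sub0r !mul0r oppr0 modulus0 expr2 !mul0r.
have -> : w ^+ k.+1 - z ^+ k.+1 - k.+1%:R * z ^+ k * (w - z) =
    w * (w ^+ k - z ^+ k - k%:R * z ^+ k.-1 * (w - z)) +
    k%:R * z ^+ k.-1 * (w - z) ^+ 2.
  case: k {IH} => [|k]; first by rewrite !expr1 !expr0; ring.
  by rewrite -pred_Sn !exprS -[k.+2]addn2 -[k.+1]addn1 !natrD; ring.
rewrite (le_trans (modulusD _ _))// !modulusM !modulusX.
apply: (le_trans (y := k%:R ^+ 2 * modulus (w - z) ^+ 2 +
    k%:R * modulus (w - z) ^+ 2)).
  apply: lerD; first by rewrite (le_trans _ IH)// ler_piMl ?modulus_ge0.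
  rewrite -expr2 ler_wpM2r ?exprn_ge0 ?modulus_ge0// modulus_nat ler_piMr//.
  by rewrite exprn_ile1 ?modulus_ge0.
rewrite -mulrDl ler_wpM2r ?exprn_ge0 ?modulus_ge0// -natr1.
by have : 0 <= (k%:R : R) by []; set x : R := k%:R; nra.
Qed.

(** Of the four orders of decay, two pay for the factor k^2 of the termwise remainder and two for
    summability. *)
Lemma ps_taylor a B z w : rdec_by 4 B a -> modulus z < 1 -> modulus w < 1 ->
  modulus (ps a w - ps a z - ps (deriv_coef a) z * (w - z)) <=
  2 * B * modulus (w - z) ^+ 2.
Proof.
move=> aB z1 w1; rewrite !psE//.
have sz := asum_ps (isT : (1 < 4)%N) aB (ltW z1).
have sw := asum_ps (isT : (1 < 4)%N) aB (ltW w1).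
have sd := asum_ps (isT : (1 < 3)%N) (rdec_by_deriv aB) (ltW z1).
set f := fun k => a k * (w ^+ k - z ^+ k - k%:R * z ^+ k.-1 * (w - z)).
have fs : asum f (2 * (B * modulus (w - z) ^+ 2)).
  apply: asum_sqr => k; rewrite modulusM.
  apply: (le_trans (y := modulus (a k) * (k.+1%:R ^+ 2 * modulus (w - z) ^+ 2) * k.+1%:R ^+ 2)).
    rewrite ler_wpM2r ?exprn_ge0// ler_wpM2l ?modulus_ge0//.
    rewrite (le_trans (pow_taylor _ (ltW z1) (ltW w1)))//.
    by rewrite ler_wpM2r ?exprn_ge0 ?modulus_ge0// ler_pXn2r ?nnegrE// ler_nat.
  rewrite [leLHS](_ : _ = modulus (a k) * k.+1%:R ^+ 4 * modulus (w - z) ^+ 2); last by ring.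
  by rewrite ler_wpM2r ?exprn_ge0 ?modulus_ge0.
set g := fun k => (w - z) * (k%:R * a k * z ^+ k.-1).
have hg : asum g (modulus (w - z) * (2 * B)).
  move=> [|n].
    by rewrite big_ord0 mulr_ge0 ?modulus_ge0 ?mulr_ge0 ?(rdec_by_ge0 aB).
  rewrite big_ord_recl {1}/g !mul0r mulr0 modulus0 add0r.
  exact: (asumZ (w - z) sd n).
have hd : csum (fun k => deriv_coef a k * z ^+ k) * (w - z) = csum g.
  by rewrite (csum_recl hg) {1}/g !mul0r mulr0 add0r mulrC -(csumZ (w - z) sd).
rewrite hd -(csumB sw sz) -(csumB (asumB sw sz) hg).
rewrite (_ : (fun k => _) = f); first by rewrite (le_trans (csum_le fs))// mulrA.
apply/funext => k; rewrite /f /g.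
set x := a k; set y := z ^+ _; set t := z ^+ _; set s := w ^+ k.
by ring.
Qed.

End power_series.

(** * The discrete series on power series *)

Section discrete_series_action.
Context {R : realType}.
Implicit Types (a b : nat -> cplx R) (z w : cplx R) (B e : R)
  (g h X Y : 'M[cplx R]_2) (v : cplx R -> cplx R).

Definition mobius_den g z : cplx R := - g 1 0 * z + g 0 0.
Definition mobius_num g z : cplx R := g 1 1 * z - g 0 1.

Lemma discrete_seriesE n g v z : modulus z < 1 ->
  discrete_series n g v z =
  mobius_den g z ^- n * v (mobius_num g z / mobius_den g z).
Proof. by rewrite /discrete_series norm_lt1 => ->. Qed.

Lemma discrete_series_out n g v z : 1 <= modulus z -> discrete_series n g v z = 0.
Proof. by rewrite /discrete_series norm_lt1 leNgt => /negbTE ->. Qed.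

Lemma SU11_mod g : SU11 g -> modulus (g 0 0) ^+ 2 - modulus (g 0 1) ^+ 2 = 1.
Proof.
move=> [_ _]; rewrite !normE -!ofRX -ofRB => h.
by apply: (@ofR_inj R); rewrite h.
Qed.

(** SU(1,1) preserves the Hermitian form of signature (1,1); evaluated at (z, 1) this shows that the
    Moebius action preserves the disc. *)
Lemma mobius_modulus g z : SU11 g ->
  modulus (mobius_den g z) ^+ 2 - modulus (mobius_num g z) ^+ 2 =
  1 - modulus z ^+ 2.
Proof.
move=> sg; have := SU11_mod sg; case: sg => h1 h2 _.
rewrite /mobius_den /mobius_num h1 h2 !modulus_sqr !partE.
set x := rpart (g 0 0); set x' := ipart (g 0 0).
set y := rpart (g 0 1); set y' := ipart (g 0 1).
set t := rpart z; set t' := ipart z => h.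
transitivity ((x ^+ 2 + x' ^+ 2 - (y ^+ 2 + y' ^+ 2)) * (1 - (t ^+ 2 + t' ^+ 2))).
  by ring.
by rewrite h mul1r.
Qed.

(** |alpha| - |beta| = 1 / (|alpha| + |beta|) because |alpha|^2 - |beta|^2 = 1, and |beta| <
    |alpha|. The bound is uniform in z, so pi_n(g) is bounded in the sup norm. *)
Lemma mobius_den_ge g z : SU11 g -> modulus z < 1 ->
  (2 * modulus (g 0 0))^-1 <= modulus (mobius_den g z).
Proof.
move=> sg z1; have h := SU11_mod sg; have [g10 _ _] := sg.
have a0 := modulus_ge0 (g 0 0); have b0 := modulus_ge0 (g 0 1).
have ba : modulus (g 0 1) < modulus (g 0 0).
  by rewrite -(@ltr_pXn2r _ 2)// -subr_gt0 h.
have a1 : 0 < modulus (g 0 0) by apply: le_lt_trans ba.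
apply: (le_trans (y := modulus (g 0 0) - modulus (g 0 1))).
  rewrite -div1r ler_pdivrMr ?mulr_gt0//.
  move: h ba a1 b0; set A := modulus (g 0 0); set D := modulus (g 0 1) => h ba a1 b0.
  have e : (A - D) * (A + D) = 1 by rewrite -[RHS]h; ring.
  by rewrite -[leLHS]e ler_wpM2l ?subr_ge0 ?(ltW ba)//; lra.
rewrite /mobius_den mulNr [X in _ <= modulus X]addrC; apply: le_trans (modulus_lerB _ _).
rewrite lerB// modulusM g10 modulus_conj ler_piMr// ltW//.
Qed.

Lemma SU11_mod00 g : SU11 g -> 0 < modulus (g 0 0).
Proof.
move=> /SU11_mod h; rewrite lt_neqAle modulus_ge0 andbT; apply/eqP => h0.
by move: h; rewrite -h0; have := sqr_ge0 (modulus (g 0 1)); lra.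
Qed.

Lemma mobius_den_neq0 g z : SU11 g -> modulus z < 1 -> mobius_den g z != 0.
Proof.
move=> sg z1; rewrite -modulus_gt0; apply: lt_le_trans (mobius_den_ge sg z1).
by rewrite invr_gt0 mulr_gt0// SU11_mod00.
Qed.

Lemma mobius_disc g z : SU11 g -> modulus z < 1 ->
  modulus (mobius_num g z / mobius_den g z) < 1.
Proof.
move=> sg z1; have d0 := mobius_den_neq0 sg z1.
rewrite modulusM modulusV ltr_pdivrMr ?modulus_gt0// mul1r.
rewrite -(@ltr_pXn2r _ 2)// ?nnegrE ?modulus_ge0//.
rewrite -subr_gt0 mobius_modulus// subr_gt0.
by rewrite -(expr1n _ 2) ltr_pXn2r// nnegrE ?modulus_ge0.
Qed.

Lemma discrete_series_le n g v B : SU11 g ->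
  (forall z, modulus z < 1 -> modulus (v z) <= B) ->
  forall z, modulus (discrete_series n g v z) <= (2 * modulus (g 0 0)) ^+ n * B.
Proof.
move=> sg vB z; have B0 : 0 <= B.
  by apply: le_trans (vB 0 _); rewrite ?modulus_ge0// modulus0.
have [z1|z1] := ltP (modulus z) 1; last first.
  rewrite discrete_series_out// modulus0 mulr_ge0// exprn_ge0// mulr_ge0//.
  exact: modulus_ge0.
rewrite discrete_seriesE// modulusM ler_pM ?modulus_ge0//; last first.
  exact/vB/mobius_disc.
rewrite modulusV modulusX -exprVn lerXn2r ?nnegrE ?invr_ge0 ?modulus_ge0//.
  by rewrite mulr_ge0// modulus_ge0.
rewrite -[leRHS]invrK lef_pV2 ?posrE ?invr_gt0 ?mulr_gt0 ?SU11_mod00//.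
  exact: mobius_den_ge.
by rewrite modulus_gt0 mobius_den_neq0.
Qed.

Lemma mx22_mul g h i j : (g *m h) i j = g i 0 * h 0 j + g i 1 * h 1 j.
Proof. by rewrite mxE big_ord_recl big_ord1 /=; congr (_ + g i _ * h _ j); apply: val_inj. Qed.

Lemma SU11M g h : SU11 g -> SU11 h -> SU11 (g *m h).
Proof.
move=> [g1 g2 g3] [h1 h2 h3]; have dg := SU11_mod (And3 g1 g2 g3).
have dh := SU11_mod (And3 h1 h2 h3); split; rewrite ?mx22_mul.
- by rewrite g1 g2 h1 h2; apply: complex_eq; rewrite !partE; ring.
- by rewrite g1 g2 h1 h2; apply: complex_eq; rewrite !partE; ring.
- rewrite !normE -!ofRX -ofRB -ofR1; congr ofR.
  rewrite h1 h2; move: dg dh; rewrite !modulus_sqr !partE.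
  set x := rpart (g 0 0); set x' := ipart (g 0 0).
  set y := rpart (g 0 1); set y' := ipart (g 0 1).
  set s := rpart (h 0 0); set s' := ipart (h 0 0).
  set t := rpart (h 0 1); set t' := ipart (h 0 1) => dg dh.
  transitivity ((x ^+ 2 + x' ^+ 2 - (y ^+ 2 + y' ^+ 2)) *
    (s ^+ 2 + s' ^+ 2 - (t ^+ 2 + t' ^+ 2))); first by ring.
  by rewrite dg dh mulr1.
Qed.

(** Numerator and denominator are linear forms in (z, 1), so those of g h at z are those of h at the
    image point times the denominator of g: the cocycle identity. *)
Lemma discrete_series_mul n g h v z : SU11 g -> SU11 h ->
  discrete_series n (g *m h) v z = discrete_series n g (discrete_series n h v) z.
Proof.
move=> sg sh; have [z1|z1] := ltP (modulus z) 1; last first.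
  by rewrite !discrete_series_out.
rewrite !discrete_seriesE ?mobius_disc//.
have dg := mobius_den_neq0 sg z1.
have dh := mobius_den_neq0 sh (mobius_disc sg z1).
have dgh := mobius_den_neq0 (SU11M sg sh) z1.
have aux (p q : cplx R) : mobius_den g z * (p * (mobius_num g z / mobius_den g z) + q) =
    p * mobius_num g z + q * mobius_den g z by field.
have e1 : mobius_den (g *m h) z =
    mobius_den g z * mobius_den h (mobius_num g z / mobius_den g z).
  rewrite [X in _ = _ * X]/mobius_den aux /mobius_num /mobius_den !mx22_mul.
  by ring.
have e2 : mobius_num (g *m h) z =
    mobius_den g z * mobius_num h (mobius_num g z / mobius_den g z).
  rewrite [X in _ = _ * X]/mobius_num -mulrN1 aux.
  rewrite /mobius_num /mobius_den !mx22_mul.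
  by ring.
by rewrite e1 e2 exprMn invfM mulrA -mulf_div divff// mul1r.
Qed.

Lemma discrete_series1 n v z : modulus z < 1 -> discrete_series n 1%:M v z = v z.
Proof.
move=> z1; rewrite discrete_seriesE// /mobius_den /mobius_num !mxE/=.
by rewrite ?mulr0n ?mulr1n oppr0 mul0r add0r mul1r addr0 divr1 expr1n invr1 mul1r.
Qed.

Lemma discrete_seriesB n g v v' z :
  discrete_series n g (v - v') z = discrete_series n g v z - discrete_series n g v' z.
Proof. by rewrite /discrete_series; case: ifP; rewrite ?subr0// mulrBr. Qed.

Lemma discrete_seriesZ n g (c : cplx R) v z :
  discrete_series n g (c *: v) z = c * discrete_series n g v z.
Proof. by rewrite /discrete_series; case: ifP; rewrite ?mulr0// => _; rewrite mulrCA. Qed.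

(** Induction on k by dividing by 1 + y, whose inverse has modulus at most 2 when |y| <= 1/2; this
    is the factor 2 in the new constant. *)
Lemma inv_pow_taylor k : exists2 C : R, 0 <= C & forall y : cplx R, modulus y <= 1 / 2 ->
  modulus ((1 + y) ^- k - 1 + k%:R * y) <= C * modulus y ^+ 2.
Proof.
elim: k => [|k [C C0 IH]].
  exists 0 => // y _; rewrite invr1 subrr mul0r addr0 modulus0 mul0r//.
exists (2 * (C + k.+1%:R)); first by rewrite mulr_ge0// addr_ge0.
move=> y y2; have y1 : 2^-1 <= modulus (1 + y).
  rewrite -[y]opprK; apply: le_trans (modulus_lerB _ _).
  by rewrite modulus1 modulusN; lra.
have y0 : 1 + y != 0 by rewrite -modulus_gt0; apply: lt_le_trans y1.
have -> : (1 + y) ^- k.+1 - 1 + k.+1%:R * y = (1 + y)^-1 *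
    (((1 + y) ^- k - 1 + k%:R * y) + k.+1%:R * y ^+ 2).
  rewrite exprS invfM -natr1.
  set u := (1 + y) ^- k; apply: (mulfI y0); rewrite mulrA divff// mul1r.
  by rewrite mulrDr mulrBr mulrA divff// mul1r; ring.
rewrite modulusM -mulrA ler_pM ?modulus_ge0//.
  rewrite modulusV -[leRHS]invrK lef_pV2 ?posrE ?invr_gt0//.
  exact: lt_le_trans y1.
by rewrite (le_trans (modulusD _ _))// mulrDl lerD ?IH// modulusM modulus_nat modulusX.
Qed.

Lemma inv_pow_lip k : exists2 C : R, 0 <= C & forall y : cplx R, modulus y <= 1 / 2 ->
  modulus ((1 + y) ^- k - 1) <= C * modulus y.
Proof.
have [C C0 h] := inv_pow_taylor k; exists (C + k%:R); first by rewrite addr_ge0.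
move=> y y2; rewrite (_ : _ - 1 = ((1 + y) ^- k - 1 + k%:R * y) - k%:R * y); last by ring.
rewrite (le_trans (modulusB _ _))// mulrDl lerD//.
  rewrite (le_trans (h _ y2))// ler_wpM2l// expr2 ler_piMl ?modulus_ge0//.
  by rewrite (le_trans y2)//; lra.
by rewrite modulusM modulus_nat.
Qed.

End discrete_series_action.

(** * The infinitesimal action on coefficients *)

Section lie_action_coef.
Context {R : realType}.
Implicit Types (a b : nat -> cplx R) (z w : cplx R) (B e : R)
  (g h X Y : 'M[cplx R]_2) (v : cplx R -> cplx R).

(* The coefficients of [d pi_n(X) v], when those of [v] are [a]. *)
Definition lie_coef n X a : nat -> cplx R := fun k =>
  (- n%:R * X 0 0) * a k + ((n%:R * X 1 0) * shiftr a k +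
  (X 1 0 * shiftr (shiftr (deriv_coef a)) k +
  ((X 1 1 - X 0 0) * shiftr (deriv_coef a) k + (- X 0 1) * deriv_coef a k))).

Lemma rdec_lie n X a : rdec a -> rdec (lie_coef n X a).
Proof.
move=> ra; have rd := rdec_deriv ra.
by repeat apply: rdecD; apply: rdecZ => //; repeat apply: rdec_shiftr.
Qed.

(** The first-order differential operator behind [lie_coef]: the term in -n is the derivative of the
    automorphy factor, the quadratic polynomial is the vector field of the Moebius action. *)
Lemma ps_lie n X a z : rdec a -> ps (lie_coef n X a) z =
  - n%:R * (X 0 0 - X 1 0 * z) * ps a z +
  (X 1 0 * z ^+ 2 + (X 1 1 - X 0 0) * z - X 0 1) * ps (deriv_coef a) z.
Proof.
move=> ra; have rd := rdec_deriv ra; have rs := rdec_shiftr ra.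
have rds := rdec_shiftr rd; have rdss := rdec_shiftr rds.
have rp := @rdec_pbound R.
rewrite psD; [|by apply: pboundZ; apply: rp|].
  rewrite psD; [|by apply: pboundZ; apply: rp|].
    rewrite psD; [|by apply: pboundZ; apply: rp|].
      rewrite psD; [|by apply: pboundZ; apply: rp|by apply: pboundZ; apply: rp].
      rewrite !psZ ?ps_shiftr//; try exact: rp.
      by ring.
    by apply: pboundD; apply: pboundZ; apply: rp.
  by repeat apply: pboundD; apply: pboundZ; apply: rp.
by repeat apply: pboundD; apply: pboundZ; apply: rp.
Qed.

(** Only [deriv_coef] costs an order of decay; the shifts merely change the constant, which is read
    off from the sum of the five bounds. *)
Lemma rdec_by_lie n X m : exists2 C : R, 0 <= C &
  forall a B, rdec_by m.+1 B a -> rdec_by m (C * B) (lie_coef n X a).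
Proof.
eexists; last first.
  move=> a B aB; have aB' := rdec_byW (leqnSn m) aB.
  have dB := rdec_by_deriv aB.
  have := rdec_byD (rdec_byZ (- n%:R * X 0 0) aB')
    (rdec_byD (rdec_byZ (n%:R * X 1 0) (rdec_by_shiftr aB'))
    (rdec_byD (rdec_byZ (X 1 0) (rdec_by_shiftr (rdec_by_shiftr dB)))
    (rdec_byD (rdec_byZ (X 1 1 - X 0 0) (rdec_by_shiftr dB))
      (rdec_byZ (- X 0 1) dB)))).
  by rewrite !mulrA -!mulrDl; apply.
by rewrite ?addr_ge0 ?mulr_ge0 ?modulus_ge0 ?exprn_ge0.
Qed.

Lemma ps_lie_le n : exists2 C : R, 0 <= C & forall X a B e z,
  rdec a -> rdec_by 4 B a -> (forall i j, modulus (X i j) <= e) ->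
  modulus (ps (lie_coef n X a) z) <= C * B * e.
Proof.
exists (4 * n%:R + 8); first by rewrite addr_ge0.
move=> X a B e z ra aB Xe.
have e0 : 0 <= e by apply: le_trans (Xe 0 0); exact: modulus_ge0.
have B0 := rdec_by_ge0 aB.
have [z1|z1] := ltP (modulus z) 1; last first.
  by rewrite ps_out// modulus0 !mulr_ge0// addr_ge0.
have h1 : modulus (ps a z) <= 2 * B by exact: (ps_le _ _ aB).
have h2 : modulus (ps (deriv_coef a) z) <= 2 * B.
  exact: (ps_le _ _ (rdec_by_deriv aB)).
have zz := modulus_ge0 z.
rewrite ps_lie// (le_trans (modulusD _ _))// !modulusM modulusN modulus_nat.
rewrite (_ : _ * B * e = 4 * n%:R * B * e + 8 * B * e); last by ring.
rewrite lerD//.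
  rewrite (_ : 4 * _ * _ * _ = n%:R * (2 * e) * (2 * B)); last by ring.
  rewrite ler_pM ?mulr_ge0 ?modulus_ge0// ler_wpM2l//.
  rewrite (le_trans (modulusB _ _))// modulusM mulr2n mulrDl mul1r lerD//.
  by rewrite (le_trans (ler_piMr _ (ltW z1))) ?modulus_ge0.
rewrite (_ : 8 * _ * _ = (4 * e) * (2 * B)); last by ring.
rewrite ler_pM ?mulr_ge0 ?modulus_ge0//.
rewrite (le_trans (modulusB _ _))//.
have u1 : modulus (X 1 0 * z ^+ 2) <= e.
  rewrite modulusM modulusX (le_trans (ler_piMr _ _)) ?modulus_ge0//.
  by rewrite exprn_ile1// ltW.
have u2 : modulus ((X 1 1 - X 0 0) * z) <= 2 * e.
  rewrite modulusM (le_trans (ler_piMr _ (ltW z1))) ?modulus_ge0//.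
  rewrite (le_trans (modulusB _ _))//.
  by have := Xe 1 1; have := Xe 0 0; lra.
have u3 := Xe 0 1; have := modulusD (X 1 0 * z ^+ 2) ((X 1 1 - X 0 0) * z).
lra.
Qed.

(** The key estimate near the identity, uniform in z and Y with an error quadratic in the size of Y.
    Differentiability along one-parameter subgroups and continuity on SU(1,1) both follow from
    it. *)
Lemma discrete_series_taylor n : exists2 C : R, 0 <= C & forall Y a B e z,
  rdec a -> rdec_by 4 B a -> (forall i j, modulus (Y i j) <= e) -> e <= 1 / 4 ->
  SU11 (1%:M + Y) ->
  modulus (discrete_series n (1%:M + Y) (ps a) z - ps a z - ps (lie_coef n Y a) z) <=
  C * B * e ^+ 2.
Proof.
have [C1 C10 hC1] := @inv_pow_taylor R n.
have [C2 C20 hC2] := @inv_pow_lip R n.+1.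
exists (2 ^+ n * 128 + C2 * 16 + C1 * 8).
  by rewrite !addr_ge0 ?mulr_ge0 ?exprn_ge0.
move=> Y a B e z ra aB Ye e4 sY.
have e0 : 0 <= e by apply: le_trans (Ye 0 0); exact: modulus_ge0.
have B0 := rdec_by_ge0 aB.
have [z1|z1] := ltP (modulus z) 1; last first.
  rewrite discrete_series_out// !ps_out// !subr0 modulus0 !mulr_ge0 ?exprn_ge0//.
  by rewrite !addr_ge0 ?mulr_ge0 ?exprn_ge0.
have zz := modulus_ge0 z.
set y := Y 0 0 - Y 1 0 * z.
set et := Y 1 1 * z - Y 0 1 - y * z.
have dE : mobius_den (1%:M + Y) z = 1 + y.
  by rewrite /mobius_den /y !mxE/= ?mulr0n ?mulr1n; ring.
have mE : mobius_num (1%:M + Y) z = (1 + y) * z + et.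
  by rewrite /mobius_num /et !mxE/= ?mulr0n ?mulr1n; ring.
have ye : modulus y <= 2 * e.
  rewrite (le_trans (modulusB _ _))// modulusM.
  have := Ye 0 0; have := Ye 1 0; have := modulus_ge0 (Y 1 0).
  by nra.
have ete : modulus et <= 4 * e.
  rewrite (le_trans (modulusB _ _))//.
  have := modulusB (Y 1 1 * z) (Y 0 1); rewrite !modulusM.
  have := Ye 1 1; have := Ye 0 1; have := modulus_ge0 (Y 1 1); have := modulus_ge0 y.
  by nra.
have y2 : modulus y <= 1 / 2 by lra.
have d0 : 1 + y != 0 by rewrite -dE mobius_den_neq0.
have d2 : modulus (1 + y)^-1 <= 2.
  rewrite modulusV -[leRHS]invrK lef_pV2 ?posrE ?invr_gt0// ?modulus_gt0//.
  rewrite -[y]opprK; apply: le_trans (modulus_lerB _ _).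
  by rewrite modulus1 modulusN; lra.
set w := ((1 + y) * z + et) / (1 + y).
have wE : w - z = et / (1 + y) by rewrite /w; field.
have w1 : modulus w < 1 by rewrite /w -mE -dE mobius_disc.
have we : modulus (w - z) <= 8 * e.
  rewrite wE modulusM (_ : 8 * e = (4 * e) * 2); last by ring.
  by rewrite ler_pM ?modulus_ge0.
rewrite discrete_seriesE// dE mE -/w ps_lie//.
set v := ps a z; set v' := ps (deriv_coef a) z.
have h1 : modulus v <= 2 * B by exact: (ps_le _ _ aB).
have h2 : modulus v' <= 2 * B.
  exact: (ps_le _ _ (rdec_by_deriv aB)).
have h3 := ps_taylor aB z1 w1.
rewrite -/v -/v' in h3.
have k1 := hC1 _ y2; have k2 := hC2 _ y2.
set E1 := ps a w - v - v' * (w - z) in h3.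
set E2 := (1 + y) ^- n - 1 + n%:R * y in k1.
set E3 := (1 + y) ^- n.+1 - 1 in k2.
(* [E1] is the Taylor remainder of the series between z and w, [E2] that of (1 + y)^-n; [E3] appears
   because w - z = et / (1 + y) turns the derivative term into et (1 + y)^-(n+1). They contribute
   the summands with 128, [C1 * 8] and [C2 * 16] of the constant. *)
rewrite (_ : _ - _ - _ = (1 + y) ^- n * E1 + (E3 * et) * v' + E2 * v); last first.
  rewrite -/y (_ : Y 1 0 * z ^+ 2 + _ - _ = et); last by rewrite /et /y; ring.
  rewrite /E1 /E2 /E3 wE exprS invfM.
  set u := (1 + y) ^- n; set u1 := (1 + y)^-1; set pw := ps a w.
  by ring.
rewrite (_ : _ * B * _ = 2 ^+ n * 128 * B * e ^+ 2 + C2 * 16 * B * e ^+ 2 +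
  C1 * 8 * B * e ^+ 2); last by ring.
rewrite (le_trans (modulusD _ _))// lerD//; last first.
  rewrite modulusM (_ : C1 * 8 * B * e ^+ 2 = (C1 * (2 * e) ^+ 2) * (2 * B)); last by ring.
  rewrite ler_pM ?modulus_ge0// (le_trans k1)// ler_wpM2l//.
  by rewrite lerXn2r ?nnegrE ?modulus_ge0// mulr_ge0.
rewrite (le_trans (modulusD _ _))// lerD//; last first.
  rewrite !modulusM (_ : C2 * 16 * B * e ^+ 2 = (C2 * (2 * e)) * (4 * e) * (2 * B)); last by ring.
  rewrite ler_pM ?mulr_ge0 ?modulus_ge0// ler_pM ?modulus_ge0// (le_trans k2)//.
  by rewrite ler_wpM2l.
rewrite modulusM modulusV modulusX -exprVn -modulusV.
rewrite (_ : _ * 128 * _ * _ = 2 ^+ n * (2 * B * (8 * e) ^+ 2)); last by ring.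
rewrite ler_pM ?exprn_ge0 ?modulus_ge0//.
  by rewrite lerXn2r ?nnegrE ?modulus_ge0.
rewrite (le_trans h3)// ler_wpM2l ?mulr_ge0// lerXn2r ?nnegrE ?modulus_ge0//.
by rewrite mulr_ge0.
Qed.

End lie_action_coef.

(** * Monotonicity of integrals of nonnegative functions *)

Section nonneg_integral.
Local Open Scope ereal_scope.

(** The integral of a nonnegative function is a supremum over the simple functions below it, and
    this is monotone whether or not the function is measurable. *)
Lemma nonneg_le_integral d (T : measurableType d) (R : realType)
    (mu : {measure set T -> \bar R}) (D : set T) (f g : T -> \bar R) :
  (forall x, D x -> 0 <= f x) -> (forall x, D x -> f x <= g x) ->
  \int[mu]_(x in D) f x <= \int[mu]_(x in D) g x.
Proof.
move=> f0 fg; have g0 x : D x -> 0 <= g x.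
  by move=> Dx; apply: le_trans (fg _ Dx); exact: f0.
rewrite !ge0_integralE//; apply: le_ereal_sup => _ [h hf <-]; exists h => //= x.
by apply: le_trans (hf x) _; exact: lee_restrict.
Qed.

Lemma nonneg_le_integral_set d (T : measurableType d) (R : realType)
    (mu : {measure set T -> \bar R}) (D E : set T) (f g : T -> \bar R) :
  (forall x, D x -> 0 <= f x) -> (forall x, E x -> 0 <= g x) ->
  (forall x, D x -> E x /\ f x <= g x) ->
  \int[mu]_(x in D) f x <= \int[mu]_(x in E) g x.
Proof.
move=> f0 g0 DE; rewrite integral_mkcond [leRHS]integral_mkcond.
apply: nonneg_le_integral => x _; first exact: erestrict_ge0.
rewrite /patch; case: ifPn => [/set_mem Dx|_].
  by have [Ex fg] := DE _ Dx; rewrite mem_set.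
by case: ifPn => // /set_mem; exact: g0.
Qed.

End nonneg_integral.

(** * The Bergman norm and the sup norm *)

Section bergman_norm.
Context {R : realType}.
Implicit Types (f v : cplx R -> cplx R) (n : nat) (B : R).

Definition bergman_int n f : \bar R :=
  (\int[plane_measure R]_(p in point_of @^-1` disc)
    (modulus (f (point_of p)) ^+ 2 * weight n (point_of p))%:E)%E.

Lemma bergman_normE n f : bergman_norm n f = Num.sqrt (fine (bergman_int n f)).
Proof.
rewrite /bergman_norm /inner /cintegral /Rintegral.
rewrite rpartD rpart_ofR rpartM rpart_imag ipart_ofR mul0r mulr0 subr0 addr0.
congr (Num.sqrt (fine _)); apply: eq_integral => p _ /=.
by rewrite mul_conj_sqr -ofRM.
Qed.

Lemma weight_ge0 n (z : cplx R) : modulus z < 1 -> 0 <= weight n z.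
Proof.
move=> z1; rewrite exprn_ge0// subr_ge0 exprn_ile1 ?modulus_ge0//; exact: ltW.
Qed.

Lemma weight_le1 n (z : cplx R) : modulus z < 1 -> weight n z <= 1.
Proof.
move=> z1; rewrite exprn_ile1// ?gerBl ?exprn_ge0 ?modulus_ge0//.
rewrite subr_ge0 exprn_ile1 ?modulus_ge0//; exact: ltW.
Qed.

Lemma bergman_int_ge0 n f : (0 <= bergman_int n f)%E.
Proof.
apply: integral_ge0 => p /discE p1; by rewrite lee_fin mulr_ge0 ?sqr_ge0 ?weight_ge0.
Qed.

Definition rect (x1 x2 y1 y2 : R) : set (plane R) := `[x1, x2] `*` `[y1, y2].

Lemma measurable_rect x1 x2 y1 y2 : measurable (rect x1 x2 y1 y2).
Proof. exact: measurableX. Qed.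

Lemma lebesgue_measure_seg (x y : R) : x <= y ->
  lebesgue_measure (`[x, y]%classic : set R) = (y - x)%:E.
Proof.
move=> xy; rewrite lebesgue_measure_itv/= lte_fin.
by case: ltgtP xy => // -> _; rewrite subrr.
Qed.

Lemma plane_measure_rect x1 x2 y1 y2 : x1 <= x2 -> y1 <= y2 ->
  plane_measure R (rect x1 x2 y1 y2) = ((x2 - x1) * (y2 - y1))%:E.
Proof.
move=> x12 y12; rewrite /plane_measure /rect.
apply: etrans; first by apply: product_measure1E.
by rewrite EFinM; congr (_ * _)%E; exact: lebesgue_measure_seg.
Qed.

(** The weight is at most 1 and the disc lies in a square of area 4. Sup-norm estimates of the
    action become Bergman-norm estimates in this way. *)
Lemma bergman_int_le n f B : (forall z, modulus z < 1 -> modulus (f z) <= B) ->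
  (bergman_int n f <= (4 * B ^+ 2)%:E)%E.
Proof.
move=> fB; have B0 : 0 <= B.
  by apply: le_trans (fB 0 _); rewrite ?modulus_ge0// modulus0.
apply: (@le_trans _ _ (\int[plane_measure R]_(p in rect (-1) 1 (-1) 1) (B ^+ 2)%:E)%E).
  apply: nonneg_le_integral_set.
  - by move=> p /discE p1; rewrite lee_fin mulr_ge0 ?sqr_ge0 ?weight_ge0.
  - by move=> p _; rewrite lee_fin sqr_ge0.
  - move=> p /discE p1; split; last first.
      rewrite lee_fin -[leRHS]mulr1 ler_pM ?sqr_ge0 ?weight_ge0 ?weight_le1//.
      by rewrite lerXn2r ?nnegrE ?modulus_ge0 ?fB.
    have := rpart_le (point_of p); have := ipart_le (point_of p).
    rewrite /rpart/ipart/= !ler_norml => /andP[? ?] /andP[? ?].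
    by rewrite /rect/= !in_itv/=; split; apply/andP; split; lra.
rewrite integral_cst ?plane_measure_rect//; last exact: measurable_rect.
by rewrite -EFinM lee_fin; lra.
Qed.

Lemma bergman_norm_le n f B : (forall z, modulus z < 1 -> modulus (f z) <= B) ->
  bergman_norm n f <= 2 * B.
Proof.
move=> fB; have B0 : 0 <= B.
  by apply: le_trans (fB 0 _); rewrite ?modulus_ge0// modulus0.
rewrite bergman_normE -[2 * B]ger0_norm ?mulr_ge0// -sqrtr_sqr ler_wsqrtr//.
have := bergman_int_le n fB; have := bergman_int_ge0 n f.
case: bergman_int => [x|//|//]; rewrite !lee_fin/= => _ /le_trans; apply.
by rewrite exprMn -natrX.
Qed.

End bergman_norm.

(** * Exponentials of 2 x 2 matrices *)

Section matrix_exponential.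
Context {R : realType}.
Implicit Types (X M N : 'M[cplx R]_2) (t : R).

Lemma ord2E (i : 'I_2) : i = 0 \/ i = 1.
Proof. by case: i => [[|[|//]] ?]; [left|right]; apply: val_inj. Qed.

Lemma nbhs_mx2P M (A : set 'M[cplx R]_2) : nbhs M A <->
  exists2 d : R, 0 < d & forall N, (forall i j, modulus (N i j - M i j) < d) -> A N.
Proof.
split; last first.
  move=> [d d0 dA]; exists (fun i j => [set w | modulus (w - M i j) < d]).
    by move=> i j; apply/nbhs_cplxP; exists d.
  by move=> N hN; exact: dA.
move=> [P hP PA].
have /choice[D hD] (ij : 'I_2 * 'I_2) : exists d : R, 0 < d /\
    forall w, modulus (w - M ij.1 ij.2) < d -> P ij.1 ij.2 w.
  by have /nbhs_cplxP[d d0 dP] := hP ij.1 ij.2; exists d.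
have D0 ij : 0 < D ij by have [] := hD ij.
exists (Num.min (Num.min (D (0, 0)) (D (0, 1))) (Num.min (D (1, 0)) (D (1, 1)))).
  by rewrite !lt_min !D0.
move=> N hN; apply: PA => i j; have [_ /(_ (N i j))] := hD (i, j); apply.
have := hN i j; rewrite !lt_min => /andP[/andP[h00 h01] /andP[h10 h11]].
by have [hi|hi] := ord2E i; have [hj|hj] := ord2E j; rewrite hi hj in h00 h01 h10 h11 *.
Qed.

Lemma cvg_mx2P (T : Type) (F : set_system T) (FF : Filter F)
    (f : T -> 'M[cplx R]_2) M :
  (forall i j, f x i j @[x --> F] --> M i j) -> f x @[x --> F] --> M.
Proof.
move=> h A /nbhs_mx2P[d d0 dA].
have h' i j : \forall x \near F, modulus (f x i j - M i j) < d.
  by have /cvg_cplxP/(_ _ d0) := h i j.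
have : \forall x \near F, [/\ modulus (f x 0 0 - M 0 0) < d, modulus (f x 0 1 - M 0 1) < d,
    modulus (f x 1 0 - M 1 0) < d & modulus (f x 1 1 - M 1 1) < d].
  by near=> x; split; near: x; exact: h'.
apply: filterS => x [h00 h01 h10 h11]; apply: dA => i j.
by case: (ord2E i) => ->; case: (ord2E j) => ->.
Unshelve. all: by end_near. Qed.

(** An entry of a product of 2 x 2 matrices is a sum of two terms, hence the 2 in [2 * c]. *)
Lemma mx2_pow_le X (c : R) : (forall i j, modulus (X i j) <= c) ->
  forall k i j, modulus ((X ^+ k) i j) <= (2 * c) ^+ k.
Proof.
move=> Xc; have c0 : 0 <= c by apply: le_trans (Xc 0 0); exact: modulus_ge0.
elim=> [|k IH] i j.
  by rewrite !expr0 mxE; case: (i == j); rewrite ?modulus0 ?modulus1.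
rewrite !exprS -[X * _]/(X *m _) mx22_mul (le_trans (modulusD _ _))// !modulusM.
have := ler_pM (modulus_ge0 _) (modulus_ge0 _) (Xc i 0) (IH 0 j).
have := ler_pM (modulus_ge0 _) (modulus_ge0 _) (Xc i 1) (IH 1 j).
lra.
Qed.

Lemma exp_series_le (x : R) n : 0 <= x -> \sum_(k < n) k`!%:R^-1 * x ^+ k <= expR x.
Proof.
move=> x0; rewrite /expR.
have -> : \sum_(k < n) k`!%:R^-1 * x ^+ k = series (exp_coeff x) n.
  rewrite /series/= big_mkord; apply: eq_bigr => i _.
  by rewrite exp_coeffE.
apply: nondecreasing_cvgn_le; last exact: is_cvg_series_exp_coeff.
apply/nondecreasing_seqP => m; rewrite /series/= big_nat_recr//= lerDl.
exact: exp_coeff_ge0.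
Qed.

Definition exp_term X i j : nat -> cplx R := fun k => k`!%:R^-1 * (X ^+ k) i j.

Lemma exp_termE X i j k : exp_term X i j k = k`!%:R^-1 * (X ^+ k) i j.
Proof. by []. Qed.

Lemma asum_exp X (c : R) i j : (forall i j, modulus (X i j) <= c) ->
  asum (exp_term X i j) (expR (2 * c)).
Proof.
move=> Xc n; have c0 : 0 <= c by apply: le_trans (Xc 0 0); exact: modulus_ge0.
apply: le_trans (exp_series_le n (mulr_ge0 (ler0n _ 2) c0)).
apply: ler_sum => k _; rewrite modulusM modulusV modulus_nat ler_wpM2l ?invr_ge0//.
exact: mx2_pow_le.
Qed.

Lemma mx2_bound X : exists c, forall i j, modulus (X i j) <= c.
Proof.
exists (\sum_i \sum_j modulus (X i j)) => i j.
rewrite (bigD1 i)//= (bigD1 j)//= -addrA lerDl addr_ge0//.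
  by rewrite sumr_ge0// => ? _; rewrite modulus_ge0.
by rewrite sumr_ge0// => ? _; rewrite sumr_ge0// => ? _; rewrite modulus_ge0.
Qed.

Lemma expmxE X i j : expmx X i j = csum (exp_term X i j).
Proof.
have [c Xc] := mx2_bound X.
suff -> : expmx X = \matrix_(i, j) csum (exp_term X i j) by rewrite mxE.
apply: cvg_lim => //; apply: cvg_mx2P => k l; rewrite mxE.
have := asum_cvg (asum_exp k l Xc); apply: cvg_trans.
apply: near_eq_cvg; near=> n.
rewrite /series/= summxE big_mkord; apply: eq_bigr => m _.
by rewrite mxE.
Unshelve. all: by end_near. Qed.

(** Each term of index at least 2 carries |t|^2, and |t| <= 1 disposes of the other powers of t;
    what remains is the exponential series of X. *)
Lemma expmx_taylor X : exists2 C : R, 0 <= C & forall t, `|t| <= 1 ->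
  forall i j, modulus ((expmx (ofR t *: X) - 1%:M - ofR t *: X) i j) <= C * `|t| ^+ 2.
Proof.
have [c Xc] := mx2_bound X; exists (expR (2 * c)); first exact: expR_ge0.
move=> t t1 i j.
have tXc k l : modulus ((ofR t *: X) k l) <= c.
  by rewrite mxE modulusM modulus_ofR (le_trans (ler_piMl _ _))// modulus_ge0.
rewrite !mxE expmxE (csum_split 2 (asum_exp i j tXc)) big_ord_recl big_ord1.
have -> : exp_term (ofR t *: X) i j (ord0 : 'I_2) = 1%:M i j.
  by rewrite exp_termE/= fact0 invr1 mul1r expr0.
have -> : exp_term (ofR t *: X) i j (lift ord0 ord0 : 'I_2) = ofR t * X i j.
  by rewrite exp_termE/= (_ : bump 0 0 = 1%N)// invr1 mul1r expr1 mxE.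
rewrite mxE (_ : _ - _ - _ = csum (fun k => exp_term (ofR t *: X) i j (2 + k)%N)); last by ring.
apply: csum_le => n.
apply: (le_trans (y := \sum_(k < n) (`|t| ^+ 2 * modulus (exp_term X i j (2 + k)%N)))).
  have aux m : modulus (exp_term (ofR t *: X) i j m) = `|t| ^+ m * modulus (exp_term X i j m).
    rewrite !exp_termE exprZn [in LHS]mxE -modulus_ofR -modulusX -modulusM.
    by congr modulus; ring.
  have aux2 m : (2 <= m)%N ->
      modulus (exp_term (ofR t *: X) i j m) <= `|t| ^+ 2 * modulus (exp_term X i j m).
    move=> m2; rewrite aux ler_wpM2r ?modulus_ge0//.
    by rewrite -(subnKC m2) exprD ler_piMr ?exprn_ge0// exprn_ile1.
  by apply: ler_sum => k _; exact: (aux2 (2 + k)%N isT).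
rewrite -mulr_sumr mulrC ler_wpM2r ?exprn_ge0//.
exact: asum_shift (asum_exp i j Xc) n.
Qed.

Definition eit t : cplx R := ofR (cos t) + imag * ofR (sin t).

Lemma eit_sqr t : modulus (eit t) = 1.
Proof.
apply/eqP; rewrite -(@eqrXn2 _ 2)// ?modulus_ge0// expr1n modulus_sqr !partE.
apply/eqP; rewrite -[RHS](cos2Dsin2 t); ring.
Qed.

Lemma csum_eit t : csum (fun k => k`!%:R^-1 * (imag * ofR t) ^+ k) = eit t.
Proof.
have pw k : k`!%:R^-1 * (imag * ofR t) ^+ k = ofR (cos_coeff t k) + imag * ofR (sin_coeff t k) :> cplx R.
  have ipow m : imag ^+ m = ofR ((~~ odd m)%:R * (-1) ^+ m./2) + imag * ofR ((odd m)%:R * (-1) ^+ m.-1./2) :> cplx R.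
    rewrite -{1}(odd_double_half m) exprD -mul2n exprM expr2 imag_sqr.
    have -> : (-1) ^+ m./2 = ofR ((-1) ^+ m./2) :> cplx R by rewrite ofRX ofRN.
    have [om|om] := boolP (odd m); last first.
      by rewrite expr0 mul1r mul1r mul0r ofR0 mulr0 addr0.
    have -> : m.-1./2 = m./2.
      by rewrite -[in LHS](odd_double_half m) om/= doubleK.
    by rewrite expr1 mul0r add0r mul1r.
  rewrite exprMn ipow cos_coeffE sin_coeffE -ofRX -ofR_nat -ofRV.
  by apply: complex_eq; rewrite !partE; ring.
apply: cvg_csum; apply: cvg_rpart_ipart.
- have : series (cos_coeff t) @ \oo --> cos t by rewrite unlock; exact: is_cvg_series_cos_coeff.
  apply: cvg_trans; apply: near_eq_cvg; near=> n.
  rewrite /series/= big_mkord rpart_sum; apply: eq_bigr => k _.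
  by rewrite pw !partE; ring.
- have : series (sin_coeff t) @ \oo --> sin t by rewrite unlock; exact: is_cvg_series_sin_coeff.
  apply: cvg_trans; apply: near_eq_cvg; near=> n.
  rewrite /series/= big_mkord ipart_sum; apply: eq_bigr => k _.
  by rewrite pw !partE; ring.
Unshelve. all: by end_near. Qed.

Lemma eitE t : eit (- t) = (eit t)^*.
Proof. by apply: complex_eq; rewrite /eit !partE ?cosN ?sinN; ring. Qed.

Lemma eitD t s : eit (t + s) = eit t * eit s.
Proof. by apply: complex_eq; rewrite /eit !partE ?cosD ?sinD; ring. Qed.

Lemma eit0 : eit 0 = 1.
Proof. by apply: complex_eq; rewrite /eit !partE ?cos0 ?sin0; ring. Qed.

(** The generator of the maximal compact subgroup diag(e^(it), e^(-it)), which acts by rotations on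
    the disc and diagonally on the monomials z^k. *)
Definition rot_gen : 'M[cplx R]_2 := mx22 imag 0 0 (- imag).

Lemma expmx_rot t : expmx (ofR t *: rot_gen) = mx22 (eit t) 0 0 (eit (- t)).
Proof.
have pw k : (ofR t *: rot_gen) ^+ k =
    mx22 ((imag * ofR t) ^+ k) 0 0 ((imag * ofR (- t)) ^+ k).
  elim: k => [|k IH].
    apply/matrixP => i j; rewrite !expr0 !mxE.
    by case: (ord2E i) => ->; case: (ord2E j) => ->.
  rewrite exprS IH -[_ * _]/(_ *m _); apply/matrixP => i j; rewrite mx22_mul !mxE/=.
  rewrite !exprS ofRN.
  by case: (ord2E i) => ->; case: (ord2E j) => -> /=; ring.
apply/matrixP => i j; rewrite expmxE [RHS]mxE.
rewrite -csum_eit -csum_eit /exp_term; under [in LHS]eq_fun do rewrite pw mxE.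
case: (ord2E i) => ->; case: (ord2E j) => -> //=.
  by rewrite (@csum_fin _ _ 0) ?big_ord0// => k _; rewrite mulr0.
by rewrite (@csum_fin _ _ 0) ?big_ord0// => k _; rewrite mulr0.
Qed.

Lemma SU11_rot t : SU11 (mx22 (eit t) 0 0 (eit (- t))).
Proof.
split; rewrite !mxE/= ?eitE//; first by rewrite rmorph0.
by rewrite !normE eit_sqr modulus0 expr1n expr0n subr0.
Qed.

Lemma su11_rot : su11 rot_gen.
Proof. by move=> t; rewrite expmx_rot; exact: SU11_rot. Qed.

End matrix_exponential.

(** * Rapidly decreasing power series are smooth vectors *)

Section power_series_smooth.
Context {R : realType}.
Implicit Types (a b : nat -> cplx R) (z w : cplx R) (B e t : R)
  (g h X Y : 'M[cplx R]_2) (v : cplx R -> cplx R).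

Lemma derivableP_quad (v : cplx R -> cplx R) z (d : cplx R) (C : R) :
  (\forall w \near z, modulus (v w - v z - d * (w - z)) <= C * modulus (w - z) ^+ 2) ->
  derivable v z 1.
Proof.
move=> /nbhs_cplxP[r r0 hr]; apply/cvg_ex; exists d; apply/cvg_cplxP => e e0.
have C1 : 0 < `|C| + 1 by rewrite ltr_pwDr.
have m0 : 0 < Num.min r (e / (`|C| + 1)) by rewrite lt_min r0 divr_gt0.
near=> x.
have x0 : x != 0 by near: x; exact: nbhs_dnbhs_neq.
have : modulus x < Num.min r (e / (`|C| + 1)).
  near: x; apply: nbhs_dnbhs; apply/nbhs_cplxP; exists (Num.min r (e / (`|C| + 1))) => // w.
  by rewrite subr0.
rewrite lt_min => /andP[xr xe].
have xE : (x *: (1 : cplx R) + z) - z = x by rewrite addrK /GRing.scale/= mulr1.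
have := hr (x *: 1 + z); rewrite xE => /(_ xr) hx.
rewrite /= -[_ *: _]/(x^-1 * _).
rewrite (_ : x^-1 * _ - d = x^-1 * (v (x *: 1 + z) - v z - d * x)); last first.
  by rewrite [RHS]mulrBr [x^-1 * (d * x)]mulrCA mulVf// mulr1.
rewrite modulusM modulusV ltr_pdivrMl ?modulus_gt0//.
apply: le_lt_trans hx _; rewrite expr2 mulrA [ltRHS]mulrC.
rewrite ltr_pM2r ?modulus_gt0//.
apply: (@le_lt_trans _ _ ((`|C| + 1) * modulus x)); last by rewrite mulrC -ltr_pdivlMr.
by rewrite ler_wpM2r ?modulus_ge0// ler_wpDr// ler_norm.
Unshelve. all: by end_near. Qed.

Lemma near_disc z : modulus z < 1 -> \forall w \near z, modulus w < 1.
Proof.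
move=> z1; apply/nbhs_cplxP; exists (1 - modulus z); first by rewrite subr_gt0.
move=> w wz; have := modulusD (w - z) z; rewrite subrK => h.
by apply: le_lt_trans h _; rewrite -ltrBrDr.
Qed.

Lemma derivable_ps a z : rdec a -> modulus z < 1 -> derivable (ps a) z 1.
Proof.
move=> ra z1; have [B aB] := ra 4%N.
apply: (@derivableP_quad _ _ (ps (deriv_coef a) z) (2 * B)).
by apply: filterS (near_disc z1) => w w1; exact: ps_taylor.
Qed.

Lemma holomorphic_discrete_series n g v : SU11 g ->
  holomorphic v -> holomorphic (discrete_series n g v).
Proof.
move=> sg hv z /discE z1; have d0 := mobius_den_neq0 sg z1.
apply: (@near_eq_derivable _ _ _ (fun w => (mobius_den g w)^-1 ^+ n *
  v (mobius_num g w / mobius_den g w))).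
  by apply: filterS (near_disc z1) => w w1; rewrite discrete_seriesE// exprVn.
have did : differentiable (id : cplx R -> cplx R) z by [].
have dden : differentiable (mobius_den g) z.
  apply: differentiableD => //; apply: differentiableM => //.
have dnum : differentiable (mobius_num g) z.
  apply: differentiableB => //; apply: differentiableM => //.
have dinv := differentiableV dden d0.
apply/derivable1_diffP; apply: differentiableM.
  elim: n => [|n IH]; first by under eq_fun do rewrite expr0; exact: differentiable_cst.
  by under eq_fun do rewrite exprS; exact: differentiableM.
apply: (@differentiable_comp _ _ _ _ (fun w => mobius_num g w / mobius_den g w) v).
  exact: differentiableM.
by apply/derivable1_diffP/hv/discE/mobius_disc.
Qed.

Lemma holomorphic_ps a : rdec a -> holomorphic (ps a).
Proof. by move=> ra z /discE; exact: derivable_ps. Qed.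

Lemma bergman_bounded n v B : (forall z, ~ disc z -> v z = 0) -> holomorphic v ->
  (forall z, modulus z < 1 -> modulus (v z) <= B) -> bergman n v.
Proof.
move=> v0 hv vB; split=> //.
by apply: le_lt_trans (bergman_int_le n vB) _; rewrite ltry.
Qed.

Lemma bergman_ps n g a : SU11 g -> rdec a -> bergman n (discrete_series n g (ps a)).
Proof.
move=> sg ra; have [B aB] := ra 2%N.
apply: (@bergman_bounded _ _ ((2 * modulus (g 0 0)) ^+ n * (2 * B))).
- by move=> z /discE/negP; rewrite -leNgt => z1; rewrite discrete_series_out.
- exact/holomorphic_discrete_series/holomorphic_ps.
- by move=> z z1; apply: discrete_series_le => // w w1; exact: (ps_le _ _ aB).
Qed.

Lemma ps_discrete_series1 n a : discrete_series n 1%:M (ps a) = ps a.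
Proof.
apply/funext => z; have [z1|z1] := ltP (modulus z) 1.
  by rewrite discrete_series1.
by rewrite discrete_series_out// ps_out.
Qed.

Lemma SU11_1 : SU11 (1%:M : 'M[cplx R]_2).
Proof.
split; rewrite !mxE/= ?mulr0n ?mulr1n; first by rewrite rmorph0.
  by rewrite rmorph1.
by rewrite normr0 normr1 expr1n expr0n subr0.
Qed.

Lemma bergman_ps1 n a : rdec a -> bergman n (ps a).
Proof. by rewrite -(ps_discrete_series1 n); exact: bergman_ps SU11_1. Qed.

Lemma ps_lie_linear n t X Y a z : rdec a ->
  ps (lie_coef n (ofR t *: X + Y) a) z =
  ofR t * ps (lie_coef n X a) z + ps (lie_coef n Y a) z.
Proof. by move=> ra; rewrite !ps_lie// !mxE; ring. Qed.

(** exp(tX) = 1 + (tX + E) with E = O(t^2). As [ps (lie_coef n Y a)] is linear in Y, the first-order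
    term of [discrete_series_taylor] is t d pi_n(X) plus the contribution of E, again O(t^2). *)
Lemma expmx_derivative n X a : su11 X -> rdec a -> exists K d : R, 0 < d /\
  forall t z, t != 0 -> `|t| < d -> modulus z < 1 ->
  modulus ((ofR t)^-1 * (discrete_series n (expmx (ofR t *: X)) (ps a) z - ps a z) -
    ps (lie_coef n X a) z) <= K * `|t|.
Proof.
move=> sX ra; have [B aB] := ra 4%N; have B0 := rdec_by_ge0 aB.
have [C C0 hC] := expmx_taylor X; have [c Xc] := mx2_bound X.
have [C1 C10 hC1] := @discrete_series_taylor R n; have [C2 C20 hC2] := @ps_lie_le R n.
have c0 : 0 <= c by apply: le_trans (Xc 0 0); exact: modulus_ge0.
set M := C + c + 1; have M0 : 0 < M by rewrite ltr_pwDr// addr_ge0.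
(* For |t| below (4 M)^-1 the entries of tX + E are at most 1/4, the range of
   [discrete_series_taylor]. *)
exists (C1 * B * M ^+ 2 + C2 * B * C), (Num.min 1 (4 * M)^-1); split.
  by rewrite lt_min ltr01 invr_gt0 mulr_gt0.
move=> t z t0; rewrite lt_min => /andP[t1 t2] z1.
set E := expmx (ofR t *: X) - 1%:M - ofR t *: X.
have EC := hC t (ltW t1); rewrite -/E in EC.
have eE : expmx (ofR t *: X) = 1%:M + (ofR t *: X + E).
  by rewrite /E [X in 1%:M + X]addrC subrK addrC subrK.
have tn : 0 < `|t| by rewrite normr_gt0.
have Ye i j : modulus ((ofR t *: X + E) i j) <= M * `|t|.
  rewrite mxE (le_trans (modulusD _ _))// mxE modulusM modulus_ofR.
  have := EC i j; have : C * `|t| ^+ 2 <= C * `|t|.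
    by rewrite ler_wpM2l// expr2 ler_piMl// ltW.
  have : `|t| * modulus (X i j) <= `|t| * c by rewrite ler_wpM2l.
  rewrite /M; move: (modulus _) (`|t|) tn => x y y0; lra.
have Y4 : M * `|t| <= 1 / 4.
  rewrite mulrC -ler_pdivlMr//; apply: le_trans (ltW t2) _.
  by rewrite invfM div1r.
have sY : SU11 (1%:M + (ofR t *: X + E)) by rewrite -eE; exact: sX.
have := hC1 _ _ _ _ z ra aB Ye Y4 sY.
rewrite -eE ps_lie_linear//.
have := hC2 _ _ _ _ z ra aB EC.
set p := ps _ z; set q := ps _ z; set r := ps _ z; set s := discrete_series _ _ _ _.
move=> h1 h2.
have tC : ofR t != 0 by rewrite ofR_eq0.
rewrite (_ : _ - _ = (ofR t)^-1 * ((s - q - (ofR t * r + p)) + p)); last by field.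
rewrite modulusM modulusV modulus_ofR ler_pdivrMl// (le_trans (modulusD _ _))//.
apply: le_trans (lerD h2 h1) _; rewrite le_eqVlt; apply/orP; left; apply/eqP; ring.
Qed.

Definition SU11_inv g : 'M[cplx R]_2 := mx22 (g 1 1) (- g 0 1) (- g 1 0) (g 0 0).

Lemma SU11_invP g : SU11 g -> SU11 (SU11_inv g) /\ g *m SU11_inv g = 1%:M.
Proof.
move=> sg; have h := SU11_mod sg; case: sg => g1 g2 _.
have d1 : g 0 0 * (g 0 0)^* - g 0 1 * (g 0 1)^* = 1 by rewrite !mul_conj_sqr -ofRB h.
split; last first.
  apply/matrixP => i j; rewrite mx22_mul !mxE/= g1 g2.
  case: (ord2E i) => ->; case: (ord2E j) => -> /=; rewrite ?mulr0n ?mulr1n ?g1 ?g2.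
  - by rewrite -[RHS]d1; ring.
  - by ring.
  - by ring.
  - by rewrite -[RHS]d1; ring.
split; rewrite !mxE/= ?g1 ?g2 ?conjCK ?rmorphN//.
rewrite !normE modulusN modulus_conj -!ofRX -ofRB h//.
Qed.

(** Writing h = g (1 + Y) with Y = g^-1 (h - g) reduces continuity at g to the estimate at the
    identity, followed by the sup-norm bound for pi_n(g). *)
Lemma discrete_series_continuous n g a : SU11 g -> rdec a -> exists K d : R, 0 < d /\
  forall h e z, SU11 h -> (forall i j, modulus (h i j - g i j) <= e) -> e < d ->
  modulus z < 1 ->
  modulus (discrete_series n h (ps a) z - discrete_series n g (ps a) z) <= K * e.
Proof.
move=> sg ra; have [B aB] := ra 4%N; have B0 := rdec_by_ge0 aB.
have [C1 C10 hC1] := @discrete_series_taylor R n; have [C2 C20 hC2] := @ps_lie_le R n.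
have [si gi] := SU11_invP sg; set g' := SU11_inv g in si gi.
have [c g'c] := mx2_bound g'.
have c0 : 0 <= c by apply: le_trans (g'c 0 0); exact: modulus_ge0.
set M := 2 * c + 1; have M0 : 0 < M by rewrite ltr_pwDr// mulr_ge0.
exists ((2 * modulus (g 0 0)) ^+ n * (C1 * B * M + C2 * B * M)), (4 * M)^-1.
split; first by rewrite invr_gt0 mulr_gt0.
move=> h e z sh he ed z1.
have e0 : 0 <= e by apply: le_trans (he 0 0); exact: modulus_ge0.
set Y := g' *m (h - g).
have g'g : g' *m g = 1%:M.
  by apply: mulmx1C.
have hE : h = g *m (1%:M + Y).
  by rewrite mulmxDr mulmx1 /Y mulmxA gi mul1mx addrC subrK.
have YE : 1%:M + Y = g' *m h by rewrite /Y mulmxBr g'g addrC subrK.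
have sY : SU11 (1%:M + Y) by rewrite YE; exact: SU11M.
have Ye i j : modulus (Y i j) <= M * e.
  rewrite /Y mx22_mul (le_trans (modulusD _ _))// !modulusM ![(h - g) _ _]mxE.
  rewrite ![(- g) _ _]mxE.
  have := ler_pM (modulus_ge0 _) (modulus_ge0 _) (g'c i 0) (he 0 j).
  have := ler_pM (modulus_ge0 _) (modulus_ge0 _) (g'c i 1) (he 1 j).
  by rewrite /M; lra.
have Y4 : M * e <= 1 / 4.
  rewrite mulrC -ler_pdivlMr//; apply: le_trans (ltW ed) _.
  by rewrite invfM div1r.
have -> : discrete_series n h (ps a) z - discrete_series n g (ps a) z =
    discrete_series n g (discrete_series n (1%:M + Y) (ps a) - ps a) z.
  by rewrite discrete_seriesB {1}hE discrete_series_mul.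
rewrite -mulrA.
apply: discrete_series_le => // w w1.
have h1 := hC1 _ _ _ _ w ra aB Ye Y4 sY; have h2 := hC2 _ _ _ _ w ra aB Ye.
rewrite -[X in modulus X]/(discrete_series n (1%:M + Y) (ps a) w - ps a w).
rewrite -[X in modulus X](subrK (ps (lie_coef n Y a) w)) (le_trans (modulusD _ _))//.
apply: le_trans (lerD h1 h2) _.
rewrite [leRHS]mulrDl lerD//; last by rewrite !mulrA.
rewrite -!mulrA ler_wpM2l// ler_wpM2l// expr2 ler_piMl ?mulr_ge0 ?(ltW M0)//.
by lra.
Qed.

Lemma within_SU11 g (A : set 'M[cplx R]_2) (d : R) : 0 < d ->
  (forall h, SU11 h -> (forall i j, modulus (h i j - g i j) < d) -> A h) ->
  \forall h \near within SU11 (nbhs g), A h.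
Proof.
move=> d0 hA; apply/nbhs_mx2P; exists d => // h hd sh; exact: hA.
Qed.

Lemma continuous_on_SU11_ps n a : rdec a ->
  continuous_on_SU11 n (fun g => discrete_series n g (ps a)).
Proof.
move=> ra g sg; have [K [d [d0 hK]]] := discrete_series_continuous n sg ra.
apply/cvgrPdist_lt => e e0.
have K1 : 0 < 2 * `|K| + 1 by rewrite ltr_pwDr// mulr_ge0.
set d' := Num.min (d / 2) (e / (2 * `|K| + 1)).
have d'0 : 0 < d' by rewrite lt_min !divr_gt0.
apply: (@within_SU11 _ _ d') => // h sh hd.
rewrite sub0r normrN ger0_norm; last by rewrite bergman_normE sqrtr_ge0.
apply: (@le_lt_trans _ _ (2 * (K * d'))).
  apply: bergman_norm_le => z z1; apply: hK => //.
    by move=> i j; exact/ltW/hd.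
  by rewrite gt_min ltr_pdivrMr// ltr_pMr// ltr1n.
apply: (@le_lt_trans _ _ (2 * `|K| * d')).
  by rewrite -mulrA ler_wpM2l// ler_wpM2r ?(ltW d'0)// ler_norm.
apply: (@lt_le_trans _ _ ((2 * `|K| + 1) * d')); first by rewrite ltr_pM2r// ltrDl.
by rewrite mulrC -ler_pdivlMr// ge_min lexx orbT.
Qed.

(** pi_n(g exp(tX)) = pi_n(g) pi_n(exp(tX)), so the difference quotient at g is pi_n(g) applied to
    the one at the identity, and pi_n(g) is bounded in the sup norm. *)
Lemma lie_derivative_ps n X a : su11 X -> rdec a ->
  is_lie_derivative n X (fun g => discrete_series n g (ps a))
    (fun g => discrete_series n g (ps (lie_coef n X a))).
Proof.
move=> sX ra g sg; split; first exact/bergman_ps/rdec_lie.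
have [K [d [d0 hK]]] := expmx_derivative n sX ra.
apply/cvgrPdist_lt => e e0.
set L := (2 * modulus (g 0 0)) ^+ n.
have L0 : 0 <= L by rewrite exprn_ge0// mulr_ge0// modulus_ge0.
have K1 : 0 < 2 * L * `|K| + 1 by rewrite ltr_pwDr// !mulr_ge0.
near=> t.
have t0 : t != 0 by near: t; exact: nbhs_dnbhs_neq.
have td : `|t| < Num.min d (e / (2 * L * `|K| + 1)).
  near: t; apply: dnbhs0_lt; by rewrite lt_min d0 divr_gt0.
rewrite lt_min in td; have [td1 td2] := andP td.
rewrite sub0r normrN ger0_norm; last by rewrite bergman_normE sqrtr_ge0.
apply: (@le_lt_trans _ _ (2 * (L * (K * `|t|)))).
  apply: bergman_norm_le => z z1.
  set E := expmx _; have sE : SU11 E by exact: sX.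
  rewrite (_ : _ z = discrete_series n g ((ofR t)^-1 *: (discrete_series n E (ps a) - ps a)
     - ps (lie_coef n X a)) z); last first.
    rewrite discrete_seriesB discrete_seriesZ discrete_seriesB -discrete_series_mul//.
    by rewrite -ofRV.
  apply: discrete_series_le => // w w1; exact: hK.
apply: (@le_lt_trans _ _ (2 * L * `|K| * `|t|)).
  by rewrite !mulrA ler_wpM2r// ler_wpM2l ?mulr_ge0// ler_norm.
apply: (@le_lt_trans _ _ ((2 * L * `|K| + 1) * `|t|)); first by rewrite ler_wpM2r// lerDl.
by rewrite mulrC -ltr_pdivlMr.
Unshelve. all: by end_near. Qed.

(** The derivative along X of the orbit map of a rapidly decreasing series is the orbit map of
    another such series, so the induction on k closes on itself. *)
Lemma class_C_ps n k a : rdec a -> class_C n k (fun g => discrete_series n g (ps a)).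
Proof.
elim: k a => [|k IH] a ra; split => //; try exact: continuous_on_SU11_ps.
move=> X sX; exists (fun g => discrete_series n g (ps (lie_coef n X a))).
  exact: lie_derivative_ps.
exact/IH/rdec_lie.
Qed.

Lemma smooth_ps n a : rdec a -> smooth_vector n (ps a).
Proof. by move=> ra; split; [exact: bergman_ps1|move=> k; exact: class_C_ps]. Qed.

End power_series_smooth.

(** * Cauchy's theorem on the disc *)

Section segment_integral.
Context {R : realType}.
Implicit Types (f g F : R -> R) (a b c : R).

Definition seg_int a b f : R := \int[@lebesgue_measure R]_(x in `[a, b]) f x.

Lemma seg_integrable a b f : continuous f ->
  (@lebesgue_measure R).-integrable `[a, b] (EFin \o f).
Proof.
move=> cf; apply: continuous_compact_integrable; first exact: segment_compact.
by apply: continuous_subspaceT.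
Qed.

Lemma seg_intD a b f g : continuous f -> continuous g ->
  seg_int a b (fun x => f x + g x) = seg_int a b f + seg_int a b g.
Proof. by move=> cf cg; rewrite /seg_int RintegralD//; exact: seg_integrable. Qed.

Lemma seg_intB a b f g : continuous f -> continuous g ->
  seg_int a b (fun x => f x - g x) = seg_int a b f - seg_int a b g.
Proof. by move=> cf cg; rewrite /seg_int RintegralB//; exact: seg_integrable. Qed.

Lemma seg_intZ a b (k : R) f : continuous f ->
  seg_int a b (fun x => k * f x) = k * seg_int a b f.
Proof. by move=> cf; rewrite /seg_int RintegralZl//; exact: seg_integrable. Qed.

Lemma seg_int_split a b c f : continuous f -> a <= b -> b <= c ->
  seg_int a c f = seg_int a b f + seg_int b c f.
Proof.
move=> cf ab bc; rewrite /seg_int.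
have /(_ (BLeft a) (BRight c) b) := @Rintegral_itvB R f.
rewrite !bnd_simp => /(_ (seg_integrable _ _ cf) ab bc).
rewrite Rintegral_itv_obnd_cbnd; first by move=> <-; rewrite subrKC.
apply: (@integrableS _ _ _ lebesgue_measure `[b, c]) => //.
  by apply: subset_itvr; rewrite bnd_simp.
exact: seg_integrable.
Qed.

Lemma seg_int_le a b f M : continuous f -> a <= b ->
  (forall x, a <= x <= b -> `|f x| <= M) -> `|seg_int a b f| <= M * (b - a).
Proof.
move=> cf ab fM; rewrite /seg_int.
apply: le_trans (le_normr_Rintegral _ (seg_integrable _ _ cf)) _ => //.
have -> : M * (b - a) = seg_int a b (fun=> M).
  rewrite /seg_int Rintegral_cst//; congr (_ * _).
  by rewrite -[LHS]/(fine (b - a)%:E); congr fine; exact/esym/lebesgue_measure_seg.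
apply: le_Rintegral => //.
- by apply: (@seg_integrable a b (fun x => `|f x|)) => x; apply: cvg_norm; exact: cf.
- by apply: (@seg_integrable a b (fun=> M)) => x; exact: cvg_cst.
Qed.

Lemma seg_int_FTC a b f F : continuous f -> (forall x : R, is_derive x (1 : R) F (f x)) ->
  a <= b -> seg_int a b f = F b - F a.
Proof.
move=> cf dF; rewrite le_eqVlt => /predU1P[->|ab].
  by rewrite /seg_int set_itv1 Rintegral_set1 subrr.
have cF : continuous F.
  move=> x; apply: differentiable_continuous; apply/derivable1_diffP.
  by have [] := dF x.
rewrite /seg_int /Rintegral (@continuous_FTC2 R f F a b ab)//.
- exact: continuous_subspaceT.
- split.
  + by move=> x _; have [] := dF x.
  + by apply: cvg_at_right_filter; exact: cF.
  + by apply: cvg_at_left_filter; exact: cF.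
- by move=> x _; rewrite derive1E; exact: derive_val.
Qed.

End segment_integral.

(** * Goursat's theorem for locally exact forms *)

Section goursat.
Context {R : realType}.
Implicit Types (A B U : R -> R -> R).

(** The line integral of A dx + B dy along the boundary of a rectangle, counterclockwise. *)
Definition boundary_int A B (x1 x2 y1 y2 : R) : R :=
  seg_int x1 x2 (A^~ y1) + seg_int y1 y2 (B x2) -
  seg_int x1 x2 (A^~ y2) - seg_int y1 y2 (B x1).

Definition separately_continuous A B :=
  (forall y, continuous (A^~ y)) /\ (forall x, continuous (B x)).

Definition is_differential U A B :=
  [/\ forall x y : R, is_derive x (1 : R) (U^~ y) (A x y),
      forall x y : R, is_derive y (1 : R) (U x) (B x y) & separately_continuous A B].

(* Complex differentiability of f provides this for the form f(z)dz. *)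
Definition locally_exact A B := forall p q e : R, 0 < e ->
  exists (d : R) (U Ux Uy : R -> R -> R), [/\ 0 < d, is_differential U Ux Uy &
    forall x y, `|x - p| <= d -> `|y - q| <= d ->
      `|A x y - Ux x y| <= e * (`|x - p| + `|y - q|) /\
      `|B x y - Uy x y| <= e * (`|x - p| + `|y - q|)].

Lemma boundary_int_split A B x1 x2 x3 y1 y2 y3 : separately_continuous A B ->
  x1 <= x2 -> x2 <= x3 -> y1 <= y2 -> y2 <= y3 ->
  boundary_int A B x1 x3 y1 y3 =
  boundary_int A B x1 x2 y1 y2 + boundary_int A B x2 x3 y1 y2 +
  boundary_int A B x1 x2 y2 y3 + boundary_int A B x2 x3 y2 y3.
Proof.
move=> [cA cB] x12 x23 y12 y23; rewrite /boundary_int.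
rewrite !(@seg_int_split _ x1 x2 x3)// !(@seg_int_split _ y1 y2 y3)//; try exact: cA; try exact: cB.
ring.
Qed.

Lemma boundary_int_exact U A B x1 x2 y1 y2 : is_differential U A B ->
  x1 <= x2 -> y1 <= y2 -> boundary_int A B x1 x2 y1 y2 = 0.
Proof.
move=> [dx dy [cA cB]] x12 y12; rewrite /boundary_int.
rewrite (seg_int_FTC (F := U^~ y1))// (seg_int_FTC (F := U^~ y2))//.
rewrite (seg_int_FTC (F := U x1))// (seg_int_FTC (F := U x2))//.
ring.
Qed.

(** Subtracting the exact form dU does not change the boundary integral; afterwards each side
    contributes at most M times its length. *)
Lemma boundary_int_le A B U Ux Uy x1 x2 y1 y2 M : separately_continuous A B ->
  is_differential U Ux Uy -> x1 <= x2 -> y1 <= y2 ->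
  (forall x y, x1 <= x <= x2 -> y1 <= y <= y2 ->
    `|A x y - Ux x y| <= M /\ `|B x y - Uy x y| <= M) ->
  `|boundary_int A B x1 x2 y1 y2| <= 2 * M * ((x2 - x1) + (y2 - y1)).
Proof.
move=> [cA cB] dU x12 y12 h.
have := boundary_int_exact dU x12 y12; case: dU => _ _ [cx cy].
rewrite -[boundary_int A _ _ _ _ _]subr0 => <-; rewrite /boundary_int.
have hA y : y1 <= y <= y2 ->
    `|seg_int x1 x2 (A^~ y) - seg_int x1 x2 (Ux^~ y)| <= M * (x2 - x1).
  move=> yy; rewrite -seg_intB; [|exact: cA|exact: cx].
  apply: seg_int_le => // [|x xx]; last by have [] := h x y xx yy.
  by move=> x; apply: cvgB; [exact: cA|exact: cx].
have hB x : x1 <= x <= x2 ->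
    `|seg_int y1 y2 (B x) - seg_int y1 y2 (Uy x)| <= M * (y2 - y1).
  move=> xx; rewrite -seg_intB; [|exact: cB|exact: cy].
  apply: seg_int_le => // [|y yy]; last by have [] := h x y xx yy.
  by move=> y; apply: cvgB; [exact: cB|exact: cy].
have := hA y1; have := hA y2; have := hB x1; have := hB x2.
rewrite !lexx x12 y12 !ler_norml => /(_ isT)/andP[? ?] /(_ isT)/andP[? ?].
move=> /(_ isT)/andP[? ?] /(_ isT)/andP[? ?]; apply/andP; split; lra.
Qed.

(** Bisection: if the integral has absolute value c > 0, nested rectangles scaled by 2^-k keep at
    least c 4^-k of it. Near their common point the form is exact up to e times the distance, and
    distance and perimeter are both of order 2^-k, so a small e leaves less than c 4^-k. *)
Lemma goursat A B x1 x2 y1 y2 : separately_continuous A B -> locally_exact A B ->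
  x1 <= x2 -> y1 <= y2 -> boundary_int A B x1 x2 y1 y2 = 0.
Proof.
move=> cAB lAB x12 y12; apply/eqP/negPn/negP => bd0.
set w := x2 - x1; set h := y2 - y1.
have w0 : 0 <= w by rewrite subr_ge0.
have h0 : 0 <= h by rewrite subr_ge0.
set c := `|boundary_int A B x1 x2 y1 y2|.
have c0 : 0 < c by rewrite normr_gt0.
pose u (k : nat) : R := 2^-1 ^+ k.
have u0 k : 0 < u k by rewrite exprn_gt0.
have uS k : u k = u k.+1 + u k.+1 by rewrite /u exprS; lra.
pose Q (k : nat) (p : R * R) :=
  c * u k ^+ 2 <= `|boundary_int A B p.1 (p.1 + w * u k) p.2 (p.2 + h * u k)|.
have step (kp : nat * (R * R)) : exists p' : R * R, Q kp.1 kp.2 ->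
    Q kp.1.+1 p' /\ (kp.2.1 <= p'.1 <= kp.2.1 + w * u kp.1.+1) /\
      (kp.2.2 <= p'.2 <= kp.2.2 + h * u kp.1.+1).
  case: kp => k [x y] /=.
  have [Qk|nQ] := pselect (Q k (x, y)); last by exists (x, y) => /nQ.
  have wu : 0 <= w * u k.+1 by rewrite mulr_ge0// ltW.
  have hu : 0 <= h * u k.+1 by rewrite mulr_ge0// ltW.
  have e1 : x + w * u k = x + w * u k.+1 + w * u k.+1 by rewrite (uS k); ring.
  have e2 : y + h * u k = y + h * u k.+1 + h * u k.+1 by rewrite (uS k); ring.
  move: Qk; rewrite /Q/= e1 e2 (@boundary_int_split _ _ x (x + w * u k.+1) _ y (y + h * u k.+1))// ?lerDl//.
  rewrite (_ : c * u k ^+ 2 = 4 * (c * u k.+1 ^+ 2)); last by rewrite (uS k); ring.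
  set b1 := boundary_int _ _ x _ y _; set b2 := boundary_int _ _ (x + _) _ y _.
  set b3 := boundary_int _ _ x _ (y + _) _; set b4 := boundary_int _ _ (x + _) _ (y + _) _.
  set m := c * u k.+1 ^+ 2 => hm.
  have [h1|h1] := leP m `|b1|.
    exists (x, y) => _; split; [exact: h1|by rewrite /= !lexx !lerDl wu hu].
  have [h2|h2] := leP m `|b2|.
    exists (x + w * u k.+1, y) => _; split; [exact: h2|by rewrite /= !lexx !lerDl wu hu].
  have [h3|h3] := leP m `|b3|.
    exists (x, y + h * u k.+1) => _; split; [exact: h3|by rewrite /= !lexx !lerDl wu hu].
  have [h4|h4] := leP m `|b4|.
    exists (x + w * u k.+1, y + h * u k.+1) => _; split; [exact: h4|by rewrite /= !lexx !lerDl wu hu].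
  have := ler_normD (b1 + b2 + b3) b4; have := ler_normD (b1 + b2) b3.
  by have := ler_normD b1 b2; lra.
have [f hf] := choice step.
pose s := fix s k : R * R := if k is k'.+1 then f (k', s k') else (x1, y1).
have Qs k : Q k (s k).
  elim: k => [|k IH]; last by have [] := hf (k, s k) IH.
  by rewrite /Q /= /u expr0 !mulr1 expr1n mulr1 /w /h !subrKC lexx.
have s1 k : (s k).1 <= (s k.+1).1 <= (s k).1 + w * u k.+1.
  by have [_ []] := hf (k, s k) (Qs k).
have s2 k : (s k).2 <= (s k.+1).2 <= (s k).2 + h * u k.+1.
  by have [_ []] := hf (k, s k) (Qs k).
(* Left end points increase and right end points decrease, so the limit of the former lies in every
   interval. This is used once for each coordinate. *)
have nest (t : nat -> R) (l : R) : 0 <= l ->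
    (forall k, t k <= t k.+1 <= t k + l * u k.+1) ->
    exists p, forall k, t k <= p <= t k + l * u k.
  move=> l0 ht.
  have tn : nondecreasing_seq t by apply/nondecreasing_seqP => k; have /andP[] := ht k.
  have tb k : t k + l * u k <= t 0 + l.
    elim: k => [|k IH]; first by rewrite /u mulr1.
    by have /andP[_] := ht k; move: IH; rewrite (uS k) mulrDr; lra.
  have ti m k : (m <= k)%N -> t k + l * u k <= t m + l * u m.
    move=> /subnK <-; elim: (k - m)%N => [|i IH]; first by rewrite add0n.
    rewrite addSn; apply: le_trans IH.
    by have /andP[_] := ht (i + m)%N; rewrite (uS (i + m)) mulrDr; lra.
  have tle m k : t m <= t k + l * u k.
    have [mk|/ltnW km] := leqP m k.
      by apply: le_trans (tn _ _ mk) _; rewrite lerDl mulr_ge0// ltW.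
    apply: le_trans _ (ti _ _ km); rewrite lerDl mulr_ge0// ltW//.
  have cv : cvgn t.
    apply: nondecreasing_is_cvgn => //.
    by exists (t 0 + l * u 0) => _ [k _ <-]; exact: tle.
  exists (limn t) => k; apply/andP; split.
    exact: nondecreasing_cvgn_le.
  by apply: limr_le => //; near=> m; exact: tle.
have [p hp] := nest _ _ w0 s1; have [q hq] := nest _ _ h0 s2.
set L := w + h + 1; have L0 : 0 < L by rewrite ltr_pwDr// addr_ge0.
(* With this e the final bound becomes c u_k^2 (w + h) / (2 L), which is below c u_k^2 since w + h <
   L. *)
have e0 : 0 < c / (4 * L ^+ 2) by rewrite divr_gt0// mulr_gt0// exprn_gt0.
have [d [U [Ux [Uy [d0 dU hU]]]]] := lAB p q _ e0.
have [k hk] : exists k, L * u k < d.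
  have : u k @[k --> \oo] --> (0 : R) by apply: cvg_expr; rewrite ger0_norm ?invr_ge0//; lra.
  have dL : 0 < d / L by rewrite divr_gt0.
  move=> /cvgrPdist_lt /(_ _ dL) [k _ /(_ k (leqnn k))].
  rewrite sub0r normrN gtr0_norm// ltr_pdivlMr// mulrC => ?.
  by exists k.
have := Qs k; rewrite /Q leNgt => /negP; apply.
have := hp k; have := hq k; move: (s k) => [x y] /= /andP[q1 q2] /andP[p1 p2].
have wu : 0 <= w * u k by rewrite mulr_ge0// ltW.
have hu : 0 <= h * u k by rewrite mulr_ge0// ltW.
have uk := u0 k.
have hM x' y' : x <= x' <= x + w * u k -> y <= y' <= y + h * u k ->
   `|A x' y' - Ux x' y'| <= c / (4 * L ^+ 2) * (L * u k) /\
   `|B x' y' - Uy x' y'| <= c / (4 * L ^+ 2) * (L * u k).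
  move=> /andP[? ?] /andP[? ?].
  have xp : `|x' - p| <= w * u k by rewrite ler_norml; apply/andP; split; lra.
  have yq : `|y' - q| <= h * u k by rewrite ler_norml; apply/andP; split; lra.
  have le : w * u k + h * u k <= L * u k by rewrite -mulrDl ler_wpM2r ?(ltW uk)// lerDl.
  have [||h1 h2] := hU x' y'; [lra|lra|].
  by split; [apply: le_trans h1 _|apply: le_trans h2 _]; rewrite ler_wpM2l ?(ltW e0)//; lra.
have := boundary_int_le cAB dU _ _ hM; rewrite !lerDl => /(_ wu hu).
move=> /le_lt_trans; apply.
rewrite (_ : 2 * _ * _ = c * u k ^+ 2 * ((w + h) / (2 * L))); last first.
  by field; rewrite gt_eqF.
rewrite gtr_pMr ?mulr_gt0 ?exprn_gt0// ltr_pdivrMr ?mulr_gt0// mul1r /L.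
lra.
Unshelve. all: by end_near. Qed.

End goursat.

(** * Complex-valued functions of a real variable *)

Section complex_derivative.
Context {R : realType}.
Implicit Types (f g : R -> cplx R) (t : R) (l m c : cplx R).

Lemma rpart_continuous : continuous (@rpart R).
Proof.
move=> z; apply/(cvgrPdist_lt (FF := nbhs_filter z)) => e e0; apply/nbhs_cplxP; exists e => // w wz.
by rewrite -rpartB; apply: le_lt_trans (rpart_le _) _; rewrite modulusC.
Qed.

Lemma ipart_continuous : continuous (@ipart R).
Proof.
move=> z; apply/(cvgrPdist_lt (FF := nbhs_filter z)) => e e0; apply/nbhs_cplxP; exists e => // w wz.
by rewrite -ipartB; apply: le_lt_trans (ipart_le _) _; rewrite modulusC.
Qed.

Lemma modulus_continuous : continuous (@modulus R).
Proof.
move=> z; apply/(cvgrPdist_lt (FF := nbhs_filter z)) => e e0; apply/nbhs_cplxP; exists e => // w wz.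
rewrite ltr_norml; have := modulus_lerB z w; have := modulus_lerB w z.
by rewrite [modulus (z - w)]modulusC => h1 h2; apply/andP; split; lra.
Qed.

Lemma continuous_parts f t :
  {for t, continuous (rpart \o f)} -> {for t, continuous (ipart \o f)} ->
  {for t, continuous f}.
Proof.
move=> /cvgrPdist_lt h1 /cvgrPdist_lt h2; apply/cvg_cplxP => e e0.
have e2 : 0 < e / 2 by rewrite divr_gt0.
near=> s; apply: le_lt_trans (modulus_le _) _; rewrite [e]splitr rpartB ipartB.
apply: ltrD; rewrite distrC; near: s; [exact: h1|exact: h2].
Unshelve. all: by end_near. Qed.

(** The normed structure of [cplx R] is over itself, so a derivative in a real variable is taken
    separately in the real and imaginary parts. *)
Definition cder f t l :=
  is_derive t (1 : R) (rpart \o f) (rpart l) /\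
  is_derive t (1 : R) (ipart \o f) (ipart l).

Lemma cder_eq f t l m : cder f t l -> l = m -> cder f t m.
Proof. by move=> h <-. Qed.

Lemma cder_continuous f t l : cder f t l -> {for t, continuous f}.
Proof.
move=> [[h1 _] [h2 _]]; apply: continuous_parts.
  exact/differentiable_continuous/derivable1_diffP.
exact/differentiable_continuous/derivable1_diffP.
Qed.

Lemma cder_cst c t : cder (fun=> c) t 0.
Proof. by split; exact: is_derive_cst. Qed.

Lemma cder_ofR (h : R -> R) t (d : R) : is_derive t (1 : R) h d ->
  cder (fun x => ofR (h x)) t (ofR d).
Proof. by move=> hd; split => //; exact: is_derive_cst. Qed.

Lemma cder_id t : cder (fun x => ofR x) t 1.
Proof. by apply: cder_ofR; exact: is_derive_id. Qed.

Lemma cderD f g t l m : cder f t l -> cder g t m -> cder (fun x => f x + g x) t (l + m).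
Proof.
move=> [f1 f2] [g1 g2]; split.
  rewrite rpartD (_ : _ \o _ = (rpart \o f) + (rpart \o g)); first exact: is_deriveD.
  by apply/funext => x; rewrite /= rpartD.
rewrite ipartD (_ : _ \o _ = (ipart \o f) + (ipart \o g)); first exact: is_deriveD.
by apply/funext => x; rewrite /= ipartD.
Qed.

Lemma cderM f g t l m : cder f t l -> cder g t m ->
  cder (fun x => f x * g x) t (l * g t + f t * m).
Proof.
move=> [f1 f2] [g1 g2]; split.
  rewrite (_ : _ \o _ = (rpart \o f) * (rpart \o g) - (ipart \o f) * (ipart \o g)).
    apply: is_derive_eq; rewrite /= !partE /GRing.scale/=; ring.
  by apply/funext => x; rewrite /= rpartM.
rewrite (_ : _ \o _ = (rpart \o f) * (ipart \o g) + (ipart \o f) * (rpart \o g)).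
  apply: is_derive_eq; rewrite /= !partE /GRing.scale/=; ring.
by apply/funext => x; rewrite /= ipartM.
Qed.

Lemma cderZ c f t l : cder f t l -> cder (fun x => c * f x) t (c * l).
Proof. by move=> h; apply: cder_eq (cderM (cder_cst c t) h) _; rewrite mul0r add0r. Qed.

Lemma cderN f t l : cder f t l -> cder (fun x => - f x) t (- l).
Proof.
move=> h; rewrite -mulN1r (_ : (fun x => _) = (fun x => -1 * f x)).
  exact: cderZ.
by apply/funext => x; rewrite mulN1r.
Qed.

Lemma cderB f g t l m : cder f t l -> cder g t m -> cder (fun x => f x - g x) t (l - m).
Proof. by move=> hf hg; apply: cderD hf (cderN hg). Qed.

Lemma cder_conj f t l : cder f t l -> cder (fun x => (f x)^*) t l^*.
Proof.
move=> [h1 h2]; split.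
  rewrite rpart_conj (_ : _ \o _ = rpart \o f)//.
  by apply/funext => x; rewrite /= rpart_conj.
rewrite ipart_conj (_ : _ \o _ = - (ipart \o f)); first exact: is_deriveN.
by apply/funext => x; rewrite /= ipart_conj.
Qed.

Lemma cderX f t l k : cder f t l -> cder (fun x => f x ^+ k) t (k%:R * f t ^+ k.-1 * l).
Proof.
move=> h; elim: k => [|k IH].
  by rewrite mul0r mul0r; under eq_fun do rewrite expr0; exact: cder_cst.
under eq_fun do rewrite exprS; apply: cder_eq (cderM h IH) _.
by case: k {IH} => [|k]; rewrite /= ?expr0 ?mul0r -?natr1 ?exprS; ring.
Qed.

(** 1 / f = conj(f) / |f|^2 reduces the inverse to that of a positive real function. *)
Lemma cderV f t l : (forall x, f x != 0) -> cder f t l ->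
  cder (fun x => (f x)^-1) t (- l / f t ^+ 2).
Proof.
move=> f0 h.
have [hc hs] := (cder_conj h, cder_continuous h).
have mV x : (f x)^-1 = ofR (modulus (f x) ^+ 2)^-1 * (f x)^*.
  rewrite ofRV -mul_conj_sqr invfM mulfVK//.
  by rewrite -modulus_eq0 modulus_conj modulus_eq0.
have m0 : modulus (f t) ^+ 2 != 0 by rewrite expf_neq0// modulus_eq0.
have [dm _] : cder (fun x => f x * (f x)^*) t (l * (f t)^* + f t * l^*) := cderM h hc.
have dm' : is_derive t (1 : R) (fun x => modulus (f x) ^+ 2)
    (rpart (l * (f t)^* + f t * l^*)).
  rewrite (_ : (fun x => _) = rpart \o (fun x => f x * (f x)^*))//.
  by apply/funext => x /=; rewrite mul_conj_sqr.
have := cderM (cder_ofR (@is_deriveV R (fun x : R => modulus (f x) ^+ 2) t _ 1 m0 dm')) hc.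
rewrite (_ : (fun x => _) = (fun x => (f x)^-1)); last by apply/funext => x; rewrite mV.
move=> /cder_eq; apply.
have c0 : (f t)^* != 0 by rewrite -modulus_eq0 modulus_conj modulus_eq0.
have -> : ofR (- modulus (f t) ^+ 2 ^- 2 *: rpart (l * (f t)^* + f t * l^*)) =
   - (f t * (f t)^*) ^- 2 * (l * (f t)^* + f t * l^*).
  rewrite /GRing.scale/= ofRM ofRN ofRV ofRX mul_conj_sqr; congr (_ * _).
  by apply: complex_eq; rewrite !partE; ring.
have -> : ofR ((modulus (f t) ^+ 2)^-1) = (f t * (f t)^*)^-1 by rewrite mul_conj_sqr ofRV.
have ft := f0 t; move: (f t) (f t)^* c0 ft l^* => u v v0 u0 l'.
by field; rewrite ?u0 ?v0.
Qed.

Lemma cder_eit t : cder eit t (imag * eit t).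
Proof.
apply: cder_eq (cderD (cder_ofR (is_derive_cos t)) (cderZ imag (cder_ofR (is_derive_sin t)))) _.
by apply: complex_eq; rewrite /eit !partE; ring.
Qed.

Definition cseg_int (a b : R) f : cplx R :=
  ofR (seg_int a b (rpart \o f)) + imag * ofR (seg_int a b (ipart \o f)).

Lemma continuous_rpart f : continuous f -> continuous (rpart \o f).
Proof. by move=> cf x; apply: continuous_comp; [exact: cf|exact: rpart_continuous]. Qed.

Lemma continuous_ipart f : continuous f -> continuous (ipart \o f).
Proof. by move=> cf x; apply: continuous_comp; [exact: cf|exact: ipart_continuous]. Qed.

Lemma cseg_intD a b f g : continuous f -> continuous g ->
  cseg_int a b (fun x => f x + g x) = cseg_int a b f + cseg_int a b g.
Proof.
move=> cf cg; rewrite /cseg_int.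
rewrite (_ : _ \o _ = fun x => (rpart \o f) x + (rpart \o g) x); last first.
  by apply/funext => x; rewrite /= rpartD.
rewrite (_ : ipart \o (fun x => f x + g x) = fun x => (ipart \o f) x + (ipart \o g) x); last first.
  by apply/funext => x; rewrite /= ipartD.
rewrite (seg_intD _ _ (continuous_rpart cf) (continuous_rpart cg)).
rewrite (seg_intD _ _ (continuous_ipart cf) (continuous_ipart cg)).
by rewrite !ofRD; ring.
Qed.

Lemma cseg_intZ a b c f : continuous f ->
  cseg_int a b (fun x => c * f x) = c * cseg_int a b f.
Proof.
move=> cf; rewrite /cseg_int; have cr := continuous_rpart cf; have ci := continuous_ipart cf.
have crZ (k : R) : continuous (fun x => k * (rpart \o f) x).
  by move=> x; apply: cvgM; [exact: cvg_cst|exact: cr].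
have ciZ (k : R) : continuous (fun x => k * (ipart \o f) x).
  by move=> x; apply: cvgM; [exact: cvg_cst|exact: ci].
rewrite (_ : _ \o _ = fun x => rpart c * (rpart \o f) x - ipart c * (ipart \o f) x); last first.
  by apply/funext => x; rewrite /= rpartM.
rewrite (_ : ipart \o (fun x => c * f x) = fun x => rpart c * (ipart \o f) x + ipart c * (rpart \o f) x); last first.
  by apply/funext => x; rewrite /= ipartM.
rewrite (seg_intB _ _ (crZ _) (ciZ _)) (seg_intD _ _ (ciZ _) (crZ _)) !seg_intZ//.
by apply: complex_eq; rewrite !partE; ring.
Qed.

Lemma cseg_int_le a b f (M : R) : continuous f -> a <= b ->
  (forall x, a <= x <= b -> modulus (f x) <= M) ->
  modulus (cseg_int a b f) <= 2 * (M * (b - a)).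
Proof.
move=> cf ab fM; apply: le_trans (modulusD _ _) _.
rewrite modulusM modulus_imag mul1r !modulus_ofR mulr_natl mulr2n lerD//.
  apply: seg_int_le => // [|x xx]; first exact: continuous_rpart.
  exact: le_trans (rpart_le _) (fM _ xx).
apply: seg_int_le => // [|x xx]; first exact: continuous_ipart.
exact: le_trans (ipart_le _) (fM _ xx).
Qed.

Lemma cseg_int_FTC a b f (F : R -> cplx R) : continuous f ->
  (forall x, cder F x (f x)) -> a <= b -> cseg_int a b f = F b - F a.
Proof.
move=> cf dF ab; rewrite /cseg_int.
rewrite (seg_int_FTC (continuous_rpart cf) (fun x => (dF x).1) ab).
rewrite (seg_int_FTC (continuous_ipart cf) (fun x => (dF x).2) ab).
by apply: complex_eq; rewrite !partE/=; ring.
Qed.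

(** A complex number is determined by the real parts of its multiples by 1 and -i; with this, the
    real forms of Goursat's theorem speak about complex line integrals. *)
Lemma cseg_int_rpart a b f c : continuous f ->
  seg_int a b (fun x => rpart (c * f x)) = rpart (c * cseg_int a b f).
Proof.
move=> cf; rewrite -(cseg_intZ a b c cf) /cseg_int rpartD rpart_ofR rpartM.
by rewrite rpart_imag ipart_ofR mul0r mulr0 subr0 addr0.
Qed.

End complex_derivative.

(** * The Cauchy kernel pulled back to a deformation of the circle *)

Section cauchy.
Context {R : realType}.
Implicit Types (z w : cplx R) (x y th : R).
Local Notation circ := (2 * pi : R).

Lemma eit_lip th th' : modulus (eit th - eit th') <= 2 * `|th - th'|.
Proof.
wlog le : th th' / th' <= th.
  move=> h; have [le|/ltW le] := leP th' th; first exact: h.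
  by rewrite modulusC distrC; exact: h.
have cs : continuous (@sin R) by exact: continuous_sin.
have cc : continuous (@cos R) by exact: continuous_cos.
have h1 : `|cos th - cos th'| <= th - th'.
  have cN : continuous (fun x : R => - sin x) by move=> x; apply: cvgN; exact: cs.
  rewrite -(seg_int_FTC cN _ le) -[leRHS]mul1r.
  apply: seg_int_le => // x _; rewrite normrN ler_norml sin_geN1 sin_le1//.
have h2 : `|sin th - sin th'| <= th - th'.
  rewrite -(seg_int_FTC cc _ le) -[leRHS]mul1r.
  apply: seg_int_le => // x _; rewrite ler_norml cos_geN1 cos_le1//.
apply: le_trans (modulus_le _) _; rewrite /eit !partE.
rewrite [`|th - th'|]ger0_norm ?subr_ge0// mulr_natl mulr2n lerD//.
  by apply: le_trans h1; rewrite le_eqVlt; apply/orP; left; apply/eqP; congr `|_|; ring.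
by apply: le_trans h2; rewrite le_eqVlt; apply/orP; left; apply/eqP; congr `|_|; ring.
Qed.

Lemma derivable_expansion (f : cplx R -> cplx R) z : derivable f z 1 ->
  exists d : cplx R, forall e : R, 0 < e -> exists2 r : R, 0 < r &
    forall w, modulus (w - z) < r ->
      modulus (f w - f z - d * (w - z)) <= e * modulus (w - z).
Proof.
move=> /cvg_ex[d /cvg_cplxP hd]; exists d => e e0.
have /nbhs_cplxP[r r0 hr] := hd e e0; exists r => // w wr.
have [->|wz] := eqVneq w z; first by rewrite !subrr mulr0 subr0 modulus0 mulr0.
have wz0 : w - z != 0 by rewrite subr_eq0.
have := hr (w - z); rewrite subr0 => /(_ wr wz0).
rewrite /= [_ *: 1]mulr1 subrK -[_ *: _]/((w - z)^-1 * _) => /ltW h.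
rewrite (_ : f w - f z - d * (w - z) =
    ((w - z)^-1 * (f w - f z) - d) * (w - z)); last by field.
by rewrite modulusM ler_wpM2r ?modulus_ge0.
Qed.

(* The decreasing factor moving the circle towards z; it is positive and at
   most 1 on the whole line. *)
Definition shrink x : R := (1 + x ^+ 2)^-1.

Lemma shrink_gt0 x : 0 < shrink x.
Proof. by rewrite invr_gt0 ltr_pwDl// sqr_ge0. Qed.

Lemma shrink_le1 x : shrink x <= 1.
Proof. by rewrite invf_le1 ?ltr_pwDl ?sqr_ge0// lerDl sqr_ge0. Qed.

Definition dshrink x : R := - (2 * x) * shrink x ^+ 2.

Lemma x_shrink_le x : `|x| * shrink x <= 1 / 2.
Proof.
have h : 0 < 1 + x ^+ 2 by rewrite ltr_pwDl// sqr_ge0.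
rewrite /shrink ler_pdivrMr// -(real_normK (num_real x)).
by have := sqr_ge0 (`|x| - 1); lra.
Qed.

Lemma dshrink_le x : `|dshrink x| <= 1.
Proof.
rewrite /dshrink normrM normrN normrM normr_nat (ger0_norm (sqr_ge0 _)).
have := x_shrink_le x; have := shrink_gt0 x; have := shrink_le1 x.
have := normr_ge0 x; rewrite expr2; move: (shrink x) `|x| => s t; nra.
Qed.

Lemma shrink_lip x y : `|shrink x - shrink y| <= `|x - y|.
Proof.
have h t : 0 < 1 + t ^+ 2 :> R by rewrite ltr_pwDl// sqr_ge0.
have -> : shrink x - shrink y = (y - x) * (x + y) * (shrink x * shrink y).
  by rewrite /shrink; field; rewrite !gt_eqF.
rewrite !normrM distrC -mulrA ler_piMr// -normrM.
have hx := x_shrink_le x; have hy := x_shrink_le y.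
have sx := shrink_gt0 x; have sy := shrink_gt0 y.
have sx1 := shrink_le1 x; have sy1 := shrink_le1 y.
rewrite !normrM (gtr0_norm sx) (gtr0_norm sy).
apply: (@le_trans _ _ ((`|x| + `|y|) * (shrink x * shrink y))).
  by rewrite ler_wpM2r ?mulr_ge0 ?(ltW sx) ?(ltW sy)// ler_normD.
have := normr_ge0 x; have := normr_ge0 y.
move: (`|x|) (`|y|) (shrink x) (shrink y) hx hy sx sy sx1 sy1 => a b s t *.
nra.
Qed.

Lemma is_derive_shrink x : is_derive x (1 : R) shrink (dshrink x).
Proof.
have h t : 1 + t ^+ 2 != 0 :> R by rewrite gt_eqF// ltr_pwDl// sqr_ge0.
rewrite /shrink; apply: is_derive_eq.
by rewrite /dshrink /shrink /GRing.scale/=; field.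
Qed.

Section disc_cauchy.
Variables (v : cplx R -> cplx R) (r : R) (z : cplx R).
Hypotheses (hv : holomorphic v) (r01 : 0 < r < 1) (zr : modulus z < r).

Let r0 : 0 < r. Proof. by case/andP: r01. Qed.
Let r1 : r < 1. Proof. by case/andP: r01. Qed.

Definition circle th : cplx R := ofR r * eit th.
(** Deforms the circle (x = 0) along segments towards z (x to infinity). It is defined for every
    real x and never meets z, so the pulled-back form lives on the whole plane. *)
Definition contour x th : cplx R := z + (circle th - z) * ofR (shrink x).
(** The coefficient of dtheta in dw / (w - z) along the contour; it does not depend on x because
    [shrink x] cancels. *)
Definition dlog th : cplx R := imag * circle th / (circle th - z).

Lemma circle_mod th : modulus (circle th) = r.
Proof. by rewrite modulusM eit_sqr mulr1 modulus_ofR gtr0_norm. Qed.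

Lemma circle_neq0 th : circle th != 0.
Proof. by rewrite -modulus_gt0 circle_mod. Qed.

Lemma circle_sub_ge th : r - modulus z <= modulus (circle th - z).
Proof. by rewrite -{1}(circle_mod th); exact: modulus_lerB. Qed.

Lemma circle_sub_neq0 th : circle th - z != 0.
Proof.
by rewrite -modulus_gt0; apply: lt_le_trans (circle_sub_ge th); rewrite subr_gt0.
Qed.

Lemma circle_sub_le th : modulus (circle th - z) <= 2.
Proof.
by apply: le_trans (modulusB _ _) _; rewrite circle_mod; move: zr r1; lra.
Qed.

Lemma contour_disc x th : modulus (contour x th) < 1.
Proof.
have s0 := shrink_gt0 x; have s1 := shrink_le1 x.
have -> : contour x th = z * ofR (1 - shrink x) + circle th * ofR (shrink x).
  by rewrite /contour ofRB ofR1; ring.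
apply: le_lt_trans (modulusD _ _) _.
rewrite (modulusM z) (modulusM (circle th)) circle_mod !modulus_ofR.
rewrite !ger0_norm ?subr_ge0// ?(ltW s0)//.
apply: (@le_lt_trans _ _ (r * (1 - shrink x) + r * shrink x)).
  by rewrite lerD2r ler_wpM2r ?subr_ge0// ltW.
by rewrite -mulrDr subrK mulr1.
Qed.

Lemma contour_neq x th : contour x th - z != 0.
Proof.
rewrite /contour addrC addKr mulf_neq0 ?circle_sub_neq0//.
by rewrite ofR_eq0 gt_eqF// shrink_gt0.
Qed.

Lemma cder_circle th : cder circle th (imag * circle th).
Proof. by apply: cder_eq (cderZ (ofR r) (cder_eit th)) _; rewrite /circle; ring. Qed.

Lemma cder_contour_x x th :
  cder (contour^~ th) x ((circle th - z) * ofR (dshrink x)).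
Proof.
have := cderD (cder_cst z x) (cderZ (circle th - z) (cder_ofR (is_derive_shrink x))).
by rewrite add0r.
Qed.

Lemma cder_contour_y x th :
  cder (contour x) th (imag * circle th * ofR (shrink x)).
Proof.
have := cderD (cder_cst z th) (cderM (cderB (cder_circle th) (cder_cst z th))
  (cder_cst (ofR (shrink x)) th)).
by rewrite add0r mulr0 addr0 subr0.
Qed.

Lemma contour_lip x th p q :
  modulus (contour x th - contour p q) <= 2 * (`|x - p| + `|th - q|).
Proof.
have -> : contour x th - contour p q =
    (circle th - z) * ofR (shrink x - shrink p) + (circle th - circle q) * ofR (shrink p).
  by rewrite /contour ofRB; ring.
apply: le_trans (modulusD _ _) _.
rewrite (modulusM (circle th - z)) (modulusM (circle th - circle q)) !modulus_ofR mulrDr lerD//.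
  by rewrite ler_pM ?modulus_ge0 ?circle_sub_le ?shrink_lip.
rewrite (gtr0_norm (shrink_gt0 _)).
apply: le_trans (ler_piMr (modulus_ge0 _) (shrink_le1 _)) _.
rewrite /circle -mulrBr modulusM modulus_ofR gtr0_norm//.
apply: le_trans (eit_lip _ _); rewrite ler_piMl ?modulus_ge0//; exact: ltW.
Qed.

Let f w := v w / (w - z).

Lemma derivable_cauchy_kernel w : modulus w < 1 -> w - z != 0 -> derivable f w 1.
Proof.
move=> w1 wz; apply/derivable1_diffP; apply: differentiableM.
  by apply/derivable1_diffP/hv/discE.
by apply: differentiableV => //; apply: differentiableB.
Qed.

Variable lam : cplx R.
(** The pullback of Re(lam f(w) dw) under [contour]: [A] is the coefficient of dx, [B] that of
    dtheta. *)
Let A x th := rpart (lam * (f (contour x th) * ((circle th - z) * ofR (dshrink x)))).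
Let B x th := rpart (lam * (f (contour x th) * (imag * circle th * ofR (shrink x)))).

Lemma kernel_continuous x th : {for contour x th, continuous f}.
Proof.
apply/differentiable_continuous/derivable1_diffP.
exact: derivable_cauchy_kernel (contour_disc _ _) (contour_neq _ _).
Qed.

Lemma circle_continuous : continuous circle.
Proof. by move=> th; exact: cder_continuous (cder_circle th). Qed.

Lemma ofR_continuous : continuous (@ofR R).
Proof. by move=> x; exact: cder_continuous (cder_id x). Qed.

Lemma shrink_continuous : continuous shrink.
Proof.
move=> x; apply/differentiable_continuous/derivable1_diffP.
by have [] := is_derive_shrink x.
Qed.

Lemma dshrink_continuous : continuous dshrink.
Proof.
move=> x; apply: cvgM; last by apply: cvgM; exact: shrink_continuous.
by apply: cvgN; apply: cvgM; [exact: cvg_cst|exact: cvg_id].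
Qed.

Lemma cauchy_form_continuous : separately_continuous A B.
Proof.
split.
  move=> th; apply: continuous_rpart => x.
  apply: cvgM; first exact: cvg_cst.
  apply: cvgM.
    apply: (@continuous_comp _ _ _ (contour^~ th) f).
      exact: cder_continuous (cder_contour_x x th).
    exact: kernel_continuous.
  apply: cvgM; first exact: cvg_cst.
  by apply: continuous_comp; [exact: dshrink_continuous|exact: ofR_continuous].
move=> x; apply: continuous_rpart => th.
apply: cvgM; first exact: cvg_cst.
apply: cvgM.
  apply: (@continuous_comp _ _ _ (contour x) f).
    exact: cder_continuous (cder_contour_y x th).
  exact: kernel_continuous.
apply: cvgM; last exact: cvg_cst.
by apply: cvgM; [exact: cvg_cst|exact: circle_continuous].
Qed.

(** Near w0 the kernel is affine up to o(|w - w0|). The affine part has the quadratic antiderivative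
    [P], up to the factor lam included in it, so its pullback is exact; the Lipschitz bound of the
    contour turns the error into e times the distance in the parameters. *)
Lemma cauchy_form_exact : locally_exact A B.
Proof.
move=> p q e e0.
have [d hd] := derivable_expansion
  (derivable_cauchy_kernel (contour_disc p q) (contour_neq p q)).
set w0 := contour p q in hd *.
have K0 : 0 < 4 * modulus lam + 1 by rewrite ltr_pwDr// mulr_ge0// modulus_ge0.
have [rho rho0 hr] := hd _ (divr_gt0 e0 K0).
pose P w := lam * (f w0 * w + d / 2 * (w - w0) ^+ 2).
pose dP w := lam * (f w0 + d * (w - w0)).
(* By [contour_lip], parameters within rho / 5 keep the contour within 4/5 rho of w0. *)
exists (rho / 5), (fun x th => rpart (P (contour x th))),
  (fun x th => rpart (dP (contour x th) * ((circle th - z) * ofR (dshrink x)))),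
  (fun x th => rpart (dP (contour x th) * (imag * circle th * ofR (shrink x)))).
have chain (g : R -> cplx R) t l : cder g t l ->
    cder (fun x => P (g x)) t (dP (g t) * l).
  move=> gl.
  have := cderZ lam (cderD (cderZ (f w0) gl) (cderZ (d / 2) (cderX 2 (cderB gl (cder_cst w0 t))))).
  move=> /cder_eq; apply; rewrite /dP subr0 expr1; by field.
have cP (g : R -> cplx R) t : {for t, continuous g} -> {for t, continuous (fun x => dP (g x))}.
  move=> cg; apply: cvgM; first exact: cvg_cst.
  apply: cvgD; first exact: cvg_cst.
  apply: cvgM; first exact: cvg_cst.
  by apply: cvgB; [exact: cg|exact: cvg_cst].
split; first by rewrite divr_gt0.
  split.
  - by move=> x th; have [] := chain _ _ _ (cder_contour_x x th).
  - by move=> x th; have [] := chain _ _ _ (cder_contour_y x th).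
  - split.
      move=> th; apply: continuous_rpart => x; apply: cvgM.
        by apply: (cP (contour^~ th)); exact: cder_continuous (cder_contour_x x th).
      apply: cvgM; first exact: cvg_cst.
      by apply: continuous_comp; [exact: dshrink_continuous|exact: ofR_continuous].
    move=> x; apply: continuous_rpart => th; apply: cvgM.
      by apply: (cP (contour x)); exact: cder_continuous (cder_contour_y x th).
    apply: cvgM; last exact: cvg_cst.
    by apply: cvgM; [exact: cvg_cst|exact: circle_continuous].
move=> x th xp thq.
have lip := contour_lip x th p q; rewrite -/w0 in lip.
have /hr : modulus (contour x th - w0) < rho.
  by apply: le_lt_trans lip _; move: rho0; lra.
set E := f (contour x th) - _ - _ => hE.
have bound (k : cplx R) : modulus k <= 2 ->
    `|rpart (lam * (f (contour x th) * k)) - rpart (dP (contour x th) * k)| <=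
    e * (`|x - p| + `|th - q|).
  move=> k2; rewrite -rpartB (_ : _ - _ = lam * E * k); last by rewrite /E /dP; ring.
  apply: le_trans (rpart_le _) _; rewrite !modulusM.
  set D := `|x - p| + `|th - q| in lip *.
  have D0 : 0 <= D by rewrite addr_ge0.
  have h1 : modulus E <= e / (4 * modulus lam + 1) * (2 * D).
    by apply: le_trans hE _; rewrite ler_wpM2l// ltW// divr_gt0.
  have h2 : modulus lam * modulus E * modulus k <=
      modulus lam * (e / (4 * modulus lam + 1) * (2 * D)) * 2.
    by rewrite ler_pM ?mulr_ge0 ?modulus_ge0// ler_wpM2l ?modulus_ge0.
  apply: le_trans h2 _.
  rewrite (_ : _ * 2 = e * D * (4 * modulus lam / (4 * modulus lam + 1))); last by field; rewrite gt_eqF.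
  rewrite ler_piMr ?mulr_ge0 ?(ltW e0)// ler_pdivrMr// mul1r lerDl//.
split; apply: bound.
  rewrite modulusM modulus_ofR -[leRHS]mulr1.
  by rewrite ler_pM ?modulus_ge0 ?circle_sub_le ?dshrink_le.
rewrite modulusM modulus_ofR (modulusM imag) modulus_imag mul1r circle_mod (gtr0_norm (shrink_gt0 _)).
have := shrink_gt0 x; have := shrink_le1 x; move: r0 r1; nra.
Qed.

End disc_cauchy.
End cauchy.

(** * Cauchy's formula and the Taylor expansion *)

Section cauchy_expansion.
Context {R : realType}.
Local Notation circ := (2 * pi : R).

Lemma circ_ge0 : 0 <= circ.
Proof. by rewrite mulr_ge0// pi_ge0. Qed.

Lemma eit_circ : eit circ = 1 :> cplx R.
Proof. by rewrite /eit mulr_natl cos2pi sin2pi ofR1 ofR0 mulr0 addr0. Qed.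

Section fixed_point.
Variables (v : cplx R -> cplx R) (r : R) (z : cplx R).
Hypotheses (hv : holomorphic v) (r01 : 0 < r < 1) (zr : modulus z < r).

Let r0 : 0 < r. Proof. by case/andP: r01. Qed.
Let r1 : r < 1. Proof. by case/andP: r01. Qed.

Lemma circle_circ : circle r circ = circle r 0.
Proof. by rewrite /circle eit_circ eit0. Qed.

Lemma holomorphic_continuous w : modulus w < 1 -> {for w, continuous v}.
Proof. by move=> w1; apply/differentiable_continuous/derivable1_diffP/hv/discE. Qed.

Lemma dlog_continuous : continuous (dlog r z).
Proof.
move=> th; apply: cvgM.
  by apply: cvgM; [exact: cvg_cst|exact: circle_continuous].
apply: cvgV; first exact: (circle_sub_neq0 r01 zr).
by apply: cvgB; [exact: circle_continuous|exact: cvg_cst].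
Qed.

Lemma dlog_le th : modulus (dlog r z th) <= r / (r - modulus z).
Proof.
rewrite /dlog modulusM (modulusM imag) modulus_imag mul1r (circle_mod r01) modulusV.
rewrite ler_pM2l// lef_pV2 ?posrE ?subr_gt0//; first exact: (circle_sub_ge z r01).
by apply: lt_le_trans (circle_sub_ge z r01 th); rewrite subr_gt0.
Qed.

Lemma contour_continuous x : continuous (contour r z x).
Proof. by move=> th; exact: cder_continuous (cder_contour_y r z x th). Qed.

Let I x := cseg_int 0 circ (fun th => v (contour r z x th) * dlog r z th).

Lemma I_continuous x : continuous (fun th => v (contour r z x th) * dlog r z th).
Proof.
move=> th; apply: cvgM; last exact: dlog_continuous.
apply: (@continuous_comp _ _ _ (contour r z x) v); first exact: contour_continuous.
exact/holomorphic_continuous/contour_disc.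
Qed.

(** Goursat on [0, x] x [0, 2 pi]: the sides theta = 0 and theta = 2 pi cancel by periodicity, the
    other two are Re(lam I(x)) and Re(lam I(0)). Taking lam = 1 and lam = -i recovers both parts. *)
Lemma cauchy_invariance x : 0 <= x -> I x = I 0.
Proof.
move=> x0.
have key lam : rpart (lam * I x) = rpart (lam * I 0).
  have := goursat (cauchy_form_continuous hv r01 zr lam) (cauchy_form_exact hv r01 zr lam)
    x0 circ_ge0.
  rewrite /boundary_int circle_circ.
  set a1 := seg_int 0 x _; set b1 := seg_int 0 circ _.
  set a2 := seg_int 0 x _; set b2 := seg_int 0 circ _.
  have -> : a2 = a1.
    by rewrite /a2 /a1 /contour circle_circ.
  have bE y b : b = seg_int 0 circ (fun th => rpart (lam * (v (contour r z y th) /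
       (contour r z y th - z) * (imag * circle r th * ofR (shrink y))))) ->
      b = rpart (lam * I y).
    move=> ->; rewrite /I -cseg_int_rpart; last exact: I_continuous.
    congr (seg_int _ _ _); apply/funext => th; congr (rpart (lam * _)).
    have c0 := circle_sub_neq0 r01 zr th.
    have s0 : ofR (shrink y) != 0 by rewrite ofR_eq0 gt_eqF// shrink_gt0.
    rewrite /dlog [X in _ / X](_ : _ = (circle r th - z) * ofR (shrink y)).
      by move: (v _) (circle r th - z) (circle r th) (ofR _) c0 s0 => p q s t q0 t0; field; rewrite q0 t0.
    by rewrite /contour addrC addKr.
  rewrite (bE x b1 erefl) (bE 0 b2 erefl) [a1 + _]addrC addrK => /eqP.
  by rewrite subr_eq0 => /eqP.
apply: complex_eq; first by have := key 1; rewrite !mul1r.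
have aux (w : cplx R) : rpart (- imag * w) = ipart w by rewrite !partE; ring.
by have := key (- imag); rewrite !aux.
Qed.

(** The integral does not depend on x, and for large x the contour is close to z, where v is
    continuous. *)
Lemma cauchy_limit : I 0 = v z * cseg_int 0 circ (dlog r z).
Proof.
set W := cseg_int _ _ _.
have h e : 0 < e -> modulus (I 0 - v z * W) <= e * (2 * (r / (r - modulus z) * circ)).
  move=> e0.
  have z1 : modulus z < 1 by apply: lt_trans zr r1.
  have /cvg_cplxP/(_ _ e0)/nbhs_cplxP[d d0 hd] := @holomorphic_continuous z z1.
  have [x x0 xd] : exists2 x, 0 <= x & 2 * shrink x < d.
    (* 2 shrink(2 / d) = 2 / (1 + 4 / d^2) is below d because d + 4 / d > 2. *)
    exists (2 / d); first by rewrite divr_ge0// ltW.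
    rewrite /shrink ltr_pdivrMr ?ltr_pwDl ?sqr_ge0//.
    rewrite (_ : d * _ = d + 4 / d); last by field; rewrite gt_eqF.
    have d'0 : 0 < d^-1 by rewrite invr_gt0.
    have : d * d^-1 = 1 by rewrite divff// gt_eqF.
    have := sqr_ge0 (d - 1).
    move: d^-1 d'0 => d' d'0; nra.
  rewrite -(cauchy_invariance x0) /I /W -(cseg_intZ _ _ _ dlog_continuous).
  rewrite -mulN1r -cseg_intZ; last first.
    by move=> th; apply: cvgM; [exact: cvg_cst|exact: dlog_continuous].
  rewrite -cseg_intD; last 2 first.
  - exact: I_continuous.
  - move=> th; apply: cvgM; first exact: cvg_cst.
    by apply: cvgM; [exact: cvg_cst|exact: dlog_continuous].
  have -> : e * (2 * (r / (r - modulus z) * circ)) =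
      2 * (e * (r / (r - modulus z)) * (circ - 0)) by rewrite subr0; ring.
  apply: cseg_int_le; last 2 first.
  - exact: circ_ge0.
  - move=> th _; rewrite mulN1r -mulrBl modulusM ler_pM ?modulus_ge0 ?dlog_le//.
    apply/ltW/hd; apply: le_lt_trans xd.
    rewrite /contour addrC addKr modulusM modulus_ofR (gtr0_norm (shrink_gt0 _)).
    by rewrite ler_wpM2r ?circle_sub_le// ltW// shrink_gt0.
  move=> th; apply: cvgD; first exact: I_continuous.
  apply: cvgM; first exact: cvg_cst.
  by apply: cvgM; [exact: cvg_cst|exact: dlog_continuous].
apply/eqP; rewrite -subr_eq0 -modulus_eq0 eq_le modulus_ge0 andbT.
set K := 2 * (r / (r - modulus z) * circ) in h.
have K0 : 0 <= K.
  by rewrite !mulr_ge0 ?pi_ge0 ?invr_ge0 ?subr_ge0 ?(ltW zr) ?(ltW r0).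
have K1 : 0 < K + 1 by rewrite ltr_pwDr.
apply/ler_addgt0Pr => e e0; rewrite add0r; apply: le_trans (h _ (divr_gt0 e0 K1)) _.
by rewrite mulrAC ler_pdivrMr// ler_wpM2l ?(ltW e0)// lerDl.
Qed.

Lemma contour0 th : contour r z 0 th = circle r th.
Proof. by rewrite /contour /shrink expr0n/= addr0 invr1 ofR1 mulr1 subrKC. Qed.

(** The finite geometric series of 1 / (c - z) in powers of z / c. Its exact remainder is a multiple
    of [dlog], so [dlog_le] estimates it. *)
Lemma dlog_expand N th : dlog r z th =
  \sum_(k < N) imag * z ^+ k * (circle r th) ^- k + (z / circle r th) ^+ N * dlog r z th.
Proof.
have c0 := circle_neq0 r01 th; have cz := circle_sub_neq0 r01 zr th.
elim: N => [|N IH]; first by rewrite big_ord0 expr0 mul1r add0r.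
rewrite big_ord_recr/= -addrA; rewrite {1}IH; congr (_ + _).
rewrite exprSr expr_div_n /dlog.
have cN : circle r th ^+ N != 0 by rewrite expf_neq0.
move: (circle r th) (z ^+ N) (circle r th ^+ N) c0 cz cN => c zN cN' c0 cz cN0.
by field; rewrite c0 cz cN0.
Qed.

End fixed_point.

Lemma cseg_int_sum (a b : R) N (f : nat -> R -> cplx R) :
  (forall k, continuous (f k)) ->
  continuous (fun th => \sum_(k < N) f k th) /\
  cseg_int a b (fun th => \sum_(k < N) f k th) = \sum_(k < N) cseg_int a b (f k).
Proof.
move=> cf; elim: N => [|N [IHc IH]].
  split; first by under eq_fun do rewrite big_ord0; move=> x; exact: cvg_cst.
  under eq_fun do rewrite big_ord0; rewrite big_ord0 /cseg_int.
  rewrite (_ : rpart \o _ = fun=> 0); last by apply/funext.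
  rewrite (_ : ipart \o _ = fun=> 0); last by apply/funext.
  by rewrite /seg_int Rintegral_cst// mul0r ofR0 mulr0 addr0.
split.
  under eq_fun do rewrite big_ord_recr/=.
  by move=> x; apply: cvgD; [exact: IHc|exact: cf].
under eq_fun do rewrite big_ord_recr/=.
by rewrite (cseg_intD a b IHc (cf N)) IH big_ord_recr.
Qed.

Lemma cseg_int_one (a b : R) : a <= b -> cseg_int a b (fun=> 1) = ofR (b - a).
Proof.
move=> ab; have c1 : continuous (fun _ : R => 1 : cplx R) by move=> ?; exact: cvg_cst.
by rewrite (cseg_int_FTC c1 (@cder_id R) ab) ofRB.
Qed.

Section radius.
Variables (v : cplx R -> cplx R) (r : R).
Hypotheses (hv : holomorphic v) (r01 : 0 < r < 1).

Let r0 : 0 < r. Proof. by case/andP: r01. Qed.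
Let r1 : r < 1. Proof. by case/andP: r01. Qed.

Lemma circle_pow_continuous k : continuous (fun th => circle r th ^- k).
Proof.
elim: k => [|k IH] th.
  by under eq_fun do rewrite expr0 invr1; exact: cvg_cst.
under eq_fun do rewrite exprS invfM.
apply: cvgM; last exact: IH.
by apply: cvgV; [exact: circle_neq0|exact: circle_continuous].
Qed.

Lemma circle_quot_continuous z N : continuous (fun th => (z / circle r th) ^+ N).
Proof.
have -> : (fun th => (z / circle r th) ^+ N) = (fun th => z ^+ N * circle r th ^- N).
  by apply/funext => th; rewrite expr_div_n.
by move=> th; exact: (cvgM (cvg_cst _) (@circle_pow_continuous N th)).
Qed.

(** As dc = i c dtheta, the function c^-(k+1) has the periodic antiderivative i / (k+1) c^-(k+1). *)
Lemma circle_int k : cseg_int 0 circ (fun th => circle r th ^- k.+1) = 0.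
Proof.
have cn th := circle_neq0 r01 th.
rewrite (cseg_int_FTC (F := fun th => imag / k.+1%:R * (circle r th)^-1 ^+ k.+1)).
- by rewrite circle_circ subrr.
- exact: circle_pow_continuous.
- move=> th; apply: cder_eq (cderZ _ (cderX k.+1 (cderV cn (cder_circle r th)))) _.
  have k0 : (k.+1%:R : cplx R) != 0 by rewrite pnatr_eq0.
  rewrite /= -exprVn exprS.
  have := cn th; move: (circle r th) (k.+1%:R) k0 => c m m0 c0.
  transitivity (- (imag * imag) * (c^-1 * c^-1 ^+ k) : cplx R).
    move: (c^-1 ^+ k) => u; field.
    by rewrite ?c0 ?m0.
  by rewrite imag_sqr opprK mul1r -exprS exprVn.
- exact: circ_ge0.
Qed.

Lemma geo_small (q C e : R) : 0 <= q < 1 -> 0 < e -> \forall N \near \oo, C * q ^+ N < e.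
Proof.
move=> /andP[q0 q1] e0.
have : C * q ^+ N @[N --> \oo] --> C * 0.
  by apply: cvgM; [exact: cvg_cst|apply: cvg_expr; rewrite ger0_norm].
rewrite mulr0 => /cvgrPdist_lt/(_ _ e0); apply: filterS => N.
by rewrite sub0r normrN => /ltr_normlW.
Qed.

(** In [dlog_expand] only the term k = 0 has a nonzero integral, and the remainder decays like (|z|
    / r)^N. *)
Lemma dlog_int z : modulus z < r -> cseg_int 0 circ (dlog r z) = imag * ofR circ.
Proof.
move=> zr; set K := 2 * (r / (r - modulus z) * circ).
have q01 : 0 <= modulus z / r < 1.
  by rewrite divr_ge0 ?modulus_ge0 ?(ltW r0)//= ltr_pdivrMr// mul1r.
have h N : (0 < N)%N -> modulus (cseg_int 0 circ (dlog r z) - imag * ofR circ) <=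
    K * (modulus z / r) ^+ N.
  case: N => // N _.
  have cf k : continuous (fun th => imag * z ^+ k * circle r th ^- k).
    by move=> th; apply: cvgM; [exact: cvg_cst|exact: circle_pow_continuous].
  have crem : continuous (fun th => (z / circle r th) ^+ N.+1 * dlog r z th).
    move=> th; by apply: cvgM; [exact: circle_quot_continuous|exact: (dlog_continuous r01 zr)].
  have [cs sE] := cseg_int_sum 0 circ N.+1 cf.
  rewrite {1}(funext (dlog_expand r01 zr N.+1)) (cseg_intD 0 circ cs crem) sE big_ord_recl/=.
  rewrite [X in _ + X + _ - _]big1 ?addr0; last first.
    move=> k _; by rewrite /bump/= add1n (cseg_intZ 0 circ _ (@circle_pow_continuous k.+1)) circle_int mulr0.
  have -> : cseg_int 0 circ (fun th => imag * z ^+ 0 * circle r th ^- 0) = imag * ofR circ.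
    rewrite (_ : (fun th => _) = fun=> imag * 1); last first.
      by apply/funext => th; rewrite !expr0 invr1 !mulr1.
    have c1 : continuous (fun _ : R => 1 : cplx R) by move=> ?; exact: cvg_cst.
    by rewrite (cseg_intZ 0 circ imag c1) (cseg_int_one circ_ge0) subr0.
  rewrite addrC addKr.
  have -> : K * (modulus z / r) ^+ N.+1 =
    2 * ((modulus z / r) ^+ N.+1 * (r / (r - modulus z)) * (circ - 0)).
    by rewrite /K subr0; ring.
  apply: cseg_int_le; [exact: crem|exact: circ_ge0|] => th _.
  rewrite modulusM ler_pM ?modulus_ge0 ?dlog_le// modulusX modulusM modulusV.
  by rewrite (circle_mod r01).
apply/eqP; rewrite -subr_eq0 -modulus_eq0 eq_le modulus_ge0 andbT.
apply/ler_addgt0Pr => e e0; rewrite add0r.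
have [N _ /(_ N.+1 (leqnSn N)) hN] := geo_small K q01 e0.
exact: le_trans (h N.+1 isT) (ltW hN).
Qed.

Definition taylor_coef k : cplx R :=
  (ofR circ)^-1 * cseg_int 0 circ (fun th => v (circle r th) * circle r th ^- k).

Lemma circle_v_continuous : continuous (fun th => v (circle r th)).
Proof.
move=> th; apply: (@continuous_comp _ _ _ (circle r) v); first exact: circle_continuous.
by apply: (holomorphic_continuous hv); rewrite (circle_mod r01).
Qed.

Lemma circle_v_bounded : exists M, forall th, 0 <= th <= circ -> modulus (v (circle r th)) <= M.
Proof.
have [|c _ hc] := @EVT_max R (fun th => modulus (v (circle r th))) 0 circ circ_ge0.
  apply: continuous_subspaceT => th.
  apply: (@continuous_comp _ _ _ (fun th => v (circle r th)) (@modulus R)).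
    exact: circle_v_continuous.
  exact: modulus_continuous.
by exists (modulus (v (circle r c))) => th hth; apply: hc; rewrite in_itv.
Qed.

(** Cauchy's formula expanded by [dlog_expand], with the normalization 2 pi i from [dlog_int]; the
    first part is Cauchy's estimate. The coefficients come from one circle and so depend on r until
    [expands_unique] is available. *)
Lemma taylor_circle : exists M : R, (forall k, modulus (taylor_coef k) * r ^+ k <= M) /\
  forall z, modulus z < r -> \sum_(k < n) taylor_coef k * z ^+ k @[n --> \oo] --> v z.
Proof.
have [M hM] := circle_v_bounded.
have M0 : 0 <= M by apply: le_trans (hM 0 _); rewrite ?modulus_ge0// lexx circ_ge0.
have c0 : 0 < circ by rewrite mulr_gt0// pi_gt0.
have cv k : continuous (fun th => v (circle r th) * circle r th ^- k).
  by move=> th; apply: cvgM; [exact: circle_v_continuous|exact: circle_pow_continuous].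
exists (2 * M); split.
  move=> k; rewrite /taylor_coef modulusM modulusV modulus_ofR (gtr0_norm c0).
  rewrite -ler_pdivlMr ?exprn_gt0// mulrC ler_pdivrMr//.
  have -> : 2 * M / r ^+ k * circ = 2 * (M * r ^- k * (circ - 0)) by rewrite subr0; ring.
  apply: cseg_int_le => //; first exact: circ_ge0.
  move=> th hth; rewrite modulusM ler_pM ?modulus_ge0 ?hM//.
  by rewrite modulusV modulusX (circle_mod r01).
move=> z zr; apply/cvg_cplxP => e e0.
have q01 : 0 <= modulus z / r < 1.
  by rewrite divr_ge0 ?modulus_ge0 ?(ltW r0)//= ltr_pdivrMr// mul1r.
have := geo_small (2 * (M * (r / (r - modulus z)))) q01 e0.
apply: filterS => N; apply: le_lt_trans.
have cC : ofR circ != 0 by rewrite ofR_eq0 gt_eqF.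
have i0 : imag != 0 :> cplx R by rewrite -modulus_gt0 modulus_imag.
have cf k : continuous (fun th => imag * z ^+ k * (v (circle r th) * circle r th ^- k)).
  by move=> th; apply: cvgM; [exact: cvg_cst|exact: cv].
have crem : continuous (fun th => v (circle r th) * ((z / circle r th) ^+ N * dlog r z th)).
  move=> th; apply: cvgM; first exact: circle_v_continuous.
  by apply: cvgM; [exact: circle_quot_continuous|exact: (dlog_continuous r01 zr)].
have [cs sE] := cseg_int_sum 0 circ N cf.
have vE : v z * (imag * ofR circ) = imag * ofR circ * (\sum_(k < N) taylor_coef k * z ^+ k) +
    cseg_int 0 circ (fun th => v (circle r th) * ((z / circle r th) ^+ N * dlog r z th)).
  rewrite -[in LHS](dlog_int zr) -(cauchy_limit hv r01 zr).
  under eq_fun do rewrite contour0.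
  have -> : (fun th => v (circle r th) * dlog r z th) =
      (fun th => (\sum_(k < N) imag * z ^+ k * (v (circle r th) * circle r th ^- k)) +
        v (circle r th) * ((z / circle r th) ^+ N * dlog r z th)).
    apply/funext => th; rewrite {1}(dlog_expand r01 zr N) mulrDr mulr_sumr.
    by congr (_ + _); apply: eq_bigr => k _; ring.
  rewrite (cseg_intD 0 circ cs crem) sE; congr (_ + _); rewrite mulr_sumr; apply: eq_bigr => k _.
  rewrite (cseg_intZ 0 circ _ (cv k)) /taylor_coef.
  by move: (cseg_int _ _ _) (ofR circ) cC (z ^+ k) => S W W0 zk; field.
set E := cseg_int _ _ _ in vE.
have -> : \sum_(k < N) taylor_coef k * z ^+ k - v z = - (E / (imag * ofR circ)).
  have -> : E = v z * (imag * ofR circ) - imag * ofR circ * (\sum_(k < N) taylor_coef k * z ^+ k).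
    by rewrite vE addrC addKr.
  by move: (\sum_(k < N) _) (ofR circ) cC => S W W0; field; rewrite i0 W0.
rewrite modulusN modulusM modulusV (modulusM imag) modulus_imag mul1r modulus_ofR (gtr0_norm c0).
rewrite ler_pdivrMr//.
have -> : 2 * (M * (r / (r - modulus z))) * (modulus z / r) ^+ N * circ =
   2 * (M * ((modulus z / r) ^+ N * (r / (r - modulus z))) * (circ - 0)).
  by rewrite subr0; ring.
apply: cseg_int_le; [exact: crem|exact: circ_ge0|] => th hth.
rewrite modulusM ler_pM ?modulus_ge0 ?hM//.
rewrite modulusM ler_pM ?modulus_ge0 ?dlog_le// modulusX modulusM modulusV.
by rewrite (circle_mod r01).
Qed.

End radius.
End cauchy_expansion.

(** * Moments in a holomorphic coordinate *)

Section plane_integral.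
Context {R : realType}.
Implicit Types (F G : R * R -> R).

Lemma continuous_fst_section F y : continuous F -> continuous (fun x => F (x, y)).
Proof.
move=> cF x; apply: (@cvg_comp _ _ _ (fun x : R => (x, y)) F (nbhs x) (nbhs (x, y))).
  exact: (cvg_pair cvg_id (cvg_cst y)).
exact: cF.
Qed.

Lemma continuous_snd_section F x : continuous F -> continuous (fun y => F (x, y)).
Proof.
move=> cF y; apply: (@cvg_comp _ _ _ (fun y : R => (x, y)) F (nbhs y) (nbhs (x, y))).
  exact: (cvg_pair (cvg_cst x) cvg_id).
exact: cF.
Qed.

(* F is the pointwise limit of functions whose dependence on the first
   coordinate is piecewise constant on countably many intervals. *)
Lemma continuous_plane_measurable F : continuous F ->
  measurable_fun (setT : set (plane R)) (F : plane R -> measurableTypeR R).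
Proof.
move=> cF; pose q (n : nat) (x : R) : R := (Num.floor (x * n.+1%:R))%:~R / n.+1%:R.
pose Fn n (p : plane R) : measurableTypeR R := F (q n p.1, p.2).
have n0 n : 0 < n.+1%:R :> R by rewrite ltr0n.
have mFn n : measurable_fun setT (Fn n).
  move=> _ Y mY; rewrite setTI.
  have -> : Fn n @^-1` Y = \bigcup_(k : int)
     ([set x : R | Num.floor (x * n.+1%:R) = k] `*` [set y : R | Y (F (k%:~R / n.+1%:R, y))]).
    apply/seteqP; split => [[x y] /= hY|[x y] [k _ [/= <-]]] //.
    by exists (Num.floor (x * n.+1%:R)).
  apply: countable_bigcupT_measurable => // k.
  apply: measurableX.
    have -> : [set x : R | Num.floor (x * n.+1%:R) = k] =
        `[k%:~R / n.+1%:R, (k + 1)%:~R / n.+1%:R[%classic.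
      apply/seteqP; split => x /=; rewrite in_itv/= ler_pdivrMr// ltr_pdivlMr//.
        by move=> <-; rewrite floor_le floorD1_gt.
      by move=> /floor_def.
    exact: measurable_itv.
  have cFk := @continuous_snd_section F (k%:~R / n.+1%:R) cF.
  by have := continuous_measurable_fun cFk measurableT mY; rewrite setTI.
have qx x : q n x @[n --> \oo] --> x.
  apply/cvgrPdist_lt => e e0.
  have := near_infty_natSinv_lt (PosNum e0); apply: filterS => n /= hn.
  have h1 : q n x <= x by rewrite /q ler_pdivrMr// floor_le.
  have h2 : x < q n x + n.+1%:R^-1.
    rewrite /q -{2}[n.+1%:R^-1]mul1r -mulrDl ltr_pdivlMr//.
    by rewrite -[X in _ + X]/(1%:~R) -intrD floorD1_gt.
  by rewrite ger0_norm ?subr_ge0// ltrBlDl; apply: lt_trans h2 _; rewrite ltrD2l.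
apply: (@measurable_fun_cvg _ _ _ _ Fn) => //.
move=> [x y] _; apply: (@cvg_comp _ _ _ (fun n => (q n x, y)) F _ (nbhs (x, y))).
  exact: (cvg_pair (qx x) (cvg_cst y)).
exact: cF.
Qed.

Lemma continuous_rect_bounded F (x1 x2 y1 y2 : R) : continuous F ->
  exists M, forall x y, x1 <= x <= x2 -> y1 <= y <= y2 -> `|F (x, y)| <= M.
Proof.
move=> cF.
have cr : compact (`[x1, x2]%classic `*` `[y1, y2]%classic : set (R * R)).
  by apply: compact_setX; exact: segment_compact.
have /compact_bounded[M [_ hM]] := continuous_compact (continuous_subspaceT cF) cr.
exists (M + 1) => x y hx hy; apply: (hM (M + 1)); first by rewrite ltrDl.
by exists (x, y) => //; split; rewrite /= in_itv.
Qed.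

Lemma continuous_rect_integrable F (x1 x2 y1 y2 : R) : continuous F ->
  x1 <= x2 -> y1 <= y2 ->
  (plane_measure R).-integrable (rect x1 x2 y1 y2) (EFin \o F).
Proof.
move=> cF x12 y12; have [M hM] := continuous_rect_bounded x1 x2 y1 y2 cF.
apply: measurable_bounded_integrable.
- exact: measurable_rect.
- by rewrite plane_measure_rect// ltry.
- apply: measurable_funS (continuous_plane_measurable cF) => //.
- exists M; split; rewrite ?num_real// => N MN [x y] [/=].
  by rewrite !in_itv/= => hx hy; apply: le_trans (ltW MN); exact: hM.
Qed.

Definition rect_int (x1 x2 y1 y2 : R) F : R :=
  \int[plane_measure R]_(p in rect x1 x2 y1 y2) F p.

(** Fubini and the fundamental theorem of calculus: on each horizontal line the integral of the
    derivative is a difference of two zero boundary values. *)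
Lemma rect_int_dx (x1 x2 y1 y2 : R) (F G : R * R -> R) : continuous G ->
  x1 <= x2 -> y1 <= y2 ->
  (forall x y : R, is_derive x (1 : R) (fun x => F (x, y)) (G (x, y))) ->
  (forall y, F (x1, y) = 0 /\ F (x2, y) = 0) ->
  rect_int x1 x2 y1 y2 G = 0.
Proof.
move=> cG x12 y12 dF F0; rewrite /rect_int /Rintegral integral_mkcond.
have ig := continuous_rect_integrable cG x12 y12.
have it : (plane_measure R).-integrable setT
    ((EFin \o G : plane R -> \bar R) \_ (rect x1 x2 y1 y2)).
  by apply/(integrable_mkcond _ (measurable_rect x1 x2 y1 y2)).
have <- := @integral21_prod_meas1 _ _ (measurableTypeR R) (measurableTypeR R) R lebesgue_measure lebesgue_measure _ it.
rewrite integral0_eq// => y _; rewrite /fubini_G.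
have cGy := @continuous_fst_section G y cG.
have [yy|nyy] := boolP (y \in `[y1, y2]); last first.
  apply: integral0_eq => x _; rewrite /patch memNset//= => -[_ /= hy].
  by rewrite hy in nyy.
have -> : (\int[lebesgue_measure]_x (((EFin \o G : plane R -> \bar R) \_ (rect x1 x2 y1 y2)) (x, y)) =
    \int[lebesgue_measure]_(x in `[x1, x2]) (EFin \o (fun x => G (x, y))) x)%E.
  rewrite [RHS]integral_mkcond; apply: eq_integral => x _; rewrite /patch.
  have [xx|nxx] := boolP (x \in `[x1, x2]).
    by rewrite !mem_set.
  rewrite !memNset//=; last by move=> [/= hx _]; rewrite hx in nxx.
  by move=> /= hx; rewrite hx in nxx.
have := seg_int_FTC cGy (fun x => dF x y) x12.
have [-> ->] := F0 y; rewrite subrr /seg_int /Rintegral => h.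
rewrite -[LHS]fineK; first by rewrite h.
exact: integrable_fin_num (seg_integrable _ _ cGy).
Qed.

Lemma rect_int_dy (x1 x2 y1 y2 : R) (F G : R * R -> R) : continuous G ->
  x1 <= x2 -> y1 <= y2 ->
  (forall x y : R, is_derive y (1 : R) (fun y => F (x, y)) (G (x, y))) ->
  (forall x, F (x, y1) = 0 /\ F (x, y2) = 0) ->
  rect_int x1 x2 y1 y2 G = 0.
Proof.
move=> cG x12 y12 dF F0; rewrite /rect_int /Rintegral integral_mkcond.
have ig := continuous_rect_integrable cG x12 y12.
have it : (plane_measure R).-integrable setT
    ((EFin \o G : plane R -> \bar R) \_ (rect x1 x2 y1 y2)).
  by apply/(integrable_mkcond _ (measurable_rect x1 x2 y1 y2)).
have <- := @integral12_prod_meas1 _ _ (measurableTypeR R) (measurableTypeR R) R lebesgue_measure lebesgue_measure _ it.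
rewrite integral0_eq// => x _; rewrite /fubini_F.
have cGx := @continuous_snd_section G x cG.
have [xx|nxx] := boolP (x \in `[x1, x2]); last first.
  apply: integral0_eq => y _; rewrite /patch memNset//= => -[/= hx _].
  by rewrite hx in nxx.
have -> : (\int[lebesgue_measure]_y (((EFin \o G : plane R -> \bar R) \_ (rect x1 x2 y1 y2)) (x, y)) =
    \int[lebesgue_measure]_(y in `[y1, y2]) (EFin \o (fun y => G (x, y))) y)%E.
  rewrite [RHS]integral_mkcond; apply: eq_integral => y _; rewrite /patch.
  have [yy|nyy] := boolP (y \in `[y1, y2]).
    by rewrite !mem_set.
  rewrite !memNset//=; last by move=> [_ /= hy]; rewrite hy in nyy.
  by move=> /= hy; rewrite hy in nyy.
have := seg_int_FTC cGx (fun y => dF x y) y12.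
have [-> ->] := F0 x; rewrite subrr /seg_int /Rintegral => h.
rewrite -[LHS]fineK; first by rewrite h.
exact: integrable_fin_num (seg_integrable _ _ cGx).
Qed.

Lemma rect_intD (x1 x2 y1 y2 : R) F G : continuous F -> continuous G ->
  x1 <= x2 -> y1 <= y2 -> rect_int x1 x2 y1 y2 (fun p => F p + G p) =
  rect_int x1 x2 y1 y2 F + rect_int x1 x2 y1 y2 G.
Proof.
move=> cF cG x12 y12; rewrite /rect_int.
apply: RintegralD; [exact: measurable_rect|exact: continuous_rect_integrable..].
Qed.

Lemma rect_intB (x1 x2 y1 y2 : R) F G : continuous F -> continuous G ->
  x1 <= x2 -> y1 <= y2 -> rect_int x1 x2 y1 y2 (fun p => F p - G p) =
  rect_int x1 x2 y1 y2 F - rect_int x1 x2 y1 y2 G.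
Proof.
move=> cF cG x12 y12; rewrite /rect_int.
apply: RintegralB; [exact: measurable_rect|exact: continuous_rect_integrable..].
Qed.

Lemma rect_intZ (x1 x2 y1 y2 : R) (k : R) F : continuous F ->
  x1 <= x2 -> y1 <= y2 -> rect_int x1 x2 y1 y2 (fun p => k * F p) =
  k * rect_int x1 x2 y1 y2 F.
Proof.
move=> cF x12 y12; rewrite /rect_int.
apply: RintegralZl; [exact: measurable_rect|exact: continuous_rect_integrable].
Qed.

Lemma rect_int_le (x1 x2 y1 y2 : R) F G : continuous F -> continuous G ->
  x1 <= x2 -> y1 <= y2 ->
  (forall x y, x1 <= x <= x2 -> y1 <= y <= y2 -> F (x, y) <= G (x, y)) ->
  rect_int x1 x2 y1 y2 F <= rect_int x1 x2 y1 y2 G.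
Proof.
move=> cF cG x12 y12 FG; rewrite /rect_int.
apply: le_Rintegral; [exact: measurable_rect|exact: continuous_rect_integrable..|].
by move=> [x y] [/=]; rewrite !in_itv/= => hx hy; exact: FG.
Qed.

Lemma rect_int_sum (x1 x2 y1 y2 : R) N (F : nat -> R * R -> R) :
  (forall k, continuous (F k)) -> x1 <= x2 -> y1 <= y2 ->
  continuous (fun p => \sum_(k < N) F k p) /\
  rect_int x1 x2 y1 y2 (fun p => \sum_(k < N) F k p) =
  \sum_(k < N) rect_int x1 x2 y1 y2 (F k).
Proof.
move=> cF x12 y12; elim: N => [|N [IHc IH]].
  split; first by under eq_fun do rewrite big_ord0; move=> x; exact: cvg_cst.
  under eq_fun do rewrite big_ord0; rewrite big_ord0 /rect_int.
  by rewrite Rintegral_cst ?mul0r//; exact: measurable_rect.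
split.
  under eq_fun do rewrite big_ord_recr/=.
  by move=> x; apply: cvgD; [exact: IHc|exact: cF].
under eq_fun do rewrite big_ord_recr/=.
by rewrite (rect_intD IHc (cF N) x12 y12) IH big_ord_recr.
Qed.

Lemma rect_int_ge (x1 x2 y1 y2 a1 a2 b1 b2 : R) F (M : R) : continuous F ->
  x1 <= x2 -> y1 <= y2 -> a1 <= a2 -> b1 <= b2 -> 0 <= M ->
  x1 <= a1 -> a2 <= x2 -> y1 <= b1 -> b2 <= y2 ->
  (forall x y, x1 <= x <= x2 -> y1 <= y <= y2 -> 0 <= F (x, y)) ->
  (forall x y, a1 <= x <= a2 -> b1 <= y <= b2 -> M <= F (x, y)) ->
  M * ((a2 - a1) * (b2 - b1)) <= rect_int x1 x2 y1 y2 F.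
Proof.
move=> cF x12 y12 a12 b12 M0 xa ax yb by_ F0 FM.
have fin := integrable_fin_num (measurable_rect x1 x2 y1 y2) (continuous_rect_integrable cF x12 y12).
rewrite /rect_int /Rintegral -lee_fin fineK//.
rewrite -lee_fin in M0.
have -> : (M * ((a2 - a1) * (b2 - b1)))%:E =
    (\int[plane_measure R]_(p in rect a1 a2 b1 b2) M%:E)%E.
  by rewrite integral_cst ?plane_measure_rect//; exact: measurable_rect.
apply: nonneg_le_integral_set.
- by move=> p _.
- by move=> [x y] [/=]; rewrite !in_itv/= => hx hy; rewrite lee_fin; exact: F0.
- move=> [x y] [/= hx hy]; move: (hx) (hy); rewrite !in_itv/= => hx' hy'.
  split; last by rewrite lee_fin; exact: FM.
  case/andP: hx' => ? ?; case/andP: hy' => ? ?.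
  by rewrite /rect/= !in_itv/=; split; apply/andP; split; lra.
Qed.

End plane_integral.

(** * Powers of the positive part *)

Section positive_part.
Context {R : realType}.
Implicit Types (s t : R).

Definition pos_part t : R := (t + `|t|) / 2.

Lemma pos_part_ge0 t : 0 <= pos_part t.
Proof. by rewrite /pos_part; have := ler_norm (- t); rewrite normrN; lra. Qed.

Lemma pos_partE t : 0 <= t -> pos_part t = t.
Proof. by move=> t0; rewrite /pos_part ger0_norm//; lra. Qed.

Lemma pos_part0 t : t <= 0 -> pos_part t = 0.
Proof. by move=> t0; rewrite /pos_part ler0_norm//; lra. Qed.

Lemma pos_part_le t c : 0 <= c -> t <= c -> pos_part t <= c.
Proof.
move=> c0 tc; have [t0|/ltW t0] := leP 0 t; first by rewrite pos_partE.
by rewrite pos_part0.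
Qed.

Lemma pos_part_continuous : continuous pos_part.
Proof.
move=> t; apply: cvgM; last exact: cvg_cst.
by apply: cvgD; [exact: cvg_id|apply: cvg_norm; exact: cvg_id].
Qed.

Lemma is_derive_quad (f : R -> R) t (d C : R) :
  (forall s, `|f s - f t - d * (s - t)| <= C * (s - t) ^+ 2) ->
  is_derive t (1 : R) f d.
Proof.
move=> h.
have hl : h^-1 *: ((f \o shift t) (h *: (1 : R)) - f t) @[h --> 0^'] --> d.
  apply/cvgrPdist_lt => e e0.
  have C1 : 0 < `|C| + 1 by rewrite ltr_pwDr.
  near=> x; have x0 : x != 0 by near: x; exact: nbhs_dnbhs_neq.
  have xe : `|x| < e / (`|C| + 1) by near: x; apply: dnbhs0_lt; rewrite divr_gt0.
  have := h (x + t); rewrite addrK => hx.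
  rewrite /= -[x *: 1]/(x * 1) mulr1 -[_ *: _]/(x^-1 * _) distrC.
  rewrite (_ : x^-1 * _ - d = x^-1 * (f (x + t) - f t - d * x)); last first.
    by rewrite [RHS]mulrBr [x^-1 * (d * x)]mulrCA mulVf// mulr1.
  rewrite normrM normfV ltr_pdivrMl ?normr_gt0//.
  apply: le_lt_trans hx _; rewrite -[x ^+ 2]ger0_norm ?sqr_ge0// expr2 normrM mulrA mulrC.
  rewrite ltr_pM2l ?normr_gt0//.
  apply: (@le_lt_trans _ _ ((`|C| + 1) * `|x|)); last by rewrite mulrC -ltr_pdivlMr.
  by rewrite ler_wpM2r// ler_wpDr// ler_norm.
apply: DeriveDef; first by apply/cvg_ex; exists d.
exact: cvg_lim.
Unshelve. all: by end_near. Qed.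

(** The square s_+^2 has a first-order remainder of at most (s - t)^2, hence a derivative
    everywhere; higher powers follow from s_+^(e+3) = s s_+^(e+2). *)
Lemma is_derive_pos_part t e :
  is_derive t (1 : R) (fun s => pos_part s ^+ e.+2) (e.+2%:R * pos_part t ^+ e.+1).
Proof.
elim: e => [|e IH].
  rewrite expr1; apply: (@is_derive_quad _ _ _ 1) => s.
  rewrite mul1r ler_norml.
  have q1 := sqr_ge0 (s - t); have q2 := sqr_ge0 s; have q3 := sqr_ge0 t.
  have [t0|/ltW t0] := leP 0 t; have [s0|/ltW s0] := leP 0 s.
  - by rewrite (pos_partE s0) (pos_partE t0); apply/andP; split; lra.
  - rewrite (pos_partE t0) (pos_part0 s0); have := mulr_ge0_le0 t0 s0 => ts.
    by apply/andP; split; lra.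
  - rewrite (pos_partE s0) (pos_part0 t0); have := mulr_ge0_le0 s0 t0 => ts.
    by apply/andP; split; lra.
  - by rewrite (pos_part0 s0) (pos_part0 t0); apply/andP; split; lra.
have e1 : (fun s => pos_part s ^+ e.+3) = (fun s => s * pos_part s ^+ e.+2).
  apply/funext => s; have [s0|/ltW s0] := leP 0 s; first by rewrite exprS (pos_partE s0).
  by rewrite (pos_part0 s0) !expr0n/= mulr0.
rewrite e1; apply: is_derive_eq; rewrite /GRing.scale/=.
have [t0|/ltW t0] := leP 0 t; last by rewrite (pos_part0 t0) !expr0n/= !mulr0 add0r mul0r.
by rewrite (pos_partE t0) -[e.+3]addn1 natrD !exprS; ring.
Qed.

End positive_part.

(** * Monomials with a radial cutoff *)

Section cutoff_monomial.
Context {R : realType}.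
Implicit Types (z l : cplx R) (r : R).

Definition cutoff r e z : R := pos_part (r ^+ 2 - modulus z ^+ 2) ^+ e.
Definition cut_mono r e j k z : cplx R := z ^+ j * z^* ^+ k * ofR (cutoff r e z).

(** The differential of [cut_mono r e.+1 j k] in the direction l: terms in l are the d/dz part,
    terms in conj(l) the d/dconj(z) part, and d|z|^2 = conj(z) l + z conj(l) produces the two terms
    with exponent e. *)
Definition dcut_mono r e j k z l : cplx R :=
  j%:R * z ^+ j.-1 * z^* ^+ k * ofR (cutoff r e.+1 z) * l +
  (k%:R * z ^+ j * z^* ^+ k.-1 * ofR (cutoff r e.+1 z) -
   e.+1%:R * z ^+ j.+1 * z^* ^+ k * ofR (cutoff r e z)) * l^* -
  e.+1%:R * z ^+ j * z^* ^+ k.+1 * ofR (cutoff r e z) * l.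

(** The cutoff exponent [e.+1] is at least 2, where powers of the positive part are differentiable
    even on the circle |z| = r. *)
Lemma cder_cut_mono r e j k (g : R -> cplx R) t l : (0 < e)%N -> cder g t l ->
  cder (fun s => cut_mono r e.+1 j k (g s)) t (dcut_mono r e j k (g t) l).
Proof.
case: e => // e _ gl; have gc := cder_conj gl.
have [dm _] : cder (fun x => g x * (g x)^*) t (l * (g t)^* + g t * l^*) := cderM gl gc.
have dm' : is_derive t (1 : R) (fun x => r ^+ 2 - modulus (g x) ^+ 2)
    (- rpart (l * (g t)^* + g t * l^*)).
  have -> : (fun x => r ^+ 2 - modulus (g x) ^+ 2) =
      cst (r ^+ 2) - (rpart \o (fun x => g x * (g x)^*)).
    apply/funext => x; rewrite -[RHS]/(r ^+ 2 - rpart (g x * (g x)^*)).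
    by rewrite mul_conj_sqr.
  apply: is_derive_eq; by rewrite sub0r.
have dp := @is_derive1_comp R (fun s => pos_part s ^+ e.+2)
  (fun x => r ^+ 2 - modulus (g x) ^+ 2) t _ _ (is_derive_pos_part (r ^+ 2 - modulus (g t) ^+ 2) e) dm'.
have := cderM (cderM (cderX j gl) (cderX k gc)) (cder_ofR dp).
move=> /cder_eq; apply; rewrite /dcut_mono /cutoff.
have -> : ofR (e.+2%:R * pos_part (r ^+ 2 - modulus (g t) ^+ 2) ^+ e.+1 *
    - rpart (l * (g t)^* + g t * l^*)) =
    - e.+2%:R * ofR (pos_part (r ^+ 2 - modulus (g t) ^+ 2) ^+ e.+1) *
     (l * (g t)^* + g t * l^*).
  rewrite !ofRM ofRN ofR_nat mulrN !mulNr; congr (- (_ * _)).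
  by apply: complex_eq; rewrite !partE; ring.
rewrite /= (exprS (g t) j) (exprS (g t)^* k).
move: (ofR (pos_part _ ^+ e.+2)) (ofR (pos_part _ ^+ e.+1)) (e.+2%:R) => U V m.
move: (g t ^+ j.-1) ((g t)^* ^+ k.-1) (g t ^+ j) ((g t)^* ^+ k) => a b c d.
by move: (g t) (g t)^* l^* => z z' l'; ring.
Qed.

Lemma conj_continuous : continuous (fun z : cplx R => z^*).
Proof.
move=> z; apply/(cvg_cplxP (nbhs_filter z)) => e e0; apply/nbhs_cplxP; exists e => // w wz.
by rewrite -rmorphB modulus_conj.
Qed.

Section plane_continuity.
Variable T : topologicalType.
Implicit Types (f g : T -> cplx R) (h : T -> R).

Lemma ctM f g : continuous f -> continuous g -> continuous (fun p => f p * g p).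
Proof. by move=> cf cg p; apply: cvgM; [exact: cf|exact: cg]. Qed.

Lemma ctD f g : continuous f -> continuous g -> continuous (fun p => f p + g p).
Proof. by move=> cf cg p; apply: cvgD; [exact: cf|exact: cg]. Qed.

Lemma ctB f g : continuous f -> continuous g -> continuous (fun p => f p - g p).
Proof. by move=> cf cg p; apply: cvgB; [exact: cf|exact: cg]. Qed.

Lemma ctC (c : cplx R) : continuous (fun _ : T => c).
Proof. by move=> p; exact: cvg_cst. Qed.

Lemma ctX f k : continuous f -> continuous (fun p => f p ^+ k).
Proof.
move=> cf; elim: k => [|k IH]; first by under eq_fun do rewrite expr0; exact: ctC.
by under eq_fun do rewrite exprS; exact: ctM.
Qed.

Lemma ct_conj f : continuous f -> continuous (fun p => (f p)^*).
Proof.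
move=> cf p; apply: (@cvg_comp _ _ _ f (fun z => z^*) (nbhs p) (nbhs (f p))); first exact: cf.
exact: conj_continuous.
Qed.

Lemma ct_ofR h : continuous h -> continuous (fun p => ofR (h p)).
Proof.
move=> ch p; apply: (@cvg_comp _ _ _ h ofR (nbhs p) (nbhs (h p))); first exact: ch.
exact: ofR_continuous.
Qed.

Lemma ct_rpart f : continuous f -> continuous (fun p => rpart (f p)).
Proof.
move=> cf p; apply: (@cvg_comp _ _ _ f rpart (nbhs p) (nbhs (f p))); first exact: cf.
exact: rpart_continuous.
Qed.

Lemma ct_modulus f : continuous f -> continuous (fun p => modulus (f p)).
Proof.
move=> cf p; apply: (@cvg_comp _ _ _ f modulus (nbhs p) (nbhs (f p))); first exact: cf.
exact: modulus_continuous.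
Qed.

Lemma rtM h h' : continuous h -> continuous h' -> continuous (fun p => h p * h' p).
Proof. by move=> cf cg p; apply: cvgM; [exact: cf|exact: cg]. Qed.

Lemma rtD h h' : continuous h -> continuous h' -> continuous (fun p => h p + h' p).
Proof. by move=> cf cg p; apply: cvgD; [exact: cf|exact: cg]. Qed.

Lemma rtC (c : R) : continuous (fun _ : T => c).
Proof. by move=> p; exact: cvg_cst. Qed.

Lemma rtX h k : continuous h -> continuous (fun p => h p ^+ k).
Proof.
move=> cf; elim: k => [|k IH]; first by under eq_fun do rewrite expr0; exact: rtC.
by under eq_fun do rewrite exprS; exact: rtM.
Qed.

Lemma ct_cutoff r e f : continuous f -> continuous (fun p => cutoff r e (f p)).
Proof.
move=> cf; apply: rtX => p.
apply: (@cvg_comp _ _ _ (fun p => r ^+ 2 - modulus (f p) ^+ 2) pos_part (nbhs p)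
  (nbhs (r ^+ 2 - modulus (f p) ^+ 2))); last exact: pos_part_continuous.
by apply: cvgB; [exact: cvg_cst|apply: rtX; exact: ct_modulus].
Qed.

Lemma ct_cut_mono r e j k f : continuous f -> continuous (fun p => cut_mono r e j k (f p)).
Proof.
move=> cf; apply: ctM; last by apply: ct_ofR; exact: ct_cutoff.
by apply: ctM; [exact: ctX|apply: ctX; exact: ct_conj].
Qed.

Lemma ct_dcut_mono r e j k f g : continuous f -> continuous g ->
  continuous (fun p => dcut_mono r e j k (f p) (g p)).
Proof.
move=> cf cg; have cc := ct_conj cf; have cgc := ct_conj cg.
have c1 e' := ct_ofR (@ct_cutoff r e' f cf).
have cX i := @ctX f i cf; have cY i := @ctX _ i cc.
have cm (c : cplx R) i i' e' := ctM (ctM (ctM (@ctC c) (cX i)) (cY i')) (c1 e').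
exact: ctB (ctD (ctM (cm _ _ _ _) cg) (ctM (ctB (cm _ _ _ _) (cm _ _ _ _)) cgc))
  (ctM (cm _ _ _ _) cg).
Qed.

End plane_continuity.
End cutoff_monomial.

(* A holomorphic coordinate [w] on the plane.  For a function f(w), f(conj w) of
   the coordinate, the divergence of the field (P f, Q f) is J times the
   derivative of f with respect to conj(w); J is the Jacobian of the
   coordinate up to a constant. *)
Record chart (R : realType) := Chart {
  ch_w : R * R -> cplx R;
  ch_w1 : R * R -> cplx R;
  ch_w2 : R * R -> cplx R;
  ch_P : R * R -> cplx R;
  ch_P1 : R * R -> cplx R;
  ch_Q : R * R -> cplx R;
  ch_Q2 : R * R -> cplx R;
  ch_J : R * R -> R;
  ch_dw1 : forall x y, cder (fun x => ch_w (x, y)) x (ch_w1 (x, y));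
  ch_dw2 : forall x y, cder (fun y => ch_w (x, y)) y (ch_w2 (x, y));
  ch_dP : forall x y, cder (fun x => ch_P (x, y)) x (ch_P1 (x, y));
  ch_dQ : forall x y, cder (fun y => ch_Q (x, y)) y (ch_Q2 (x, y));
  ch_cw : continuous ch_w;
  ch_cw1 : continuous ch_w1;
  ch_cw2 : continuous ch_w2;
  ch_cP : continuous ch_P;
  ch_cP1 : continuous ch_P1;
  ch_cQ : continuous ch_Q;
  ch_cQ2 : continuous ch_Q2;
  ch_cJ : continuous ch_J;
  ch_J_ge0 : forall p, 0 <= ch_J p;
  ch_div : forall p, ch_P1 p + ch_Q2 p = 0;
  ch_holo : forall p, ch_P p * ch_w1 p + ch_Q p * ch_w2 p = 0;
  ch_jac : forall p, ch_P p * (ch_w1 p)^* + ch_Q p * (ch_w2 p)^* = ofR (ch_J p) }.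

(** * Orthogonality of monomials in a chart *)

Section moments.
Context {R : realType}.
Variables (c : chart R) (r x1 x2 y1 y2 : R).
Hypotheses (r01 : 0 <= r <= 1) (x12 : x1 <= x2) (y12 : y1 <= y2).
Hypotheses (bx : forall y, r <= modulus (ch_w c (x1, y)) /\ r <= modulus (ch_w c (x2, y)))
  (by_ : forall x, r <= modulus (ch_w c (x, y1)) /\ r <= modulus (ch_w c (x, y2))).
Local Notation w := (ch_w c).
Local Notation J := (ch_J c).
Local Notation "\rint F" := (rect_int x1 x2 y1 y2 F) (at level 10).

Lemma cutoff_ge0 e z : 0 <= cutoff r e z.
Proof. by rewrite exprn_ge0// pos_part_ge0. Qed.

Lemma cutoff_out e z : (0 < e)%N -> r <= modulus z -> cutoff r e z = 0.
Proof.
move=> e0 rz; rewrite /cutoff pos_part0 ?expr0n ?(gtn_eqF e0)//.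
rewrite subr_le0 lerXn2r ?nnegrE ?modulus_ge0//.
by case/andP: r01.
Qed.

Definition moment e j k (lam : cplx R) : R :=
  \rint (fun p => rpart (lam * cut_mono r e j k (w p)) * J p).

Lemma ct_moment e j k lam :
  continuous (fun p => rpart (lam * cut_mono r e j k (w p)) * J p).
Proof.
apply: rtM; last exact: ch_cJ.
by apply/ct_rpart/ctM; [exact: ctC|apply: ct_cut_mono; exact: ch_cw].
Qed.

(** The divergence of (P f, Q f), for f the monomial with cutoff exponent [e.+1], is J df/dconj(w);
    its integral is 0 as f vanishes on the boundary, and both terms of the derivative are cut-off
    monomials again. The factor [lam] lets one real identity cover real and imaginary parts. *)
Lemma moment_rec e j k lam : (0 < e)%N ->
  k%:R * moment e.+1 j k.-1 lam = e.+1%:R * moment e j.+1 k lam.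
Proof.
move=> e0.
pose f p := cut_mono r e.+1 j k (w p).
have cw := @ch_cw _ c; have cf : continuous f by exact: ct_cut_mono.
pose D1 p := ch_P1 c p * f p + ch_P c p * dcut_mono r e j k (w p) (ch_w1 c p).
pose D2 p := ch_Q2 c p * f p + ch_Q c p * dcut_mono r e j k (w p) (ch_w2 c p).
have cD1 : continuous D1.
  apply: ctD; first by apply: ctM cf; exact: ch_cP1.
  by apply: ctM; [exact: ch_cP|apply: ct_dcut_mono; [exact: cw|exact: ch_cw1]].
have cD2 : continuous D2.
  apply: ctD; first by apply: ctM cf; exact: ch_cQ2.
  by apply: ctM; [exact: ch_cQ|apply: ct_dcut_mono; [exact: cw|exact: ch_cw2]].
have f0 p : r <= modulus (w p) -> f p = 0.
  by move=> h; rewrite /f /cut_mono (@cutoff_out e.+1)// ofR0 mulr0.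
have i1 : \rint (fun p => rpart (lam * D1 p)) = 0.
  apply: (@rect_int_dx _ _ _ _ _ (fun p => rpart (lam * (ch_P c p * f p)))) => //.
  - exact: ct_rpart (ctM (@ctC R _ lam) cD1).
  - move=> x y.
    by have [] := cderZ lam (cderM (ch_dP c x y) (cder_cut_mono r j k e0 (ch_dw1 c x y))).
  - by move=> y; have [h1 h2] := bx y; rewrite !f0// !mulr0.
have i2 : \rint (fun p => rpart (lam * D2 p)) = 0.
  apply: (@rect_int_dy _ _ _ _ _ (fun p => rpart (lam * (ch_Q c p * f p)))) => //.
  - exact: ct_rpart (ctM (@ctC R _ lam) cD2).
  - move=> x y.
    by have [] := cderZ lam (cderM (ch_dQ c x y) (cder_cut_mono r j k e0 (ch_dw2 c x y))).
  - by move=> x; have [h1 h2] := by_ x; rewrite !f0// !mulr0.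
(* The field is divergence-free and annihilates dw ([ch_holo]), so only the part along conj(dw)
   survives, and there [ch_jac] supplies the factor J. *)
have key p : rpart (lam * D1 p) + rpart (lam * D2 p) =
    k%:R * (rpart (lam * cut_mono r e.+1 j k.-1 (w p)) * J p) -
    e.+1%:R * (rpart (lam * cut_mono r e j.+1 k (w p)) * J p).
  rewrite -rpartD.
  have -> : lam * D1 p + lam * D2 p =
     ofR (k%:R * J p) * (lam * cut_mono r e.+1 j k.-1 (w p)) -
     ofR (e.+1%:R * J p) * (lam * cut_mono r e j.+1 k (w p)).
    rewrite !ofRM !ofR_nat -(ch_jac c p) /D1 /D2.
    have e1 : ch_P1 c p = - ch_Q2 c p by apply/eqP; rewrite -addr_eq0 ch_div.
    have e2 := ch_holo c p.
    rewrite e1 /f /dcut_mono /cut_mono.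
    set A := ofR (cutoff r e.+1 _); set B := ofR (cutoff r e _).
    move: (w p) (w p)^* (ch_w1 c p) (ch_w1 c p)^* (ch_w2 c p) (ch_w2 c p)^* (ch_P c p) (ch_Q c p)
      (ch_Q2 c p) e2 => z z' a a' b b' P Q Q2 e2.
    set t1 := z ^+ j.-1; set t2 := z' ^+ k; set t3 := z ^+ j; set t4 := z' ^+ k.-1.
    set t5 := z ^+ j.+1; set t6 := z' ^+ k.+1.
    transitivity (lam * ((j%:R * t1 * t2 * A - e.+1%:R * t3 * t6 * B) * (P * a + Q * b) +
      (k%:R * t3 * t4 * A - e.+1%:R * t5 * t2 * B) * (P * a' + Q * b'))); first by ring.
    by rewrite e2; ring.
  have rZ (t : R) (u : cplx R) : rpart (ofR t * u) = t * rpart u by rewrite !partE; ring.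
  by rewrite rpartB !rZ; ring.
apply/eqP; rewrite -subr_eq0 /moment.
have cm := @ct_moment; have ck (t : R) e' j' k' := rtM (@rtC R _ t) (@ct_moment e' j' k' lam).
rewrite -(rect_intZ _ (@ct_moment e.+1 j k.-1 lam) x12 y12).
rewrite -(rect_intZ _ (@ct_moment e j.+1 k lam) x12 y12).
rewrite -(rect_intB (ck _ _ _ _) (ck _ _ _ _) x12 y12).
under eq_fun do rewrite -key.
have cl1 := ct_rpart (ctM (@ctC R _ lam) cD1); have cl2 := ct_rpart (ctM (@ctC R _ lam) cD2).
by rewrite (rect_intD cl1 cl2 x12 y12) i1 i2 addr0.
Qed.

(** For k = 0 the left side of the recursion is 0; otherwise it lowers j and k by one while raising
    e, so the induction is uniform in e. *)
Lemma moment_gt e j k lam : (0 < e)%N -> (k < j)%N -> moment e j k lam = 0.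
Proof.
elim: k e j => [|k IH] e [|j]// e0 kj; have := moment_rec j _ lam e0.
  move=> /(_ 0%N); rewrite mul0r => /esym/eqP; rewrite mulf_eq0 pnatr_eq0/= => /eqP.
  by [].
move=> /(_ k.+1); rewrite /= IH// mulr0 => /esym/eqP; rewrite mulf_eq0 pnatr_eq0/=.
by move=> /eqP.
Qed.

Lemma moment_conj e j k lam : moment e j k lam = moment e k j lam^*.
Proof.
rewrite /moment; congr (rect_int _ _ _ _ _); apply/funext => p; congr (_ * _).
rewrite -[RHS]rpart_conj /cut_mono; congr rpart.
by rewrite !rmorphM/= !conjCK !rmorphXn/= conjCK conj_ofR; ring.
Qed.

Lemma moment_neq e j k lam : (0 < e)%N -> j != k -> moment e j k lam = 0.
Proof.
move=> e0; rewrite neq_ltn => /orP[jk|kj]; last exact: moment_gt.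
by rewrite moment_conj moment_gt.
Qed.

Definition diag_moment e k : R :=
  \rint (fun p => modulus (w p) ^+ k ^+ 2 * cutoff r e (w p) * J p).

Lemma moment_diag e k lam : moment e k k lam = rpart lam * diag_moment e k.
Proof.
rewrite /moment /diag_moment -rect_intZ//; last first.
  apply: rtM; last exact: ch_cJ.
  apply: rtM; last by apply: ct_cutoff; exact: ch_cw.
  by apply/rtX/rtX/ct_modulus; exact: ch_cw.
congr (rect_int _ _ _ _ _); apply/funext => p.
rewrite /cut_mono -exprMn mul_conj_sqr -ofRX -ofRM exprAC !partE; ring.
Qed.

(** Multiplying by the phase of conj(b_k) and testing against conj(w)^k leaves |b_k| by
    orthogonality, and |w^k| <= 1 on the support of the cutoff. For polynomials all integrands are
    continuous. *)
Lemma coef_moment_le e N (b : nat -> cplx R) k : (0 < e)%N -> (k < N)%N ->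
  modulus (b k) * diag_moment e k <=
  \rint (fun p => modulus (\sum_(i < N) b i * w p ^+ i) * cutoff r e (w p) * J p).
Proof.
move=> e0 kN; have cw := @ch_cw _ c; have cJ := @ch_cJ _ c.
have csum_ : continuous (fun p => \sum_(i < N) b i * w p ^+ i).
  elim: N {kN} => [|N IH]; first by under eq_fun do rewrite big_ord0; exact: ctC.
  under eq_fun do rewrite big_ord_recr/=; apply: ctD IH _.
  by apply: ctM; [exact: ctC|exact: ctX].
have cbig : continuous (fun p => modulus (\sum_(i < N) b i * w p ^+ i) * cutoff r e (w p) * J p).
  exact: (rtM (rtM (ct_modulus csum_) (@ct_cutoff _ _ r e _ cw)) cJ).
have [b0|b0] := eqVneq (b k) 0.
  rewrite b0 modulus0 mul0r /rect_int /Rintegral; apply: fine_ge0; apply: integral_ge0.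
  move=> q _; rewrite lee_fin; apply: mulr_ge0; last exact: ch_J_ge0.
  by apply: mulr_ge0; [exact: modulus_ge0|exact: cutoff_ge0].
pose lam := (b k)^* / ofR (modulus (b k)).
have m0 : 0 < modulus (b k) by rewrite modulus_gt0.
have lam1 : modulus lam = 1.
  by rewrite modulusM modulusV modulus_conj modulus_ofR gtr0_norm// divff// gt_eqF.
have lamb : lam * b k = ofR (modulus (b k)).
  rewrite /lam mulrAC [X in X / _]mulrC mul_conj_sqr -ofRV -ofRM; congr ofR.
  by field; rewrite gt_eqF.
have [_ sE] := rect_int_sum N (fun i => @ct_moment e i k (lam * b i)) x12 y12.
have -> : modulus (b k) * diag_moment e k =
    \rint (fun p => \sum_(i < N) rpart (lam * b i * cut_mono r e i k (w p)) * J p).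
  rewrite sE (bigD1 (Ordinal kN))//= [X in _ + X]big1 ?addr0; last first.
    by move=> i ik; apply: moment_neq => //; apply: contra ik => /eqP ik; apply/eqP/val_inj.
  by rewrite -[RHS]/(moment e k k (lam * b k)) moment_diag lamb.
have [cl _] := rect_int_sum N (fun i => @ct_moment e i k (lam * b i)) x12 y12.
apply: (rect_int_le cl cbig x12 y12) => x y _ _.
rewrite -mulr_suml ler_wpM2r ?ch_J_ge0// -rpart_sum.
have -> : \sum_(i < N) lam * b i * cut_mono r e i k (w (x, y)) =
   lam * (\sum_(i < N) b i * w (x, y) ^+ i) * ((w (x, y))^* ^+ k * ofR (cutoff r e (w (x, y)))).
  by rewrite mulr_sumr mulr_suml; apply: eq_bigr => i _; rewrite /cut_mono; ring.
apply: le_trans (ler_norm _) _; apply: le_trans (rpart_le _) _.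
rewrite modulusM [modulus (lam * _)]modulusM lam1 mul1r.
rewrite modulusM modulus_ofR modulusX modulus_conj [`|_|]ger0_norm; last exact: cutoff_ge0.
rewrite ler_wpM2l ?modulus_ge0//.
have [wr|wr] := leP r (modulus (w (x, y))); first by rewrite cutoff_out// mulr0.
rewrite ler_piMl ?cutoff_ge0// exprn_ile1 ?modulus_ge0//.
by apply: le_trans (ltW wr) _; case/andP: r01.
Qed.

End moments.

(** * Coefficient bounds from integrals over a chart *)

Section coefficient_estimate.
Context {R : realType}.
Implicit Types (b : nat -> cplx R) (h : cplx R -> cplx R).

(** The Cauchy bound at radius s accompanies the expansion because it gives uniform convergence on
    smaller discs. *)
Definition expands b h (s : R) := (exists M, forall k, modulus (b k) * s ^+ k <= M) /\
  forall z, modulus z < s -> \sum_(k < m) b k * z ^+ k @[m --> \oo] --> h z.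

(** The tail is dominated by a geometric series of ratio r / s, hence at most 1 for large N,
    uniformly in |z| < r. *)
Lemma expands_uniform b h (r s : R) : 0 <= r -> r < s -> expands b h s ->
  \forall N \near \oo, forall z, modulus z < r ->
    modulus (\sum_(k < N) b k * z ^+ k) <= modulus (h z) + 1.
Proof.
move=> r0 rs [[M hM] hh]; have s0 : 0 < s := le_lt_trans r0 rs.
pose q := r / s; have q01 : 0 <= q < 1 by rewrite divr_ge0 ?(ltW s0)//= ltr_pdivrMr// mul1r.
have [q0 q1] := andP q01; have q1' : 0 < 1 - q by rewrite subr_gt0.
have M0 : 0 <= M by apply: le_trans (hM 0%N); rewrite mulr_ge0 ?modulus_ge0.
have geo n : \sum_(k < n) q ^+ k <= (1 - q)^-1.
  rewrite -(ler_pM2l q1') divff ?gt_eqF//.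
  by have := subrX1 q n; have := exprn_ge0 n q0; lra.
have := geo_small (M * (1 - q)^-1) q01 ltr01; apply: filterS => N hN z zr.
have zs : modulus z < s := lt_trans zr rs.
have term k : modulus (b k * z ^+ k) <= M * q ^+ k.
  rewrite modulusM modulusX.
  apply: (@le_trans _ _ (modulus (b k) * s ^+ k * q ^+ k)).
    rewrite -mulrA -exprMn ler_wpM2l ?modulus_ge0// lerXn2r ?nnegrE ?modulus_ge0//.
      by rewrite mulr_ge0 ?(ltW s0).
    by rewrite /q mulrC divfK ?gt_eqF// ltW.
  by rewrite ler_wpM2r ?exprn_ge0.
have tail : modulus (h z - \sum_(k < N) b k * z ^+ k) <= 1.
  have cv : \sum_(k < m + N) b k * z ^+ k - \sum_(k < N) b k * z ^+ k @[m --> \oo] -->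
      h z - \sum_(k < N) b k * z ^+ k.
    apply: cvgB; last exact: cvg_cst.
    have := hh z zs.
    by rewrite -(cvg_shiftn N).
  apply: (cvg_modulus_le cv) => m; rewrite addnC big_split_ord/= [X in X - _]addrC addrK.
  apply: le_trans (modulus_sum _ _ _) _.
  apply: (@le_trans _ _ (\sum_(k < m) M * q ^+ N * q ^+ k)).
    by apply: ler_sum => k _; rewrite -mulrA -exprD; exact: term.
  rewrite -mulr_sumr; apply: le_trans (ltW hN); rewrite [leRHS]mulrAC.
  by apply: ler_wpM2l; [exact: mulr_ge0 (exprn_ge0 _ q0)|exact: geo].
have := modulus_lerB (\sum_(k < N) b k * z ^+ k) (h z).
by rewrite modulusC; lra.
Qed.

Section chart_estimate.
Variables (c : chart R) (r x1 x2 y1 y2 : R).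
Hypotheses (r01 : 0 <= r <= 1) (x12 : x1 <= x2) (y12 : y1 <= y2).
Hypotheses (bx : forall y, r <= modulus (ch_w c (x1, y)) /\ r <= modulus (ch_w c (x2, y)))
  (by_ : forall x, r <= modulus (ch_w c (x, y1)) /\ r <= modulus (ch_w c (x, y2))).
Local Notation w := (ch_w c).
Local Notation J := (ch_J c).

(** From polynomials to h: on the support of the cutoff a partial sum is at most |h| + 1, and [A0]
    accounts for this 1. The majorant [A + G p] is the shape in which an L^p bound enters, through x
    <= 1 + x^p. *)
Lemma coef_moment_bound e b h s (A A0 : R) (G : R * R -> R) k :
  (0 < e)%N -> r < s -> expands b h s -> 0 <= A -> 0 <= A0 ->
  (forall p, rect x1 x2 y1 y2 p -> 0 <= G p) ->
  (forall p, rect x1 x2 y1 y2 p -> modulus (w p) < r -> cutoff r e (w p) * J p <= A0) ->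
  (forall p, rect x1 x2 y1 y2 p -> modulus (w p) < r ->
     modulus (h (w p)) * (cutoff r e (w p) * J p) <= A + G p) ->
  ((modulus (b k) * diag_moment c r x1 x2 y1 y2 e k)%:E <=
   ((A + A0) * ((x2 - x1) * (y2 - y1)))%:E + \int[plane_measure R]_(p in rect x1 x2 y1 y2) (G p)%:E)%E.
Proof.
move=> e0 rs hb A_ge0 A0_ge0 G0 hA0 hA.
have r0 : 0 <= r by case/andP: r01.
have [N0 _ hN0] := expands_uniform r0 rs hb.
pose N := (N0 + k.+1)%N; have kN : (k < N)%N by rewrite /N; lia.
have {hN0} hN := hN0 N (leq_addr _ _).
have main := coef_moment_le r01 x12 y12 bx by_ b e0 kN.
have cw := @ch_cw _ c; have cJ := @ch_cJ _ c.
have csum_ N' : continuous (fun p => \sum_(i < N') b i * w p ^+ i).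
  elim: N' => [|N' IH]; first by under eq_fun do rewrite big_ord0; exact: ctC.
  under eq_fun do rewrite big_ord_recr/=; apply: ctD IH _.
  exact: (ctM (@ctC R _ (b N')) (@ctX R _ _ N' cw)).
pose F (p : R * R) := modulus (\sum_(i < N) b i * w p ^+ i) * cutoff r e (w p) * J p.
have cF : continuous F := rtM (rtM (ct_modulus (csum_ N)) (@ct_cutoff _ _ r e _ cw)) cJ.
(* [P] is continuous and will be shown to lie below [G]: additivity of the integral is used for [P]
   only, and [G] enters by monotonicity. *)
pose P (p : R * R) := pos_part (F p - (A + A0)).
have cP : continuous P.
  move=> p; apply: (@cvg_comp _ _ _ (fun p => F p - (A + A0)) pos_part (nbhs p)
    (nbhs (F p - (A + A0)))); last exact: pos_part_continuous.
  apply: cvgB; [exact: cF|exact: cvg_cst].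
have cA := @rtC R (R * R)%type (A + A0).
have le1 := le_trans main (rect_int_le cF (rtD cA cP) x12 y12 _).
have {le1} le1 : modulus (b k) * diag_moment c r x1 x2 y1 y2 e k <=
    (A + A0) * ((x2 - x1) * (y2 - y1)) + rect_int x1 x2 y1 y2 P.
  have -> : (A + A0) * ((x2 - x1) * (y2 - y1)) = rect_int x1 x2 y1 y2 (fun=> A + A0).
    rewrite /rect_int Rintegral_cst; last exact: measurable_rect.
    by rewrite plane_measure_rect.
  rewrite -(rect_intD cA cP x12 y12); apply: le1 => x y _ _.
  have := pos_part_ge0 (F (x, y) - (A + A0)); rewrite /P.
  have [h0|/ltW h0] := leP 0 (F (x, y) - (A + A0)); first by rewrite (pos_partE h0); lra.
  by rewrite (pos_part0 h0); lra.
apply: (@le_trans _ _ ((A + A0) * ((x2 - x1) * (y2 - y1)) + rect_int x1 x2 y1 y2 P)%:E).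
  by rewrite lee_fin.
have fin := integrable_fin_num (measurable_rect x1 x2 y1 y2) (continuous_rect_integrable cP x12 y12).
rewrite EFinD; apply: leeD2l; rewrite /rect_int /Rintegral fineK//.
apply: nonneg_le_integral => p hp; first by rewrite lee_fin; exact: pos_part_ge0.
rewrite lee_fin; apply: pos_part_le; first exact: G0.
have [wr|wr] := leP r (modulus (w p)).
  by rewrite /F cutoff_out// mulr0 mul0r sub0r; have := G0 p hp; lra.
have := hA0 p hp wr; have := hA p hp wr.
have K0 : 0 <= cutoff r e (w p) * J p by rewrite mulr_ge0 ?ch_J_ge0 ?cutoff_ge0.
have FE : F p = modulus (\sum_(i < N) b i * w p ^+ i) * (cutoff r e (w p) * J p).
  by rewrite [RHS]mulrA.
have := ler_wpM2r K0 (hN _ wr); rewrite -FE mulrDl mul1r.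
lra.
Qed.

End chart_estimate.
End coefficient_estimate.

(** * Bounds for Taylor coefficients *)

Section power_series_uniqueness.
Context {R : realType}.
Implicit Types (a b : nat -> cplx R) (h : cplx R -> cplx R).

Lemma expands_le b h s s' : 0 <= s' -> s' <= s -> expands b h s -> expands b h s'.
Proof.
move=> s0 ss [[M hM] hh]; split; last by move=> z zs; apply: hh; exact: lt_le_trans ss.
exists M => k; apply: le_trans (hM k); rewrite ler_wpM2l ?modulus_ge0//.
by rewrite lerXn2r ?nnegrE// (le_trans s0).
Qed.

Lemma expandsB a b h h' s : 0 <= s -> expands a h s -> expands b h' s ->
  expands (fun k => a k - b k) (fun z => h z - h' z) s.
Proof.
move=> s0 [[M hM] hh] [[M' hM'] hh']; split.
  exists (M + M') => k; apply: le_trans (lerD (hM k) (hM' k)).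
  by rewrite -mulrDl ler_wpM2r ?exprn_ge0// modulusB.
move=> z zs; under eq_fun do under eq_bigr do rewrite mulrBl.
by under eq_fun do rewrite sumrB; apply: cvgB; [exact: hh|exact: hh'].
Qed.

Lemma expandsZ (t : cplx R) b h s : expands b h s ->
  expands (fun k => t * b k) (fun z => t * h z) s.
Proof.
move=> [[M hM] hh]; split.
  by exists (modulus t * M) => k; rewrite modulusM -mulrA ler_wpM2l ?modulus_ge0.
move=> z zs; under eq_fun do under eq_bigr do rewrite -mulrA.
by under eq_fun do rewrite -mulr_sumr; apply: cvgM; [exact: cvg_cst|exact: hh].
Qed.

(** Strong induction: when the coefficients below m vanish, evaluation at a small real t gives |b_m|
    t^m <= 2 M (t / s)^(m+1), and t tends to 0. *)
Lemma expands0 b s : 0 < s -> expands b (fun=> 0) s -> forall k, b k = 0.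
Proof.
move=> s0 [[M hM] hh] k; elim/ltn_ind: k => m IH.
have M0 : 0 <= M by apply: le_trans (hM 0%N); rewrite mulr_ge0 ?modulus_ge0.
have bd t : 0 < t -> t <= s / 2 -> modulus (b m) <= 2 * M / s ^+ m.+1 * t.
  move=> t0 ts; have ts' : t < s by apply: le_lt_trans ts _; rewrite ltr_pdivrMr// ltr_pMr// ltr1n.
  pose q := t / s; have q0 : 0 < q by rewrite divr_gt0.
  have q2 : q <= 1 / 2 by rewrite ler_pdivrMr// mulrAC mul1r ler_pdivlMr//; lra.
  have cv : \sum_(k < n + m.+1) b k * ofR t ^+ k @[n --> \oo] --> (0 : cplx R).
    have tm : modulus (ofR t) < s by rewrite modulus_ofR gtr0_norm.
    by have := hh _ tm; rewrite -(cvg_shiftn m.+1).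
  have cv' : b m * ofR t ^+ m - \sum_(k < n + m.+1) b k * ofR t ^+ k @[n --> \oo] -->
      b m * ofR t ^+ m - 0 by apply: cvgB; [exact: cvg_cst|exact: cv].
  have geo n : \sum_(k < n) q ^+ k <= 2.
    have := subrX1 q n; have := exprn_ge0 n (ltW q0).
    have : 0 <= \sum_(k < n) q ^+ k by apply: sumr_ge0 => i _; rewrite exprn_ge0// ltW.
    by nra.
  have := cvg_modulus_le cv' (B := 2 * M * q ^+ m.+1) _; rewrite subr0 => h.
  have {h} : modulus (b m * ofR t ^+ m) <= 2 * M * q ^+ m.+1.
    apply: h => n; rewrite addnC big_split_ord/= big_ord_recr/= big1 ?add0r; last first.
      by move=> i _; rewrite IH ?mul0r.
    rewrite opprD addrA subrr sub0r modulusN; apply: le_trans (modulus_sum _ _ _) _.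
    apply: (@le_trans _ _ (\sum_(k < n) M * q ^+ m.+1 * q ^+ k)).
      apply: ler_sum => k _; rewrite -mulrA -exprD modulusM modulusX modulus_ofR gtr0_norm//.
      rewrite /q expr_div_n mulrCA; apply: le_trans (_ : _ <= t ^+ (m.+1 + k) * (M / s ^+ (m.+1 + k))) _.
        by rewrite mulrC ler_wpM2l ?exprn_ge0 ?(ltW t0)// ler_pdivlMr ?exprn_gt0.
      by [].
    rewrite -mulr_sumr -[2 * M]mulrC -!mulrA ler_wpM2l// mulrC ler_wpM2r ?exprn_ge0 ?(ltW q0)//.
  rewrite modulusM modulusX modulus_ofR gtr0_norm// -ler_pdivlMr ?exprn_gt0// => /le_trans; apply.
  rewrite le_eqVlt; apply/orP; left; apply/eqP; rewrite /q expr_div_n exprS.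
  by field; rewrite !gt_eqF// exprn_gt0.
apply/eqP; rewrite -modulus_eq0 eq_le modulus_ge0 andbT; apply/ler_addgt0Pl => e e0.
rewrite addr0; pose D := 2 * M / s ^+ m.+1.
have D0 : 0 <= D by rewrite divr_ge0 ?mulr_ge0 ?exprn_ge0// ltW.
pose t := Order.min (s / 2) (e / (D + 1)).
have D1 : 0 < D + 1 by rewrite ltr_wpDl.
have t0 : 0 < t by rewrite lt_min !divr_gt0.
apply: le_trans (bd t t0 _) _; first by rewrite ge_min lexx.
have te : t <= e / (D + 1) by rewrite ge_min lexx orbT.
rewrite -/D; apply: (@le_trans _ _ ((D + 1) * t)); first by rewrite ler_wpM2r ?(ltW t0)//; lra.
by rewrite mulrC -ler_pdivlMr.
Qed.

Lemma expands_unique a b h s : 0 < s -> expands a h s -> expands b h s -> forall k, a k = b k.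
Proof.
move=> s0 ha hb k; apply/eqP; rewrite -subr_eq0; apply/eqP.
apply: (expands0 (b := fun k => a k - b k) s0).
have -> : (fun=> 0) = (fun z => h z - h z) by apply/funext => z; rewrite subrr.
exact: expandsB (ltW s0) ha hb.
Qed.

(** Taylor coefficients taken on two circles agree by uniqueness on the smaller disc, so those of
    radius 1/2 serve every s < 1. *)
Lemma holomorphic_expands h : holomorphic h -> exists b, forall s, 0 <= s < 1 -> expands b h s.
Proof.
move=> hh; exists (taylor_coef h (1 / 2)).
have ex r : 0 < r < 1 -> expands (taylor_coef h r) h r by move=> r01; have [M hM] := taylor_circle hh r01; split; [exists M|]; case: hM.
have e2 : expands (taylor_coef h (1 / 2)) h (1 / 2) by apply: ex; apply/andP; split; lra.
move=> s /andP[s0 s1]; have [s2|s2] := leP s (1 / 2); first exact: expands_le e2.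
have s0' : 0 < s by lra.
have es : expands (taylor_coef h s) h s by apply: ex; rewrite s0'.
suff -> : taylor_coef h (1 / 2) = taylor_coef h s by [].
have h2 : 0 < 1 / 2 :> R by lra.
apply/funext; exact: (expands_unique h2 e2 (expands_le (ltW h2) (ltW s2) es)).
Qed.

Lemma expands_ps a : pbound a -> forall s, 0 <= s < 1 -> expands a (ps a) s.
Proof.
move=> [m [B aB]] s /andP[s0 s1]; have pa : pbound a by exists m, B.
split.
  have [M hM] := natX_geo m (introT andP (conj s0 s1)).
  have B0 : 0 <= B by have := le_trans (modulus_ge0 _) (aB 0%N); rewrite expr1n mulr1.
  exists (B * M) => k; apply: (@le_trans _ _ (B * k.+1%:R ^+ m * s ^+ k)).
    by rewrite ler_wpM2r ?exprn_ge0.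
  by rewrite -mulrA ler_wpM2l.
move=> z zs; have z1 := lt_trans zs s1; rewrite psE//.
by have [B' aB'] := pbound_asum pa z1; exact: asum_cvg aB'.
Qed.

Lemma ps_inj a b : pbound a -> pbound b -> ps a = ps b -> a = b.
Proof.
move=> pa pb e; have h2 : 0 < 1 / 2 :> R by lra.
have h1 : 0 <= (1 / 2 : R) < 1 by apply/andP; split; lra.
have ea := expands_ps pa h1; have eb := expands_ps pb h1; rewrite -e in eb.
apply/funext; exact: (expands_unique h2 ea eb).
Qed.

End power_series_uniqueness.

(** * The cutoff radius and lower bounds for diagonal moments *)

Section diagonal_moments.
Context {R : realType}.

(** The reciprocal of 1 - r^2. The shift by 6 makes it at least 36 and at least 6 k, the two
    inequalities behind |w|^(2k) >= 1/2 in [diag_moment_ge]. *)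
Definition cut_scale k : R := (k + 6)%:R ^+ 2.
Definition cut_radius k : R := Num.sqrt (1 - (cut_scale k)^-1).

Lemma cut_scale_ge36 k : 36 <= cut_scale k.
Proof.
rewrite /cut_scale -natrX ler_nat; apply: (@leq_trans (6 ^ 2)) => //.
by rewrite leq_exp2r//; lia.
Qed.

Lemma cut_scale_gt0 k : 0 < cut_scale k.
Proof. by have := cut_scale_ge36 k; lra. Qed.

Lemma cut_scale_ge6k k : 6 * k%:R <= cut_scale k.
Proof. by rewrite /cut_scale -natrX -natrM ler_nat; lia. Qed.

Lemma cut_scale_le k : cut_scale k <= 36 * k.+1%:R ^+ 2.
Proof. by rewrite /cut_scale -!natrX -natrM ler_nat; lia. Qed.

Lemma cut_scaleV_le1 k : 0 < (cut_scale k)^-1 <= 1.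
Proof.
rewrite invr_gt0 cut_scale_gt0 invf_le1 ?cut_scale_gt0//.
by have := cut_scale_ge36 k; lra.
Qed.

Lemma cut_radius_sqr k : cut_radius k ^+ 2 = 1 - (cut_scale k)^-1.
Proof. by rewrite sqr_sqrtr// subr_ge0; case/andP: (cut_scaleV_le1 k). Qed.

Lemma cut_radius_ge0 k : 0 <= cut_radius k. Proof. exact: sqrtr_ge0. Qed.

Lemma cut_radius_lt1 k : cut_radius k < 1.
Proof.
rewrite -(@ltr_pXn2r _ 2)// ?nnegrE ?cut_radius_ge0// cut_radius_sqr expr1n.
by have /andP[] := cut_scaleV_le1 k; lra.
Qed.

Lemma cut_radius_bound k : 0 <= cut_radius k <= 1.
Proof. by rewrite cut_radius_ge0 ltW// cut_radius_lt1. Qed.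

Lemma cut_radius_le k (z : cplx R) : 1 - modulus z ^+ 2 <= (cut_scale k)^-1 -> cut_radius k <= modulus z.
Proof.
move=> h; rewrite -(@ler_pXn2r _ 2)// ?nnegrE ?cut_radius_ge0 ?modulus_ge0// cut_radius_sqr.
by lra.
Qed.

Lemma bernoulli_le k (x : R) : 0 <= x <= 1 -> 1 - k%:R * x <= (1 - x) ^+ k.
Proof.
move=> /andP[x0 x1]; elim: k => [|k IH]; first by rewrite expr0; lra.
have x1' : 0 <= 1 - x by lra.
rewrite exprS; apply: le_trans (ler_wpM2l x1' IH).
have : 0 <= k%:R * x ^+ 2 by rewrite mulr_ge0 ?sqr_ge0.
by rewrite -natr1; nra.
Qed.

Variable c : chart R.

(** With K = [cut_scale k], on the smaller box |w|^(2k) >= (1 - 3/K)^k >= 1 - 3k/K >= 1/2, and r^2 -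
    |w|^2 >= 2/K - 1/K = 1/K bounds the cutoff from below. *)
Lemma diag_moment_ge (x1 x2 y1 y2 : R) e k (a1 a2 b1 b2 j0 : R) :
  x1 <= x2 -> y1 <= y2 -> a1 <= a2 -> b1 <= b2 -> 0 <= j0 ->
  x1 <= a1 -> a2 <= x2 -> y1 <= b1 -> b2 <= y2 ->
  (forall x y, a1 <= x <= a2 -> b1 <= y <= b2 -> j0 <= ch_J c (x, y) /\
    2 / cut_scale k <= 1 - modulus (ch_w c (x, y)) ^+ 2 <= 3 / cut_scale k) ->
  2^-1 * (cut_scale k)^-1 ^+ e * j0 * ((a2 - a1) * (b2 - b1)) <=
  diag_moment c (cut_radius k) x1 x2 y1 y2 e k.
Proof.
move=> x12 y12 a12 b12 j00 xa ax yb by_ h; have s0 := cut_scale_gt0 k.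
have si0 : 0 <= (cut_scale k)^-1 by rewrite invr_ge0 ltW.
have cw := @ch_cw _ c; have cJ := @ch_cJ _ c.
have cF := rtM (rtM (@rtX R _ _ 2 (@rtX R _ _ k (ct_modulus cw))) (@ct_cutoff _ _ (cut_radius k) e _ cw)) cJ.
have M0 : 0 <= 2^-1 * (cut_scale k)^-1 ^+ e * j0 by rewrite !mulr_ge0 ?exprn_ge0.
apply: (rect_int_ge cF x12 y12 a12 b12 M0 xa ax yb by_).
  move=> x y _ _; apply: mulr_ge0; last exact: ch_J_ge0.
  by apply: mulr_ge0; [exact: sqr_ge0|exact: cutoff_ge0].
move=> x y hx hy; have [hJ /andP[h2 h3]] := h x y hx hy.
apply: ler_pM hJ; [by rewrite mulr_ge0 ?exprn_ge0|exact: j00|].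
apply: ler_pM; [by []|by rewrite exprn_ge0| |].
  rewrite -exprM mulnC exprM; set m := modulus _ ^+ 2 in h2 h3 *.
  have t3 : 0 <= 3 / cut_scale k <= 1.
    apply/andP; split; first by rewrite divr_ge0// ltW.
    by rewrite ler_pdivrMr//; have := cut_scale_ge36 k; lra.
  have le1 : (1 - 3 / cut_scale k) ^+ k <= m ^+ k.
    by case/andP: t3 => _ t3; rewrite lerXn2r ?nnegrE ?sqr_ge0//; lra.
  apply: le_trans le1; apply: le_trans (bernoulli_le k t3).
  suff : k%:R * (3 / cut_scale k) <= 2^-1 by lra.
  by rewrite mulrA ler_pdivrMr//; have := cut_scale_ge6k k; lra.
have h4 : (cut_scale k)^-1 <= cut_radius k ^+ 2 - modulus (ch_w c (x, y)) ^+ 2.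
  by rewrite cut_radius_sqr; lra.
rewrite /cutoff pos_partE; last exact: le_trans h4.
by rewrite lerXn2r ?nnegrE// (le_trans si0).
Qed.

End diagonal_moments.

(** * Taylor coefficients and the Bergman integral *)

Section bergman_coefficients.
Context {R : realType}.
Let half : cplx R := ofR 2^-1.

(** The field (1/2, i/2) is d/dconj(z) = (d/dx + i d/dy) / 2, so the Jacobian factor is 1. *)
Definition cartesian_chart : chart R.
Proof.
refine (@Chart R (fun p => ofR p.1 + imag * ofR p.2) (fun=> 1) (fun=> imag)
  (fun=> half) (fun=> 0) (fun=> imag * half) (fun=> 0) (fun=> 1) _ _ _ _ _ _ _ _ _ _ _ _ _ _ _ _).
- move=> x y; exact: cder_eq (cderD (cder_id x) (cder_cst (imag * ofR y) x)) (addr0 _).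
- move=> x y; apply: cder_eq (cderD (cder_cst (ofR x) y) (cderZ imag (cder_id y))) _.
  by rewrite add0r mulr1.
- by move=> x y; exact: cder_cst.
- by move=> x y; exact: cder_cst.
- exact: (ctD (ct_ofR (fun p => cvg_fst)) (ctM (@ctC R _ imag) (ct_ofR (fun p => cvg_snd)))).
- exact: (@ctC R _ 1).
- exact: (@ctC R _ imag).
- exact: (@ctC R _ half).
- exact: (@ctC R _ 0).
- exact: (@ctC R _ (imag * half)).
- exact: (@ctC R _ 0).
- exact: (@rtC R _ 1).
- by move=> _; exact: ler01.
- by move=> _; exact: addr0.
- by move=> _; rewrite mulr1 mulrAC imag_sqr mulN1r addrN.
- move=> _; rewrite conj_imag conjC1 mulr1 mulrN mulrAC imag_sqr mulN1r opprK -ofRD.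
  by congr ofR; lra.
Defined.

Lemma cartesian_wE p : ch_w cartesian_chart p = point_of p.
Proof. by case: p => x y; rewrite point_ofE. Qed.

Lemma modulus_point_of (x y : R) : modulus (point_of (x, y)) ^+ 2 = x ^+ 2 + y ^+ 2.
Proof. exact: modulus_sqr. Qed.

Lemma cartesian_diag_ge e k :
  (200%:R)^-1 * (cut_scale k)^-1 ^+ e.+2 <= diag_moment cartesian_chart (cut_radius k) (-1) 1 (-1) 1 e k.
Proof.
have s0 := @cut_scale_gt0 R k; have s36 := @cut_scale_ge36 R k.
pose t : R := (cut_scale k)^-1; have t0 : 0 < t by rewrite invr_gt0.
have t1 : t <= 36^-1 by rewrite lef_pV2 ?posrE.
(* With t = 1/K, on this box 1 - x^2 runs to first order over [2.2 t, 2.8 t], and t <= 1/36 controls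
   the rest, which keeps 1 - |z|^2 between 2 t and 3 t. The area is 3/100 t^2. *)
apply: le_trans (@diag_moment_ge R cartesian_chart (-1) 1 (-1) 1 e k (1 - 7 / 5 * t) (1 - 11 / 10 * t) 0 (t / 10) 1 _ _ _ _ _ _ _ _ _ _); try lra.
  rewrite -/t mulr1 !exprS; have : 0 <= t ^+ e by rewrite exprn_ge0// ltW.
  by nra.
move=> x y /andP[x1 x2] /andP[y1 y2]; split; first exact: lexx.
rewrite cartesian_wE modulus_point_of -[_ / cut_scale k]/(2 * t) -[_ / cut_scale k]/(3 * t).
by apply/andP; split; nra.
Qed.

(** [coef_moment_bound] in the Cartesian chart with cutoff exponent n + 1: inside radius r the
    cutoff is below the weight, and x <= 1 + x^2 compares |v| with |v|^2. The constant 1600 is 200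
    from the diagonal moment times 8, the area 4 times [A + A0] = 2. *)
Lemma bergman_coef_le1 n : exists2 C : R, 0 <= C & forall v b k (B : R),
  (forall z, ~ disc z -> v z = 0) -> (forall s, 0 <= s < 1 -> expands b v s) ->
  (bergman_int n v <= B%:E)%E ->
  modulus (b k) <= C * k.+1%:R ^+ (2 * n.+3) * (1 + B).
Proof.
exists (1600 * 36 ^+ n.+3); first exact: mulr_ge0 (ler0n _ _) (exprn_ge0 _ (ler0n _ _)).
move=> v b k B v0 hb vB; have s0 := @cut_scale_gt0 R k.
have B0 : 0 <= B by rewrite -lee_fin; apply: le_trans (bergman_int_ge0 n v) vB.
pose G (p : R * R) := modulus (v (point_of p)) ^+ 2 * weight n (point_of p).
have G0 p : 0 <= G p.
  have [p1|p1] := ltP (modulus (point_of p)) 1; first by rewrite mulr_ge0 ?sqr_ge0 ?weight_ge0.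
  by rewrite /G v0 ?modulus0 ?expr0n ?mul0r// => /discE; rewrite ltNge p1.
have bd (x y : R) : 1 <= `|x| \/ 1 <= `|y| -> cut_radius k <= modulus (ch_w cartesian_chart (x, y)).
  move=> h; apply: cut_radius_le; rewrite cartesian_wE modulus_point_of.
  have /andP[t0 _] := @cut_scaleV_le1 R k.
  have q1 := sqr_ge0 x; have q2 := sqr_ge0 y.
  have sq (z : R) : 1 <= `|z| -> 1 <= z ^+ 2.
    by move=> z1; rewrite -real_normK ?num_real// exprn_ege1.
  by case: h => /sq; lra.
have n11 : 1 <= `|-1 : R| by rewrite normrN1.
have n1 : 1 <= `|1 : R| by rewrite normr1.
have l11 : (-1 : R) <= 1 by lra.
have r1 := @cut_radius_lt1 R k; have r0 := @cut_radius_ge0 R k.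
have rs : @cut_radius R k < (1 + @cut_radius R k) / 2 by lra.
have s01 : 0 <= (1 + @cut_radius R k) / 2 < 1 by apply/andP; split; lra.
have cut p : modulus (ch_w cartesian_chart p) < cut_radius k ->
    0 <= cutoff (cut_radius k) n.+1 (ch_w cartesian_chart p) <= weight n (point_of p) /\
    weight n (point_of p) <= 1.
  rewrite cartesian_wE => pr; have p1 := lt_trans pr r1.
  rewrite cutoff_ge0 weight_le1//; split => //=.
  have q0 := sqr_ge0 (modulus (point_of p)).
  have r2 : @cut_radius R k ^+ 2 <= 1 by rewrite exprn_ile1// ltW.
  have m2 : modulus (point_of p) ^+ 2 <= @cut_radius R k ^+ 2 by rewrite lerXn2r ?nnegrE ?modulus_ge0// ltW.
  rewrite /cutoff pos_partE ?subr_ge0//.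
  apply: (@le_trans _ _ ((1 - modulus (point_of p) ^+ 2) ^+ n.+1)).
    rewrite lerXn2r ?nnegrE ?subr_ge0//; first exact: le_trans m2 r2.
    exact: lerB.
  rewrite /weight; apply: ler_wiXn2l; [by rewrite subr_ge0 (le_trans m2 r2)|by rewrite gerBl|exact: leq_trans (leq_subr 2 n) (leqnSn n)].
have := @coef_moment_bound R cartesian_chart (cut_radius k) (-1) 1 (-1) 1 (cut_radius_bound k) l11 l11
  (fun y => conj (bd (-1) y (or_introl n11)) (bd 1 y (or_introl n1)))
  (fun x => conj (bd x (-1) (or_intror n11)) (bd x 1 (or_intror n1)))
  n.+1 b v _ 1 1 G k isT rs (hb _ s01) ler01 ler01 (fun p _ => G0 p).
have h1 p : rect (-1) 1 (-1) 1 p -> modulus (ch_w cartesian_chart p) < cut_radius k ->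
   cutoff (cut_radius k) n.+1 (ch_w cartesian_chart p) * ch_J cartesian_chart p <= 1.
  by move=> _ /cut[/andP[_ h] /(le_trans h)]; rewrite [ch_J _ _](erefl : _ = 1) mulr1.
have h2 p : rect (-1) 1 (-1) 1 p -> modulus (ch_w cartesian_chart p) < cut_radius k ->
   modulus (v (ch_w cartesian_chart p)) *
   (cutoff (cut_radius k) n.+1 (ch_w cartesian_chart p) * ch_J cartesian_chart p) <= 1 + G p.
  move=> _ /cut[/andP[c0 c1] w1]; rewrite [ch_J _ _](erefl : _ = 1) mulr1 cartesian_wE in c0 c1 *.
  rewrite /G; move: (cutoff _ _ _) (weight _ _) (modulus _) (modulus_ge0 (v (point_of p))) c0 c1 w1.
  move=> c w m m0 c0 c1 w1; have := ler_wpM2l m0 c1.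
  have mw : m <= 1 + m ^+ 2 by nra.
  by have := ler_wpM2r (le_trans c0 c1) mw; lra.
move=> /(_ h1 h2) main.
have Gint : (\int[plane_measure R]_(p in rect (-1) 1 (-1) 1) (G p)%:E <= B%:E)%E.
  apply: le_trans vB.
  apply: (@le_trans _ _ (\int[plane_measure R]_(p in setT) (G p)%:E)%E).
    apply: nonneg_le_integral_set => [p _|p _|p _]; rewrite ?lee_fin//.
  rewrite /bergman_int [leRHS]integral_mkcond; apply: nonneg_le_integral => p _; first by rewrite lee_fin.
  rewrite /patch; case: ifPn => [_|]; first exact: lexx.
  move=> /negP np; rewrite /G v0; last by move=> dp; apply: np; rewrite inE.
  by rewrite modulus0 expr0n mul0r.
have {}main := le_trans main (leeD2l _ Gint); rewrite -EFinD lee_fin in main.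
have := cartesian_diag_ge n.+1 k; set D := diag_moment _ _ _ _ _ _ _ _ in main * => hD.
have t0 : 0 < (cut_scale k : R)^-1 ^+ n.+3 by rewrite exprn_gt0// invr_gt0.
have {main} main : modulus (b k) * (200%:R^-1 * (cut_scale k)^-1 ^+ n.+3) <= 8 + B.
  apply: le_trans (ler_wpM2l (modulus_ge0 _) hD) _; apply: le_trans main _; lra.
have : modulus (b k) * (cut_scale k)^-1 ^+ n.+3 <= 1600 * (1 + B) by lra.
rewrite exprVn -ler_pdivlMr ?invr_gt0 ?exprn_gt0// invrK => /le_trans; apply.
have h : cut_scale k ^+ n.+3 <= 36 ^+ n.+3 * k.+1%:R ^+ (2 * n.+3) :> R.
  rewrite exprM -exprMn; apply: lerXn2r; rewrite ?nnegrE; [exact: ltW| |exact: cut_scale_le].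
  by apply: mulr_ge0; [exact: ler0n|exact: exprn_ge0].
have B1 : 0 <= 1600 * (1 + B) by lra.
by move: h (ler_wpM2l B1 h); move: (cut_scale k ^+ n.+3) (36 ^+ n.+3) (_ ^+ (2 * n.+3)) => S P Q _; lra.
Qed.

End bergman_coefficients.

(** * Smooth vectors as power series *)

Section rotation.
Context {R : realType}.
Local Notation mu := (@lebesgue_measure R).
Local Open Scope ereal_scope.

Lemma lebesgue_integral_shift (a : R) (f : measurableTypeR R -> \bar R) :
  measurable_fun setT f -> (forall x, 0 <= f x) ->
  \int[mu]_x f (x + a)%R = \int[mu]_x f x.
Proof.
move=> mf f0; pose phi (x : measurableTypeR R) : measurableTypeR R := (x + a)%R.
have mphi : measurable_fun setT phi.
  apply: continuous_measurable_fun => x; apply: cvgD; [exact: cvg_id|exact: cvg_cst].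
pose phi_mixin := isMeasurableFun.Build _ _ _ _ _ mphi.
pose phi_pack : {mfun measurableTypeR R >-> measurableTypeR R} := HB.pack phi phi_mixin.
have e := ge0_integral_pushforward mphi mu measurableT mf (fun y _ => f0 y).
rewrite preimage_setT in e; rewrite -[LHS]e.
apply/esym; apply: (@eq_measure_integral _ _ R setT (pushforward mu phi_pack) mu) => A mA _.
apply: lebesgue_measure_unique mA => _ [[b c] _ <-].
have pE : phi @^-1` [set` `]b, c]] = [set` `](b - a)%R, (c - a)%R]].
  by apply/seteqP; split => x /=; rewrite !in_itv/= /phi ltrBlDr lerBrDr.
rewrite -[RHS]/(mu (phi @^-1` [set` `]b, c]])) pE.
rewrite !lebesgue_measure_itv/= !lte_fin ltrD2r.
by case: ifP => // _; rewrite -!EFinB; congr EFin; ring.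
Qed.

Lemma measurable_linear (p q : R) :
  measurable_fun setT (fun z : plane R => (p * z.1 + q * z.2)%R : measurableTypeR R).
Proof.
apply: continuous_plane_measurable.
by apply: rtD; apply: rtM; (exact: rtC || (move=> z; exact: cvg_fst) || (move=> z; exact: cvg_snd)).
Qed.

Definition linear2 (a b c d : R) (z : plane R) : plane R :=
  (a * z.1 + b * z.2, c * z.1 + d * z.2)%R.

Lemma measurable_linear2 a b c d : measurable_fun setT (linear2 a b c d).
Proof. by apply: measurable_fun_pair; exact: measurable_linear. Qed.

Let invariant a b c d := forall f : plane R -> \bar R, measurable_fun setT f ->
  (forall z, 0 <= f z) -> \int[plane_measure R]_z f (linear2 a b c d z) = \int[plane_measure R]_z f z.

(** By Tonelli, a shear acts as a translation on each horizontal line. *)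
Lemma shear_fst_invariant t : invariant 1 t 0 1.
Proof.
move=> f mf f0; have mf' := measurableT_comp mf (measurable_linear2 1 t 0 1).
rewrite /plane_measure (fubini_tonelli2 _ mf' (fun z => f0 _)) (fubini_tonelli2 f mf f0).
apply: eq_integral => y _; rewrite /fubini_G/=.
rewrite -[RHS](@lebesgue_integral_shift (t * y)%R (fun x => f (x, y))) //.
  by apply: eq_integral => x _; rewrite /linear2/= !mul1r mul0r add0r.
exact: measurable_fun_pair1.
Qed.

Lemma shear_snd_invariant t : invariant 1 0 t 1.
Proof.
move=> f mf f0; have mf' := measurableT_comp mf (measurable_linear2 1 0 t 1).
rewrite /plane_measure (fubini_tonelli1 _ mf' (fun z => f0 _)) (fubini_tonelli1 f mf f0).
apply: eq_integral => x _; rewrite /fubini_F/=.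
rewrite -[RHS](@lebesgue_integral_shift (t * x)%R (fun y => f (x, y))) //.
  by apply: eq_integral => y _; rewrite /linear2/= !mul1r mul0r addr0 addrC.
exact: measurableT_comp mf (pair1_measurable x).
Qed.

Lemma invariantM a b c d a' b' c' d' : invariant a b c d -> invariant a' b' c' d' ->
  invariant (a * a' + b * c') (a * b' + b * d') (c * a' + d * c') (c * b' + d * d').
Proof.
move=> i1 i2 f mf f0; rewrite -(i1 f mf f0).
have mf' := measurableT_comp mf (measurable_linear2 a b c d).
rewrite -[RHS](i2 _ mf' (fun z => f0 _)); apply: eq_integral => z _; congr f.
by rewrite /linear2/=; congr (_, _); ring.
Qed.

(* A rotation by an angle that is not a multiple of pi is a product of three shears. *)
Lemma rotation_invariant (a b : R) : (a ^+ 2 + b ^+ 2 = 1)%R -> invariant a (- b) b a.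
Proof.
have eqI (p q s t p' q' s' t' : R) : p = p' -> q = q' -> s = s' -> t = t' ->
    invariant p q s t -> invariant p' q' s' t' by move=> -> -> -> ->.
have main (u v : R) : (u ^+ 2 + v ^+ 2 = 1)%R -> v != 0%R -> invariant u (- v) v u.
  move=> uv v0; have u2 : (u ^+ 2 = 1 - v ^+ 2)%R by rewrite -uv addrK.
  have := invariantM (invariantM (shear_fst_invariant ((u - 1) / v))
    (shear_snd_invariant v)) (shear_fst_invariant ((u - 1) / v)).
  apply: eqI; try by field.
  have -> : ((1 * 1 + (u - 1) / v * v) * ((u - 1) / v) + (1 * 0 + (u - 1) / v * 1) * 1 =
    (u ^+ 2 - 1) / v)%R by field.
  by rewrite u2; field.
move=> ab; have [b0|b0] := eqVneq b 0%R; last exact: main.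
(* Now the sine is 0 and a is 1 or -1; the rotation is a product of two quarter turns, whose sines
   are 1 and -a. *)
have i1 : invariant 0 (- 1) 1 0 by apply: main; [ring|exact: oner_neq0].
have a0 : a != 0%R by apply/eqP => a0; move/eqP: ab; rewrite a0 b0 expr0n/= addr0 eq_sym oner_eq0.
have i2 : invariant 0 (- - a) (- a) 0 by apply: main; [rewrite -ab b0; ring|rewrite oppr_eq0].
by have := invariantM i2 i1; apply: eqI; rewrite ?b0; ring.
Qed.

End rotation.

(** * The Bergman space: linearity and continuity of coefficients *)

Section bergman_space.
Context {R : realType}.
Implicit Types (v w : cplx R -> cplx R) (n k : nat) (b : nat -> cplx R).
Local Notation D := (point_of @^-1` (@disc R) : set (plane R)).

Lemma continuous_point_of : continuous (@point_of R).
Proof.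
have e : @point_of R = ch_w (@cartesian_chart R) by apply/funext => p; rewrite cartesian_wE.
by rewrite e; exact: ch_cw.
Qed.

Lemma measurable_disc : measurable D.
Proof.
have h := continuous_plane_measurable (ct_modulus continuous_point_of).
have := h measurableT _ (measurable_itv `]-oo, 1[); rewrite setTI; congr measurable.
apply/seteqP; split => p /=; rewrite in_itv/=; first by move/discE.
by move=> /discE.
Qed.

(** On the disc v is a pointwise limit of polynomials, which are continuous on the plane. *)
Lemma holomorphic_measurable v : holomorphic v ->
  measurable_fun D (fun p => modulus (v (point_of p)) : measurableTypeR R).
Proof.
move=> hv; have [b hb] := holomorphic_expands hv.
apply: (@measurable_fun_cvg _ _ _ _
   (fun m p => modulus (\sum_(k < m) b k * point_of p ^+ k) : measurableTypeR R)).
  move=> m; apply: measurable_funS (continuous_plane_measurable _) => //.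
  apply: ct_modulus; elim: m => [|m IH]; first by under eq_fun do rewrite big_ord0; exact: ctC.
  under eq_fun do rewrite big_ord_recr/=.
  exact: (ctD IH (ctM (@ctC R _ (b m)) (@ctX R _ _ m continuous_point_of))).
move=> p /discE p1; have s1 : 0 <= (1 + modulus (point_of p)) / 2 < 1.
  by have := modulus_ge0 (point_of p); move=> m0; apply/andP; split; lra.
have [_ /(_ (point_of p)) h] := hb _ s1.
apply: (@cvg_comp _ _ _ _ modulus _ (nbhs (v (point_of p)))); last exact: modulus_continuous.
by apply: h; lra.
Qed.

Definition bergman_density n v (p : plane R) : \bar R :=
  (modulus (v (point_of p)) ^+ 2 * weight n (point_of p))%:E.

Lemma bergman_density_ge0 n v p : D p -> (0 <= bergman_density n v p)%E.
Proof. by move=> /discE p1; rewrite lee_fin mulr_ge0 ?sqr_ge0 ?weight_ge0. Qed.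

Lemma measurable_weight n :
  measurable_fun setT (fun p : plane R => weight n (point_of p) : measurableTypeR R).
Proof.
apply: continuous_plane_measurable; apply: rtX => p; apply: cvgB; first exact: cvg_cst.
by apply: (@rtX R _ _ 2 _ p); apply: ct_modulus; exact: continuous_point_of.
Qed.

Lemma measurable_bergman_density n v : holomorphic v ->
  measurable_fun D (bergman_density n v).
Proof.
move=> hv; apply/measurable_EFinP; apply: measurable_funM.
  apply: measurable_funX; exact: holomorphic_measurable.
by apply: measurable_funS (measurable_weight n).
Qed.

Lemma bergman_intZ n (t : cplx R) v : holomorphic v ->
  bergman_int n (t *: v) = ((modulus t ^+ 2)%:E * bergman_int n v)%E.
Proof.
move=> hv; rewrite /bergman_int -ge0_integralZl //.
- apply: eq_integral => p _; rewrite -EFinM; congr EFin.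
  by rewrite -[(t *: v) _]/(t * v (point_of p)) modulusM; ring.
- exact: measurable_disc.
- exact: (measurable_bergman_density n hv).
- by move=> p; exact: bergman_density_ge0.
- by rewrite lee_fin sqr_ge0.
Qed.

Lemma bergmanZ n (t : cplx R) v : bergman n v -> bergman n (t *: v).
Proof.
move=> [v0 hv vi]; split.
- by move=> z dz; rewrite -[(t *: v) z]/(t * v z) v0// mulr0.
- by move=> z dz; apply: derivableZ; exact: hv.
- rewrite -/(bergman_int n (t *: v)) bergman_intZ//.
  have := bergman_int_ge0 n v; rewrite -/(bergman_int n v) in vi.
  by case: (bergman_int n v) vi => [r|//|//] _ _; rewrite -EFinM ltry.
Qed.

Lemma bergmanD n v w : bergman n v -> bergman n w -> bergman n (v + w).
Proof.
move=> [v0 hv vi] [w0 hw wi]; split.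
- by move=> z dz; rewrite -[(v + w) z]/(v z + w z) v0// w0// addr0.
- by move=> z dz; apply: derivableD; [exact: hv|exact: hw].
have mv := measurable_bergman_density n hv; have mw := measurable_bergman_density n hw.
rewrite -/(bergman_int n (v + w)).
apply: (@le_lt_trans _ _ (2%:E * (bergman_int n v + bergman_int n w))%E).
  rewrite /bergman_int -ge0_integralD//; [|exact: measurable_disc|by move=> p; exact: bergman_density_ge0
    |by move=> p; exact: bergman_density_ge0].
  rewrite -ge0_integralZl//; [|exact: measurable_disc|by apply: emeasurable_funD
    |by move=> p Dp; apply: adde_ge0; exact: bergman_density_ge0].
  apply: nonneg_le_integral => p; first by move/bergman_density_ge0; apply.
  move=> /discE p1; rewrite -EFinD -EFinM lee_fin -mulrDl mulrA ler_wpM2r ?weight_ge0//.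
  have := modulusD (v (point_of p)) (w (point_of p)).
  have := modulus_ge0 ((v + w) (point_of p)).
  rewrite -[(v + w) _]/(v (point_of p) + w (point_of p)).
  move: (modulus _) (modulus (v _)) (modulus (w _)) => x y z x0 xyz.
  have h : x ^+ 2 <= (y + z) ^+ 2 by rewrite lerXn2r ?nnegrE// (le_trans x0).
  by apply: le_trans h _; have := sqr_ge0 (y - z); nra.
have := bergman_int_ge0 n v; have := bergman_int_ge0 n w.
rewrite -/(bergman_int n v) -/(bergman_int n w) in vi wi.
case: (bergman_int n v) vi => [r|//|//] _; case: (bergman_int n w) wi => [r'|//|//] _ _ _.
by rewrite -EFinD -EFinM ltry.
Qed.

Lemma bergmanB n v w : bergman n v -> bergman n w -> bergman n (v - w).
Proof.
by move=> bv bw; rewrite -scaleN1r; apply: bergmanD => //; exact: bergmanZ.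
Qed.

Lemma bergman_expands n v : bergman n v -> exists b, forall s, 0 <= s < 1 -> expands b v s.
Proof. by move=> [_ hv _]; exact: holomorphic_expands. Qed.

(** [bergman_coef_le1] for t v reads t |b_k| <= K (1 + t^2 B). The choice t = B^(-1/2) makes this
    linear in the norm; for B = 0, arbitrarily large t force b_k = 0. *)
Lemma bergman_coef_le n : exists2 C : R, 0 <= C & forall v b k, bergman n v ->
  (forall s, 0 <= s < 1 -> expands b v s) ->
  modulus (b k) <= C * k.+1%:R ^+ (2 * n.+3) * bergman_norm n v.
Proof.
have [C C0 hC] := bergman_coef_le1 (R := R) n; exists (2 * C); first by rewrite mulr_ge0.
move=> v b k [v0 hv vi] hb; rewrite -/(bergman_int n v) in vi.
rewrite bergman_normE; have B0 := bergman_int_ge0 n v.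
have BE : bergman_int n v = (fine (bergman_int n v))%:E by rewrite fineK// ge0_fin_numE.
set B := fine _ in BE *; rewrite BE lee_fin in B0.
set K := C * k.+1%:R ^+ (2 * n.+3).
have K0 : 0 <= K by apply: mulr_ge0 => //; exact: exprn_ge0.
have main t : 0 < t -> t * modulus (b k) <= K * (1 + t ^+ 2 * B).
  move=> t0; have := @hC (ofR t *: v) (fun k => ofR t * b k) k (t ^+ 2 * B).
  rewrite modulusM modulus_ofR gtr0_norm//; apply.
  - by move=> z dz; rewrite -[(_ *: v) z]/(ofR t * v z) v0// mulr0.
  - by move=> s s01; exact: expandsZ (hb s s01).
  - by rewrite bergman_intZ// BE -EFinM modulus_ofR gtr0_norm.
have -> : 2 * C * k.+1%:R ^+ (2 * n.+3) = 2 * K by rewrite /K; ring.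
have [Bp|] := ltP 0 B.
  have N0 : 0 < Num.sqrt B by rewrite sqrtr_gt0.
  have iN : 0 < (Num.sqrt B)^-1 by rewrite invr_gt0.
  have := main _ iN; rewrite exprVn sqr_sqrtr ?(ltW Bp)// mulVf ?gt_eqF//.
  by rewrite mulrC ler_pdivrMr//; lra.
move=> Bn; have {B0 Bn} B00 : B = 0 by apply/eqP; rewrite eq_le Bn B0.
rewrite B00 sqrtr0 mulr0; apply/ler_addgt0Pl => e e0; rewrite addr0.
have t0 : 0 < (K + 1) / e by rewrite divr_gt0// ltr_wpDl.
have := main _ t0; rewrite B00 mulr0 addr0 mulr1 => h.
have : (K + 1) * modulus (b k) <= (K + 1) * e.
  apply: (@le_trans _ _ (K * e)); last by rewrite ler_wpM2r ?(ltW e0)//; lra.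
  by move: h; rewrite mulrAC ler_pdivrMr.
by rewrite ler_pM2l// ltr_wpDl.
Qed.

End bergman_space.

(** * Rotations and their derivative on coefficients *)

Section smooth_vectors.
Context {R : realType}.
Implicit Types (v w : cplx R -> cplx R) (n k : nat) (a b c : nat -> cplx R) (X : 'M[cplx R]_2)
  (F : 'M[cplx R]_2 -> cplx R -> cplx R).

Lemma eitX t m : eit (m%:R * t) = eit t ^+ m :> cplx R.
Proof.
elim: m => [|m IH]; first by rewrite mul0r eit0.
by rewrite exprS -IH -eitD -natr1 mulrDl mul1r addrC.
Qed.

Lemma eitN_inv t : eit (- t) = (eit t)^-1 :> cplx R.
Proof.
have t0 : eit t != 0 :> cplx R by rewrite -modulus_gt0 eit_sqr.
by apply: (mulfI t0); rewrite -eitD subrr eit0 divff.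
Qed.

Definition rotmx (s : R) : 'M[cplx R]_2 := expmx (ofR s *: rot_gen).

Lemma rotmxE s : rotmx s = mx22 (eit s) 0 0 (eit (- s)). Proof. exact: expmx_rot. Qed.

Lemma SU11_rotmx s : SU11 (rotmx s). Proof. rewrite rotmxE; exact: SU11_rot. Qed.

Lemma rotmxD s t : rotmx s *m rotmx t = rotmx (s + t).
Proof.
apply/matrixP => i j; rewrite !rotmxE mx22_mul !mxE/=.
by case: (ord2E i) => ->; case: (ord2E j) => -> /=;
  rewrite ?(mul0r, mulr0, addr0, add0r) -?eitD -?opprD.
Qed.

Lemma discrete_series_rot n s v z : modulus z < 1 ->
  discrete_series n (rotmx s) v z = eit (- (n%:R * s)) * v (eit (- (2 * s)) * z).
Proof.
move=> z1; rewrite discrete_seriesE// /mobius_den /mobius_num rotmxE !mxE/=.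
rewrite oppr0 mul0r add0r addr0 -exprVn -eitN_inv mulrAC -eitD -mulrN eitX; congr (_ * v _).
by congr (eit _ * _); ring.
Qed.

Lemma point_of_linear2 (p q x y : R) :
  point_of (linear2 p (- q) q p (x, y)) = (ofR p + imag * ofR q) * point_of (x, y).
Proof.
rewrite -[linear2 _ _ _ _ _]/(p * x + - q * y, q * x + p * y) !point_ofE.
by apply: complex_eq; rewrite !partE; ring.
Qed.

(** The automorphy factor of a rotation has modulus 1 and the weight is radial, so the integral is
    that of v composed with a rotation of the plane, under which Lebesgue measure is invariant. *)
Lemma bergman_rot n s v : bergman n v -> bergman n (discrete_series n (rotmx s) v).
Proof.
move=> [v0 hv vi]; split.
- by move=> z /discE/negP; rewrite -leNgt => z1; rewrite discrete_series_out.
- exact: holomorphic_discrete_series (SU11_rotmx s) hv.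
apply: le_lt_trans vi; rewrite le_eqVlt; apply/orP; left; apply/eqP.
rewrite integral_mkcond [RHS]integral_mkcond.
set f := ((fun p : plane R => (modulus (v (point_of p)) ^+ 2 * weight n (point_of p))%:E) \_ _)%E.
have f0 p : (0 <= f p)%E.
  by rewrite /f/patch; case: ifPn => // /set_mem dp; exact: (bergman_density_ge0 n v dp).
have mf : measurable_fun setT f.
  apply/(measurable_restrictT _ measurable_disc); exact: (measurable_bergman_density n hv).
have cs : cos (- (2 * s)) ^+ 2 + sin (- (2 * s)) ^+ 2 = 1 by exact: cos2Dsin2.
rewrite -(rotation_invariant cs mf f0); apply: eq_integral => -[x y] _.
have e : point_of (linear2 (cos (- (2 * s))) (- sin (- (2 * s))) (sin (- (2 * s))) (cos (- (2 * s))) (x, y)) =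
    eit (- (2 * s)) * point_of (x, y).
  exact: point_of_linear2.
have m1 : modulus (eit (- (2 * s)) * point_of (x, y)) = modulus (point_of (x, y)).
  by rewrite modulusM eit_sqr mul1r.
rewrite /f /patch; have [p1|p1] := ltP (modulus (point_of (x, y))) 1; last first.
  by rewrite !memNset//= ?e => /discE; rewrite ?m1 ltNge p1.
rewrite !mem_set/= ?e; [|by apply/discE; rewrite m1|exact/discE].
by rewrite discrete_series_rot// modulusM eit_sqr mul1r /weight m1.
Qed.

(** The eigenvalue of pi_n(exp(s rot_gen)) on z^k: e^(-ins) from the automorphy factor, e^(-2iks)
    from the rotation of the disc by -2s. *)
Definition rot_char n k (s : R) : cplx R := eit (- ((n + k.*2)%:R * s)).

Lemma expands_rot n s v a : bergman n v -> (forall r, 0 <= r < 1 -> expands a v r) ->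
  forall r, 0 <= r < 1 -> expands (fun k => rot_char n k s * a k) (discrete_series n (rotmx s) v) r.
Proof.
move=> _ ha r r01; have [[M hM] hs] := ha r r01; split.
  by exists M => k; rewrite modulusM eit_sqr mul1r.
move=> z zr; have z1 : modulus z < 1 by case/andP: r01 => _; exact: lt_trans.
have m1 : modulus (eit (- (2 * s)) * z) = modulus z by rewrite modulusM eit_sqr mul1r.
rewrite discrete_series_rot//.
have -> : (fun m => \sum_(k < m) rot_char n k s * a k * z ^+ k) =
   (fun m => eit (- (n%:R * s)) * \sum_(k < m) a k * (eit (- (2 * s)) * z) ^+ k).
  apply/funext => m; rewrite mulr_sumr; apply: eq_bigr => k _.
  rewrite exprMn -eitX /rot_char.
  have -> : - ((n + k.*2)%:R * s) = - (n%:R * s) + k%:R * - (2 * s).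
    by rewrite natrD -mul2n natrM; ring.
  by rewrite eitD; ring.
by apply: cvgM; [exact: cvg_cst|apply: hs; rewrite m1].
Qed.

Lemma rot_char_diff n k : exists2 C : R, 0 <= C & forall s t, t != 0 -> C * `|t| <= 1 ->
  modulus ((ofR t)^-1 * (rot_char n k (s + t) - rot_char n k s) +
     imag * (n + k.*2)%:R * rot_char n k s) <= C * `|t|.
Proof.
have [C C0 hC] := expmx_taylor (rot_gen : 'M[cplx R]_2); pose m : R := (n + k.*2)%:R.
have m0 : 0 <= m by rewrite ler0n.
exists (m + C * m ^+ 2); first by rewrite addr_ge0// mulr_ge0// sqr_ge0.
move=> s t t0 tC; have mt : `|- (m * t)| <= 1.
  rewrite normrN normrM (ger0_norm m0).
  by apply: le_trans tC; rewrite ler_wpM2r// lerDl mulr_ge0 ?sqr_ge0.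
have := hC _ mt 0 0; rewrite expmx_rot !mxE/= mulr1n => h.
rewrite /rot_char -/m.
have -> : - (m * (s + t)) = - (m * s) + - (m * t) by ring.
rewrite eitD.
have -> : (ofR t)^-1 * (eit (- (m * s)) * eit (- (m * t)) - eit (- (m * s))) +
    imag * (n + k.*2)%:R * eit (- (m * s)) =
   eit (- (m * s)) * ((ofR t)^-1 * (eit (- (m * t)) - 1 - ofR (- (m * t)) * imag)).
  rewrite ofRN ofRM ofR_nat; field.
  by rewrite ofR_eq0.
rewrite modulusM eit_sqr mul1r modulusM modulusV modulus_ofR.
rewrite ler_pdivrMl ?normr_gt0//; apply: le_trans h _.
rewrite normrN normrM (ger0_norm m0) exprMn.
have : 0 <= m * `|t| ^+ 2 by rewrite mulr_ge0 ?sqr_ge0.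
lra.
Qed.

(** A coefficient is a continuous functional for the Bergman norm by [bergman_coef_le], so the
    coefficients of the derivative are the derivatives in s of [rot_char n k s * c k]. *)
Lemma lie_derivative_coef n F F' c :
  is_lie_derivative n rot_gen F F' -> (forall s, bergman n (F (rotmx s))) ->
  (forall s r, 0 <= r < 1 -> expands (fun k => rot_char n k s * c k) (F (rotmx s)) r) ->
  forall s r, 0 <= r < 1 ->
   expands (fun k => rot_char n k s * (- (imag * (n + k.*2)%:R) * c k)) (F' (rotmx s)) r.
Proof.
move=> FF' bF cF s r r01; have [bF' lim] := FF' _ (SU11_rotmx s).
have [b hb] := bergman_expands bF'.
suff -> : (fun k => rot_char n k s * (- (imag * (n + k.*2)%:R) * c k)) = b by exact: hb.
apply/funext => k; have [C C0 hC] := bergman_coef_le (R := R) n.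
have [C' C'0 hC'] := @rot_char_diff n k.
pose K := C * k.+1%:R ^+ (2 * n.+3); have K0 : 0 <= K by rewrite mulr_ge0// exprn_ge0.
apply/eqP; rewrite -subr_eq0 -modulus_eq0 eq_le modulus_ge0 andbT.
apply/ler_addgt0Pl => e e0; rewrite addr0.
have K1 : 0 < K + 1 by rewrite ltr_wpDl.
have C''0 : 0 < C' + 1 by rewrite ltr_wpDl.
pose D := modulus (c k).
have D0 : 0 <= D := modulus_ge0 _.
have hlim : \forall t \near (0 : R)^', `|bergman_norm n (ofR t^-1 *: (F (rotmx s *m expmx (ofR t *: rot_gen)) - F (rotmx s)) - F' (rotmx s))| < e / 2 / (K + 1).
  have /cvgrPdist_lt/(_ (e / 2 / (K + 1))) := lim; rewrite !divr_gt0// => /(_ isT).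
  by apply: filterS => t; rewrite sub0r normrN.
have tsm : \forall t \near (0 : R)^', `|t| < Order.min (C' + 1)^-1 (e / 2 / (C' * D + 1)).
  apply: dnbhs0_lt; rewrite lt_min invr_gt0 C''0 divr_gt0// ?divr_gt0// ltr_wpDl// mulr_ge0//.
have [t [t0 [ht1 ht2]]] : exists t : R, t != 0 /\ `|bergman_norm n (ofR t^-1 *: (F (rotmx s *m expmx (ofR t *: rot_gen)) - F (rotmx s)) - F' (rotmx s))| < e / 2 / (K + 1) /\ `|t| < Order.min (C' + 1)^-1 (e / 2 / (C' * D + 1)).
  have : \forall t \near (0 : R)^', t != 0 by exact: nbhs_dnbhs_neq.
  by move=> tn; have [t [h1 [h2 h3]]] := filter_ex (filterI tn (filterI hlim tsm)); exists t.
rewrite -/(rotmx t) rotmxD in ht1.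
move: ht2; rewrite lt_min => /andP[t1 t2].
pose q := ofR t^-1 *: (F (rotmx (s + t)) - F (rotmx s)) - F' (rotmx s).
have bq : bergman n q by apply: bergmanB => //; apply: bergmanZ; exact: bergmanB.
have eq_ r' : 0 <= r' < 1 -> expands (fun k => ofR t^-1 * (rot_char n k (s + t) * c k - rot_char n k s * c k) - b k) q r'.
  move=> h; have r0 : 0 <= r' by case/andP: h.
  exact: (expandsB r0 (expandsZ _ (expandsB r0 (cF _ _ h) (cF _ _ h))) (hb _ h)).
have := hC q _ k bq eq_; rewrite -/K => h1.
have h1' : modulus (ofR t^-1 * (rot_char n k (s + t) * c k - rot_char n k s * c k) - b k) <= e / 2.
  apply: le_trans h1 _; apply: (@le_trans _ _ ((K + 1) * (e / 2 / (K + 1)))); last first.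
    by rewrite mulrC divfK ?gt_eqF.
  have := le_lt_trans (ler_norm _) ht1; rewrite -/q => ht.
  apply: (@le_trans _ _ (K * (e / 2 / (K + 1)))); first by rewrite ler_wpM2l// ltW.
  by rewrite ler_wpM2r ?divr_ge0 ?(ltW e0) ?(ltW K1)//; lra.
have tC : C' * `|t| <= 1.
  apply: (@le_trans _ _ ((C' + 1) * `|t|)); first by rewrite ler_wpM2r//; lra.
  by rewrite mulrC -ler_pdivlMr// mul1r ltW.
have h2 := hC' s t t0 tC.
have h2' : modulus (ofR t^-1 * (rot_char n k (s + t) * c k - rot_char n k s * c k) -
    rot_char n k s * (- (imag * (n + k.*2)%:R) * c k)) <= e / 2.
  have -> : ofR t^-1 * (rot_char n k (s + t) * c k - rot_char n k s * c k) -
    rot_char n k s * (- (imag * (n + k.*2)%:R) * c k) =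
    ((ofR t)^-1 * (rot_char n k (s + t) - rot_char n k s) + imag * (n + k.*2)%:R * rot_char n k s) * c k.
    by rewrite ofRV; ring.
  rewrite modulusM; apply: (@le_trans _ _ (C' * `|t| * D)); first by rewrite ler_wpM2r.
  have CD : 0 < C' * D + 1 by rewrite ltr_wpDl// mulr_ge0.
  move: t2; rewrite ltr_pdivlMr// => t2.
  rewrite mulrAC mulrC; apply: le_trans (ltW t2); rewrite ler_wpM2l//; lra.
move: h1' h2'; set u := ofR t^-1 * _ ; set x := rot_char _ _ _ * (- _ * _).
move=> h1' h2'; have := modulusB (u - b k) (u - x).
have -> : u - b k - (u - x) = x - b k by ring.
lra.
Qed.

End smooth_vectors.

(** * Smooth vectors as rapidly decreasing sequences *)

Section smooth_vectors_coefficients.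
Context {R : realType}.
Implicit Types (v w : cplx R -> cplx R) (n k : nat) (a b c : nat -> cplx R) (X : 'M[cplx R]_2)
  (F : 'M[cplx R]_2 -> cplx R -> cplx R) (Xs : seq 'M[cplx R]_2).

Lemma class_C_coef n J F c : class_C n J F -> (forall s, bergman n (F (rotmx s))) ->
  (forall s r, 0 <= r < 1 -> expands (fun k => rot_char n k s * c k) (F (rotmx s)) r) ->
  exists2 w, bergman n w & forall r, 0 <= r < 1 ->
    expands (fun k => (- (imag * (n + k.*2)%:R)) ^+ J * c k) w r.
Proof.
elim: J F c => [|J IH] F c CF bF cF.
  exists (F (rotmx 0)) => // r r01; have := cF 0 r r01; congr expands; apply/funext => k.
  by rewrite /rot_char mulr0 oppr0 eit0.
have [_ /(_ rot_gen su11_rot)[F' FF' CF']] := CF.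
have bF' s : bergman n (F' (rotmx s)) by have [] := FF' _ (SU11_rotmx s).
have [w bw hw] := IH F' _ CF' bF' (lie_derivative_coef FF' bF cF).
exists w => // r r01; have := hw r r01; congr expands; apply/funext => k.
by rewrite exprSr mulrA.
Qed.

(** Each derivative supplies a factor n + 2k >= k + 1, as n > 0. Of the m + 2 (n+3) derivatives, 2
    (n+3) pay for the polynomial loss of [bergman_coef_le] and m remain. *)
Lemma coef_decay n m k (z : cplx R) (K : R) : (0 < n)%N ->
  modulus ((- (imag * (n + k.*2)%:R)) ^+ (m + 2 * n.+3) * z) <= K * k.+1%:R ^+ (2 * n.+3) ->
  modulus z * k.+1%:R ^+ m <= K.
Proof.
move=> n0; rewrite modulusM modulusX modulusN modulusM modulus_imag mul1r modulus_nat => h.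
have k0 : 0 < k.+1%:R ^+ (2 * n.+3) :> R by rewrite exprn_gt0.
rewrite -(ler_pM2r k0) -mulrA -exprD; apply: le_trans h; rewrite mulrC ler_wpM2r ?modulus_ge0//.
rewrite lerXn2r ?nnegrE ?ler0n// ler_nat -mul2n; lia.
Qed.

Lemma expands_psE n v a : (forall z, ~ disc z -> v z = 0) ->
  (forall r, 0 <= r < 1 -> expands a v r) -> v = ps a.
Proof.
move=> v0 ha; apply/funext => z; have [z1|z1] := ltP (modulus z) 1; last first.
  by rewrite ps_out// v0// => /discE; rewrite ltNge z1.
rewrite psE//; have r1 : 0 <= (1 + modulus z) / 2 < 1.
  by have := modulus_ge0 z; move=> m0; apply/andP; split; lra.
have [_ /(_ z) h] := ha _ r1; have zr : modulus z < (1 + modulus z) / 2 by lra.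
by rewrite (@cvg_csum _ (fun k => a k * z ^+ k) (v z) (h zr)).
Qed.

(** The converse of [smooth_ps]: the derivatives along the rotations, of every order, give
    coefficients of polynomial growth, and [coef_decay] turns them into decay. *)
Lemma smooth_psE n v : (0 < n)%N -> smooth_vector n v -> exists2 a, rdec a & v = ps a.
Proof.
move=> n0 [bv Cv]; have [a ha] := bergman_expands bv.
have v0 : forall z, ~ disc z -> v z = 0 by case: bv.
exists a; last exact: expands_psE v0 ha.
move=> m; have [C C0 hC] := bergman_coef_le (R := R) n.
have [w bw hw] := class_C_coef (Cv (m + 2 * n.+3)%N) (fun s => bergman_rot s bv)
  (fun s => expands_rot s bv ha).
exists (C * bergman_norm n w) => k; apply: (coef_decay n0).
by rewrite mulrAC; exact: hC bw hw.
Qed.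

(** [dpi] is defined by choice, so the limit must be unique: two limits of the same quotients in the
    Bergman norm have the same coefficients. *)
Lemma dpi_ps n X a : su11 X -> rdec a -> dpi n X (ps a) = ps (lie_coef n X a).
Proof.
move=> sX ra; have rl := rdec_lie n X ra.
have [_] := lie_derivative_ps n sX ra SU11_1.
rewrite !ps_discrete_series1; under eq_fun do rewrite mul1mx; move=> lim.
have bl := bergman_ps1 n rl.
rewrite /dpi; case: xgetP => [w _ [bw limw]|/(_ (ps (lie_coef n X a)))[]//].
have [b hb] := bergman_expands bw.
have w0 : forall z, ~ disc z -> w z = 0 by case: bw.
rewrite (expands_psE n w0 hb); congr ps; apply/funext => k.
have [C C0 hC] := bergman_coef_le (R := R) n.
pose K := C * k.+1%:R ^+ (2 * n.+3); have K0 : 0 <= K by rewrite mulr_ge0// exprn_ge0.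
have K1 : 0 < K + 1 by rewrite ltr_wpDl.
apply/eqP; rewrite -subr_eq0 -modulus_eq0 eq_le modulus_ge0 andbT.
apply/ler_addgt0Pl => e e0; rewrite addr0.
have d0 : 0 < e / 2 / (K + 1) by rewrite !divr_gt0.
move/cvgrPdist_lt/(_ _ d0): lim => near1; move/cvgrPdist_lt/(_ _ d0): limw => near2.
have [t [h1 h2]] := filter_ex (filterI near1 near2); move: h1 h2; rewrite !sub0r !normrN.
set q := ofR t^-1 *: _.
have bq : bergman n q.
  apply: bergmanZ; apply: bergmanB; last exact: bergman_ps1.
  by apply: bergman_ps ra; rewrite -[expmx _]/(expmx (ofR t *: X)); exact: sX.
have [u hu] := bergman_expands bq.
have bd w' c : bergman n w' -> (forall r, 0 <= r < 1 -> expands c w' r) ->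
    `|bergman_norm n (q - w')| < e / 2 / (K + 1) -> modulus (u k - c k) <= e / 2.
  move=> bw' hc /(le_lt_trans (ler_norm _)) h.
  have hq r : 0 <= r < 1 -> expands (fun k => u k - c k) (q - w') r.
    by move=> r01; have [r0 _] := andP r01; exact: expandsB r0 (hu r r01) (hc r r01).
  apply: le_trans (hC _ _ k (bergmanB bq bw') hq) _; rewrite -/K.
  apply: (@le_trans _ _ ((K + 1) * (e / 2 / (K + 1)))); last by rewrite mulrC divfK ?gt_eqF.
  apply: (@le_trans _ _ (K * (e / 2 / (K + 1)))); first by rewrite ler_wpM2l// ltW.
  by rewrite ler_wpM2r ?(ltW d0)//; lra.
move=> /(bd _ _ bl (expands_ps (rdec_pbound rl))) g1 /(bd _ _ bw hb) g2.
have := modulusB (u k - lie_coef n X a k) (u k - b k).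
have -> : u k - lie_coef n X a k - (u k - b k) = b k - lie_coef n X a k by ring.
lra.
Qed.

Lemma foldr_dpi_ps n Xs a : (forall X, X \in Xs -> su11 X) -> rdec a ->
  rdec (foldr (lie_coef n) a Xs) /\ foldr (dpi n) (ps a) Xs = ps (foldr (lie_coef n) a Xs).
Proof.
elim: Xs => [|X Xs IH] //= hX ra.
have [|r e] := IH _ ra; first by move=> Y hY; apply: hX; rewrite inE hY orbT.
split; first exact: rdec_lie.
by rewrite e dpi_ps//; apply: hX; rewrite inE eqxx.
Qed.

Lemma foldr_lie_bound n Xs m : exists2 C : R, 0 <= C & forall a T,
  rdec_by (size Xs + m) T a -> rdec_by m (C * T) (foldr (lie_coef n) a Xs).
Proof.
elim: Xs m => [|X Xs IH] m; first by exists 1 => // a T; rewrite mul1r.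
have [C C0 hC] := IH m.+1; have [C' C'0 hC'] := rdec_by_lie n X m.
exists (C' * C); first exact: mulr_ge0.
by move=> a T /=; rewrite addSnnS => /hC /hC'; rewrite mulrA.
Qed.

(** Together with [coef_le_smooth_seminorm] this identifies the Frechet topology on smooth vectors
    with that of rapidly decreasing sequences: each family of seminorms controls the other. *)
Lemma smooth_seminorm_ps n Xs : (forall X, X \in Xs -> su11 X) ->
  exists2 C : R, 0 <= C & forall a T, rdec a -> rdec_by (size Xs + 2) T a ->
    smooth_seminorm n Xs (ps a) <= C * T.
Proof.
move=> hX; have [C C0 hC] := foldr_lie_bound n Xs 2; exists (4 * C); first exact: mulr_ge0.
move=> a T ra aT; rewrite /smooth_seminorm; have [_ ->] := foldr_dpi_ps n hX ra.
apply: le_trans (bergman_norm_le (B := 2 * (C * T)) n _) _; last by rewrite !mulrA -natrM.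
by move=> z _; exact: ps_le (hC _ _ aT).
Qed.

Lemma lie_coef_rot n a k : lie_coef n rot_gen a k = - (imag * (n + k.*2)%:R) * a k.
Proof.
rewrite /lie_coef /rot_gen !mxE/= !(mulr0, mul0r, oppr0, add0r, addr0).
case: k => [|k]; first by rewrite mulr0 !addr0 double0 addn0; ring.
by rewrite /shiftr /deriv_coef natrD -mul2n natrM; ring.
Qed.

(** On coefficients the rotation generator is multiplication by -i (n + 2k), so its powers alone
    control every weighted sup norm. *)
Lemma coef_le_smooth_seminorm n m : (0 < n)%N -> exists2 C : R, 0 <= C &
  forall a, rdec a ->
    rdec_by m (C * smooth_seminorm n (nseq (m + 2 * n.+3) rot_gen) (ps a)) a.
Proof.
move=> n0; have [C C0 hC] := bergman_coef_le (R := R) n; exists C => // a ra k.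
have hX X : X \in nseq (m + 2 * n.+3) rot_gen -> su11 X.
  by rewrite mem_nseq => /andP[_ /eqP->]; exact: su11_rot.
have [rl e] := foldr_dpi_ps n hX ra; rewrite /smooth_seminorm e.
apply: (coef_decay n0); rewrite mulrAC.
have -> : (- (imag * (n + k.*2)%:R)) ^+ (m + 2 * n.+3) * a k =
    foldr (lie_coef n) a (nseq (m + 2 * n.+3) rot_gen) k.
  elim: (m + _)%N => [|j IH]; first by rewrite mul1r.
  by rewrite /= lie_coef_rot -IH exprS mulrA.
exact: hC (bergman_ps1 n rl) (expands_ps (rdec_pbound rl)).
Qed.

End smooth_vectors_coefficients.

(** * Distribution vectors as coefficient sequences *)

Section distributions.
Context {R : realType}.
Implicit Types (v w : cplx R -> cplx R) (n k m : nat) (a b c : nat -> cplx R)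
  (phi : (cplx R -> cplx R) -> cplx R) (Xs : seq 'M[cplx R]_2) (T : R).

Definition delta k : nat -> cplx R := fun j => (j == k)%:R.

Lemma rdec_by_delta k m : rdec_by m (k.+1%:R ^+ m) (delta k).
Proof.
move=> j; rewrite /delta; case: eqP => [->|_]; first by rewrite modulus1 mul1r.
by rewrite modulus0 mul0r exprn_ge0.
Qed.

Lemma rdec_delta k : rdec (delta k).
Proof. by move=> m; exists (k.+1%:R ^+ m); exact: rdec_by_delta. Qed.

Lemma rdec0 : rdec (fun=> 0 : cplx R).
Proof. by move=> m; exists 0 => k; rewrite modulus0 mul0r. Qed.

Lemma ps0 : ps (fun=> 0) = 0 :> (cplx R -> cplx R).
Proof.
apply/funext => z; have := psZ 0 z (rdec_pbound rdec0); rewrite !mul0r.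
by move=> ->.
Qed.

Lemma psP (t : cplx R) a b : rdec a -> rdec b ->
  t *: ps a + ps b = ps (fun k => t * a k + b k).
Proof.
move=> ra rb; apply/funext => z; rewrite psD; last exact: rdec_pbound rb.
  by rewrite psZ//; exact: rdec_pbound.
exact: rdec_pbound (rdecZ _ ra).
Qed.

Lemma dist_ps0 n phi : distribution_vector n phi -> phi 0 = 0.
Proof.
move=> [_ lin _]; have s0 : smooth_vector n (0 : cplx R -> cplx R).
  by rewrite -ps0; exact: smooth_ps rdec0.
have := lin (-1) 0 0 s0 s0; rewrite scaler0 addr0 rmorphN rmorph1 mulN1r addNr.
by [].
Qed.

Lemma dist_psP n phi (t : cplx R) a b : distribution_vector n phi -> rdec a -> rdec b ->
  phi (ps (fun k => t * a k + b k)) = t^* * phi (ps a) + phi (ps b).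
Proof. by move=> [_ lin _] ra rb; rewrite -psP// lin//; exact: smooth_ps. Qed.

Lemma dist_psZ n phi (t : cplx R) a : distribution_vector n phi -> rdec a ->
  phi (ps (fun k => t * a k)) = t^* * phi (ps a).
Proof.
move=> dv ra; have := dist_psP t dv ra rdec0; rewrite ps0 (dist_ps0 dv) addr0 => <-.
by congr (phi (ps _)); apply/funext => k; rewrite addr0.
Qed.

Lemma seminorms_bound n (L : seq (seq 'M[cplx R]_2)) :
  (forall Xs X, Xs \in L -> X \in Xs -> su11 X) ->
  exists m, exists2 C : R, 0 <= C & forall a T, rdec a -> rdec_by m T a ->
    forall Xs, Xs \in L -> smooth_seminorm n Xs (ps a) <= C * T.
Proof.
elim: L => [|Xs L IH] hL; first by exists 0%N, 0.
have [|m [C C0 hC]] := IH; first by move=> Ys X hY; apply: hL; rewrite inE hY orbT.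
have [|C' C'0 hC'] := @smooth_seminorm_ps R n Xs.
  by move=> X; apply: hL; rewrite inE eqxx.
exists (maxn m (size Xs + 2)), (C + C'); first exact: addr_ge0.
move=> a T ra aT Ys; rewrite inE; have T0 := rdec_by_ge0 aT.
have h1 : 0 <= C * T := mulr_ge0 C0 T0; have h2 : 0 <= C' * T := mulr_ge0 C'0 T0.
case/orP => [/eqP->|YL]; rewrite mulrDl.
  apply: le_trans (hC' a T ra (rdec_byW (leq_maxr _ _) aT)) _; lra.
apply: le_trans (hC a T ra (rdec_byW (leq_maxl _ _) aT) Ys YL) _; lra.
Qed.

(** A neighborhood of 0 on which |phi| < 1 involves finitely many seminorms, all bounded by one
    weighted sup norm; scaling the vector into this neighborhood gives the estimate. *)
Lemma distribution_le n phi : distribution_vector n phi ->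
  exists m, exists2 K : R, 0 <= K & forall a T, rdec a -> rdec_by m T a ->
    modulus (phi (ps a)) <= K * T.
Proof.
move=> dv; have v0 := dist_ps0 dv.
have s0 : smooth_vector n (0 : cplx R -> cplx R) by rewrite -ps0; exact: smooth_ps rdec0.
have [_ _ /(_ 0 s0)] := dv; rewrite v0 => cv.
have A1 : nbhs (0 : cplx R) [set z | modulus z < 1].
  by apply/nbhs_cplxP; exists 1 => // w; rewrite subr0.
have [[L e] [/= hL e0] hLe] := cv _ A1.
have [m [C C0 hC]] := seminorms_bound n hL.
have C1 : 0 < C + 1 by rewrite ltr_wpDl.
exists m, ((C + 1) / e); first by rewrite divr_ge0// ltW.
move=> a T ra aT; have T0 := rdec_by_ge0 aT.
(* The scaling factor has T in its denominator; for T = 0 the sequence itself is 0. *)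
have [T00|Tn] := eqVneq T 0.
  have -> : a = (fun=> 0).
    apply/funext => k; have := aT k; rewrite T00 => h; apply/eqP.
    rewrite -modulus_eq0 eq_le modulus_ge0 andbT.
    by rewrite -(@pmulr_lle0 _ (k.+1%:R ^+ m)) ?exprn_gt0// mulrC.
  by rewrite ps0 v0 modulus0 T00 mulr0.
have Tp : 0 < T by rewrite lt_neqAle eq_sym Tn.
pose t := e / ((C + 1) * T); have t0 : 0 < t by rewrite divr_gt0// mulr_gt0.
have rta := rdecZ (ofR t) ra.
have := hLe (ps (fun k => ofR t * a k)).
rewrite /= (dist_psZ _ dv ra) conj_ofR modulusM modulus_ofR gtr0_norm// => h.
have {h} : t * modulus (phi (ps a)) < 1.
  apply: h; split; first exact: smooth_ps.
  move=> Xs XsL; rewrite subr0.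
  apply: le_lt_trans (hC _ _ rta (rdec_byZ (ofR t) aT) Xs XsL) _.
  rewrite modulus_ofR gtr0_norm// /t.
  have -> : C * (e / ((C + 1) * T) * T) = e * (C / (C + 1)) by field; rewrite !gt_eqF.
  by rewrite -[ltRHS]mulr1 ltr_pM2l// ltr_pdivrMr// mul1r; lra.
rewrite /t mulrAC ltr_pdivrMr ?mulr_gt0// mul1r => h.
by rewrite mulrAC ler_pdivlMr// mulrC ltW.
Qed.

Definition dcoef phi : nat -> cplx R := fun k => phi (ps (delta k)).

Lemma dcoef_pbound n phi : distribution_vector n phi -> pbound (dcoef phi).
Proof.
move=> /distribution_le[m [K K0 hK]]; exists m, K => k.
exact: hK (rdec_delta k) (rdec_by_delta k m).
Qed.

Definition trunc N a : nat -> cplx R := fun k => if (k < N)%N then a k else 0.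

Lemma rdec_trunc N a : rdec a -> rdec (trunc N a).
Proof.
move=> ra m; have [B aB] := ra m; exists B => k; rewrite /trunc; case: ifP => // _.
by rewrite modulus0 mul0r (rdec_by_ge0 aB).
Qed.

Lemma truncS N a k : trunc N.+1 a k = a N * delta N k + trunc N a k.
Proof.
rewrite /trunc /delta ltnS leq_eqVlt; case: eqVneq => [->|kN] /=.
  by rewrite ltnn mulr1 addr0.
by rewrite mulr0 add0r.
Qed.

Lemma dist_trunc n phi N a : distribution_vector n phi -> rdec a ->
  phi (ps (trunc N a)) = \sum_(k < N) (a k)^* * dcoef phi k.
Proof.
move=> dv ra; elim: N => [|N IH].
  rewrite big_ord0 -(dist_ps0 dv) -ps0; congr (phi (ps _)).
  rewrite big_ord_recr/= -IH [RHS]addrC.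
rewrite -(dist_psP _ dv (rdec_delta N) (rdec_trunc N ra)).
by congr (phi (ps _)); apply/funext => k; rewrite truncS.
Qed.

Lemma asum_pairing m (B : R) T a c : (forall k, modulus (c k) <= B * k.+1%:R ^+ m) ->
  rdec_by (m + 2) T a -> asum (fun k => (a k)^* * c k) (2 * (T * B)).
Proof.
move=> cB aT; apply: asum_sqr => k; rewrite modulusM modulus_conj.
have B0 : 0 <= B by have := le_trans (modulus_ge0 _) (cB 0%N); rewrite expr1n mulr1.
apply: (@le_trans _ _ (modulus (a k) * k.+1%:R ^+ (m + 2) * B)).
  have q0 : 0 <= modulus (a k) * k.+1%:R ^+ 2 by rewrite mulr_ge0 ?modulus_ge0 ?exprn_ge0.
  have := ler_wpM2l q0 (cB k); rewrite exprD.
  by move: (modulus _) (modulus _) (_ ^+ m) (_ ^+ 2) => x y z u; lra.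
by rewrite ler_wpM2r.
Qed.

(** The part of [a] from index N on has order-m norm at most T / (N+1), where T bounds it at order m
    + 1, so phi of the truncations tends to phi of the series. The conjugates reflect conjugate
    linearity. *)
Lemma distributionE n phi a : distribution_vector n phi -> rdec a ->
  phi (ps a) = csum (fun k => (a k)^* * dcoef phi k).
Proof.
move=> dv ra; apply/esym/cvg_csum; have [m [K K0 hK]] := distribution_le dv.
have [T aT] := ra m.+1; have T0 := rdec_by_ge0 aT.
apply/(cvg_cplxP _) => e e0; have KT : 0 <= K * T by exact: mulr_ge0.
have d0 : 0 < e / (K * T + 1) by rewrite divr_gt0// ltr_wpDl.
have := near_infty_natSinv_lt (PosNum d0); apply: filterS => N /= hN.
rewrite -(dist_trunc N dv ra) modulusC.
have -> : phi (ps a) - phi (ps (trunc N a)) = phi (ps (fun k => -1 * trunc N a k + a k)).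
  by rewrite (dist_psP _ dv (rdec_trunc N ra) ra) rmorphN rmorph1 mulN1r addrC.
have rt : rdec (fun k => -1 * trunc N a k + a k) := rdecD (rdecZ _ (rdec_trunc N ra)) ra.
apply: le_lt_trans (hK _ (T / N.+1%:R) rt _) _.
  move=> k; rewrite /trunc; case: ltnP => kN.
    by rewrite mulN1r addNr modulus0 mul0r divr_ge0.
  rewrite mulr0 add0r ler_pdivlMr//; apply: le_trans (aT k).
  by rewrite exprSr -mulrA !ler_wpM2l ?modulus_ge0 ?exprn_ge0 ?ler_nat.
rewrite mulrA; apply: (@le_lt_trans _ _ ((K * T + 1) / N.+1%:R)).
  by rewrite ler_wpM2r//; lra.
by rewrite mulrC -ltr_pdivlMr// ltr_wpDl.
Qed.

Definition coef_of v : nat -> cplx R := xget (fun=> 0) [set a | rdec a /\ v = ps a].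

Lemma coef_of_ps a : rdec a -> coef_of (ps a) = a.
Proof.
move=> ra; rewrite /coef_of; case: xgetP => [b _ [rb e]|/(_ a)[]//].
by apply/esym; apply: ps_inj e; exact: rdec_pbound.
Qed.

(** The inverse of [dcoef]. Extension by 0 outside the smooth vectors makes it Leibniz equal to the
    distribution vector with coefficients [c]. *)
Definition pairing n c v : cplx R :=
  if v \in smooth_vector n then csum (fun k => (coef_of v k)^* * c k) else 0.

Lemma pairing_ps n c a : rdec a -> pairing n c (ps a) = csum (fun k => (a k)^* * c k).
Proof. by move=> ra; rewrite /pairing mem_set ?coef_of_ps//; exact: smooth_ps. Qed.

Lemma distribution_pairing n phi : (0 < n)%N -> distribution_vector n phi ->
  phi = pairing n (dcoef phi).
Proof.
move=> n0 dv; apply/funext => v; have [sv|nsv] := pselect (smooth_vector n v).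
  by have [a ra ->] := smooth_psE n0 sv; rewrite pairing_ps//; exact: distributionE dv ra.
by rewrite /pairing memNset//; case: dv => ->.
Qed.

Lemma dcoef_pairing n c : dcoef (pairing n c) = c.
Proof.
apply/funext => k; rewrite /dcoef pairing_ps; last exact: rdec_delta.
rewrite (@csum_fin _ _ k.+1); last first.
  by move=> j jk; rewrite /delta gtn_eqF// rmorph0 mul0r.
rewrite big_ord_recr/= big1 ?add0r; first by rewrite /delta eqxx rmorph1 mul1r.
by move=> i _; rewrite /delta ltn_eqF// rmorph0 mul0r.
Qed.

(** Growth of order m is paired with decay of order m + 2, and a single rotation seminorm controls
    that decay, whence continuity. *)
Lemma pairing_distribution n c : (0 < n)%N -> pbound c -> distribution_vector n (pairing n c).
Proof.
move=> n0 [m [B cB]].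
have B0 : 0 <= B by have := le_trans (modulus_ge0 _) (cB 0%N); rewrite expr1n mulr1.
have sums a : rdec a -> exists S, asum (fun k => (a k)^* * c k) S.
  by move=> /(_ (m + 2))[T aT]; exists (2 * (T * B)); exact: asum_pairing aT.
have lin (t : cplx R) a b : rdec a -> rdec b ->
    pairing n c (ps (fun k => t * a k + b k)) = t^* * pairing n c (ps a) + pairing n c (ps b).
  move=> ra rb; have rab := rdecD (rdecZ t ra) rb; rewrite !pairing_ps//.
  have [S aS] := sums a ra; have [S' bS] := sums b rb.
  rewrite -(csumZ t^* aS) -(csumD (asumZ t^* aS) bS); congr csum; apply/funext => k.
  by rewrite rmorphD rmorphM mulrDl mulrA.
split.
- by move=> v nsv; rewrite /pairing memNset.
- move=> t v w sv sw; have [a ra ->] := smooth_psE n0 sv; have [b rb ->] := smooth_psE n0 sw.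
  by rewrite psP// lin.
move=> v sv A /nbhs_cplxP[d d0 dA].
have [C C0 hC] := @coef_le_smooth_seminorm R n (m + 2) n0.
set Xs := nseq _ _ in hC.
have K0 : 0 < 2 * (C * B) + 1 by rewrite ltr_wpDl// !mulr_ge0.
exists ([:: Xs], d / (2 * (C * B) + 1)).
  split=> /=; last by rewrite divr_gt0.
  move=> Ys X; rewrite inE => /eqP->; rewrite /Xs mem_nseq => /andP[_ /eqP->].
  exact: su11_rot.
move=> w [sw /(_ Xs)]; rewrite inE eqxx => /(_ isT) h; apply: dA.
have [a ra ea] := smooth_psE n0 sv; have [b rb eb] := smooth_psE n0 sw.
have ra' := rdecZ (-1) ra; have rba := rdecD ra' rb.
have e1 : w - v = ps (fun k => -1 * a k + b k) by rewrite -psP// ea eb scaleN1r addrC.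
have e2 : pairing n c w - pairing n c v = pairing n c (w - v).
  by rewrite e1 lin// rmorphN rmorph1 mulN1r ea eb addrC.
rewrite /= e2 e1 pairing_ps//; rewrite e1 in h.
apply: le_lt_trans (csum_le (asum_pairing cB (hC _ rba))) _.
move: h; rewrite ltr_pdivlMr//; set S := smooth_seminorm _ _ _ => h.
have [S0|S0] := leP 0 S; last first.
  by apply: le_lt_trans d0; have := mulr_ge0 C0 B0; nra.
by apply: le_lt_trans h; lra.
Qed.

End distributions.

(** * The voice transform *)

Section voice_transform.
Context {R : realType}.
Implicit Types (n k : nat) (a c : nat -> cplx R) (z q : cplx R)
  (phi : (cplx R -> cplx R) -> cplx R) (g : 'M[cplx R]_2).

(* The coefficients of the series of (1 - z)^-n *)
Definition negbin n k : nat := 'C((n + k).-1, k).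

Lemma negbin0 n : negbin n 0 = 1%N. Proof. exact: bin0. Qed.

Lemma negbinS n k : negbin n.+1 k.+1 = (negbin n.+1 k + negbin n k.+1)%N.
Proof. by rewrite /negbin !addSn !addnS/= binS addnC. Qed.

Lemma negbin_gt0 n k : (0 < n)%N -> (0 < negbin n k)%N.
Proof. by move=> n0; rewrite bin_gt0; lia. Qed.

Lemma negbin_le n k : (negbin n k <= k.+1 ^ n)%N.
Proof.
elim: n k => [|n IHn] k.
  by rewrite /negbin add0n; case: k => // k; rewrite bin_small.
elim: k => [|k IHk]; first by rewrite negbin0 exp1n.
rewrite negbinS; apply: (@leq_trans (k.+1 * k.+2 ^ n + k.+2 ^ n)); last first.
  by rewrite -mulSnr expnS.
apply: leq_add (IHn _); apply: leq_trans IHk _; rewrite expnS leq_mul2l /=.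
by case: (n) => // m; rewrite leq_exp2r.
Qed.

Definition negbin_coef n q : nat -> cplx R := fun k => (negbin n k)%:R * q ^+ k.

Lemma rdec_negbin n q : modulus q < 1 -> rdec (negbin_coef n q).
Proof.
move=> q1 m; have [B hB] := natX_geo (n + m) (introT andP (conj (modulus_ge0 q) q1)).
exists B => k; apply: le_trans (hB k); rewrite modulusM modulus_nat modulusX exprD mulrAC.
rewrite ler_wpM2r ?exprn_ge0 ?modulus_ge0// ler_wpM2r ?exprn_ge0//.
by rewrite -natrX ler_nat negbin_le.
Qed.

Lemma pbound_negbin n c : pbound c -> pbound (fun k => (negbin n k)%:R * c k).
Proof.
move=> [m [B hB]]; exists (n + m)%N, B => k; rewrite modulusM modulus_nat exprD mulrCA.
by apply: ler_pM; rewrite ?modulus_ge0// -natrX ler_nat negbin_le.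
Qed.

Lemma ps_delta0 z : modulus z < 1 -> ps (delta 0) z = 1.
Proof.
move=> z1; rewrite psE// (@csum_fin _ _ 1); first by rewrite big_ord1 mulr1.
by case=> // k _; rewrite /delta mul0r.
Qed.

(** Multiplication by 1 - q z lowers n by one; on coefficients this is Pascal's rule [negbinS]. *)
Lemma ps_negbin n q z : modulus q < 1 -> modulus z < 1 ->
  ps (negbin_coef n q) z = (1 - q * z) ^- n.
Proof.
move=> q1 z1; elim: n => [|n IH].
  rewrite expr0 invr1 -(ps_delta0 z1); congr (ps _ z); apply/funext => -[|k].
    by rewrite /negbin_coef /negbin mul1r.
  by rewrite /negbin_coef /negbin add0n bin_small// mul0r.
have qz : 1 - q * z != 0.
  apply/eqP => /eqP; rewrite subr_eq0 => /eqP e; have := ltr_pM (modulus_ge0 q) (modulus_ge0 z) q1 z1.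
  by rewrite -modulusM -e modulus1 mulr1 ltxx.
have rn := rdec_negbin n.+1 q1; have rs := rdecZ (- q) (rdec_shiftr rn).
apply: (mulIf qz); rewrite exprSr invfM divfK//.
rewrite -IH mulrBr mulr1.
have -> : negbin_coef n q = fun k => negbin_coef n.+1 q k + - q * shiftr (negbin_coef n.+1 q) k.
  apply/funext => -[|k]; first by rewrite /shiftr mulr0 addr0 /negbin_coef !negbin0.
  by rewrite /shiftr /negbin_coef negbinS natrD exprS; ring.
rewrite psD; [|exact: rdec_pbound..].
rewrite psZ; last exact: rdec_pbound (rdec_shiftr rn).
by rewrite ps_shiftr//; ring.
Qed.

Lemma SU11_ratio g : SU11 g -> modulus (g 0 1 / g 1 1) < 1.
Proof.
move=> sg; have := SU11_mod sg; have a0 := SU11_mod00 sg; case: sg => _ -> _ h.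
rewrite modulusM modulusV modulus_conj ltr_pdivrMr// mul1r.
by rewrite -(@ltr_pXn2r _ 2)// ?nnegrE ?modulus_ge0//; lra.
Qed.

(** The constant d is mapped to d (alpha - conj(beta) z)^-n = d alpha^-n (1 - q z)^-n with q =
    conj(beta) / alpha, a binomial series in z. *)
Lemma discrete_series_psi n g (d : cplx R) : SU11 g ->
  discrete_series n g (d *: psi) =
  ps (fun k => (d * (g 0 0) ^- n) * negbin_coef n (g 0 1 / g 1 1)^* k).
Proof.
move=> sg; have q1 := SU11_ratio sg; rewrite -modulus_conj in q1.
apply/funext => z; have [z1|z1] := ltP (modulus z) 1; last first.
  by rewrite discrete_series_out// ps_out.
have g0 : g 0 0 != 0 by rewrite -modulus_gt0 SU11_mod00.
rewrite discrete_seriesZ discrete_seriesE// psZ; last exact: rdec_pbound (rdec_negbin n q1).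
rewrite ps_negbin// /psi norm_lt1 mobius_disc// mulr1 -mulrA; congr (d * _).
rewrite -invfM -exprMn; congr (_ ^- n); rewrite /mobius_den.
have [-> -> _] := sg; rewrite rmorphM/= fmorphV/= conjCK; field.
exact: g0.
Qed.

(** Conjugate linearity turns powers of q = conj(beta) / alpha into powers of beta / conj(alpha): up
    to the factor conj(alpha)^-n the result is a holomorphic series in that coordinate. *)
Lemma distribution_psi n phi g (d : cplx R) : (0 < n)%N -> SU11 g -> distribution_vector n phi ->
  phi (discrete_series n g (d *: psi)) =
  d^* * (g 1 1) ^- n * ps (fun k => (negbin n k)%:R * dcoef phi k) (g 0 1 / g 1 1).
Proof.
move=> n0 sg dv; have q1 := SU11_ratio sg; have q1' := q1; rewrite -modulus_conj in q1'.
rewrite discrete_series_psi// (distributionE dv); last exact: rdecZ (rdec_negbin n q1').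
rewrite psE//; have [B hB] := pbound_asum (pbound_negbin n (dcoef_pbound dv)) q1.
rewrite -(csumZ _ hB); congr csum; apply/funext => k.
rewrite /negbin_coef; move: (g 0 1 / g 1 1) => q.
rewrite !rmorphM/= !rmorphXn/= conjCK conjC_nat fmorphV/= rmorphXn/=.
have [_ <- _] := sg; move: (g 1 1 ^- n) => y; ring.
Qed.

(** A coordinate of G onto the right half-plane; w is its Cayley transform i (tau - 1) / (tau + 1).
    As Re(tau) = a^2 >= 0 for every pair, 1 / (tau + 1) is regular on the whole plane, as a [chart]
    requires. *)
Definition tau (x : R * R) : cplx R := ofR (x.1 ^+ 2) - imag * ofR (x.1 * x.2).

Lemma tau1_neq0 (x : R * R) : tau x + 1 != 0.
Proof.
apply/eqP => /(congr1 rpart); rewrite /tau !partE; have := sqr_ge0 x.1; lra.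
Qed.

Lemma cayley_entries (x : R * R) :
  [/\ cayley x 0 0 = 2^-1 * (ofR x.1 + ofR x.1^-1 + imag * ofR x.2),
      cayley x 0 1 = 2^-1 * (ofR x.2 + imag * (ofR x.1 - ofR x.1^-1)),
      cayley x 1 0 = 2^-1 * (ofR x.2 - imag * (ofR x.1 - ofR x.1^-1)) &
      cayley x 1 1 = 2^-1 * (ofR x.1 + ofR x.1^-1 - imag * ofR x.2)].
Proof.
rewrite /cayley /axb_mx !mxE !big_ord_recl !big_ord0 !mxE/= !big_ord_recl !big_ord0 !mxE/=.
rewrite ofR0; have i2 := @imag_sqr R.
split; congr (_ * _).
- transitivity (ofR x.1 + ofR x.2 * imag - imag * imag * ofR x.1^-1); first by ring.
  by rewrite i2; ring.
- by ring.
- transitivity (- imag * ofR x.1 - imag * imag * ofR x.2 + imag * ofR x.1^-1); first by ring.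
  by rewrite i2; ring.
- transitivity (- (imag * imag) * ofR x.1 - imag * ofR x.2 + ofR x.1^-1); first by ring.
  by rewrite i2; ring.
Qed.

Lemma SU11_cayley (x : R * R) : axb x -> SU11 (cayley x).
Proof.
move=> /= x0; have [e00 e01 e10 e11] := cayley_entries x.
have c2 : (2^-1 : cplx R)^* = 2^-1 by rewrite fmorphV/= conjC_nat.
rewrite /SU11/= e00 e01 e10 e11; split.
- rewrite rmorphM/= c2 rmorphD rmorphM/= rmorphB/= !conj_ofR conj_imag.
  by congr (_ * _); ring.
- rewrite rmorphM/= c2 !rmorphD rmorphM/= !conj_ofR conj_imag.
  by congr (_ * _); ring.
rewrite !normE -!ofRX -[LHS]ofRB -[RHS]ofR1; congr ofR.
rewrite !(modulusM 2^-1) modulusV modulus_nat !exprMn !modulus_sqr !partE.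
field; exact: lt0r_neq0.
Qed.

Lemma cayley11 (x : R * R) : axb x -> cayley x 1 1 = (tau x + 1) / ofR (2 * x.1).
Proof.
move=> /= /lt0r_neq0 x0; have [_ _ _ ->] := cayley_entries x.
have xc : ofR x.1 != 0 by rewrite ofR_eq0.
by rewrite /tau !ofRM ofR_nat ofRV; field.
Qed.

Lemma cayley01 (x : R * R) : axb x -> cayley x 0 1 = imag * (tau x - 1) / ofR (2 * x.1).
Proof.
move=> /= /lt0r_neq0 x0; have [_ -> _ _] := cayley_entries x.
have xc : ofR x.1 != 0 by rewrite ofR_eq0.
rewrite /tau !ofRM ofR_nat ofRV.
transitivity ((imag * (ofR x.1 ^+ 2 - 1) - (imag * imag) * (ofR x.1 * ofR x.2)) / (2 * ofR x.1)).
  by rewrite imag_sqr; field.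
by field.
Qed.

Definition half_plane_coord (x : R * R) : cplx R := imag - 2 * imag / (tau x + 1).

Lemma cayley_ratio (x : R * R) : axb x -> cayley x 0 1 / cayley x 1 1 = half_plane_coord x.
Proof.
move=> hx; rewrite cayley11// cayley01//; have t0 := tau1_neq0 x.
have xc : ofR (2 * x.1) != 0 by rewrite ofR_eq0 mulf_neq0 ?lt0r_neq0.
move: (ofR _) xc t0 => r r0 t0; rewrite /half_plane_coord; field; by rewrite t0 r0.
Qed.

Lemma voiceE n (d : cplx R) phi (x : R * R) : (0 < n)%N -> axb x -> distribution_vector n phi ->
  voice n (d *: psi) phi x = d^* * (cayley x 1 1) ^- n *
    ps (fun k => (negbin n k)%:R * dcoef phi k) (half_plane_coord x).
Proof.
by move=> n0 hx dv; rewrite /voice distribution_psi ?cayley_ratio//; exact: SU11_cayley.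
Qed.

End voice_transform.

(** * The chart of the group and its cutoff rectangle *)

Section group_chart.
Context {R : realType}.
Implicit Types (x y : R) (p : R * R).

Definition tau_dx p : cplx R := ofR (2 * p.1) - imag * ofR p.2.
Definition tau_dy p : cplx R := - imag * ofR p.1.
Definition theta p : cplx R := (tau p + 1)^-1.

Lemma cder_tau_x x y : cder (fun x => tau (x, y)) x (tau_dx (x, y)).
Proof.
have h := cderB (cderM (cder_id x) (cder_id x)) (cderZ (imag * ofR y) (cder_id x)).
have -> : (fun x => tau (x, y)) = (fun x => ofR x * ofR x - imag * ofR y * ofR x).
  by apply/funext => t; rewrite /tau /= !ofRM; ring.
by apply: cder_eq h _; rewrite /tau_dx/= ofRM ofR_nat; ring.
Qed.

Lemma cder_tau_y x y : cder (fun y => tau (x, y)) y (tau_dy (x, y)).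
Proof.
have h := cderB (cder_cst (ofR (x ^+ 2)) y) (cderZ (imag * ofR x) (cder_id y)).
have -> : (fun y => tau (x, y)) = (fun y => ofR (x ^+ 2) - imag * ofR x * ofR y).
  by apply/funext => t; rewrite /tau /= (ofRM x t); ring.
by apply: cder_eq h _; rewrite /tau_dy/=; ring.
Qed.

Lemma cder_theta_x x y : cder (fun x => theta (x, y)) x (- tau_dx (x, y) * theta (x, y) ^+ 2).
Proof.
apply: cder_eq (cderV (fun t => tau1_neq0 (t, y)) (cderD (cder_tau_x x y) (cder_cst 1 x))) _.
by rewrite addr0 -exprVn.
Qed.

Lemma cder_theta_y x y : cder (fun y => theta (x, y)) y (- tau_dy (x, y) * theta (x, y) ^+ 2).
Proof.
apply: cder_eq (cderV (fun t => tau1_neq0 (x, t)) (cderD (cder_tau_y x y) (cder_cst 1 y))) _.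
by rewrite addr0 -exprVn.
Qed.

Lemma ct_fst : continuous (fun p => p.1). Proof. by move=> p; exact: cvg_fst. Qed.
Lemma ct_snd : continuous (fun p => p.2). Proof. by move=> p; exact: cvg_snd. Qed.

Lemma ct_tau : continuous (fun p => tau p).
Proof.
exact: (ctB (ct_ofR (@rtX R _ _ 2 ct_fst)) (ctM (@ctC R _ imag) (ct_ofR (rtM ct_fst ct_snd)))).
Qed.

Lemma ct_theta : continuous theta.
Proof.
move=> p; apply: cvgV; first exact: tau1_neq0.
exact: (ctD ct_tau (@ctC R _ 1)).
Qed.

Lemma ct_tau_dx : continuous tau_dx.
Proof.
exact: (ctB (ct_ofR (rtM (@rtC R _ 2) ct_fst)) (ctM (@ctC R _ imag) (ct_ofR ct_snd))).
Qed.

Lemma ct_tau_dy : continuous tau_dy.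
Proof. exact: (ctM (@ctC R _ (- imag)) (ct_ofR ct_fst)). Qed.

(** The field (P, Q) is theta^2 times the vector (- tau_y, tau_x), a multiple of (- w_y, w_x): it
    annihilates w, and it is divergence-free because mixed derivatives commute. *)
Let P p : cplx R := imag * ofR p.1 * theta p ^+ 2.
Let P1 p : cplx R := imag * theta p ^+ 2 - 2 * imag * ofR p.1 * theta p ^+ 3 * tau_dx p.
Let Q p : cplx R := tau_dx p * theta p ^+ 2.
Let w1 p : cplx R := 2 * imag * theta p ^+ 2 * tau_dx p.
Let w2 p : cplx R := 2 * imag * theta p ^+ 2 * tau_dy p.

Let cP1 : continuous P1.
Proof.
exact: (ctB (ctM (@ctC R _ imag) (@ctX R _ _ 2 ct_theta)) (ctM (ctM (ctM (@ctC R _ (2 * imag)) (ct_ofR ct_fst)) (@ctX R _ _ 3 ct_theta)) ct_tau_dx)).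
Qed.

Definition group_chart : chart R.
Proof.
refine (@Chart R half_plane_coord w1 w2 P P1 Q (fun p => - P1 p)
  (fun p => 8 * p.1 ^+ 2 * modulus (theta p) ^+ 4) _ _ _ _ _ _ _ _ _ _ _ _ _ _ _ _).
- move=> x y; apply: cder_eq (cderB (cder_cst imag x) (cderZ (2 * imag) (cder_theta_x x y))) _.
  by rewrite /w1; ring.
- move=> x y; apply: cder_eq (cderB (cder_cst imag y) (cderZ (2 * imag) (cder_theta_y x y))) _.
  by rewrite /w2; ring.
- move=> x y; apply: cder_eq (cderM (cderZ imag (cder_id x)) (cderX 2 (cder_theta_x x y))) _.
  by rewrite /P1/=; ring.
- move=> x y; apply: cder_eq (cderM (cderB (cder_cst (ofR (2 * x)) y) (cderZ imag (cder_id y))) (cderX 2 (cder_theta_y x y))) _.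
  by rewrite /P1 /tau_dx /tau_dy/=; ring.
- exact: (ctB (@ctC R _ imag) (ctM (@ctC R _ (2 * imag)) ct_theta)).
- exact: (ctM (ctM (@ctC R _ (2 * imag)) (@ctX R _ _ 2 ct_theta)) ct_tau_dx).
- exact: (ctM (ctM (@ctC R _ (2 * imag)) (@ctX R _ _ 2 ct_theta)) ct_tau_dy).
- exact: (ctM (ctM (@ctC R _ imag) (ct_ofR ct_fst)) (@ctX R _ _ 2 ct_theta)).
- exact: cP1.
- exact: (ctM ct_tau_dx (@ctX R _ _ 2 ct_theta)).
- by move=> p; apply: cvgN; exact: cP1.
- exact: (rtM (rtM (@rtC R _ 8) (@rtX R _ _ 2 ct_fst)) (@rtX R _ _ 4 (ct_modulus ct_theta))).
- by move=> p; rewrite mulr_ge0 ?exprn_ge0 ?modulus_ge0// mulr_ge0// sqr_ge0.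
- by move=> p; exact: addrN.
- by move=> p; rewrite /P /Q /w1 /w2 /tau_dy; ring.
- move=> p; have -> : ofR (8 * p.1 ^+ 2 * modulus (theta p) ^+ 4) =
      8 * ofR p.1 ^+ 2 * (theta p * (theta p)^*) ^+ 2.
    by rewrite mul_conj_sqr -!ofRX -(ofR_nat 8) -!ofRM; congr ofR; ring.
  rewrite /P /Q /w1 /w2 /tau_dx /tau_dy; move: (theta p) (@imag_sqr R) => t i2.
  rewrite !(rmorphM, rmorphB, rmorphN)/= ?conjC_nat !conj_ofR !conj_imag !ofRM !ofR_nat.
  transitivity (8 * - (imag * imag) * ofR p.1 ^+ 2 * (t * t^*) ^+ 2); first by ring.
  by rewrite i2; ring.
Defined.

Definition group_den p : R := (p.1 ^+ 2 + 1) ^+ 2 + p.1 ^+ 2 * p.2 ^+ 2.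

Lemma group_den_gt0 p : 0 < group_den p.
Proof.
have h1 := sqr_ge0 p.1; have h2 := sqr_ge0 p.2; rewrite /group_den.
by have := mulr_ge0 h1 h2; nra.
Qed.

Lemma modulus_tau1 p : modulus (tau p + 1) ^+ 2 = group_den p.
Proof. by rewrite modulus_sqr /tau /group_den !partE; ring. Qed.

Lemma modulus_theta p : modulus (theta p) ^+ 2 = (group_den p)^-1.
Proof. by rewrite /theta modulusV exprVn modulus_tau1. Qed.

Lemma half_plane_modulus p : 1 - modulus (half_plane_coord p) ^+ 2 = 4 * p.1 ^+ 2 / group_den p.
Proof.
have -> : half_plane_coord p = imag * (tau p - 1) / (tau p + 1).
  by rewrite /half_plane_coord; field; exact: tau1_neq0.
rewrite modulusM modulusV exprMn exprVn modulus_tau1 modulusM modulus_imag mul1r.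
have d0 := lt0r_neq0 (group_den_gt0 p).
have -> : modulus (tau p - 1) ^+ 2 = group_den p - 4 * p.1 ^+ 2.
  by rewrite modulus_sqr /tau /group_den !partE; ring.
by field.
Qed.

Lemma group_chart_J p : ch_J group_chart p = 8 * p.1 ^+ 2 / group_den p ^+ 2.
Proof.
transitivity (8 * p.1 ^+ 2 * modulus (theta p) ^+ 4); first by [].
by rewrite -[4%N]/(2 * 2)%N exprM modulus_theta exprVn.
Qed.

(** By [half_plane_modulus] this quantity is 1 - |w|^2, so |conj(alpha)|^-n is the radial factor (1
    - |w|^2)^(n/2). *)
Lemma cayley11_modulus p : axb p -> modulus (cayley p 1 1) ^- 2 = 4 * p.1 ^+ 2 / group_den p.
Proof.
move=> hp; rewrite cayley11// modulusM modulusV exprMn exprVn modulus_tau1.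
rewrite modulus_ofR real_normK ?num_real//; field.
by rewrite (lt0r_neq0 (group_den_gt0 p)) (lt0r_neq0 hp).
Qed.

Local Notation N k := ((k + 6)%:R : R).

Lemma N_ge6 (k : nat) : 6 <= N k. Proof. by rewrite ler_nat leq_addl. Qed.

(** For a = 1/(2N) and a = 2N one has 4 a^2 / (a^2 + 1)^2 <= N^-2, so 1 - |w|^2 <= 1 - r^2 and the
    cutoff vanishes there. The rectangle has size polynomial in k and stays away from a = 0. *)
Lemma group_radius_x (k : nat) y :
  @cut_radius R k <= modulus (half_plane_coord ((2 * N k)^-1, y)) /\
  @cut_radius R k <= modulus (half_plane_coord (2 * N k, y)).
Proof.
have N6 := N_ge6 k; have N0 : 0 < N k by lra.
have s0 := @cut_scale_gt0 R k; have y0 := sqr_ge0 y.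
have aux x : 0 < x -> 4 * x ^+ 2 * @cut_scale R k <= (x ^+ 2 + 1) ^+ 2 ->
    @cut_radius R k <= modulus (half_plane_coord (x, y)).
  move=> x0 h; apply: cut_radius_le; rewrite half_plane_modulus.
  rewrite ler_pdivrMr ?group_den_gt0// [leRHS]mulrC ler_pdivlMr//.
  by apply: le_trans h _; rewrite /group_den/= lerDl mulr_ge0 ?sqr_ge0.
split; apply: aux; rewrite ?invr_gt0 ?mulr_gt0// /cut_scale.
  rewrite exprVn exprMn; have M0 : 0 < N k ^+ 2 by rewrite exprn_gt0.
  have -> : 4 * (2 ^+ 2 * N k ^+ 2)^-1 * N k ^+ 2 = 1 by field; exact: lt0r_neq0.
  have i0 : 0 <= (2 ^+ 2 * N k ^+ 2)^-1 by rewrite invr_ge0 mulr_ge0// ltW.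
  by nra.
have -> : 4 * (2 * N k) ^+ 2 * N k ^+ 2 = ((2 * N k) ^+ 2) ^+ 2 by ring.
by have := sqr_ge0 (2 * N k); move: ((2 * N k) ^+ 2) => t t0; nra.
Qed.

(** For |b| = 2N the denominator is at least a^2 b^2 = 4 a^2 N^2, whence 1 - |w|^2 <= N^-2. *)
Lemma group_radius_y (k : nat) x :
  @cut_radius R k <= modulus (half_plane_coord (x, - (2 * N k))) /\
  @cut_radius R k <= modulus (half_plane_coord (x, 2 * N k)).
Proof.
have s0 := @cut_scale_gt0 R k; have x0 := sqr_ge0 x.
have aux y : y ^+ 2 = 4 * @cut_scale R k -> @cut_radius R k <= modulus (half_plane_coord (x, y)).
  move=> h; apply: cut_radius_le; rewrite half_plane_modulus.
  rewrite ler_pdivrMr ?group_den_gt0// [leRHS]mulrC ler_pdivlMr//.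
  by rewrite /group_den/= h; have := sqr_ge0 (x ^+ 2 + 1); lra.
by split; apply: aux; rewrite /cut_scale; ring.
Qed.

Lemma group_diag_ge (e k : nat) :
  8^-1 * (@cut_scale R k)^-1 ^+ e.+2 <=
  diag_moment group_chart (@cut_radius R k) ((2 * N k)^-1) (2 * N k) (- (2 * N k)) (2 * N k) e k.
Proof.
have N6 := N_ge6 k; have N0 : 0 < N k by lra.
have s0 := @cut_scale_gt0 R k; have s36 := @cut_scale_ge36 R k.
have i1 : (2 * N k)^-1 <= 1 by rewrite invf_le1; lra.
have j0 : 0 <= 2^-1 / @cut_scale R k ^+ 2 by rewrite divr_ge0// sqr_ge0.
(* For 1 <= a <= 2 and 6/5 N <= b <= 13/10 N the denominator lies between 4/3 a^2 K and 2 a^2 K: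
   then 1 - |w|^2 is in [2/K, 3/K] and the Jacobian factor is at least 1/(2 K^2). *)
apply: le_trans (@diag_moment_ge R group_chart _ _ _ _ e k 1 2 (6 / 5 * N k) (13 / 10 * N k)
   (2^-1 / @cut_scale R k ^+ 2) _ _ _ _ j0 _ _ _ _ _); try lra.
  pose t := (@cut_scale R k)^-1; have t0 : 0 < t by rewrite invr_gt0.
  have -> : (@cut_scale R k ^+ 2)^-1 = t * t by rewrite /t -expr2 exprVn.
  rewrite -/t 2!(exprS t); have := exprn_ge0 e (ltW t0); move: (t ^+ e) => T T0.
  have tt : 0 <= T * (t * t) * (N k - 6) by rewrite !mulr_ge0 ?(ltW t0)//; lra.
  have tt0 : 0 <= T * (t * t) by rewrite !mulr_ge0 ?(ltW t0).
  by move: tt tt0; move: (N k) => M tt tt0; lra.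
move=> x y /andP[x1 x2] /andP[y1 y2].
have q1 : (x ^+ 2 + 1) ^+ 2 <= 25 / 4 * x ^+ 2.
  have : x ^+ 2 + 1 <= 5 / 2 * x by nra.
  by have := sqr_ge0 x; nra.
have xx : 1 <= x ^+ 2 by nra.
have xx4 : x ^+ 2 <= 4 by nra.
have yy1 : 36 / 25 * @cut_scale R k <= y ^+ 2 by rewrite /cut_scale; nra.
have yy2 : y ^+ 2 <= 169 / 100 * @cut_scale R k by rewrite /cut_scale; nra.
have D0 := group_den_gt0 (x, y).
have D1 : group_den (x, y) <= 2 * x ^+ 2 * @cut_scale R k.
  by rewrite /group_den/=; move: (@cut_scale R k) (y ^+ 2) (x ^+ 2) s0 s36 yy1 yy2 xx q1 => K Y X *; nra.
have D2 : 4 / 3 * x ^+ 2 * @cut_scale R k <= group_den (x, y).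
  by rewrite /group_den/=; have := sqr_ge0 (x ^+ 2 + 1);
    move: (@cut_scale R k) (y ^+ 2) (x ^+ 2) s0 s36 yy1 yy2 xx q1 => K Y X *; nra.
rewrite group_chart_J half_plane_modulus/=; split.
  rewrite ler_pdivrMr ?exprn_gt0// mulrAC ler_pdivlMr ?exprn_gt0//.
  have : group_den (x, y) ^+ 2 <= (2 * x ^+ 2 * @cut_scale R k) ^+ 2.
    apply: lerXn2r D1; rewrite nnegrE; first exact: ltW.
    apply: mulr_ge0 (ltW s0); exact: mulr_ge0 (ler0n _ 2) (sqr_ge0 _).
  have : 0 <= x ^+ 2 * @cut_scale R k ^+ 2 * (4 - x ^+ 2).
    by rewrite mulr_ge0 ?subr_ge0// mulr_ge0 ?sqr_ge0.
  by move: (group_den _ ^+ 2) (@cut_scale R k) (x ^+ 2) => D K X; lra.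
by apply/andP; split; rewrite ler_pdivrMr// mulrAC ler_pdivlMr//; lra.
Qed.

End group_chart.

(** * The coorbit space *)

Section Lp_spaces.
Context {R : realType}.
Implicit Types (p : R) (f g : R * R -> cplx R).
Local Notation haar := (@haar R).

Lemma measurable_axb : measurable (@axb R).
Proof.
rewrite (_ : axb = `]0, +oo[%classic `*` setT); first exact: measurableX.
by apply/seteqP; split => x /=; rewrite in_itv/= andbT// => -[].
Qed.

(** On the rectangle the Haar density a^-2 is at least x2^-2, so x2^-2 times the restricted Lebesgue
    measure lies below Haar measure, and integrals compare as the measures do. *)
Lemma plane_le_haar (x1 x2 y1 y2 : R) (h : plane R -> \bar R) : 0 < x1 -> x1 <= x2 ->
  measurable_fun setT h -> (forall x, 0 <= h x)%E ->
  (\int[plane_measure R]_(x in rect x1 x2 y1 y2) h x <= (x2 ^+ 2)%:E * \int[haar]_x h x)%E.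
Proof.
move=> x10 x12 mh h0; have x20 : 0 < x2 := lt_le_trans x10 x12.
have mr := measurable_rect x1 x2 y1 y2.
have k0 : 0 <= x2 ^- 2 by rewrite invr_ge0 sqr_ge0.
pose m1 := mscale (NngNum k0) (mrestr (plane_measure R) mr).
have m12 S : measurable S -> (m1 S <= haar S)%E.
  move=> mS; rewrite /m1 /mscale/= /mrestr /haar.
  rewrite -integral_cst; last exact: measurableI.
  apply: nonneg_le_integral_set => [z _|z _|z [Sz [hz _]]].
  - by rewrite lee_fin.
  - by rewrite lee_fin invr_ge0 sqr_ge0.
  move: hz; rewrite /= in_itv/= => /andP[z1 z2]; have z0 : 0 < z.1 := lt_le_trans x10 z1.
  split; first by split.
  rewrite lee_fin lef_pV2 ?posrE ?exprn_gt0//.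
  by apply: lerXn2r z2; rewrite nnegrE; exact: ltW.
have := @ge0_le_measure_integral _ _ R m1 haar m12 h _ mr h0 mh.
rewrite /m1 ge0_integral_mscale//; last exact: measurable_funS mh.
rewrite (@eq_measure_integral _ _ R _ (plane_measure R)); last first.
  by move=> A _ Ar; rewrite /= /mrestr setIidl.
move=> h1; have {}h1 : ((x2 ^- 2)%:E * \int[plane_measure R]_(x in rect x1 x2 y1 y2) h x <= \int[haar]_x h x)%E.
  by apply: le_trans h1 _; apply: nonneg_le_integral_set => // z _.
have x2E : (0 <= (x2 ^+ 2)%:E)%E by rewrite lee_fin sqr_ge0.
apply: le_trans (lee_wpmul2l x2E h1).
by rewrite muleA -EFinM divff ?mul1e// expf_neq0// gt_eqF.
Qed.

(** A real function on the whole plane, in the form to which Minkowski's inequality and Fatou's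
    lemma apply. *)
Definition absf f : plane R -> measurableTypeR R := (modulus \o f) \_ (@axb R).

Lemma absfE f x : axb x -> absf f x = modulus (f x).
Proof. by move=> hx; rewrite /absf /patch mem_set. Qed.

Lemma absf_out f x : ~ axb x -> absf f x = 0.
Proof. by move=> hx; rewrite /absf /patch memNset. Qed.

Lemma absf_ge0 f x : 0 <= absf f x.
Proof.
by have [hx|hx] := pselect (axb x); [rewrite absfE// modulus_ge0|rewrite absf_out].
Qed.

Lemma absfD f g x : absf (fun y => f y + g y) x <= absf f x + absf g x.
Proof.
by have [hx|hx] := pselect (axb x); [rewrite !absfE// modulusD|rewrite !absf_out// addr0].
Qed.

Lemma absfZ (t : cplx R) f x : absf (fun y => t * f y) x = modulus t * absf f x.
Proof.
by have [hx|hx] := pselect (axb x); [rewrite !absfE// modulusM|rewrite !absf_out// mulr0].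
Qed.

Lemma measurable_absf f : measurable_fun (@axb R) (rpart \o f) ->
  measurable_fun (@axb R) (ipart \o f) -> measurable_fun setT (absf f).
Proof.
move=> mr mi; apply/(measurable_restrictT _ measurable_axb).
rewrite (_ : modulus \o f = fun x => ((rpart \o f) x ^+ 2 + (ipart \o f) x ^+ 2) `^ 2^-1).
  apply: (@measurableT_comp _ _ _ _ _ _ (@powR R ^~ 2^-1)); first exact: measurable_powR.
  by apply: measurable_funD; exact: measurable_funX.
apply/funext => x /=; rewrite -modulus_sqr powR12_sqrt ?sqr_ge0//.
by rewrite sqrtr_sqr ger0_norm// modulus_ge0.
Qed.

Definition Lp_int p f : \bar R := (\int[haar]_x (absf f x `^ p)%:E)%E.

Lemma Lp_int_ge0 p f : (0 <= Lp_int p f)%E.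
Proof. by apply: integral_ge0 => x _; rewrite lee_fin powR_ge0. Qed.

Lemma measurable_absf_powR p f : measurable_fun setT (absf f) ->
  measurable_fun setT (fun x => (absf f x `^ p)%:E).
Proof.
move=> mf; apply/measurable_EFinP.
exact: (measurableT_comp (measurable_powR p) mf).
Qed.

Lemma Lp_normN p f : Lp_norm p f = ('N[haar]_p%:E[EFin \o absf f])%E.
Proof.
apply: eq_Lnorm => x; rewrite /= /absf /patch; by case: ifP.
Qed.

Lemma Lp_normE p f : Lp_norm p f = (Lp_int p f `^ p^-1)%E.
Proof.
rewrite Lp_normN unlock /Lp_int; congr (_ `^ _)%E; apply: eq_integral => x _.
by rewrite /= ger0_norm// absf_ge0.
Qed.

Lemma Lp_norm_ge0 p f : (0 <= Lp_norm p f)%E.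
Proof. exact: Lnorm_ge0. Qed.

Lemma Lp_norm_lt p f : 0 < p -> (Lp_norm p f < +oo)%E = (Lp_int p f < +oo)%E.
Proof.
move=> p0; rewrite Lp_normE; apply/idP/idP; last exact: poweR_lty.
by apply: lty_poweRy; rewrite invr_eq0 gt_eqF.
Qed.

Lemma Lp_int_norm p f : 0 < p -> (Lp_norm p f < +oo)%E ->
  Lp_int p f = (fine (Lp_norm p f) `^ p)%:E.
Proof.
move=> p0 h; have e : (Lp_norm p f `^ p)%E = Lp_int p f.
  by rewrite Lp_normE -poweRrM mulVf ?gt_eqF// poweRe1// Lp_int_ge0.
by rewrite -e -poweR_EFin fineK// ge0_fin_numE// Lp_norm_ge0.
Qed.

Lemma le_Lp_norm p f (B : R) : 0 < p -> 0 <= B -> (Lp_int p f <= (B `^ p)%:E)%E ->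
  (Lp_norm p f <= B%:E)%E.
Proof.
move=> p0 B0 h; rewrite Lp_normE.
have -> : B%:E = ((B `^ p)%:E `^ p^-1)%E.
  by rewrite poweR_EFin -powRrM divff ?gt_eqF// powRr1.
apply: gt0_ler_poweR => //; first by rewrite invr_ge0 ltW.
  by rewrite in_itv/= Lp_int_ge0 leey.
by rewrite in_itv/= lee_fin powR_ge0 leey.
Qed.

Lemma in_LpP p f : 0 < p -> in_Lp p f <->
  [/\ measurable_fun (@axb R) (rpart \o f), measurable_fun (@axb R) (ipart \o f) &
      (Lp_int p f < +oo)%E].
Proof. by move=> p0; rewrite /in_Lp Lp_norm_lt. Qed.

Lemma Lp_normZ p (t : cplx R) f : 0 < p -> in_Lp p f ->
  Lp_norm p (fun x => (t * f x)%R) = ((modulus t)%:E * Lp_norm p f)%E.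
Proof.
move=> p0 [mr mi _]; have mf := measurable_absf mr mi.
have e : Lp_int p (fun x => t * f x) = ((modulus t `^ p)%:E * Lp_int p f)%E.
  have mp := measurable_absf_powR p mf.
  have p0' x : (0 <= (absf f x `^ p)%:E)%E by rewrite lee_fin powR_ge0.
  have k0 : (0 <= (modulus t `^ p)%:E)%E by rewrite lee_fin powR_ge0.
  rewrite /Lp_int -(ge0_integralZl _ measurableT mp (fun x _ => p0' x) k0).
  by apply: eq_integral => x _; rewrite absfZ powRM ?modulus_ge0 ?absf_ge0// EFinM.
rewrite !Lp_normE e poweRM ?Lp_int_ge0 ?lee_fin ?powR_ge0//.
by rewrite poweR_EFin -powRrM divff ?gt_eqF// powRr1// modulus_ge0.
Qed.

(** Minkowski's inequality for |f| and |g|, after the pointwise bound |f + g| <= |f| + |g|. *)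
Lemma Lp_normD p f g : 1 <= p -> in_Lp p f -> in_Lp p g ->
  (Lp_norm p (fun x => (f x + g x)%R) <= Lp_norm p f + Lp_norm p g)%E.
Proof.
move=> p1 [mr mi _] [mr' mi' _].
have mf := measurable_absf mr mi; have mg := measurable_absf mr' mi'.
rewrite (Lp_normN p f) (Lp_normN p g).
have mk := @minkowski_EFin _ _ R haar (absf f : plane R -> R) (absf g : plane R -> R) p mf mg p1.
apply: (le_trans _ mk).
rewrite Lp_normE unlock; apply: gt0_ler_poweR.
- by rewrite invr_ge0 (le_trans ler01).
- by rewrite in_itv/= Lp_int_ge0 leey.
- by rewrite in_itv/= leey andbT integral_ge0// => x _; exact: poweR_ge0.
apply: nonneg_le_integral => x _; first by rewrite lee_fin powR_ge0.
rewrite /= lee_fin; apply: ge0_ler_powR.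
- exact: le_trans ler01 p1.
- by rewrite nnegrE absf_ge0.
- by rewrite nnegrE normr_ge0.
exact: le_trans (absfD f g x) (ler_norm _).
Qed.

Lemma in_LpZ p (t : cplx R) f : 0 < p -> in_Lp p f -> in_Lp p (fun x => t * f x).
Proof.
move=> p0 fp; have [mr mi h] := fp; split.
- rewrite (_ : _ \o _ = fun x => rpart t * (rpart \o f) x - ipart t * (ipart \o f) x).
    by apply: measurable_funB; apply: measurable_funM => //; exact: measurable_cst.
  by apply/funext => x /=; rewrite rpartM.
- rewrite (_ : _ \o _ = fun x => rpart t * (ipart \o f) x + ipart t * (rpart \o f) x).
    by apply: measurable_funD; apply: measurable_funM => //; exact: measurable_cst.
  by apply/funext => x /=; rewrite ipartM.
rewrite Lp_normZ//; have := Lp_norm_ge0 p f.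
by case: (Lp_norm p f) h => [r|//|//] _ _; rewrite -EFinM ltry.
Qed.

Lemma in_LpD p f g : 1 <= p -> in_Lp p f -> in_Lp p g -> in_Lp p (fun x => f x + g x).
Proof.
move=> p1 fp gp; have [mr mi h] := fp; have [mr' mi' h'] := gp; split.
- rewrite (_ : _ \o _ = fun x => (rpart \o f) x + (rpart \o g) x); first exact: measurable_funD.
  by apply/funext => x /=; rewrite rpartD.
- rewrite (_ : _ \o _ = fun x => (ipart \o f) x + (ipart \o g) x); first exact: measurable_funD.
  by apply/funext => x /=; rewrite ipartD.
by apply: le_lt_trans (Lp_normD p1 fp gp) _; rewrite lte_add_pinfty.
Qed.

(** A positive limit is handled by continuity of exp and ln; at the limit 0 monotonicity of the
    power is used instead. *)
Lemma cvg_powR (m : nat -> R) (l p : R) : 0 < p -> (forall k, 0 <= m k) -> 0 <= l ->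
  m k @[k --> \oo] --> l -> m k `^ p @[k --> \oo] --> l `^ p.
Proof.
move=> p0 m0 l0 ml; have [le0|ln0] := eqVneq l 0.
  rewrite le0 powR0 ?gt_eqF//; apply/cvgrPdist_le => e e0.
  have d0 : 0 < e `^ p^-1 by rewrite powR_gt0.
  move/cvgrPdist_le/(_ _ d0): ml; apply: filterS => k.
  rewrite le0 !sub0r !normrN !ger0_norm ?powR_ge0// => h.
  have -> : e = (e `^ p^-1) `^ p by rewrite -powRrM mulVf ?gt_eqF// powRr1// ltW.
  by apply: ge0_ler_powR => //; rewrite ?nnegrE ?powR_ge0// ltW.
have lp : 0 < l by rewrite lt_neqAle eq_sym ln0.
have e1 : expR (p * ln (m k)) @[k --> \oo] --> l `^ p.
  rewrite /powR gt_eqF//.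
  apply: (@cvg_comp _ _ _ (fun k => p * ln (m k)) expR _ (nbhs (p * ln l))); last exact: continuous_expR.
  apply: cvgM; first exact: cvg_cst.
  apply: (@cvg_comp _ _ _ m (@ln R) _ (nbhs l)); first exact: ml.
  exact: continuous_ln.
apply: cvg_trans e1; apply: near_eq_cvg; move/cvgrPdist_lt/(_ _ lp): ml; apply: filterS => k h.
have mk : 0 < m k by move: h; rewrite ltr_norml => /andP[]; lra.
by rewrite /powR gt_eqF.
Qed.

(** Fatou's lemma for |f_k|^p; real and imaginary parts of g are measurable as pointwise limits. *)
Lemma Lp_limit p (f : nat -> R * R -> cplx R) g (B : R) : 0 < p -> 0 <= B ->
  (forall k, in_Lp p (f k)) -> (forall k, Lp_norm p (f k) <= B%:E)%E ->
  (forall x, axb x -> f k x @[k --> \oo] --> g x) ->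
  in_Lp p g /\ (Lp_norm p g <= B%:E)%E.
Proof.
move=> p0 B0 fp fB fg.
have mr : measurable_fun (@axb R) (rpart \o g).
  apply: (@measurable_fun_cvg _ _ _ _ (fun k => rpart \o f k)).
    by move=> k; have [] := fp k.
  move=> x hx; apply: (@cvg_comp _ _ _ (fun k => f k x) rpart _ (nbhs (g x))); first exact: fg.
  exact: rpart_continuous.
have mi : measurable_fun (@axb R) (ipart \o g).
  apply: (@measurable_fun_cvg _ _ _ _ (fun k => ipart \o f k)).
    by move=> k; have [] := fp k.
  move=> x hx; apply: (@cvg_comp _ _ _ (fun k => f k x) ipart _ (nbhs (g x))); first exact: fg.
  exact: ipart_continuous.
have cabs x : (absf (f k) x `^ p)%:E @[k --> \oo] --> (absf g x `^ p)%:E.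
  apply: cvg_EFin; first exact: nearW.
  have [hx|hx] := pselect (axb x); last first.
    by rewrite absf_out//; under eq_fun do rewrite /= absf_out//; exact: cvg_cst.
  have cm : absf (f k) x @[k --> \oo] --> absf g x.
    rewrite absfE//; under eq_fun do rewrite absfE//.
    apply: (@cvg_comp _ _ _ (fun k => f k x) modulus _ (nbhs (g x))); first exact: fg.
    exact: modulus_continuous.
  exact: cvg_powR p0 (fun k => absf_ge0 (f k) x) (absf_ge0 g x) cm.
have mf k : measurable_fun setT (fun x => (absf (f k) x `^ p)%:E).
  by apply: measurable_absf_powR; have [h1 h2 _] := fp k; exact: measurable_absf.
have p0' k x : (0 <= (absf (f k) x `^ p)%:E)%E by rewrite lee_fin powR_ge0.
have h := @fatou _ _ R haar setT measurableT (fun k x => (absf (f k) x `^ p)%:E) mf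
  (fun k x _ => p0' k x).
have {h} h : (Lp_int p g <= (B `^ p)%:E)%E.
  apply: (@le_trans _ _ (\int[haar]_x limn_einf (fun k => (absf (f k) x `^ p)%:E))%E).
    rewrite le_eqVlt; apply/orP; left; apply/eqP; apply: eq_integral => x _.
    by have [-> _] := cvg_limn_einf_sup (cabs x).
  apply: le_trans h _; rewrite limn_einf_lim; apply: lime_le; first exact: is_cvg_einfs.
  apply: nearW => k; apply: ge_ereal_inf; exists (Lp_int p (f k)); first by exists k => //=.
  have fin : (Lp_norm p (f k) < +oo)%E by have [] := fp k.
  rewrite (Lp_int_norm p0 fin) lee_fin; apply: ge0_ler_powR; rewrite ?nnegrE//; first exact: ltW.
    exact: fine_ge0 (Lp_norm_ge0 _ _).
  by rewrite -lee_fin fineK// ge0_fin_numE// Lp_norm_ge0.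
split; last exact: le_Lp_norm.
by apply/in_LpP => //; split => //; apply: le_lt_trans h _; rewrite ltry.
Qed.

End Lp_spaces.

(** * Coefficients are bounded by the L^p norm of the voice transform *)

Section coorbit_coefficients.
Context {R : realType}.
Implicit Types (n k : nat) (p : R) (c : nat -> cplx R) (phi : (cplx R -> cplx R) -> cplx R).

Lemma pairing_lin n (t : cplx R) c c' : (0 < n)%N -> pbound c -> pbound c' ->
  pairing n (fun k => t * c k + c' k) = t *: pairing n c + pairing n c'.
Proof.
move=> n0 [m [B cB]] [m' [B' cB']]; apply/funext => v.
rewrite -[RHS]/(t * pairing n c v + pairing n c' v).
have [sv|nsv] := pselect (smooth_vector n v); last first.
  by rewrite /pairing memNset// mulr0 addr0.
have [a ra ->] := smooth_psE n0 sv; rewrite !pairing_ps//.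
have [T aT] := ra (m + 2); have [T' aT'] := ra (m' + 2).
have s1 := asum_pairing cB aT; have s2 := asum_pairing cB' aT'.
rewrite -(csumZ t s1) -(csumD (asumZ t s1) s2); congr csum; apply/funext => k.
by rewrite mulrDr mulrCA.
Qed.

Lemma distribution_lin n (t : cplx R) phi phi' : (0 < n)%N ->
  distribution_vector n phi -> distribution_vector n phi' ->
  distribution_vector n (t *: phi + phi').
Proof.
move=> n0 dv dv'; rewrite (distribution_pairing n0 dv) (distribution_pairing n0 dv').
have pc := dcoef_pbound dv; have pc' := dcoef_pbound dv'.
have <- := pairing_lin t n0 pc pc'.
exact: pairing_distribution n0 (pboundD (pboundZ t pc) pc').
Qed.

Lemma distribution0 n : (0 < n)%N -> distribution_vector n (0 : (cplx R -> cplx R) -> cplx R).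
Proof.
move=> n0; have p0 : pbound (fun=> 0 : cplx R) := rdec_pbound rdec0.
have e := pairing_lin 0 n0 p0 p0; rewrite scale0r add0r in e.
have := pairing_distribution n0 p0.
suff -> : pairing n (fun=> 0) = (0 : (cplx R -> cplx R) -> cplx R) by [].
apply/funext => v; rewrite /pairing; case: ifP => // _.
by rewrite (@csum_fin _ _ 0) ?big_ord0// => k _; rewrite mulr0.
Qed.

Lemma distributionZ n (t : cplx R) phi : (0 < n)%N ->
  distribution_vector n phi -> distribution_vector n (t *: phi).
Proof.
by move=> n0 dv; have := distribution_lin t n0 dv (distribution0 n0); rewrite addr0.
Qed.

Local Notation N k := ((k + 6)%:R : R).
Local Notation K k := (@cut_scale R k).

(** With m = |alpha| one has 1 - |w|^2 = m^-2, so the cutoff is at most m^(-2n) <= m^-n and absorbs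
    the factor m^n between the series and the voice transform. The Jacobian factor is (1 - |w|^2)^2
    / (2 a^2), at most 2 K because a >= 1/(2N). *)
Lemma group_pointwise n k (x : R * R) (V : R) (z : cplx R) :
  (2 * N k)^-1 <= x.1 -> modulus (half_plane_coord x) < cut_radius k -> 0 <= V ->
  modulus z = V * modulus (cayley x 1 1) ^+ n ->
  cutoff (cut_radius k) n (half_plane_coord x) * ch_J group_chart x <= 2 * K k /\
  modulus z * (cutoff (cut_radius k) n (half_plane_coord x) * ch_J group_chart x) <= 2 * K k * V.
Proof.
move=> hx wr V0 ->; have N0 : 0 < N k by rewrite ltr0n addnS.
have x0 : 0 < x.1 by apply: lt_le_trans hx; rewrite invr_gt0 mulr_gt0.
have gm := cayley11_modulus (x0 : axb x); have D0 := group_den_gt0 x.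
rewrite -half_plane_modulus in gm; set m := modulus (cayley x 1 1) in gm *.
have r01 := @cut_radius_bound R k; set w := modulus (half_plane_coord x) in gm wr *.
have w0 : 0 <= w := modulus_ge0 _.
have w2 : w ^+ 2 <= cut_radius k ^+ 2 by rewrite lerXn2r ?nnegrE// ?(ltW wr)// cut_radius_ge0.
have r2 : cut_radius k ^+ 2 <= 1 :> R by case/andP: r01 => ? ?; rewrite exprn_ile1.
have s1 : 1 - w ^+ 2 <= 1 by rewrite gerBl sqr_ge0.
have s0 : 0 <= 1 - w ^+ 2 by lra.
have m0 : 0 <= m := modulus_ge0 _.
have mp : 0 < m.
  rewrite lt_neqAle eq_sym m0 andbT; apply/negP => /eqP m00.
  by move: gm; rewrite m00 expr0n/= invr0 half_plane_modulus => /esym/eqP;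
     rewrite gt_eqF// divr_gt0// mulr_gt0// exprn_gt0.
have m1 : 1 <= m.
  rewrite -(@ler_pXn2r _ 2)// ?nnegrE// expr1n -[X in _ <= X]invrK invf_ge1 ?invr_gt0 ?exprn_gt0//.
  by rewrite gm.
have M1 : 1 <= m ^+ n by rewrite exprn_ege1.
have chi : 0 <= cutoff (cut_radius k) n (half_plane_coord x) <= (m ^+ n)^-1.
  rewrite cutoff_ge0/= /cutoff pos_partE ?subr_ge0// -/w.
  apply: (@le_trans _ _ ((1 - w ^+ 2) ^+ n)); first by rewrite lerXn2r ?nnegrE ?subr_ge0//; lra.
  rewrite -gm exprVn -exprM mulnC exprM lef_pV2 ?posrE ?exprn_gt0//.
  by rewrite expr2 ler_peMr// exprn_ge0.
have J2 : 0 <= ch_J group_chart x <= 2 * K k.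
  apply/andP; split; first exact: ch_J_ge0.
  rewrite group_chart_J.
  have e1 : 8 * x.1 ^+ 2 / group_den x ^+ 2 = 2^-1 * (x.1 ^+ 2)^-1 * (1 - w ^+ 2) ^+ 2.
    by rewrite half_plane_modulus; field; rewrite !lt0r_neq0.
  have x2 : (x.1 ^+ 2)^-1 <= 4 * K k.
    have -> : 4 * K k = ((2 * N k)^-1 ^+ 2)^-1 by rewrite exprVn invrK /cut_scale; ring.
    rewrite lef_pV2 ?posrE ?exprn_gt0 ?invr_gt0 ?mulr_gt0//.
    by rewrite lerXn2r ?nnegrE ?invr_ge0 ?(ltW x0)// mulr_ge0// ltW.
  have q1 : (1 - w ^+ 2) ^+ 2 <= 1 by rewrite exprn_ile1.
  have q0 : 0 <= 2^-1 * (x.1 ^+ 2)^-1 by rewrite mulr_ge0// invr_ge0 sqr_ge0.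
  by rewrite e1; have := ler_wpM2l q0 q1; lra.
case/andP: chi => c0 c1; case/andP: J2 => j0 j1.
have cM : cutoff (cut_radius k) n (half_plane_coord x) * m ^+ n <= 1.
  by move: c1; rewrite -[_^-1]div1r ler_pdivlMr// exprn_gt0.
have c1' : cutoff (cut_radius k) n (half_plane_coord x) <= 1.
  by apply: le_trans cM; rewrite ler_peMr.
split; first by have := ler_pM c0 j0 c1' j1; rewrite mul1r.
have a0 : 0 <= cutoff (cut_radius k) n (half_plane_coord x) * m ^+ n.
  by rewrite mulr_ge0// exprn_ge0.
have := ler_wpM2l V0 (ler_pM a0 j0 cM j1); rewrite mul1r.
by move: (cutoff _ _ _) (m ^+ n) (ch_J _ _) => C M J; lra.
Qed.

(** [coef_moment_bound] in the group chart with majorant 1 + |V|^p, using x <= 1 + x^p. The factor t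
    = 1/(2K) normalizes the pointwise bound 2 K |V| of [group_pointwise]. *)
Lemma Lp_coef_le1 n p (d : cplx R) : (0 < n)%N -> 1 <= p -> exists2 C : R, 0 <= C &
  forall phi k, distribution_vector n phi -> in_Lp p (voice n (d *: psi) phi) ->
    (Lp_int p (voice n (d *: psi) phi) <= 1)%E ->
    modulus d * modulus (dcoef phi k) <= C * k.+1%:R ^+ (2 * (n + 5)).
Proof.
move=> n0 p1; have p0 : 0 < p by lra.
exists (448 * 36 ^+ (n + 5)); first exact: mulr_ge0 (ler0n _ _) (exprn_ge0 _ (ler0n _ _)).
move=> phi k dv inV V1; set V := voice n (d *: psi) phi in inV V1.
have N6 := @N_ge6 R k; have N0 : 0 < N k by lra.
have K0 := @cut_scale_gt0 R k; have K36 := @cut_scale_ge36 R k.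
pose t : R := (2 * K k)^-1; have t0 : 0 < t by rewrite invr_gt0 mulr_gt0.
have pb := pbound_negbin n (dcoef_pbound dv).
have r1 := @cut_radius_lt1 R k; have r0 := @cut_radius_ge0 R k.
have rs : @cut_radius R k < (1 + @cut_radius R k) / 2 by lra.
have s01 : 0 <= (1 + @cut_radius R k) / 2 < 1 by apply/andP; split; lra.
have ex := expandsZ (ofR t * d^*) (expands_ps pb s01).
have i1 : (2 * N k)^-1 <= 1 by rewrite invf_le1; lra.
have x12 : (2 * N k)^-1 <= 2 * N k by lra.
have y12 : - (2 * N k) <= 2 * N k by lra.
have x1p : 0 < (2 * N k)^-1 by rewrite invr_gt0; lra.
have [mr mi _] := inV; have mV := measurable_absf mr mi.
have rx x : rect ((2 * N k)^-1) (2 * N k) (- (2 * N k)) (2 * N k) x -> (2 * N k)^-1 <= x.1.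
  by move=> [/=]; rewrite in_itv/= => /andP[].
have pw x : rect ((2 * N k)^-1) (2 * N k) (- (2 * N k)) (2 * N k) x ->
    modulus (half_plane_coord x) < cut_radius k ->
    cutoff (cut_radius k) n (half_plane_coord x) * ch_J group_chart x <= 2 * K k /\
    modulus (d^* * ps (fun k => (negbin n k)%:R * dcoef phi k) (half_plane_coord x)) *
     (cutoff (cut_radius k) n (half_plane_coord x) * ch_J group_chart x) <= 2 * K k * absf V x.
  move=> /rx hx wr; have hx0 : axb x by exact: lt_le_trans hx.
  have Vge := absf_ge0 V x; apply: (group_pointwise hx wr Vge).
  rewrite absfE// /V voiceE//; set P := ps _ _; set g := cayley x 1 1.
  have g0 : g != 0.
    rewrite /g cayley11// mulf_neq0 ?tau1_neq0// invr_eq0 ofR_eq0 mulf_neq0//.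
    exact: lt0r_neq0.
  rewrite (modulusM (_ * _)) (modulusM d^* (g ^- n)) modulusV (modulusM d^*) modulusX.
  by field; rewrite expf_neq0// -[_ == 0]negbK modulus_eq0 negbK.
have hA x : rect ((2 * N k)^-1) (2 * N k) (- (2 * N k)) (2 * N k) x ->
    modulus (half_plane_coord x) < cut_radius k ->
    modulus (ofR t * d^* * ps (fun k => (negbin n k)%:R * dcoef phi k) (half_plane_coord x)) *
     (cutoff (cut_radius k) n (half_plane_coord x) * ch_J group_chart x) <= 1 + absf V x `^ p.
  move=> hx wr; have [_ h] := pw x hx wr; have Vge := absf_ge0 V x.
  rewrite -mulrA modulusM modulus_ofR gtr0_norm// -mulrA.
  apply: (@le_trans _ _ (t * (2 * K k * absf V x))); first by rewrite ler_wpM2l// ltW.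
  rewrite mulrA mulVf ?mul1r; last by rewrite gt_eqF// mulr_gt0.
  have := powR_ge0 (absf V x) p; have [V1'|V1'] := leP (absf V x) 1; first by lra.
  by have := le1r_powR (ltW V1') p1; lra.
have J0 x : rect ((2 * N k)^-1) (2 * N k) (- (2 * N k)) (2 * N k) x ->
    modulus (half_plane_coord x) < cut_radius k ->
    cutoff (cut_radius k) n (half_plane_coord x) * ch_J group_chart x <= 2 * K k.
  by move=> hx wr; have [] := pw x hx wr.
have K20 : 0 <= 2 * K k by rewrite mulr_ge0// ltW.
have pV x : (0 <= (absf V x `^ p)%:E)%E by rewrite lee_fin powR_ge0.
have main := @coef_moment_bound R group_chart (@cut_radius R k) _ _ _ _ (cut_radius_bound k) x12 y12
  (group_radius_x k) (group_radius_y k) n _ _ _ 1 (2 * K k) (fun x => absf V x `^ p) k n0 rs ex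
  ler01 K20 (fun x _ => powR_ge0 _ _) J0 hA.
have Gle := plane_le_haar (- (2 * N k)) (2 * N k) x1p x12 (measurable_absf_powR p mV) pV.
have {}Gle : (\int[plane_measure R]_(x in rect (2 * N k)^-1 (2 * N k) (- (2 * N k)) (2 * N k))
    (absf V x `^ p)%:E <= (4 * K k)%:E)%E.
  apply: le_trans Gle _; have -> : 4 * K k = (2 * N k) ^+ 2 by rewrite /cut_scale; ring.
  rewrite -[leRHS]mule1; apply: lee_wpmul2l => //; by rewrite lee_fin sqr_ge0.
have {main Gle} main := le_trans main (leeD2l _ Gle); rewrite -EFinD lee_fin in main.
have Dk := @group_diag_ge R n k.
set D := diag_moment _ _ _ _ _ _ _ _ in main Dk.
set bk := modulus _ in main.
have bE : bk = t * (modulus d * ((negbin n k)%:R * modulus (dcoef phi k))).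
  rewrite /bk (modulusM _ ((negbin n k)%:R * _)) (modulusM (ofR t)) modulus_conj modulus_ofR gtr0_norm//.
  by rewrite (modulusM (negbin n k)%:R) modulus_nat -!mulrA.
have bk0 : 0 <= bk := modulus_ge0 _.
have area : (2 * N k - (2 * N k)^-1) * (2 * N k - - (2 * N k)) <= 8 * K k.
  have -> : 8 * K k = (2 * N k) * (4 * N k) by rewrite /cut_scale; ring.
  rewrite opprK (_ : 2 * N k + 2 * N k = 4 * N k); last by ring.
  by rewrite ler_wpM2r//; lra.
have nb1 : 1 <= (negbin n k)%:R :> R by rewrite ler1n negbin_gt0.
set y := modulus d * modulus (dcoef phi k); have y0 : 0 <= y by rewrite mulr_ge0 ?modulus_ge0.
have yb : t * y <= bk.
  rewrite bE /y; apply: ler_wpM2l; first exact: ltW.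
  by apply: ler_wpM2l; [exact: modulus_ge0|rewrite ler_peMl ?modulus_ge0].
(* The area is at most 8K, and the integral of |V|^p over the rectangle at most (2N)^2 = 4K by
   comparison with Haar measure; (1 + 2K) 8K + 4K <= 28 K^2. *)
have main2 : (t * y) * (8^-1 * (K k)^-1 ^+ n.+2) <= 28 * K k ^+ 2.
  apply: (@le_trans _ _ (bk * D)).
    apply: (ler_pM _ _ yb Dk); first by rewrite mulr_ge0// ltW.
    by rewrite mulr_ge0// exprn_ge0// invr_ge0 ltW.
  apply: le_trans main _; apply: (@le_trans _ _ ((1 + 2 * K k) * (8 * K k) + 4 * K k)).
    by rewrite lerD2r ler_wpM2l//; lra.
  by move: (K k) K36 => X X36; nra.
have Kn : 0 < K k ^+ n.+2 by rewrite exprn_gt0.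
(* 448 is 28 * 16, where 16 joins the 8 of the diagonal moment and the 2 of t; the exponent is (n +
   2) + 1 + 2. *)
have main3 : y <= 448 * K k ^+ (n + 5).
  move: main2; rewrite exprVn /t.
  have -> : (2 * K k)^-1 * y * (8^-1 * (K k ^+ n.+2)^-1) = y / (16 * (K k * K k ^+ n.+2)).
    by field; rewrite !gt_eqF.
  have P0 : 0 < 16 * (K k * K k ^+ n.+2) := mulr_gt0 (ltr0n _ 16) (mulr_gt0 K0 Kn).
  rewrite (ler_pdivrMr _ _ P0) => /le_trans; apply.
  rewrite exprD !exprS expr0; move: (K k ^+ n) => Z; rewrite le_eqVlt; apply/orP; left; apply/eqP; ring.
have h : K k ^+ (n + 5) <= 36 ^+ (n + 5) * k.+1%:R ^+ (2 * (n + 5)) :> R.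
  rewrite exprM -exprMn; apply: lerXn2r; rewrite ?nnegrE; [exact: ltW| |exact: cut_scale_le].
  by apply: mulr_ge0; [exact: ler0n|exact: exprn_ge0].
by move: main3 h; move: (K k ^+ (n + 5)) (36 ^+ (n + 5)) (_ ^+ (2 * (n + 5))) => S P Q; lra.
Qed.

Lemma voiceZ n (u : cplx R -> cplx R) (t : cplx R) phi :
  voice n u (t *: phi) = (fun x => t * voice n u phi x).
Proof. by []. Qed.

Lemma voiceD n (u : cplx R -> cplx R) phi phi' :
  voice n u (phi + phi') = (fun x => voice n u phi x + voice n u phi' x).
Proof. by []. Qed.

(** Apply the normalized bound to t phi with t the inverse of the norm. If the norm is 0 every t > 0
    is admissible, so the coefficients vanish; definiteness of the coorbit norm comes from this
    case. *)
Lemma Lp_coef_le n p (d : cplx R) : (0 < n)%N -> 1 <= p -> d != 0 ->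
  exists m, exists2 C : R, 0 <= C & forall phi k, coorbit n p (d *: psi) phi ->
    modulus (dcoef phi k) <= C * k.+1%:R ^+ m * fine (Lp_norm p (voice n (d *: psi) phi)).
Proof.
move=> n0 p1 d0; have p0 : 0 < p by lra.
have [C C0 hC] := Lp_coef_le1 d n0 p1; have dm : 0 < modulus d by rewrite modulus_gt0.
exists (2 * (n + 5))%N, (C / modulus d); first by rewrite divr_ge0// ltW.
move=> phi k [dv inV]; set V := voice _ _ _ in inV *.
have Nge := Lp_norm_ge0 p V; have [_ _ Nfin] := inV.
have NE : Lp_norm p V = (fine (Lp_norm p V))%:E by rewrite fineK// ge0_fin_numE.
set B := fine _ in NE *; rewrite NE lee_fin in Nge.
have main t : 0 < t -> t * B <= 1 -> t * (modulus d * modulus (dcoef phi k)) <= C * k.+1%:R ^+ (2 * (n + 5)).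
  move=> t0 tB; have := hC (ofR t *: phi) k (distributionZ (ofR t) n0 dv).
  rewrite voiceZ -/V => h; have {h} := h (in_LpZ (ofR t) p0 inV).
  have -> : dcoef (ofR t *: phi) k = ofR t * dcoef phi k by [].
  rewrite (modulusM (ofR t)) modulus_ofR gtr0_norm// mulrCA; apply.
  have lt : (Lp_norm p (fun x => (ofR t * V x)%R) < +oo)%E by have [] := in_LpZ (ofR t) p0 inV.
  rewrite (Lp_int_norm p0 lt) Lp_normZ// NE modulus_ofR gtr0_norm//= lee_fin.
  have one : 1 `^ p = 1 :> R by rewrite powR1.
  rewrite -[leRHS]one; apply: (ge0_ler_powR (ltW p0)) tB; rewrite nnegrE; last exact: ler01.
  exact: mulr_ge0 (ltW t0) Nge.
set X := C * _ in main; have X0 : 0 <= X by apply: mulr_ge0 => //; exact: exprn_ge0.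
set y := modulus (dcoef phi k) in main *.
have -> : C / modulus d * k.+1%:R ^+ (2 * (n + 5)) * B = X * B / modulus d by rewrite /X; ring.
rewrite ler_pdivlMr// mulrC.
have [Bp|Bn] := ltP 0 B.
  have iB : 0 < B^-1 by rewrite invr_gt0.
  have := main _ iB; rewrite mulVf ?gt_eqF// => /(_ (lexx 1)).
  by rewrite ler_pdivrMl// [B * _]mulrC.
have B00 : B = 0 by apply/eqP; rewrite eq_le Bn Nge.
rewrite B00 mulr0; apply/ler_addgt0Pl => e e0; rewrite addr0.
have t0 : 0 < (X + 1) / e by rewrite divr_gt0// ltr_wpDl.
have := main _ t0; rewrite B00 mulr0 => /(_ ler01) h.
have : (X + 1) * (modulus d * y) <= (X + 1) * e.
  apply: (@le_trans _ _ (X * e)); last by rewrite ler_wpM2r ?(ltW e0)//; lra.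
  by move: h; rewrite mulrAC ler_pdivrMr.
by rewrite ler_pM2l// ltr_wpDl.
Qed.

End coorbit_coefficients.

(** * From a complete norm on a subspace to a Banach space *)

Section complete_subspace.
Context {R : realType}.
Variables (V : lmodType (cplx R)) (S : set V) (N : V -> cplx R).
Hypotheses (S0 : S 0) (SP : forall (t : cplx R) x y, S x -> S y -> S (t *: x + y)).
Hypotheses (ND : forall x y, S x -> S y -> N (x + y) <= N x + N y)
  (NZ : forall (t : cplx R) x, S x -> N (t *: x) = `|t| * N x)
  (N_eq0 : forall x, S x -> N x = 0 -> x = 0).
Hypothesis Ncomplete : forall u : nat -> V, (forall k, S (u k)) ->
  (forall e : R, 0 < e -> exists M, forall i j, (M <= i)%N -> (M <= j)%N -> N (u i - u j) < ofR e) ->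
  exists2 l, S l & forall e : R, 0 < e -> exists M, forall i, (M <= i)%N -> N (u i - l) < ofR e.

Definition sub_pred : {pred V} := fun x => `[< S x >].

Let sub_closed : submod_closed sub_pred.
Proof.
split; first exact/asboolP.
by move=> t x y /asboolP hx /asboolP hy; apply/asboolP; exact: SP.
Qed.

HB.instance Definition _ := GRing.isSubmodClosed.Build (cplx R) V sub_pred sub_closed.

(** A fresh subtype of [V]: it inherits the vector space operations and receives the norm [N],
    independently of any topology on [V]. *)
Record normed_subspace := NormedSubspace { sub_val : V; sub_in : sub_val \in sub_pred }.

HB.instance Definition _ := [isSub for sub_val].
HB.instance Definition _ := [Choice of normed_subspace by <:].
HB.instance Definition _ := [SubChoice_isSubZmodule of normed_subspace by <:].
HB.instance Definition _ := [SubZmodule_isSubLmodule of normed_subspace by <:].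

Let norm (x : normed_subspace) : cplx R := N (sub_val x).

Let sub_valP (x : normed_subspace) : S (sub_val x).
Proof. by apply/asboolP; exact: sub_in. Qed.

Let normD x y : norm (x + y) <= norm x + norm y.
Proof. by rewrite /norm (GRing.valD x y); exact: ND. Qed.

Let normZ (t : cplx R) x : norm (t *: x) = `|t| * norm x.
Proof. by rewrite /norm (GRing.valZ t x); exact: NZ. Qed.

Let norm_eq0 x : norm x = 0 -> x = 0.
Proof. by move=> h; apply: val_inj; rewrite /= (N_eq0 (sub_valP x) h). Qed.

HB.instance Definition _ := Lmodule_isNormed.Build (cplx R) normed_subspace normD normZ norm_eq0.

Let normE (x y : normed_subspace) : `|x - y| = N (sub_val x - sub_val y).
Proof. by transitivity (norm (x - y)) => //; rewrite /norm (GRing.valB x y). Qed.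

(** Completeness is asked for Cauchy filters. Centres of balls of radius 1/(i+1) belonging to F form
    a Cauchy sequence, and its limit is a limit of F. *)
Let complete (F : set_system normed_subspace) : ProperFilter F -> cauchy F -> cvg F.
Proof.
move=> PF /cauchyP Fc.
have e0 n : 0 < ofR n.+1%:R^-1 :> cplx R by rewrite ofR_gt0 invr_gt0.
have [x hx] := choice (fun n => Fc _ (e0 n)).
have dist i j : N (sub_val (x i) - sub_val (x j)) <= ofR (i.+1%:R^-1 + j.+1%:R^-1).
  have [z [zi zj]] := filter_ex (filterI (hx i) (hx j)).
  move: zi zj; rewrite -!ball_normE/= => zi zj; rewrite -normE ofRD.
  rewrite -(subrKA z); apply: le_trans (ler_normD _ _) _.
  by rewrite lerD ?(ltW zi)// distrC ltW.
have small (e : R) : 0 < e -> exists M, forall i, (M <= i)%N -> i.+1%:R^-1 < e.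
  move=> ep; have [M _ hM] := near_infty_natSinv_lt (PosNum ep).
  by exists M => i Mi; exact: hM.
have [l Sl hl] : exists2 l, S l & forall e : R, 0 < e -> exists M, forall i, (M <= i)%N -> N (sub_val (x i) - l) < ofR e.
  apply: Ncomplete => [k|e ep]; first exact: sub_valP.
  have [|M hM] := small (e / 2); first by rewrite divr_gt0.
  exists M => i j Mi Mj; apply: le_lt_trans (dist i j) _; rewrite ltr_ofR.
  by rewrite [ltRHS]splitr ltrD ?hM.
have lS : l \in sub_pred by apply/asboolP.
apply/cvg_ex; exists (NormedSubspace lS); apply/cvg_ballP => e /gt0_ofR[d d0 ->].
have [|M hM] := small (d / 2); first by rewrite divr_gt0.
have [|M' hM'] := hl (d / 2); first by rewrite divr_gt0.
pose i := maxn M M'; have h1 := hM i (leq_maxl _ _); have h2 := hM' i (leq_maxr _ _).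
apply: filterS (hx i) => y; rewrite -!ball_normE/= => hy.
rewrite -(subrKA (x i)); apply: le_lt_trans (ler_normD _ _) _.
rewrite [d]splitr ofRD; apply: ltrD; first by rewrite distrC normE.
by apply: lt_trans hy _; rewrite ltr_ofR.
Qed.

HB.instance Definition _ := Uniform_isComplete.Build normed_subspace complete.

Lemma complete_subspace_banach : is_banach S N.
Proof.
have lin : linear sub_val.
  by move=> t x y; rewrite (GRing.valD (t *: x) y) (GRing.valZ t x).
pose f : {linear normed_subspace -> V} := HB.pack sub_val (GRing.isLinear.Build (cplx R) normed_subspace V _ sub_val lin).
exists normed_subspace, f; split.
- by move=> x y; exact: val_inj.
- apply/seteqP; split => [_ [x _ <-]|x Sx]; first exact: sub_valP.
  by have h : x \in sub_pred by [apply/asboolP]; exists (NormedSubspace h).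
- by [].
Qed.

End complete_subspace.

(** * Completeness of the coorbit space *)

Section coorbit_space.
Context {R : realType}.
Variables (n : nat) (p : R) (d : cplx R).
Hypotheses (n0 : (0 < n)%N) (p1 : 1 <= p) (d0 : d != 0).
Implicit Types (phi : (cplx R -> cplx R) -> cplx R) (t : cplx R).
Local Notation S := (coorbit n p (d *: psi)).
Local Notation V := (voice n (d *: psi)).
Local Notation norm phi := (fine (Lp_norm p (V phi))).

Let p0 : 0 < p. Proof. exact: lt_le_trans ltr01 p1. Qed.

Lemma coorbit_finE phi : S phi -> Lp_norm p (V phi) = (norm phi)%:E.
Proof. by move=> [_ [_ _ h]]; rewrite fineK// ge0_fin_numE// Lp_norm_ge0. Qed.

Lemma coorbit_norm_ge0 phi : 0 <= norm phi.
Proof. exact: fine_ge0 (Lp_norm_ge0 _ _). Qed.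

Lemma coorbit_lin t phi phi' : S phi -> S phi' -> S (t *: phi + phi').
Proof.
move=> [dv iv] [dv' iv']; split; first exact: distribution_lin.
exact: in_LpD p1 (in_LpZ t p0 iv) iv'.
Qed.

Lemma coorbit_normZ t phi : S phi -> norm (t *: phi) = modulus t * norm phi.
Proof.
move=> Sphi; have [_ iv] := Sphi.
by rewrite voiceZ Lp_normZ// (coorbit_finE Sphi).
Qed.

Lemma coorbit0 : S 0.
Proof.
split; first exact: distribution0.
have e : V 0 = (fun=> 0) by apply/funext.
have I0 : Lp_int p (fun=> 0 : cplx R) = 0%E.
  apply: integral0_eq => x _.
  have -> : absf (fun=> 0 : cplx R) x = 0.
    by have [hx|hx] := pselect (axb x); [rewrite absfE// modulus0|rewrite absf_out].
  by rewrite powR0// gt_eqF.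
by rewrite e; apply/in_LpP => //; split; [exact: measurable_cst|exact: measurable_cst|rewrite I0 ltry].
Qed.

Lemma coorbitB phi phi' : S phi -> S phi' -> S (phi - phi').
Proof. by move=> h h'; rewrite addrC -scaleN1r; exact: coorbit_lin. Qed.

Lemma distributionB phi phi' : distribution_vector n phi -> distribution_vector n phi' ->
  distribution_vector n (phi - phi').
Proof.
move=> dv dv'; have -> : phi - phi' = -1 *: phi' + phi by rewrite scaleN1r addrC.
exact: (distribution_lin (-1) n0 dv' dv).
Qed.

Lemma coorbit_normD phi phi' : S phi -> S phi' -> norm (phi + phi') <= norm phi + norm phi'.
Proof.
move=> h h'; have hs : S (phi + phi') by have := coorbit_lin 1 h h'; rewrite scale1r.
rewrite -lee_fin EFinD -(coorbit_finE hs) -(coorbit_finE h) -(coorbit_finE h') voiceD.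
by case: h h' => [_ iv] [_ iv']; exact: Lp_normD p1 iv iv'.
Qed.

(** At a fixed x one has |w| < 1, so the series with coefficients of growth (k+1)^m converges
    absolutely, its moduli summing to at most [Q]; coefficient errors small relative to (k+1)^m
    therefore give a small error at x. *)
Lemma voice_cvg (phi : nat -> (cplx R -> cplx R) -> cplx R) phi' m :
  (forall i, distribution_vector n (phi i)) -> distribution_vector n phi' ->
  (forall e, 0 < e -> exists M, forall i k, (M <= i)%N ->
     modulus (dcoef (phi i) k - dcoef phi' k) <= e * k.+1%:R ^+ m) ->
  forall x, axb x -> V (phi i) x @[i --> \oo] --> V phi' x.
Proof.
move=> dv dv' h x hx.
have w1 : modulus (half_plane_coord x) < 1.
  by rewrite -cayley_ratio//; apply: SU11_ratio; exact: SU11_cayley.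
have pm : pbound (fun k => ofR ((k.+1%:R : R) ^+ m)).
  by exists m, 1 => k; rewrite mul1r modulus_ofR ger0_norm// exprn_ge0.
have [Q hQ] := pbound_asum (pbound_negbin n pm) w1.
have Q0 : 0 <= Q by have := hQ 0%N; rewrite big_ord0.
set w := half_plane_coord x in w1 hQ *.
have cps : ps (fun k => (negbin n k)%:R * dcoef (phi i) k) w @[i --> \oo] -->
    ps (fun k => (negbin n k)%:R * dcoef phi' k) w.
  apply/(cvg_cplxP _) => e e0; have e1 : 0 < e / (Q + 1) by rewrite divr_gt0// ltr_wpDl.
  have [M hM] := h _ e1; exists M => // i /= Mi.
  have pi := pbound_negbin n (dcoef_pbound (dv i)); have p' := pbound_negbin n (dcoef_pbound dv').
  have [B hB] := pbound_asum pi w1; have [B' hB'] := pbound_asum p' w1.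
  rewrite !psE// -(csumB hB hB').
  have le : asum (fun k => (negbin n k)%:R * dcoef (phi i) k * w ^+ k -
      (negbin n k)%:R * dcoef phi' k * w ^+ k) (e / (Q + 1) * Q).
    move=> N; apply: le_trans (ler_wpM2l (ltW e1) (hQ N)); rewrite mulr_sumr.
    apply: ler_sum => k _; rewrite -mulrBl -mulrBr modulusM (modulusM (_ * _)).
    rewrite [leRHS]mulrA; apply: ler_wpM2r; first exact: modulus_ge0.
    rewrite (modulusM (negbin n k)%:R) (modulusM (negbin n k)%:R) modulus_ofR ger0_norm ?exprn_ge0//.
    by rewrite [leRHS]mulrCA; apply: ler_wpM2l; [exact: modulus_ge0|exact: hM].
  apply: le_lt_trans (csum_le le) _; rewrite mulrAC ltr_pdivrMr ?ltr_wpDl//.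
  by rewrite ltr_pM2l//; lra.
have -> : (fun i => V (phi i) x) = (fun i => d^* * (cayley x 1 1) ^- n *
    ps (fun k => (negbin n k)%:R * dcoef (phi i) k) w).
  by apply/funext => i; exact: (voiceE d n0 hx (dv i)).
rewrite (voiceE d n0 hx dv').
apply: cvgM; [exact: cvg_cst|exact: cps].
Qed.

Lemma cplx_cauchy (c : nat -> cplx R) :
  (forall e, 0 < e -> exists M, forall i j, (M <= i)%N -> (M <= j)%N -> modulus (c i - c j) < e) ->
  exists l : cplx R, c i @[i --> \oo] --> l.
Proof.
move=> h; have aux (f : cplx R -> R) : (forall z w, `|f z - f w| <= modulus (z - w)) ->
    cvg (f (c i) @[i --> \oo]).
  move=> fle; apply: cauchy_cvg; apply/cauchyP => e e0; have [M hM] := h e e0.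
  exists (f (c M)); exists M => // i /= Mi; rewrite -ball_normE/=.
  by apply: le_lt_trans (fle _ _) _; exact: hM.
have h1 (z w : cplx R) : `|rpart z - rpart w| <= modulus (z - w) by rewrite -rpartB; exact: rpart_le.
have h2 (z w : cplx R) : `|ipart z - ipart w| <= modulus (z - w) by rewrite -ipartB; exact: ipart_le.
have /cvg_ex[l1 hl1] := aux (@rpart R) h1; have /cvg_ex[l2 hl2] := aux (@ipart R) h2.
by exists (ofR l1 + imag * ofR l2); exact: cvg_rpart_ipart.
Qed.

(** The coefficients are Cauchy uniformly relative to (k+1)^m, and their limit defines l through
    [pairing]. Fatou's lemma for phi_i - phi_(j+M), with j going to infinity, bounds the norm of
    phi_i - l. *)
Lemma coorbit_complete (phi : nat -> (cplx R -> cplx R) -> cplx R) : (forall i, S (phi i)) ->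
  (forall e, 0 < e -> exists M, forall i j, (M <= i)%N -> (M <= j)%N -> norm (phi i - phi j) < e) ->
  exists2 l, S l & forall e, 0 < e -> exists M, forall i, (M <= i)%N -> norm (phi i - l) < e.
Proof.
move=> Sphi cau; have [m [C C0 hC]] := Lp_coef_le n0 p1 d0.
have dv i : distribution_vector n (phi i) by case: (Sphi i).
have C1 : 0 < C + 1 by rewrite ltr_wpDl.
have coefB i j k : modulus (dcoef (phi i) k - dcoef (phi j) k) <= C * k.+1%:R ^+ m * norm (phi i - phi j).
  exact: hC (coorbitB (Sphi i) (Sphi j)).
have unif e : 0 < e -> exists M, forall i j k, (M <= i)%N -> (M <= j)%N ->
    modulus (dcoef (phi i) k - dcoef (phi j) k) <= e * k.+1%:R ^+ m.
  move=> e0; have [|M hM] := cau (e / (C + 1)); first by rewrite divr_gt0.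
  exists M => i j k Mi Mj; apply: le_trans (coefB i j k) _.
  have k0 : 0 <= k.+1%:R ^+ m :> R by rewrite exprn_ge0.
  rewrite mulrAC; apply: ler_wpM2r => //.
  have hN := hM i j Mi Mj; have N0 := coorbit_norm_ge0 (phi i - phi j).
  apply: (@le_trans _ _ ((C + 1) * norm (phi i - phi j))); first by rewrite ler_wpM2r//; lra.
  by move: (ltW hN); rewrite ler_pdivlMr// mulrC.
have lim k : exists l : cplx R, dcoef (phi i) k @[i --> \oo] --> l.
  apply: cplx_cauchy => e e0; have k0 : 0 < k.+1%:R ^+ m :> R by rewrite exprn_gt0.
  have [|M hM] := unif (e / 2 / k.+1%:R ^+ m); first by rewrite !divr_gt0.
  exists M => i j Mi Mj; apply: le_lt_trans (hM i j k Mi Mj) _.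
  by rewrite divfK ?gt_eqF// ltr_pdivrMr// ltr_pMr// ltr1n.
have [c hc] := choice lim.
have unifc e : 0 < e -> exists M, forall i k, (M <= i)%N ->
    modulus (dcoef (phi i) k - c k) <= e * k.+1%:R ^+ m.
  move=> e0; have [M hM] := unif e e0; exists M => i k Mi.
  (* The index shift by M makes the Cauchy bound valid for every j, so it survives the limit. *)
  have cv : dcoef (phi i) k - dcoef (phi (j + M)%N) k @[j --> \oo] --> dcoef (phi i) k - c k.
    by apply: cvgB; [exact: cvg_cst|rewrite (cvg_shiftn M (fun j => dcoef (phi j) k)); exact: hc].
  by apply: (cvg_modulus_le cv) => j; apply: hM => //; exact: leq_addl.
(* The limit sequence differs from the coefficients of a single phi_M by at most (k+1)^m. *)
have pc : pbound c.
  have [M hM] := unifc 1 ltr01; have [m' [B hB]] := dcoef_pbound (dv M).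
  have p1' : pbound (fun k => dcoef (phi M) k - c k).
    by exists m, 1 => k; exact: hM.
  have := pboundD (dcoef_pbound (dv M)) (pboundZ (-1) p1').
  congr pbound; apply/funext => k; ring.
pose l := pairing n c; have dl : distribution_vector n l := pairing_distribution n0 pc.
have lc : dcoef l = c := dcoef_pairing n c.
have near e : 0 < e -> exists M, forall i, (M <= i)%N ->
    in_Lp p (V (phi i - l)) /\ norm (phi i - l) <= e.
  move=> e0; have [M hM] := cau e e0; exists M => i Mi.
  have SB j : S (phi i - phi (j + M)%N) := coorbitB (Sphi i) (Sphi _).
  have dB : distribution_vector n (phi i - l).
    exact: distributionB (dv i) dl.
  have hB j : (Lp_norm p (V (phi i - phi (j + M)%N)%R) <= e%:E)%E.
    have e1 := coorbit_finE (SB j); have h1 := hM i (j + M)%N Mi (leq_addl j M).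
    by apply: (@le_trans _ _ (norm (phi i - phi (j + M)%N))%:E); [rewrite e1|rewrite lee_fin; exact: ltW].
  have cv x : axb x -> V (phi i - phi (j + M)%N) x @[j --> \oo] --> V (phi i - l) x.
    apply: (@voice_cvg (fun j => phi i - phi (j + M)%N) (phi i - l) m _ dB) => [j|e' e'0].
      by have [] := SB j.
    have [M' hM'] := unifc e' e'0; exists M' => j k Mj.
    have -> : dcoef (phi i - phi (j + M)%N) k - dcoef (phi i - l) k =
        - (dcoef (phi (j + M)%N) k - c k).
      rewrite -lc -[dcoef (phi i - _) k]/(dcoef (phi i) k - dcoef (phi (j + M)%N) k).
      rewrite -[dcoef (phi i - l) k]/(dcoef (phi i) k - dcoef l k); ring.
    by rewrite modulusN; apply: hM'; exact: leq_trans Mj (leq_addr _ _).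
  have [h1 h2] := Lp_limit p0 (ltW e0) (fun j => (SB j).2) hB cv.
  split=> //; rewrite -lee_fin fineK// ge0_fin_numE ?Lp_norm_ge0//.
  by apply: le_lt_trans h2 _; rewrite ltry.
(* Membership of l is inherited from phi_M and phi_M - l, the latter lying in L^p by Fatou's
   lemma. *)
have Sl : S l.
  have [M hM] := near 1 ltr01; have [h _] := hM M (leqnn M).
  have dB : distribution_vector n (phi M - l).
    exact: distributionB (dv M) dl.
  have -> : l = phi M - (phi M - l) by rewrite opprB addrC subrK.
  by apply: coorbitB; first exact: Sphi.
exists l => // e e0; have [|M hM] := near (e / 2); first by rewrite divr_gt0.
exists M => i Mi; have [_ h] := hM i Mi; apply: le_lt_trans h _.
by rewrite ltr_pdivrMr// ltr_pMr// ltr1n.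
Qed.

Lemma coorbit_banach : is_banach S (coorbit_norm n p (d *: psi)).
Proof.
apply: complete_subspace_banach.
- exact: coorbit0.
- exact: coorbit_lin.
- by move=> x y Sx Sy; rewrite /coorbit_norm -ofRD ler_ofR; exact: coorbit_normD.
- by move=> t x Sx; rewrite /coorbit_norm normE -ofRM (coorbit_normZ t Sx).
- move=> x Sx /(@ofR_inj R _ 0) x0; have [m [C C0 hC]] := Lp_coef_le n0 p1 d0.
  have dx : distribution_vector n x by case: Sx.
  rewrite (distribution_pairing n0 dx) [RHS](distribution_pairing n0 (distribution0 n0)).
  congr pairing; apply/funext => k; apply/eqP.
  rewrite -[dcoef 0 k]/(0 : cplx R) -modulus_eq0 eq_le modulus_ge0 andbT.
  by have := hC x k Sx; rewrite x0 mulr0.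
move=> u Su cau; have [|l Sl hl] := coorbit_complete Su.
  by move=> e /cau[M hM]; exists M => i j Mi Mj; rewrite -ltr_ofR; exact: hM.
exists l => // e /hl[M hM]; exists M => i Mi; rewrite /coorbit_norm ltr_ofR; exact: hM.
Qed.

End coorbit_space.

(** Excludes the zero multiple of psi: for u = 0 the function V_u(u) would vanish identically. *)
Lemma voice0 (R : realType) n (x : R * R) : voice n 0 (embedding n (0 : cplx R -> cplx R)) x = 0.
Proof.
rewrite /voice /embedding; case: ifP => // _; rewrite /inner /cintegral.
under eq_Rintegral do rewrite mul0r mul0r.
under [X in imag * ofR X]eq_Rintegral do rewrite mul0r mul0r.
by rewrite /Rintegral !integral0 ofR0 mulr0 addr0.
Qed.

Theorem mainTheorem3 (R : realType) (n : nat) (p : R) (u : cplx R -> cplx R)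
  (hn : (2 <= n)%N) (hp : 1 < p)
  (hu : exists c : cplx R, u = c *: psi)
  (hidem : forall x : R * R, axb x ->
     convolution (voice n u (embedding n u)) (voice n u (embedding n u)) x =
     voice n u (embedding n u) x)
  (hneq0 : exists2 x : R * R, axb x & voice n u (embedding n u) x <> 0) :
  is_banach (coorbit n p u) (coorbit_norm n p u).
Proof.
case: hu => d du; have d0 : d != 0.
  apply/eqP => d0; case: hneq0 => x _; rewrite du d0 scale0r; apply; exact: voice0.
by rewrite du; apply: coorbit_banach => //; [exact: leq_trans hn|exact: ltW].
Qed.
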